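(* Let $s\in(\frac12,1)$ and suppose $K:\mathbb{R}\to\mathbb{R}$ satisfies Assumption (A) (recalled in the context) and that $K$ is not constant. Consider the problem $$(-\Delta)^su=Ke^u\ \text{ in }\mathbb{R}\quad\text{with}\quad\int_{\mathbb{R}}Ke^u\,dx<+\infty. \qquad ( * )$$ Then the following statements hold. (i) Existence: There exists an even solution $u\in L_s(\mathbb{R})$ of $( * )$. (ii) Regularity: Any solution $u\in L_s(\mathbb{R})$ of $( * )$ belongs to $C^{2s+\gamma}_{\mathrm{loc}}(\mathbb{R})$ with some $\gamma>0$. (iii) Symmetry: Any solution $u\in L_s(\mathbb{R})$ of $( * )$ with $u(x)=O(|x|^{2s-1})$ as $|x|\to\infty$ is even and monotone-decreasing in $|x|$. (iv) Uniqueness: If $u,\tilde u\in L_s(\mathbb{R})$ are even solutions of $( * )$ with $u(0)=\tilde u(0)$, then $u(x)=\tilde u(x)$ for all $x\in\mathbb{R}$. (v) Finite Morse index: Every even solution $u\in L_s(\mathbb{R})$ of $( * )$ has finite Morse index.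
   Context: Assumption (A): $K=K(x)>0$ is a strictly positive function on $\mathbb{R}$ which is even and monotone-decreasing in $|x|$ (not necessarily strictly); moreover $K$ is $C^1$ with $\partial_x\sqrt{K}\in L^\infty(\mathbb{R})$. For $s\in(0,1)$ and $\varphi\in C_c^\infty(\mathbb{R})$, $(-\Delta)^s\varphi(x) = C_s\,\mathrm{PV}\int_{\mathbb{R}}\frac{\varphi(x)-\varphi(y)}{|x-y|^{1+2s}}\,dy$ with $C_s = \frac{4^s}{\sqrt{\pi}}\frac{\Gamma(\frac12+s)}{|\Gamma(-s)|}$. The space $L_s(\mathbb{R})$ consists of all real-valued $u\in L^1_{\mathrm{loc}}(\mathbb{R})$ with $\int_{\mathbb{R}}\frac{|u(x)|}{1+|x|^{1+2s}}\,dx<+\infty$. A function $u\in L_s(\mathbb{R})$ with $e^u\in L^1_{\mathrm{loc}}(\mathbb{R})$ is a solution of $(-\Delta)^su=Ke^u$ if $\int_{\mathbb{R}}u(-\Delta)^s\varphi\,dx=\int_{\mathbb{R}}Ke^u\varphi\,dx$ for all $\varphi\in C_c^\infty(\mathbb{R})$. Solutions are identified with their continuous representatives. For $\gamma>0$, $C^\gamma_{\mathrm{loc}}(\mathbb{R})=C^{\lfloor\gamma\rfloor,\gamma-\lfloor\gamma\rfloor}_{\mathrm{loc}}(\mathbb{R})$ is the usual local Hölder space. The Morse index of a solution $u$ is the maximal dimension (in $\mathbb{N}_0\cup\{+\infty\}$) of linear subspaces $V\subset C_c^\infty(\mathbb{R})$ such that $\int_{\mathbb{R}}\varphi(-\Delta)^s\varphi\,dx-\int_{\mathbb{R}}Ke^u\varphi^2\,dx<0$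 for all $\varphi\in V\setminus\{0\}$. *)

(* Defs.v *)
From HB Require Import structures.
From mathcomp Require Import all_boot all_order all_algebra.
From mathcomp Require Import all_classical all_reals all_analysis.

Set Implicit Arguments.
Unset Strict Implicit.
Unset Printing Implicit Defensive.

Import Order.TTheory GRing.Theory Num.Theory.
Import numFieldNormedType.Exports.

Local Open Scope classical_set_scope.
Local Open Scope ring_scope.

Definition even_fun (R : realType) (f : R -> R) : Prop :=
  forall x, f (- x) = f x.

(* Monotone-decreasing in |x|, not necessarily strictly. On its own this also
   forces [f] to be even. *)
Definition decreasing_in_abs (R : realType) (f : R -> R) : Prop :=
  forall x y, `|x| <= `|y| -> f y <= f x.

(* f(x) = O(h(x)) as |x| -> oo, i.e. at +oo and -oo simultaneously. *)
Definition bigO_at_infty (R : realType) (f h : R -> R) : Prop :=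
  exists C M : R, forall x, M <= `|x| -> `|f x| <= C * `|h x|.

(* [derive1n] is total, so differentiability of the lower derivatives has to be
   required separately. *)
Definition is_Ck (R : realType) (k : nat) (f : R -> R) : Prop :=
  (forall i, (i < k)%N -> forall x, derivable (derive1n i f) x 1) /\
  continuous (derive1n k f).

(* C^{floor g, g - floor g}_loc, for g >= 0. When g is an integer the Hoelder
   exponent is 0 and, as t `^ 0 = 1 for all t, the Hoelder bound only says that
   the top derivative is locally bounded: the space is then C^g. *)
Definition holder_loc (R : realType) (g : R) (f : R -> R) : Prop :=
  let k := Num.truncn g in
  is_Ck k f /\
  forall M : R, exists C : R, forall x y, `|x| <= M -> `|y| <= M ->
    `|derive1n k f x - derive1n k f y| <= C * `|x - y| `^ (g - k%:R).

Definition assumption_A (R : realType) (K : R -> R) : Prop :=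
  [/\ forall x, 0 < K x,
      even_fun K,
      decreasing_in_abs K,
      is_Ck 1 K &
      ('N[@lebesgue_measure R]_(+oo)
         [EFin \o derive1 (fun x => Num.sqrt (K x))] < +oo)%E].

Definition test_fun (R : realType) (phi : R -> R) : Prop :=
  (forall n, is_Ck n phi) /\ compact (closure [set x | phi x != 0]).

Definition euler_integral (R : realType) (t : R) : R :=
  \int[@lebesgue_measure R]_(x in `]0, +oo[) (x `^ (t - 1) * expR (- x)).

(* The real Gamma function: Euler's integral for t > 0, extended to t < 0 not an
   integer by Gamma(t) = Gamma(t + n) / (t (t + 1) ... (t + n - 1)), where n is
   the least natural number with t + n > 0. *)
Definition Gamma (R : realType) (t : R) : R :=
  if 0 < t then euler_integral t
  else let n := (Num.truncn (- t)).+1 in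
       euler_integral (t + n%:R) / \prod_(i < n) (t + i%:R).

Definition frac_lap_const (R : realType) (s : R) : R :=
  4 `^ s / Num.sqrt pi * (Gamma (2^-1 + s) / `|Gamma (- s)|).

(* The principal value is the limit of the integrals over |x - y| > eps as
   eps -> 0+; it exists for the test functions used below. *)
Definition frac_lap (R : realType) (s : R) (phi : R -> R) (x : R) : R :=
  frac_lap_const s *
  lim ((\int[@lebesgue_measure R]_(y in [set y | (eps < `|x - y|)%R])
          ((phi x - phi y) / `|x - y| `^ (1 + 2 * s))) @[eps --> 0^'+]).

Definition in_Ls (R : realType) (s : R) (u : R -> R) : Prop :=
  locally_integrable setT u /\
  (\int[@lebesgue_measure R]_x
     (`|u x| / (1 + `|x| `^ (1 + 2 * s)))%:E < +oo)%E.

(* For u in L_s with e^u in L^1_loc, K continuous and phi a test function, both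
   integrals below converge absolutely. *)
Definition weak_solution (R : realType) (s : R) (K u : R -> R) : Prop :=
  [/\ in_Ls s u,
      locally_integrable setT (fun x => expR (u x)) &
      forall phi, test_fun phi ->
        \int[@lebesgue_measure R]_x (u x * frac_lap s phi x) =
        \int[@lebesgue_measure R]_x (K x * expR (u x) * phi x)].

Definition liouville_solution (R : realType) (s : R) (K u : R -> R) : Prop :=
  weak_solution s K u /\
  (\int[@lebesgue_measure R]_x (K x * expR (u x))%:E < +oo)%E.

(* Among measurable functions, [liouville_solution] only depends on the a.e.
   class of u; this selects the
   continuous representative, so that pointwise statements about u make sense. *)
Definition cont_liouville_solution (R : realType) (s : R) (K u : R -> R) : Prop :=
  continuous u /\ liouville_solution s K u.

Definition linear_subspace (R : realType) (V : set (R -> R)) : Prop :=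
  V (cst 0) /\
  forall (a : R) f g, V f -> V g -> V (fun x => a * f x + g x).

Definition lin_indep (R : realType) (n : nat) (phi : 'I_n -> R -> R) : Prop :=
  forall c : 'I_n -> R,
    (forall x, \sum_(i < n) c i * phi i x = 0) -> forall i, c i = 0.

(* The dimension of a subspace, in the naturals extended by +oo. *)
Definition subspace_dim (R : realType) (V : set (R -> R)) : \bar R :=
  ereal_sup [set n%:R%:E | n in
    [set n | exists phi : 'I_n -> R -> R,
               (forall i, V (phi i)) /\ lin_indep phi]].

Definition linearized_form (R : realType) (s : R) (K u phi : R -> R) : R :=
  \int[@lebesgue_measure R]_x (phi x * frac_lap s phi x) -
  \int[@lebesgue_measure R]_x (K x * expR (u x) * phi x ^+ 2).

Definition morse_index (R : realType) (s : R) (K u : R -> R) : \bar R :=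
  ereal_sup [set subspace_dim V | V in
    [set V : set (R -> R) |
       [/\ linear_subspace V, V `<=` @test_fun R &
           forall phi, V phi -> phi <> cst 0 ->
             linearized_form s K u phi < 0]]].

(* Main.v *)
(* Put p = 2s - 1 and N x = |x|^p; up to a constant N is the fundamental solution of (-Delta)^s.
   Testing against (N - M_k) * psi, with M_k a rescaled smooth copy of N at infinity, shows that an
   s-harmonic function in L_s is affine, so every solution is
     u x = a + b x - sigma * int (|x - y|^p - |y|^p) f y dy,   f = K e^u,
   with b = 0 if u is even or O(|x|^p); then f decays like exp (- c |x|^p).
   Everything else is read off this equation.
   Existence: -log of the partition function minus half the (negative) energy decreases along
   rho |-> K e^(- N * rho) / Z because N is conditionally negative definite; this bounds the p-th
   moments, makes consecutive potentials merge, and a cluster point is a fixed point.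
   Symmetry: moving planes, where the sup norm of (u x - u (2 l - x))^+ contracts for large l.
   Regularity: u' is a convolution of f with sgn x |x|^(p - 1), and f is locally Lipschitz.
   Uniqueness: if z is the difference of two even solutions u, w and d = K (e^u - e^w), then
   int_0^oo d z' >= 0 follows from a pointwise identity and the monotonicity of K and w, while it is
   <= 0 because (x + y)^(p - 1) is a superposition of the products e^(- t x) e^(- t y).
   Morse index: |phi x - phi y|^2 <= C |x - y|^p int phi (-Delta)^s phi, so the quadratic form is
   nonnegative on the functions vanishing on a sufficiently fine finite grid. *)
Require Import Defs.
From HB Require Import structures.
From mathcomp Require Import all_boot all_order all_algebra.
From mathcomp Require Import all_classical all_reals all_analysis.
From mathcomp Require Import measurable_realfun real_interval.
From mathcomp Require Import ring lra.

Set Implicit Arguments.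
Unset Strict Implicit.
Unset Printing Implicit Defensive.

Import Order.TTheory GRing.Theory Num.Theory.
Import numFieldNormedType.Exports.

Local Open Scope classical_set_scope.
Local Open Scope ring_scope.

(** * Lebesgue integrals of real functions on the line *)

Section RealIntegral.
Context {R : realType}.
Local Notation mu := (@lebesgue_measure R).
Implicit Types (f g h : R -> R) (a b c x y : R).

(** The obstacle is the nonlocal tail: for a compactly supported phi the function (-Delta)^s phi is
    only known to decay like |x|^(-p-2), which is exactly the weight of L_s, so cutting off test
    functions produces errors that do not become small by themselves. The Liouville step therefore
    makes (-Delta)^s phi close to a multiple of a prescribed second difference in the sup norm
    weighted by (1 + |x|)^(p + 2). The second difference is what pays for this: it gains k^(-2) on
    the smooth copy M_k, and the total error k^(p - 1) vanishes because p < 1. Neither Sobolev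
    spaces nor a maximum principle is used; the operator is handled through its truncations to |x -
    y| > e, Fubini and dominated convergence. One inequality serves twice: Cauchy-Schwarz for the
    form - int int d(x) N(x - y) d(y) against a difference of two point masses. It makes consecutive
    potentials merge in the existence proof and it bounds the oscillation of test functions for the
    Morse index. Nonconstancy of K gives strictness in the moving planes: equality under one
    reflection would make K periodic on the half line, hence constant by monotonicity. *)

Definition intg f : Prop := mu.-integrable setT (EFin \o f).

Lemma intg_meas f : intg f -> measurable_fun setT f.
Proof. by move=> /integrableP[/measurable_EFinP]. Qed.

Lemma intg_le f g : measurable_fun setT f -> (forall x, `|f x| <= g x) ->
  intg g -> intg f.
Proof.
move=> mf fg ig; apply: (le_integrable measurableT _ _ ig).
  exact/measurable_EFinP.
move=> x _ /=; by rewrite lee_fin (le_trans (fg x))// ler_norm.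
Qed.

Lemma eq_intg f g : f =1 g -> intg f -> intg g.
Proof. by move=> /funext->. Qed.

Lemma intg0 : intg (fun=> 0).
Proof. exact: integrable0. Qed.

Lemma intgD f g : intg f -> intg g -> intg (fun x => f x + g x).
Proof. by move=> fi gi; exact: (integrableD measurableT fi gi). Qed.

Lemma intgZ c f : intg f -> intg (fun x => c * f x).
Proof. by move=> fi; exact: (integrableZl measurableT c fi). Qed.

Lemma intgZr c f : intg f -> intg (fun x => f x * c).
Proof. by move=> fi; apply: eq_intg (intgZ c fi) => x; rewrite mulrC. Qed.

Lemma intgN f : intg f -> intg (fun x => - f x).
Proof. by move=> fi; apply: eq_intg (intgZ (-1) fi) => x; rewrite mulN1r. Qed.

Lemma intgB f g : intg f -> intg g -> intg (fun x => f x - g x).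
Proof. by move=> fi gi; apply: intgD => //; exact: intgN. Qed.

Lemma intg_norm f : intg f -> intg (fun x => `|f x|).
Proof. by move=> fi; exact: integrable_norm. Qed.

Lemma intgMb c f h : intg f -> measurable_fun setT h -> (forall x, `|h x| <= c) ->
  intg (fun x => h x * f x).
Proof.
move=> fi mh hc; have mf := intg_meas fi.
apply: (@intg_le _ (fun x => c * `|f x|)); last exact/intgZ/intg_norm.
  exact: measurable_funM.
by move=> x; rewrite normrM ler_wpM2r.
Qed.

Lemma ID f g : intg f -> intg g ->
  \int[mu]_x (f x + g x) = \int[mu]_x f x + \int[mu]_x g x.
Proof. exact: RintegralD. Qed.

Lemma IB f g : intg f -> intg g ->
  \int[mu]_x (f x - g x) = \int[mu]_x f x - \int[mu]_x g x.
Proof. exact: RintegralB. Qed.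

Lemma IZ c f : intg f -> \int[mu]_x (c * f x) = c * \int[mu]_x f x.
Proof. exact: RintegralZl. Qed.

Lemma IZr c f : intg f -> \int[mu]_x (f x * c) = (\int[mu]_x f x) * c.
Proof. exact: RintegralZr. Qed.

Lemma IN f : intg f -> \int[mu]_x (- f x) = - \int[mu]_x f x.
Proof.
move=> fi; rewrite -mulN1r -IZ//; apply: eq_Rintegral => x _; by rewrite mulN1r.
Qed.

Lemma eq_I f g : f =1 g -> \int[mu]_x f x = \int[mu]_x g x.
Proof. by move=> /funext->. Qed.

Lemma I0 : \int[mu]_x (0 : R) = 0.
Proof. by rewrite Rintegral_cst// mul0r. Qed.

Lemma I_ge0 f : (forall x, 0 <= f x) -> 0 <= \int[mu]_x f x.
Proof. by move=> f0; exact: Rintegral_ge0. Qed.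

Lemma I_le f g : intg f -> intg g -> (forall x, f x <= g x) ->
  \int[mu]_x f x <= \int[mu]_x g x.
Proof. by move=> fi gi fg; exact: le_Rintegral. Qed.

Lemma I_norm f : intg f -> `|\int[mu]_x f x| <= \int[mu]_x `|f x|.
Proof. by move=> fi; exact: le_normr_Rintegral. Qed.

Lemma I_norm_le f g : intg f -> intg g -> (forall x, `|f x| <= g x) ->
  `|\int[mu]_x f x| <= \int[mu]_x g x.
Proof.
move=> fi gi fg; apply: le_trans (I_norm fi) _.
by apply: I_le => //; exact: intg_norm.
Qed.

Lemma EFin_I f : intg f -> (\int[mu]_x f x)%:E = (\int[mu]_x (f x)%:E)%E.
Proof. by move=> fi; rewrite /Rintegral fineK//; exact: integrable_fin_num. Qed.

Lemma intg_ge0P f : measurable_fun setT f -> (forall x, 0 <= f x) ->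
  (\int[mu]_x (f x)%:E < +oo)%E -> intg f.
Proof.
move=> mf f0 foo; apply/integrableP; split; first exact/measurable_EFinP.
by under eq_integral do rewrite /= ger0_norm//.
Qed.

Lemma intg_lty f : intg f -> (\int[mu]_x (f x)%:E < +oo)%E.
Proof. by move=> fi; rewrite -EFin_I// ltry. Qed.

Lemma dct (fn : nat -> R -> R) f g :
  (forall n, measurable_fun setT (fn n)) -> intg g ->
  (forall n x, `|fn n x| <= g x) -> (forall x, fn n x @[n --> \oo] --> f x) ->
  intg f /\ (\int[mu]_x fn n x) @[n --> \oo] --> \int[mu]_x f x.
Proof.
move=> mfn ig fng fnf.
have mf : measurable_fun setT f.
  by apply: (measurable_fun_cvg mfn) => x _; exact: fnf.
have [fi _ cv] : [/\ mu.-integrable setT (EFin \o f),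
  [sequence (\int[mu]_x `|(EFin \o fn n) x - (EFin \o f) x|)%E]_n @ \oo --> 0%E &
  [sequence (\int[mu]_x (EFin \o fn n) x)%E]_n @ \oo --> (\int[mu]_x (EFin \o f) x)%E].
  apply: (@dominated_convergence _ _ _ mu setT measurableT _ _ (EFin \o g)) => //.
  - by move=> n; apply/measurable_EFinP; exact: mfn.
  - exact/measurable_EFinP.
  - by apply: aeW => x _; apply: cvg_EFin; [exact: nearW|exact: fnf].
  - by apply: aeW => x n _ /=; rewrite lee_fin.
split => //; apply: fine_cvg.
by rewrite EFin_I.
Qed.

(** Used for improper integrals: the truncations [fn] are integrated exactly, their values have a
    common bound, and the limit is then integrable. *)
Lemma intg_fatou (fn : nat -> R -> R) f c :
  (forall n, intg (fn n)) -> (forall n x, 0 <= fn n x) ->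
  (forall x, fn n x @[n --> \oo] --> f x) ->
  (forall n, \int[mu]_x fn n x <= c) -> intg f /\ \int[mu]_x f x <= c.
Proof.
move=> ifn fn0 fnf fnc.
have f0 x : 0 <= f x.
  have <- : lim (fn n x @[n --> \oo]) = f x by apply/cvg_lim => //; exact: fnf.
  by apply: limr_ge; [apply/cvg_ex; exists (f x); exact: fnf|apply: nearW => n; exact: fn0].
have mf : measurable_fun setT f.
  by apply: (measurable_fun_cvg (fun n => intg_meas (ifn n))) => x _; exact: fnf.
have le : (\int[mu]_x (f x)%:E <= c%:E)%E.
  have H := @fatou _ _ _ mu setT measurableT (fun n => EFin \o fn n).
  have -> : (\int[mu]_x (f x)%:E = \int[mu]_x limn_einf (fun n => (EFin \o fn n) x))%E.
    apply: eq_integral => x _.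
    have hx : (EFin \o fn n) x @[n --> \oo] --> (f x)%:E.
      by apply: cvg_EFin; [exact: nearW|exact: fnf].
    by have [-> _] := cvg_limn_einf_sup hx.
  apply: le_trans (H _ _) _.
  - by move=> n; apply/measurable_EFinP; exact: intg_meas (ifn n).
  - by move=> n x _; rewrite lee_fin.
  - rewrite limn_einf_lim; apply: lime_le; first exact: is_cvg_einfs.
    apply: nearW => n; apply: ereal_inf_le; exists (\int[mu]_x (EFin \o fn n) x)%E.
      by exists n => /=.
    by rewrite /= -EFin_I// lee_fin.
have fi : intg f by apply: intg_ge0P => //; exact: le_lt_trans le (ltry _).
by split => //; rewrite -lee_fin EFin_I.
Qed.

(** Both sides are measures in [A], so uniqueness of Lebesgue measure reduces the identity to
    half-open intervals. For negative [a] the preimage is half-open on the other side, which is why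
    the two signs are treated separately. *)
Lemma affine_measure a b (A : set R) : a != 0 -> measurable A ->
  mu A = (`|a|%:E * mu ((fun x => (a * x + b)%R) @^-1` A))%E.
Proof.
move=> a0 mA.
have mphi : measurable_fun (setT : set (measurableTypeR R)) (fun x => a * x + b : measurableTypeR R).
  by apply: measurable_funD => //; exact: measurable_funM.
pose phi : {mfun measurableTypeR R >-> measurableTypeR R} := HB.pack (fun x => a * x + b : R) (isMeasurableFun.Build _ _ _ _ _ mphi).
pose k : {nonneg R} := NngNum (normr_ge0 a).
rewrite (@lebesgue_measure_unique _ (mscale k (pushforward mu phi)))//.
move=> _ [[u v] _ <-].
rewrite -[RHS]/(`|a|%:E * mu (phi @^-1` `]u, v]%classic))%E.
have [an|ap] := ltP a 0.
- have -> : phi @^-1` `]u, v]%classic = `[(v - b) / a, (u - b) / a[%classic.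
    apply/seteqP; split => x /=; rewrite !in_itv/= /phi/= ltr_ndivlMr// ler_ndivrMr//.
      by move=> /andP[? ?]; apply/andP; split; nra.
    by move=> /andP[? ?]; apply/andP; split; nra.
  rewrite !lebesgue_measure_itv/= !lte_fin ltr_ndivrMr// divfK ?lt_eqF// ltrD2r.
  case: ifPn => uv; last by rewrite mule0.
  rewrite -EFinB -EFinD -EFinM ltr0_norm//; congr EFin; field; exact: a0.
- have {ap}ap : 0 < a by rewrite lt_def a0.
  have -> : phi @^-1` `]u, v]%classic = `](u - b) / a, (v - b) / a]%classic.
    apply/seteqP; split => x /=; rewrite !in_itv/= /phi/= ltr_pdivrMr// ler_pdivlMr//.
      by move=> /andP[? ?]; apply/andP; split; nra.
    by move=> /andP[? ?]; apply/andP; split; nra.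
  rewrite !lebesgue_measure_itv/= !lte_fin ltr_pdivrMr// divfK ?gt_eqF// ltrD2r.
  case: ifPn => uv; last by rewrite mule0.
  rewrite -EFinB -EFinD -EFinM gtr0_norm//; congr EFin; field; exact: a0.
Qed.

Lemma ge0_integral_affine a b f : a != 0 -> measurable_fun setT f ->
  (forall x, 0 <= f x) ->
  (\int[mu]_x (f x)%:E = `|a|%:E * \int[mu]_x (f (a * x + b))%:E)%E.
Proof.
move=> a0 mf f0.
have mphi : measurable_fun (setT : set (measurableTypeR R)) (fun x => a * x + b : measurableTypeR R).
  by apply: measurable_funD => //; exact: measurable_funM.
pose phi : {mfun measurableTypeR R >-> measurableTypeR R} := HB.pack (fun x => a * x + b : R) (isMeasurableFun.Build _ _ _ _ _ mphi).
pose k : {nonneg R} := NngNum (normr_ge0 a).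
rewrite (@eq_measure_integral _ _ _ _ (mscale k (pushforward mu phi))); last first.
  by move=> A mA _; exact: affine_measure.
rewrite ge0_integral_mscale//=; last 2 first.
- exact/measurable_EFinP.
- by move=> x _; rewrite lee_fin.
congr (_ * _)%E.
rewrite (@ge0_integral_pushforward _ _ (measurableTypeR R) (measurableTypeR R) R phi mphi mu setT (EFin \o f))//.
- exact/measurable_EFinP.
- by move=> x _ /=; rewrite lee_fin.
Qed.

Lemma intg_affine a b f : a != 0 -> intg f -> intg (fun x => f (a * x + b)).
Proof.
move=> a0 fi; have mf := intg_meas fi.
have mphi : measurable_fun (setT : set R) (fun x => a * x + b : R).
  by apply: measurable_funD => //; exact: measurable_funM.
have mf' : measurable_fun setT (fun x => f (a * x + b)) by exact: measurableT_comp.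
apply/integrableP; split; first exact/measurable_EFinP.
have /integrableP[_] := fi.
rewrite /= (@ge0_integral_affine a b (fun x => `|f x|))//; last exact: measurableT_comp.
set J := (\int[_]_(_ in _) _)%E => H.
have J0 : (0 <= J)%E by apply: integral_ge0.
rewrite ltNge leye_eq; apply/eqP => Joo; move: H; rewrite Joo.
by rewrite mulry gtr0_sg ?normr_gt0// mul1e ltxx.
Qed.

Lemma I_affine a b f : a != 0 -> intg f ->
  \int[mu]_x f x = `|a| * \int[mu]_x f (a * x + b).
Proof.
move=> a0 fi; have mf := intg_meas fi.
have fpi : intg (fun x => Num.max (f x) 0) by exact: (integrable_funrpos measurableT fi).
have fni : intg (fun x => Num.max (- f x) 0) by exact: (integrable_funrneg measurableT fi).
have fE x : f x = Num.max (f x) 0 - Num.max (- f x) 0.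
  by rewrite /Num.max; case: ifP; case: ifP; lra.
have pos g : intg g -> (forall x, 0 <= g x) ->
    \int[mu]_x g x = `|a| * \int[mu]_x g (a * x + b).
  move=> gi g0; apply: EFin_inj; rewrite EFinM !EFin_I//; last exact: intg_affine.
  exact: ge0_integral_affine (intg_meas gi) g0.
rewrite (eq_I fE) IB// (pos _ fpi) ?(pos _ fni); last 2 first.
- by move=> x; rewrite le_max lexx orbT.
- by move=> x; rewrite le_max lexx orbT.
rewrite -mulrBr -IB; last 2 first.
- exact: (intg_affine b a0 fpi).
- exact: (intg_affine b a0 fni).
by congr (_ * _); apply: eq_I => x; rewrite -fE.
Qed.

Lemma intg_shift b f : intg f -> intg (fun x => f (x + b)).
Proof.
move=> fi; apply: eq_intg (intg_affine b (oner_neq0 R) fi) => x.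
by rewrite mul1r.
Qed.

Lemma I_shift b f : intg f -> \int[mu]_x f (x + b) = \int[mu]_x f x.
Proof.
move=> fi; rewrite [RHS](I_affine b (oner_neq0 R) fi) normr1 mul1r.
by apply: eq_I => x; rewrite mul1r.
Qed.

Lemma intg_refl b f : intg f -> intg (fun x => f (b - x)).
Proof.
move=> fi; have m1 : -1 != 0 :> R by rewrite oppr_eq0 oner_eq0.
by apply: eq_intg (intg_affine b m1 fi) => x; rewrite mulN1r addrC.
Qed.

Lemma I_refl b f : intg f -> \int[mu]_x f (b - x) = \int[mu]_x f x.
Proof.
move=> fi; have m1 : -1 != 0 :> R by rewrite oppr_eq0 oner_eq0.
rewrite [RHS](I_affine b m1 fi) normrN1 mul1r.
by apply: eq_I => x; rewrite mulN1r addrC.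
Qed.

Lemma ae_sub (P Q : R -> Prop) : (forall x, P x -> Q x) ->
  {ae mu, forall x, P x} -> {ae mu, forall x, Q x}.
Proof.
move=> PQ [N [mN N0 sub]]; exists N; split => //; apply: subset_trans sub.
by move=> x nq /PQ.
Qed.

(** Tonelli for |F| with the majorant [g] gives integrability on the product, hence Fubini. The
    sections in the second variable are integrable only almost everywhere, so the identity for the
    real-valued inner integral is an almost everywhere comparison. *)
Lemma fub (F : R -> R -> R) (g : R -> R) :
  measurable_fun setT (fun z : R * R => F z.1 z.2) ->
  (forall x, intg (F x)) -> intg g -> (forall x, \int[mu]_y `|F x y| <= g x) ->
  [/\ {ae mu, forall y, intg (F ^~ y)},
      intg (fun x => \int[mu]_y F x y), intg (fun y => \int[mu]_x F x y) &
      \int[mu]_x \int[mu]_y F x y = \int[mu]_y \int[mu]_x F x y].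
Proof.
move=> mF iF ig Fg.
pose f (z : measurableTypeR R * measurableTypeR R) := (F z.1 z.2)%:E.
have mf : measurable_fun setT f by exact/measurable_EFinP.
have ff : (mu \x mu)%E.-integrable setT f.
  have H0 := (@integrable12ltyP _ _ _ _ R mu mu f mf).
  apply H0; apply: le_lt_trans (intg_lty ig).
  apply: ge0_le_integral => //.
  - by move=> x _; exact: integral_ge0.
  - apply: (measurable_fun_fubini_tonelli_F (abse \o f)).
      exact: measurableT_comp.
    by move=> x; exact: abse_ge0.
  - exact: measurable_int ig.
  - by move=> x _; rewrite /f/= -EFin_I ?lee_fin//; exact: intg_norm.
have i1 : intg (fun x => \int[mu]_y F x y).
  apply: (@intg_le _ g) => //; last first.
    by move=> x; apply: le_trans (I_norm (iF x)) (Fg x).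
  exact: (measurableT_comp (fine_measurable measurableT) (measurable_fubini_F ff)).
have aey : {ae mu, forall y, intg (F ^~ y)} by exact: (ae_integrable2 ff).
have m2 : measurable_fun setT (fun y => \int[mu]_x F x y).
  exact: (measurableT_comp (fine_measurable measurableT) (measurable_fubini_G ff)).
have i2 : intg (fun y => \int[mu]_x F x y).
  apply/integrableP; split; first exact/measurable_EFinP.
  have H0 := (@integrable21ltyP _ _ _ _ R mu mu f mf).
  have {H0} := (proj1 H0 ff); apply: le_lt_trans.
  apply: ge0_le_integral => //.
  - by apply: measurableT_comp => //; exact/measurable_EFinP.
  - apply: (measurable_fun_fubini_tonelli_G (abse \o f)).
      exact: measurableT_comp.
    by move=> x; exact: abse_ge0.
  - move=> y _; apply: (@le_trans _ _ `|\int[mu]_x f (x, y)|%E).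
      rewrite /= /Rintegral /f /=.
      (* [fine] sends an infinite inner integral to 0, so the bound survives at exceptional [y]. *)
      by case: (\int[mu]_x _)%E => [r| |] //=; rewrite normr0 leey.
    apply: le_abse_integral => //.
    exact: measurableT_comp.
apply: (And4 aey i1 i2); apply: EFin_inj; rewrite (EFin_I i1) (EFin_I i2).
transitivity (\int[mu]_x \int[mu]_y f (x, y))%E.
  by apply: eq_integral => x _; rewrite EFin_I.
rewrite (Fubini ff); apply: ae_eq_integral => //.
- exact: measurable_fubini_G ff.
- exact/measurable_EFinP.
- by apply: ae_sub aey => y iy _; rewrite EFin_I.
Qed.

Lemma I_ae f g : measurable_fun setT f -> measurable_fun setT g ->
  {ae mu, forall x, f x = g x} -> \int[mu]_x f x = \int[mu]_x g x.
Proof.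
move=> mf mg fg; congr fine; apply: ae_eq_integral => //; try exact/measurable_EFinP.
by apply: ae_sub fg => x ->.
Qed.

Lemma intg_ae f g : measurable_fun setT g -> {ae mu, forall x, f x = g x} ->
  intg f -> intg g.
Proof.
move=> mg fg fi; have mf := intg_meas fi.
apply/integrableP; split; first exact/measurable_EFinP.
have /integrableP[_] := fi; apply: le_lt_trans.
rewrite le_eqVlt; apply/orP; left; apply/eqP; apply: ae_eq_integral => //.
- by apply: measurableT_comp => //; exact/measurable_EFinP.
- by apply: measurableT_comp => //; exact/measurable_EFinP.
- by apply: ae_sub fg => x /= ->.
Qed.

Lemma intg_itv a b c f : measurable_fun setT f ->
  (forall x, a <= x <= b -> `|f x| <= c) ->
  intg (fun x => if a <= x <= b then f x else 0).
Proof.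
move=> mf fc.
have mi : measurable_fun (setT : set R) (fun x : R => a <= x <= b).
  by apply: measurable_and; apply: measurable_fun_ler.
apply: (@intg_le _ (fun x => `|c| * \1_`[a, b] x)); last first.
- by apply: intgZ; exact: integrable_indic_itv.
- move=> x; rewrite indicE; case: ifPn => xab.
    rewrite mem_set ?mulr1; last by rewrite /= in_itv.
    exact: le_trans (fc _ xab) (ler_norm _).
  by rewrite normr0 mulr_ge0.
- by apply: measurable_fun_ifT.
Qed.

Lemma I_itv_cst a b c : a <= b ->
  \int[mu]_x (if a <= x <= b then c else 0) = c * (b - a).
Proof.
move=> ab.
have -> : \int[mu]_x (if a <= x <= b then c else 0) = \int[mu]_(x in `[a, b]) c.
  rewrite [RHS]Rintegral_mkcond; apply: eq_Rintegral => x _.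
  by rewrite patchE; case: ifPn => h; case: ifPn => h' //;
    move: h'; rewrite ?inE ?notin_setE /= in_itv /= ?h // => h2; exfalso; rewrite h2 in h.
by rewrite Rintegral_cst//= lebesgue_measure_itv/=; case: ifPn; rewrite lte_fin -?EFinB//=;
   rewrite -leNgt => ba; rewrite (le_anti (introT andP (conj ab ba))) subrr.
Qed.

Lemma I_gt0 f x : continuous f -> intg f -> (forall y, 0 <= f y) -> 0 < f x ->
  0 < \int[mu]_y f y.
Proof.
move=> cf fi f0 fx.
have /cvgrPdist_lt/(_ (f x / 2)) := cf x.
have fx2 : 0 < f x / 2 by rewrite divr_gt0.
move=> /(_ fx2) /nbhs_ballP [d /= d0 H].
have d2 : 0 < d / 2 by rewrite divr_gt0.
apply: (@lt_le_trans _ _ (\int[mu]_y (if x - d / 2 <= y <= x + d / 2 then f x / 2 else 0))).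
  by rewrite I_itv_cst ?mulr_gt0//; lra.
apply: I_le => //.
  apply: (@intg_itv _ _ (`|f x / 2|)) => //.
move=> y; case: ifPn => // /andP[h1 h2].
have : `|f x - f y| < f x / 2.
  by apply: H; rewrite /ball /= ltr_norml; apply/andP; split; lra.
by rewrite ltr_norml => /andP[_]; lra.
Qed.

Lemma I_eq0 f : continuous f -> intg f -> (forall y, 0 <= f y) ->
  \int[mu]_y f y = 0 -> forall x, f x = 0.
Proof.
move=> cf fi f0 I0 x; apply/eqP; rewrite eq_le f0 andbT leNgt; apply/negP => fx.
by have := I_gt0 cf fi f0 fx; rewrite I0 ltxx.
Qed.

Lemma ftc (F f : R -> R) a b : a <= b ->
  (forall x, a <= x <= b -> is_derive x 1 F (f x)) ->
  (forall x, a <= x <= b -> {for x, continuous f}) ->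
  \int[mu]_x (if a <= x <= b then f x else 0) = F b - F a.
Proof.
rewrite le_eqVlt => /predU1P[->|ab] dF cf.
  rewrite subrr -[RHS](mulr0 (f b)) -[X in _ * X](subrr b) -I_itv_cst//.
  apply: eq_I => x; case: ifPn => // h; congr f; apply/eqP; rewrite eq_le.
  by rewrite andbC.
have -> : \int[mu]_x (if a <= x <= b then f x else 0) = \int[mu]_(x in `[a, b]) f x.
  rewrite [RHS]Rintegral_mkcond; apply: eq_Rintegral => x _.
  by rewrite patchE; case: ifPn => h; case: ifPn => h' //;
    move: h'; rewrite ?inE ?notin_setE /= in_itv /= ?h // => h2; exfalso; rewrite h2 in h.
have dF' x : a <= x <= b -> derivable F x 1 by move=> /dF [].
have cF x : a <= x <= b -> {for x, continuous F}.
  by move=> /dF' h; apply: differentiable_continuous; exact/derivable1_diffP.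
have aab : a <= a <= b by rewrite lexx ltW.
have bab : a <= b <= b by rewrite lexx ltW.
rewrite /Rintegral (@continuous_FTC2 _ f F)//.
- apply: continuous_in_subspaceT => x /set_mem; rewrite /= in_itv /=.
  exact: cf.
- split.
  + by move=> x; rewrite in_itv/= => /andP[/ltW ax /ltW xb]; apply: dF'; rewrite ax.
  + by apply: cvg_at_right_filter; exact: cF.
  + by apply: cvg_at_left_filter; exact: cF.
- move=> x; rewrite in_itv/= => /andP[/ltW ax /ltW xb].
  by rewrite derive1E; apply: derive_val; apply: dF; rewrite ax.
Qed.

End RealIntegral.

(** * Measurability of composite expressions *)

Section Measurability.
Context d {T : measurableType d} {R : realType}.
Implicit Types (f g : T -> R) (b c : T -> bool) (a : R).

Lemma mfC a : measurable_fun setT (fun _ : T => a).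
Proof. exact: measurable_cst. Qed.
Lemma mfD f g : measurable_fun setT f -> measurable_fun setT g ->
  measurable_fun setT (fun x => f x + g x).
Proof. exact: measurable_funD. Qed.
Lemma mfN f : measurable_fun setT f -> measurable_fun setT (fun x => - f x).
Proof. by move=> mf; exact: (measurableT_comp (@oppr_measurable R setT)). Qed.
Lemma mfB f g : measurable_fun setT f -> measurable_fun setT g ->
  measurable_fun setT (fun x => f x - g x).
Proof. exact: measurable_funB. Qed.
Lemma mfM f g : measurable_fun setT f -> measurable_fun setT g ->
  measurable_fun setT (fun x => f x * g x).
Proof. exact: measurable_funM. Qed.
Lemma mfX n f : measurable_fun setT f -> measurable_fun setT (fun x => f x ^+ n).
Proof. exact: measurable_funX. Qed.
Lemma mfnorm f : measurable_fun setT f -> measurable_fun setT (fun x => `|f x|).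
Proof. by move=> mf; exact: measurableT_comp. Qed.
Lemma mfpowR a f : measurable_fun setT f -> measurable_fun setT (fun x => f x `^ a).
Proof. by move=> mf; exact: (measurableT_comp (measurable_powR a)). Qed.
Lemma mfexp f : measurable_fun setT f -> measurable_fun setT (fun x => expR (f x)).
Proof. by move=> mf; exact: (measurableT_comp (@measurable_expR R)). Qed.
Lemma mfcos f : measurable_fun setT f -> measurable_fun setT (fun x => cos (f x)).
Proof.
move=> mf; apply: (measurableT_comp _ mf).
by apply: continuous_measurable_fun; exact: continuous_cos.
Qed.
Lemma mfsin f : measurable_fun setT f -> measurable_fun setT (fun x => sin (f x)).
Proof.
move=> mf; apply: (measurableT_comp _ mf).
by apply: continuous_measurable_fun; exact: continuous_sin.
Qed.
Lemma mfif b f g : measurable_fun setT b -> measurable_fun setT f ->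
  measurable_fun setT g -> measurable_fun setT (fun x => if b x then f x else g x).
Proof. by move=> *; exact: measurable_fun_ifT. Qed.
Lemma mfle f g : measurable_fun setT f -> measurable_fun setT g ->
  measurable_fun setT (fun x => f x <= g x).
Proof. exact: measurable_fun_ler. Qed.
Lemma mflt f g : measurable_fun setT f -> measurable_fun setT g ->
  measurable_fun setT (fun x => f x < g x).
Proof. exact: measurable_fun_ltr. Qed.
Lemma mfand b c : measurable_fun setT b -> measurable_fun setT c ->
  measurable_fun setT (fun x => b x && c x).
Proof. exact: measurable_and. Qed.
Lemma mfcomp (h : R -> R) f : measurable_fun setT h -> measurable_fun setT f ->
  measurable_fun setT (fun x => h (f x)).
Proof. exact: measurableT_comp. Qed.

End Measurability.

Ltac mfun := repeat first
  [ exact: mfC | exact: measurable_id | assumption | exact: measurable_fst | exact: measurable_snd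
  | apply: mfD | apply: mfN | apply: mfM | apply: mfX | apply: mfnorm | apply: mfpowR
  | apply: mfexp | apply: mfcos | apply: mfsin | apply: mfif | apply: mfle | apply: mflt | apply: mfand
  | match goal with
    | H : measurable_fun setT ?h |- measurable_fun _ (fun x => ?h (@?f x)) =>
        apply: (mfcomp H)
    end ].

(** * Real powers: integrability, decay weights, subadditivity *)

Section Powers.
Context {R : realType}.
Local Notation mu := (@lebesgue_measure R).
Implicit Types (f g h : R -> R) (a b c r x y : R).

Lemma powR_cont a x : 0 < x -> {for x, continuous (fun y : R => y `^ a)}.
Proof.
move=> x0; apply: differentiable_continuous; apply/derivable1_diffP.
by have [] := is_derive1_powR a x0.
Qed.

Lemma le_powRr a x y : 0 <= a -> 0 <= x <= y -> x `^ a <= y `^ a.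
Proof.
by move=> a0 /andP[x0 xy]; apply: ge0_ler_powR => //; rewrite nnegrE// (le_trans x0).
Qed.

Lemma le_powRN a x y : 0 <= a -> 0 < x <= y -> y `^ (- a) <= x `^ (- a).
Proof.
move=> a0 /andP[x0 xy]; rewrite !powRN lef_pV2 ?posrE ?powR_gt0 ?(lt_le_trans x0)//.
by apply: le_powRr => //; rewrite ltW.
Qed.

Lemma powRV_le1 a x : 0 <= a -> 1 <= x -> x `^ (- a) <= 1.
Proof. by move=> a0 x1; have := @le_powRN a 1 x a0; rewrite powR1 ltr01 x1; apply. Qed.

Lemma ftc_powR r a b : r != -1 -> 0 < a <= b ->
  \int[mu]_x (if a <= x <= b then x `^ r else 0) =
  (b `^ (r + 1) - a `^ (r + 1)) / (r + 1).
Proof.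
move=> r1 /andP[a0 ab]; have r0 : r + 1 != 0 by rewrite addr_eq0.
transitivity (b `^ (r + 1) / (r + 1) - a `^ (r + 1) / (r + 1)); last by rewrite mulrBl.
apply: (@ftc _ (fun x => x `^ (r + 1) / (r + 1))) => //.
- move=> x /andP[ax _]; have x0 := lt_le_trans a0 ax.
  have D := is_derive1_powR (r + 1) x0.
  have -> : x `^ r = (r + 1) * x `^ (r + 1 - 1) / (r + 1).
    by rewrite addrK mulrAC divff// mul1r.
  rewrite (_ : (fun y => _) = (r + 1)^-1 \*: (fun y : R => y `^ (r + 1))); last first.
    by apply/funext => y /=; rewrite mulrC.
  by rewrite mulrC; exact: is_deriveZ.
- by move=> x /andP[ax _]; apply: powR_cont; exact: lt_le_trans ax.
Qed.

(** An even function is its right half plus the reflection of that half; the origin belongs to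
    neither, hence the condition [f 0 = 0]. *)
Lemma intg_half (P : R -> bool) f :
  intg (fun x => if (0 < x) && P x then f x else 0) -> f 0 = 0 ->
  intg (fun x => if P `|x| then f `|x| else 0).
Proof.
move=> h f0; apply: eq_intg (intgD h (intg_refl 0 h)) => x /=.
rewrite sub0r oppr_gt0; have [x0|x0|<-] := ltgtP 0 x.
- by rewrite gtr0_norm// addr0.
- by rewrite add0r ltr0_norm.
- by rewrite normr0 /= f0 addr0 if_same.
Qed.

Lemma intg_tail r : 1 < r -> intg (fun x => if 1 <= `|x| then `|x| `^ (- r) else 0).
Proof.
move=> r1; apply: (@intg_half (fun x => 1 <= x) (fun x => x `^ (- r))); last first.
  by rewrite powR0// oppr_eq0 gt_eqF// (lt_trans ltr01).
pose fn n x := if 1 <= x <= 1 + n%:R then x `^ (- r) else 0.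
apply: (proj1 (@intg_fatou _ fn _ ((r - 1)^-1) _ _ _ _)).
- move=> n; apply: (@intg_itv _ _ _ 1); first by mfun.
  by move=> x /andP[x1 _]; rewrite ger0_norm ?powR_ge0// powRV_le1// ltW// (lt_trans ltr01).
- by move=> n x; rewrite /fn; case: ifP => // _; exact: powR_ge0.
- move=> x; apply: cvg_near_cst.
  near=> n; rewrite /fn; have -> : (x <= 1 + n%:R) = true.
    apply: (@le_trans _ _ n%:R); last by rewrite lerDr.
    by near: n; exact: nbhs_infty_ger.
  by rewrite andbT; case: ifPn => x1; rewrite ?andbT ?andbF// ?(lt_le_trans ltr01 x1).
- move=> n; rewrite ftc_powR ?ltr01 ?lerDl//=; last by rewrite eqr_opp gt_eqF.
  rewrite powR1 -[leLHS]mulrNN -invrN opprB [-(-r + 1)]opprD opprK.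
  rewrite ler_pdivrMr ?subr_gt0// mulVf ?subr_eq0 ?gt_eqF//.
Unshelve. all: by end_near. Qed.

Lemma intg_sing r : 0 < r < 1 -> intg (fun x => if `|x| <= 1 then `|x| `^ (- r) else 0).
Proof.
move=> /andP[r0 r1]; apply: (@intg_half (fun x => x <= 1) (fun x => x `^ (- r))); last first.
  by rewrite powR0// oppr_eq0 gt_eqF.
pose fn n x := if n.+1%:R^-1 <= x <= 1 then x `^ (- r) else 0.
have n0 n : 0 < n.+1%:R^-1 :> R by [].
have n1 n : n.+1%:R^-1 <= 1 :> R by rewrite invf_le1// ler1n.
apply: (proj1 (@intg_fatou _ fn _ ((1 - r)^-1) _ _ _ _)).
- move=> n; apply: (@intg_itv _ _ _ (n.+1%:R^-1 `^ (- r))); first by mfun.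
  move=> x /andP[x1 _]; rewrite ger0_norm ?powR_ge0// le_powRN ?(ltW r0)//.
  by rewrite n0.
- by move=> n x; rewrite /fn; case: ifP => // _; exact: powR_ge0.
- move=> x; apply: cvg_near_cst.
  have [x0|x0] := leP x 0.
    by apply: nearW => n; rewrite /fn leNgt (le_lt_trans x0 (n0 n)).
  near=> n; rewrite /fn; have -> // : (n.+1%:R^-1 <= x) = true.
  rewrite invf_ple ?posrE//; apply: (@le_trans _ _ n%:R); last by rewrite ler_nat.
  by near: n; exact: nbhs_infty_ger.
- move=> n; rewrite ftc_powR ?n0 ?n1//=; last by rewrite eqr_opp lt_eqF.
  rewrite powR1 -[leRHS]mul1r [1 - r]addrC ler_wpM2r ?invr_ge0 ?lerBlDl ?lerDr ?powR_ge0//.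
  by rewrite addrC subr_ge0 ltW.
Unshelve. all: by end_near. Qed.

(** The scale in which decay is measured throughout: bounded at the origin, integrable for r > 1,
    multiplicative in r. A negative [r] measures growth, as in [wt (- p)] for |x|^p. *)
Definition wt r x : R := (1 + `|x|) `^ (- r).

Lemma wt_gt0 r x : 0 < wt r x.
Proof. by rewrite powR_gt0// ltr_wpDr. Qed.

Lemma wt_ge0 r x : 0 <= wt r x.
Proof. exact/ltW/wt_gt0. Qed.

Lemma wt_meas r : measurable_fun setT (wt r).
Proof. by rewrite /wt; mfun. Qed.

Lemma wt_le1 r x : 0 <= r -> wt r x <= 1.
Proof. by move=> r0; rewrite powRV_le1// lerDl. Qed.

Lemma wt_le_pow r x : 0 <= r -> x != 0 -> wt r x <= `|x| `^ (- r).
Proof. by move=> r0 x0; rewrite le_powRN// normr_gt0 x0/= lerDr. Qed.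

Lemma intg_wt r : 1 < r -> intg (wt r).
Proof.
move=> r1; have r0 : 0 <= r by rewrite ltW// (lt_trans ltr01).
have h : intg (fun x : R => if -1 <= x <= 1 then 1 else 0).
  by apply: (@intg_itv _ _ _ 1) => [|x _]; [mfun|rewrite normr1].
apply: (intg_le (wt_meas r) _ (intgD h (intg_tail r1))) => x.
rewrite (ger0_norm (wt_ge0 r x)) -ler_norml.
have [x1|x1] := leP `|x| 1.
  by apply: le_trans (wt_le1 x r0) _; rewrite lerDl; case: ifP => // _; exact: powR_ge0.
by rewrite (ltW x1) add0r; apply: wt_le_pow => //; rewrite -normr_gt0 (lt_trans ltr01).
Qed.

Lemma powR_lt_wt a x : 0 <= a -> `|x| `^ a <= wt (- a) x.
Proof. by move=> a0; rewrite /wt opprK le_powRr// lerDr normr_ge0 ler01. Qed.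

Lemma wtM r r' x : wt r x * wt r' x = wt (r + r') x.
Proof.
rewrite /wt opprD powRD// ; apply/implyP => _; rewrite gt_eqF// ltr_wpDr//.
Qed.

Lemma powR_le_split r x : 0 <= r -> 1 <= `|x| -> `|x| `^ (- r) <= 2 `^ r * wt r x.
Proof.
move=> r0 x1; have x0 := lt_le_trans ltr01 x1.
have : (1 + `|x|) `^ r <= 2 `^ r * `|x| `^ r.
  rewrite -powRM//; apply: le_powRr => //; lra.
have p1 : 0 < `|x| `^ r by rewrite powR_gt0.
have p2 : 0 < (1 + `|x|) `^ r by rewrite powR_gt0// addr_gt0.
rewrite /wt !powRN => h; rewrite ler_pdivlMr// mulrC ler_pdivrMr//.
Qed.

(** On [0, 1] one has t <= t^p; this is applied to the two fractions a / (a + b) and b / (a + b),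
    whose sum is 1. *)
Lemma powRD_le (p a b : R) : 0 < p <= 1 -> 0 <= a -> 0 <= b ->
  (a + b) `^ p <= a `^ p + b `^ p.
Proof.
move=> /andP[p0 p1]; rewrite le_eqVlt => /predU1P[<-|a0] b0.
  by rewrite powR0 ?gt_eqF// !add0r.
have ab0 : 0 < a + b by rewrite ltr_wpDr.
have key (t : R) : 0 <= t <= 1 -> t <= t `^ p.
  move=> /andP[]; rewrite le_eqVlt => /predU1P[<-|t0] t1; first by rewrite powR_ge0.
  by apply: ger1_powR => //; rewrite t0.
have ka : a / (a + b) <= (a / (a + b)) `^ p.
  apply: key; apply/andP; split; first by rewrite divr_ge0 ?ltW.
  by rewrite ler_pdivrMr// mul1r lerDl.
have kb : b / (a + b) <= (b / (a + b)) `^ p.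
  apply: key; apply/andP; split; first by rewrite divr_ge0// ltW.
  by rewrite ler_pdivrMr// mul1r lerDr ltW.
have E (t : R) : 0 <= t -> t `^ p = (t / (a + b)) `^ p * (a + b) `^ p.
  move=> t0; rewrite -powRM ?(ltW ab0)// ?divfK ?gt_eqF//.
  by rewrite divr_ge0// (ltW ab0).
rewrite (E a (ltW a0)) (E b b0) -mulrDl ler_peMl ?powR_ge0//.
apply: le_trans (lerD ka kb); rewrite -mulrDl divff ?gt_eqF//.
Qed.

Lemma powR_dist (p x y : R) : 0 < p <= 1 ->
  `| `|x| `^ p - `|y| `^ p | <= `|x - y| `^ p.
Proof.
move=> p01; have p0 : 0 <= p by case/andP: p01 => /ltW.
have H a b : `|a| `^ p <= `|a - b| `^ p + `|b| `^ p.
  apply: le_trans (powRD_le p01 (normr_ge0 _) (normr_ge0 _)).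
  apply: le_powRr => //; rewrite normr_ge0 /=.
  by rewrite -[X in `|X| <= _](subrK b a) ler_normD.
rewrite ler_norml; apply/andP; split.
  by rewrite lerNl opprB lerBlDr distrC H.
by rewrite lerBlDr H.
Qed.

Lemma powR_abs_cont (p : R) : 0 < p -> continuous (fun x : R => `|x| `^ p).
Proof.
move=> p0 x; have [->|x0] := eqVneq x 0.
  apply/cvgrPdist_lt => e e0; rewrite normr0 powR0 ?gt_eqF//.
  near=> y; rewrite sub0r normrN ger0_norm ?powR_ge0//.
  have -> : e = (e `^ (p^-1)) `^ p by rewrite -powRrM mulVf ?gt_eqF// powRr1 // ltW.
  rewrite gt0_ltr_powR ?nnegrE ?normr_ge0 ?powR_ge0//.
  near: y; apply/nbhs_ballP; exists (e `^ p^-1) => /=; first exact: powR_gt0.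
  by move=> y; rewrite /ball/= sub0r normrN.
apply: (@cvg_comp _ _ _ (fun y : R => `|y|) (fun y : R => y `^ p) _ (nbhs `|x|)).
  exact: norm_continuous.
by apply: powR_cont; rewrite normr_gt0.
Unshelve. all: by end_near. Qed.

End Powers.

(** * Derivatives and mean value estimates *)

Section Derivatives.
Context {R : realType}.
Implicit Types (f g h : R -> R) (a b c r x y : R).

Lemma is_derive_ext f g x d : f =1 g -> is_derive x 1 f d -> is_derive x 1 g d.
Proof. by move=> /funext->. Qed.

Lemma is_derive_near f g x d : (\forall y \near x, f y = g y) ->
  is_derive x 1 f d -> is_derive x 1 g d.
Proof.
move=> fg [df vf]; split.
  by apply: near_eq_derivable df => //; rewrite oner_neq0.
by rewrite -vf; apply: esym; apply: near_eq_derive => //; rewrite oner_neq0.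
Qed.

Lemma is_derive_cont f x d : is_derive x 1 f d -> {for x, continuous f}.
Proof.
by move=> [df _]; apply: differentiable_continuous; exact/derivable1_diffP.
Qed.

Lemma is_derive_affine f a b x d : is_derive (a * x + b) 1 f d ->
  is_derive x 1 (fun y => f (a * y + b)) (a * d).
Proof.
move=> h; have h1 : is_derive x 1 (fun y => a * y + b) a.
  by apply: is_derive_eq; rewrite scaler1 addr0 ?mulr1 ?mul1r.
have := @is_derive1_comp R f (fun y => a * y + b) x d a h h1.
by rewrite mulrC.
Qed.

Lemma is_deriveMr f g x df dg : is_derive x 1 f df -> is_derive x 1 g dg ->
  is_derive x 1 (fun y => f y * g y) (df * g x + f x * dg).
Proof.
move=> hf hg; have := @is_deriveM R R f g x 1 df dg hf hg.
by rewrite addrC /GRing.scale /= [g x * _]mulrC.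
Qed.

Lemma is_deriveZr f x c d : is_derive x 1 f d -> is_derive x 1 (fun y => c * f y) (c * d).
Proof. by move=> h; exact: is_deriveZ. Qed.

Lemma is_deriveDr f g x df dg : is_derive x 1 f df -> is_derive x 1 g dg ->
  is_derive x 1 (fun y => f y + g y) (df + dg).
Proof. by move=> hf hg; exact: is_deriveD. Qed.

Lemma mvt_eq f df a b : a <= b ->
  (forall x, a <= x <= b -> is_derive x 1 f (df x)) ->
  exists2 c, a <= c <= b & f b - f a = df c * (b - a).
Proof.
move=> ab h.
have [||c] := @MVT_segment R f df a b ab.
- move=> x; rewrite in_itv/= => /andP[/ltW h1 /ltW h2]; by apply: h; rewrite h1.
- by apply: continuous_in_subspaceT => x /set_mem; rewrite /= in_itv/= => /h/is_derive_cont.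
- by rewrite in_itv/= => cab E; exists c.
Qed.

Lemma mvt_le f df a b c : a <= b ->
  (forall x, a <= x <= b -> is_derive x 1 f (df x)) ->
  (forall x, a <= x <= b -> `|df x| <= c) -> `|f b - f a| <= c * (b - a).
Proof.
move=> ab h hc; have [t tab ->] := mvt_eq ab h.
by rewrite normrM [`|b - a|]ger0_norm ?subr_ge0// ler_wpM2r ?subr_ge0// hc.
Qed.

(** The mean value theorem twice: f (x + t) + f (x - t) has t-derivative f1 (x + t) - f1 (x - t),
    which is at most 2 c t. *)
Lemma sdiff_le f f1 f2 x t c : 0 <= t ->
  (forall y, x - t <= y <= x + t -> is_derive y 1 f (f1 y)) ->
  (forall y, x - t <= y <= x + t -> is_derive y 1 f1 (f2 y)) ->
  (forall y, x - t <= y <= x + t -> `|f2 y| <= c) ->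
  `|f (x + t) + f (x - t) - 2 * f x| <= 2 * c * t ^+ 2.
Proof.
move=> t0 d1 d2 hc.
pose h u := f (x + u) + f (x - u).
have dh u : 0 <= u <= t -> is_derive u 1 h (f1 (x + u) - f1 (x - u)).
  move=> /andP[u0 ut].
  have A : is_derive u 1 (fun u => f (1 * u + x)) (1 * f1 (x + u)).
    by apply: is_derive_affine; rewrite mul1r addrC; apply: d1; lra.
  have B : is_derive u 1 (fun u => f (-1 * u + x)) (-1 * f1 (x - u)).
    by apply: is_derive_affine; rewrite mulN1r addrC; apply: d1; lra.
  have := is_deriveDr A B.
  rewrite mul1r mulN1r; apply: is_derive_ext => v.
  by rewrite /h mul1r mulN1r [v + x]addrC [- v + x]addrC.
have -> : f (x + t) + f (x - t) - 2 * f x = h t - h 0 by rewrite /h subr0 addr0; ring.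
have -> : 2 * c * t ^+ 2 = 2 * c * t * (t - 0) by ring.
apply: (mvt_le t0 dh).
move=> u /andP[u0 ut].
have xu : x - u <= x + u by lra.
apply: le_trans (@mvt_le f1 f2 (x - u) (x + u) c xu _ _) _.
- by move=> y ?; apply: d2; lra.
- by move=> y ?; apply: hc; lra.
have c0 : 0 <= c by apply: le_trans (normr_ge0 (f2 x)) (hc x _); lra.
nra.
Qed.

Lemma powR_abs_derive a x : x != 0 ->
  is_derive x 1 (fun y => `|y| `^ a) (a * (x * `|x| `^ (a - 2))).
Proof.
move=> x0.
have E (y : R) : 0 < y -> y * y `^ (a - 2) = y `^ (a - 1).
  move=> y0; rewrite -{1}(powRr1 (ltW y0)) -powRD; last by rewrite (gt_eqF y0) implybT.
  by congr powR; ring.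
have [xn|xp|x00] := ltgtP x 0; last by rewrite x00 eqxx in x0.
- have -> : a * (x * `|x| `^ (a - 2)) = -1 * (a * (- x) `^ (a - 1)).
    by rewrite ltr0_norm// -E ?oppr_gt0//; ring.
  apply: (@is_derive_near (fun y => (-1 * y + 0) `^ a)).
    near=> y; rewrite addr0 mulN1r ltr0_norm//.
    by near: y; exact: lt_nbhsl.
  by apply: (@is_derive_affine (fun z => z `^ a)); rewrite mulN1r addr0; apply: is_derive1_powR; rewrite oppr_gt0.
- have -> : a * (x * `|x| `^ (a - 2)) = a * x `^ (a - 1) by rewrite gtr0_norm// E.
  apply: (@is_derive_near (fun y => y `^ a)); last exact: is_derive1_powR.
  near=> y; rewrite gtr0_norm//; near: y; exact: lt_nbhsr.
Unshelve. all: by end_near. Qed.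

Lemma xpowR_abs_derive a x : x != 0 ->
  is_derive x 1 (fun y => y * `|y| `^ a) ((a + 1) * `|x| `^ a).
Proof.
move=> x0; have := is_deriveMr (@is_derive_id R R x 1) (powR_abs_derive a x0).
congr is_derive; have n0 : 0 < `|x| by rewrite normr_gt0.
have -> : `|x| `^ a = x ^+ 2 * `|x| `^ (a - 2).
  rewrite -real_normK ?num_real// -(powR_mulrn 2 (ltW n0)) -powRD; last by rewrite (gt_eqF n0) implybT.
  by congr powR; ring.
by ring.
Qed.

(** The signed power; up to the factor a + 1 it is a primitive of |x|^a on the whole line, and it
    makes the truncated operator on |x|^p explicitly computable. *)
Definition Theta a x : R := x * `|x| `^ a.

Lemma Theta_derive a x : 0 < a -> is_derive x 1 (Theta a) ((a + 1) * `|x| `^ a).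
Proof.
move=> a0; have [->|x0] := eqVneq x 0; last exact: xpowR_abs_derive.
rewrite normr0 powR0 ?gt_eqF// mulr0.
have H : (h^-1 *: (Theta a (h *: 1 + 0) - Theta a 0)) @[h --> 0^'] --> (0 : R).
  have E : \forall h \near 0^', `|h| `^ a = h^-1 *: (Theta a (h *: 1 + 0) - Theta a 0).
    near=> h; have h0 : h != 0 by near: h; exact: nbhs_dnbhs_neq.
    by rewrite /Theta mul0r subr0 addr0 /GRing.scale /= mulr1 mulrA mulVf// mul1r.
  apply: cvg_trans; first by apply: near_eq_cvg; exact: E.
  have := @powR_abs_cont R a a0 0; rewrite /continuous_at normr0 powR0 ?gt_eqF//.
  by move=> /cvg_within_filter; apply.
split; first by apply/cvg_ex; exists 0.
exact/cvg_lim.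
Unshelve. all: by end_near. Qed.

Lemma hold_cont f c p : 0 < p -> (forall x y, `|f x - f y| <= c * `|x - y| `^ p) ->
  continuous f.
Proof.
move=> p0 h x; apply/cvgrPdist_le => e e0.
have hc : (fun y => `|c| * `|y - x| `^ p) y @[y --> x] --> 0.
  rewrite -[X in _ --> X](mulr0 `|c|); apply: cvgM; first exact: cvg_cst.
  have := @powR_abs_cont R p p0 0; rewrite /continuous_at normr0 powR0 ?gt_eqF// => H.
  apply: (@cvg_comp _ _ _ (fun y => y - x) (fun y => `|y| `^ p) _ (nbhs 0)) => //.
  have : (fun y : R => y - x) y @[y --> x] --> x - x.
    by apply: cvgB; [exact: cvg_id|exact: cvg_cst].
  by rewrite subrr.
move/cvgrPdist_le/(_ e e0): hc; apply: filterS => y.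
rewrite sub0r normrN => hy; apply: le_trans (h x y) _; rewrite distrC.
by apply: le_trans (ler_norm _) _; move: hy; rewrite !normrM normr_id.
Qed.

(** Young's inequality for the product y * 1 with the conjugate exponents q and q / (q - 1). *)
Lemma bernoulli_powR q y : 1 < q -> 0 <= y -> 1 + q * (y - 1) <= y `^ q.
Proof.
move=> q1 y0; have q0 : 0 < q by rewrite (lt_trans ltr01).
have q0' := gt_eqF q0.
have q10 : 0 < q / (q - 1) by rewrite divr_gt0// subr_gt0.
have := @conjugate_powR R y 1 q (q / (q - 1)) y0 ler01 q0 q10.
rewrite powR1 mulr1 => /(_ _).
have q1' : q - 1 != 0 by rewrite subr_eq0 gt_eqF.
rewrite invf_div mul1r => H.
have {}H : y <= y `^ q / q + (q - 1) / q by apply: H; field; rewrite q0'.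
move: H; rewrite -mulrDl ler_pdivlMr//; lra.
Qed.

End Derivatives.

(** * The fractional Laplacian and the kernel |x|^p *)

Section Kernel.
Context {R : realType}.
Local Notation mu := (@lebesgue_measure R).
Implicit Types (f g h F W : R -> R) (a b c r x y z e : R).

Definition cut r e (t : R) : R := if e < `|t| then `|t| `^ (- r) else 0.

Lemma cut_ge0 r e t : 0 <= cut r e t.
Proof. by rewrite /cut; case: ifP => // _; exact: powR_ge0. Qed.

Lemma cut_meas r e : measurable_fun setT (cut r e).
Proof. by rewrite /cut; mfun. Qed.

Lemma cutN r e t : cut r e (- t) = cut r e t.
Proof. by rewrite /cut normrN. Qed.

Lemma cut_scale r e a t : 0 < a -> cut r (a * e) (a * t) = a `^ (- r) * cut r e t.
Proof.
move=> a0; rewrite /cut normrM gtr0_norm// ltr_pM2l//; case: ifP => _; last by rewrite mulr0.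
by rewrite powRM// ltW.
Qed.

Lemma intg_cut r e : 1 < r -> 0 < e -> intg (cut r e).
Proof.
move=> r1 e0; have h := intgZ (e `^ (- r)) (intg_affine 0 (invr_neq0 (lt0r_neq0 e0)) (intg_tail r1)).
apply: intg_le (cut_meas r e) _ h => x /=.
rewrite ger0_norm ?cut_ge0// addr0 -[x in leLHS](mulVKf (lt0r_neq0 e0)) -{1}[e]mulr1 cut_scale//.
rewrite ler_wpM2l ?powR_ge0// /cut; case: ifPn => [/ltW->//|_].
by case: ifP => // _; exact: powR_ge0.
Qed.

Lemma cut_mulpow (p r e t : R) : e >= 0 -> `|t| `^ p * cut r e t = cut (r - p) e t.
Proof.
move=> e0; rewrite /cut; case: ifPn => [et|_]; last by rewrite mulr0.
by rewrite -powRD ?opprB// (gt_eqF (le_lt_trans e0 et)) implybT.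
Qed.

Lemma cut_le r e t : 0 <= r -> 0 < e -> cut r e t <= e `^ (- r).
Proof.
move=> r0 e0; rewrite /cut; case: ifPn => [et|_]; last exact: powR_ge0.
by rewrite le_powRN// e0 ltW.
Qed.

Variable p : R.
Hypothesis hp : 0 < p < 1.

Let p0 : 0 < p. Proof. by case/andP: hp. Qed.
Let p1 : p < 1. Proof. by case/andP: hp. Qed.
Let r1 : 1 < p + 2. Proof. by move: p0; lra. Qed.

Definition ker e : R -> R := cut (p + 2) e.

(** The truncated operator without the constant C_s; the exponent p + 2 of [ker] is 1 + 2 s for p =
    2 s - 1. It converges absolutely for every globally p-Hoelder [F], in particular for |x|^p,
    because |t|^p times the kernel decays like t^(-2). *)
Definition Dop e F x : R := \int[mu]_t ((F x - F (x + t)) * ker e t).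

Lemma intg_ker e : 0 < e -> intg (ker e).
Proof. exact: intg_cut. Qed.

Lemma intg_powker e : 0 < e -> intg (fun t => `|t| `^ p * ker e t).
Proof.
move=> e0; apply: eq_intg (@intg_cut 2 e _ e0) => [t|]; last by lra.
rewrite /ker cut_mulpow ?ltW//; by congr (cut _ _ _); ring.
Qed.

Definition Nker x : R := `|x| `^ p.

Lemma Nker_meas : measurable_fun setT Nker.
Proof. by rewrite /Nker; mfun. Qed.

Lemma Nker_dist x y : `|Nker x - Nker y| <= `|x - y| `^ p.
Proof. by apply: powR_dist; rewrite p0 ltW. Qed.

Lemma Nker_cont : continuous Nker.
Proof. exact: powR_abs_cont. Qed.

Lemma Nker_ge0 x : 0 <= Nker x.
Proof. exact: powR_ge0. Qed.

Lemma NkerN x : Nker (- x) = Nker x.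
Proof. by rewrite /Nker normrN. Qed.

Lemma Nker0 : Nker 0 = 0.
Proof. by rewrite /Nker normr0 powR0// gt_eqF. Qed.

Lemma NkerM a x : Nker (a * x) = Nker a * Nker x.
Proof. by rewrite /Nker normrM powRM. Qed.

Lemma NkerD x y : Nker (x + y) <= Nker x + Nker y.
Proof.
have := Nker_dist (x + y) y; rewrite addrK ler_norml => /andP[_].
by rewrite lerBlDr.
Qed.

Lemma le_Nker x y : `|x| <= `|y| -> Nker x <= Nker y.
Proof. by move=> xy; apply: le_powRr; [exact: ltW|rewrite normr_ge0]. Qed.

Section HolderOp.
Variables (c : R) (F : R -> R).
Hypothesis hF : forall x y, `|F x - F y| <= c * `|x - y| `^ p.

Let cF : continuous F. Proof. exact: hold_cont p0 hF. Qed.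
Let mF : measurable_fun setT F. Proof. exact: continuous_measurable_fun. Qed.

Lemma Dop_intg e x : 0 < e -> intg (fun t => (F x - F (x + t)) * ker e t).
Proof.
move=> e0; have mk := cut_meas (p + 2) e.
apply: intg_le (intgZ c (intg_powker e0)).
  apply: mfM => //; apply: mfB; [exact: mfC|].
  by apply: (mfcomp mF); mfun.
move=> t; rewrite normrM (ger0_norm (cut_ge0 _ _ _)) mulrA ler_wpM2r ?cut_ge0//.
by apply: le_trans (hF _ _) _; rewrite opprD addNKr normrN.
Qed.

Lemma Dop_le e x : 0 < e -> `|Dop e F x| <= c * \int[mu]_t (`|t| `^ p * ker e t).
Proof.
move=> e0; rewrite -IZ; last exact: intg_powker.
apply: I_norm_le; [exact: Dop_intg|exact/intgZ/intg_powker|].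
move=> t; rewrite normrM (ger0_norm (cut_ge0 _ _ _)) mulrA ler_wpM2r ?cut_ge0//.
by apply: le_trans (hF _ _) _; rewrite opprD addNKr normrN.
Qed.

Lemma Dop_holder e x y : 0 < e ->
  `|Dop e F x - Dop e F y| <= (2 * c * \int[mu]_t ker e t) * `|x - y| `^ p.
Proof.
move=> e0; rewrite -IB; [|exact: Dop_intg|exact: Dop_intg].
have -> : 2 * c * (\int[mu]_t ker e t) * `|x - y| `^ p =
    \int[mu]_t (2 * c * `|x - y| `^ p * ker e t).
  by rewrite IZ; [ring|exact: intg_ker].
apply: I_norm_le.
- by apply: intgB; exact: Dop_intg.
- exact/intgZ/intg_ker.
move=> t; rewrite -mulrBl normrM (ger0_norm (cut_ge0 _ _ _)) ler_wpM2r ?cut_ge0//.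
have -> : F x - F (x + t) - (F y - F (y + t)) = (F x - F y) - (F (x + t) - F (y + t)) by ring.
apply: le_trans (ler_normB _ _) _.
have := hF x y; have := hF (x + t) (y + t).
have -> : x + t - (y + t) = x - y by ring.
by lra.
Qed.

Lemma Dop_cont e : 0 < e -> continuous (Dop e F).
Proof. by move=> e0; apply: (hold_cont p0 (fun x y => Dop_holder x y e0)). Qed.

End HolderOp.

Lemma Dop_scale a e F x : 0 < a ->
  intg (fun t => (F (a^-1 * x) - F (a^-1 * x + t)) * ker (a^-1 * e) t) ->
  Dop e (fun y => F (a^-1 * y)) x = a `^ (- (p + 1)) * Dop (a^-1 * e) F (a^-1 * x).
Proof.
move=> a0 hi; have an0 := lt0r_neq0 a0; have ai0 : 0 < a^-1 by rewrite invr_gt0.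
have an0' := lt0r_neq0 ai0.
rewrite /Dop (I_affine 0 an0' hi) gtr0_norm// mulrA.
have -> : a `^ (- (p + 1)) * a^-1 = a `^ (- (p + 2)).
  rewrite -(powR_inv1 (ltW a0)) -powRD; last by rewrite an0 implybT.
  by congr powR; ring.
rewrite -IZ; last exact: (intg_affine 0 an0' hi).
apply: eq_I => t; rewrite addr0 -mulrDr mulrCA; congr (_ * _).
by rewrite /ker -cut_scale// !mulVKf.
Qed.

(** Folding t onto -t brings out the second difference of [F], which for F = |x|^p has an explicit
    primitive in t. *)
Lemma Dop_sym c F e x : 0 < e -> (forall x y, `|F x - F y| <= c * `|x - y| `^ p) ->
  Dop e F x = \int[mu]_t (if e < t then (2 * F x - F (x + t) - F (x - t)) * t `^ (- (p + 2)) else 0).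
Proof.
move=> e0 hF; have h := Dop_intg hF x e0.
have mF : measurable_fun setT F by apply: continuous_measurable_fun; exact: hold_cont p0 hF.
pose k t := (F x - F (x + t)) * ker e t.
pose kp t := if e < t then k t else 0.
pose km t := if e < t then k (- t) else 0.
have kE t : k t = kp t + km (- t).
  rewrite /kp /km opprK /k /ker /cut; case: (ltP e t) => et.
    by rewrite (_ : (e < - t) = false) ?addr0//; apply/negbTE; rewrite -leNgt; move: e0 et; lra.
  rewrite add0r; case: (ltP e (- t)) => ent //.
  by rewrite [X in if X then _ else _](_ : _ = false) ?mulr0//; apply/negbTE; rewrite -leNgt ler_norml; apply/andP; split; lra.
have mk : measurable_fun setT k by exact: intg_meas h.
have ikp : intg kp.
  apply: intg_le (intg_norm h); first by rewrite /kp; mfun.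
  by move=> t; rewrite /kp; case: ifP; rewrite ?normr0.
have ikm : intg km.
  have h' := intg_refl 0 h.
  apply: intg_le (intg_norm h').
    rewrite /km; apply: mfif; [by mfun| |by mfun].
    by apply: (mfcomp mk); mfun.
  by move=> t; rewrite /km sub0r; case: ifP; rewrite ?normr0.
have ikm' : intg (fun t => km (- t)).
  by apply: eq_intg (intg_refl 0 ikm) => t; rewrite sub0r.
rewrite /Dop (eq_I kE) ID// -[X in _ + X](I_refl 0)//.
rewrite -ID//; last by apply: eq_intg ikm => t; rewrite sub0r opprK.
apply: eq_I => t; rewrite sub0r opprK /kp /km; case: ifPn => et; last by rewrite addr0.
rewrite /k /ker cutN /cut gtr0_norm ?(lt_trans e0 et)// et -mulrDl; congr (_ * _).
by ring.
Qed.

End Kernel.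

(** * The power |x|^p as a fundamental solution *)

Section Fundamental.
Context {R : realType}.
Local Notation mu := (@lebesgue_measure R).
Implicit Types (f g h F W phi : R -> R) (a b c r x y z e : R).

Definition en (n : nat) : R := n.+1%:R^-1.

Lemma en_gt0 n : 0 < en n. Proof. by rewrite /en invr_gt0 ltr0n. Qed.
Lemma en_le1 n : en n <= 1. Proof. by rewrite invf_le1// ler1n. Qed.
Lemma en_cvg : en n @[n --> \oo] --> (0 : R).
Proof. exact: cvg_harmonic. Qed.

Variable p : R.
Hypothesis hp : 0 < p < 1.

Let p0 : 0 < p. Proof. by case/andP: hp. Qed.
Let p1 : p < 1. Proof. by case/andP: hp. Qed.
Let r1 : 1 < p + 2. Proof. by move: p0; lra. Qed.
Let p10 : 0 < p + 1. Proof. by move: p0; lra. Qed.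
Let pn : p + 1 != 0. Proof. exact: lt0r_neq0. Qed.

Local Notation N := (Nker p).
Local Notation D := (Dop p).
Local Notation Th := (Theta p).

Let hN x y : `|N x - N y| <= 1 * `|x - y| `^ p.
Proof. by rewrite mul1r; exact: Nker_dist. Qed.

(** By scaling, the operator truncated at e and applied to N is e^(-1) [gfun] (x / e). Once [gfun]
    is integrable this is an approximate identity, and only the total mass [Gc] survives as e tends
    to 0. *)
Definition gfun := D 1 N.

Lemma en_powN_cvg : (n.+1%:R : R) `^ (- p) @[n --> \oo] --> (0 : R).
Proof.
have E n : (n.+1%:R : R) `^ (- p) = `|en n| `^ p.
  by rewrite ger0_norm ?ltW ?en_gt0// /en -powR_inv1// -powRrM mulN1r.
under eq_fun do rewrite E.
have := @powR_abs_cont R p p0 0; rewrite /continuous_at normr0 powR0 ?gt_eqF// => H.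
exact: (@cvg_comp _ _ _ en (fun y => `|y| `^ p) _ (nbhs 0)) en_cvg H.
Qed.

(** A primitive in t of the folded integrand of [Dop_sym] for N. It exists in closed form because Th
    y = y N y: the terms t N (x + t) - t N (x - t) from the first factor and -(x + t) N (x + t) - (x
    - t) N (x - t) from the power combine to -x (N (x + t) + N (x - t)). *)
Let A x t := ((p + 1) * x)^-1 * ((Th (x + t) + Th (x - t) - 2 * Th x) * t `^ (- (p + 1))).

Lemma A_derive x (t : R) : x != 0 -> 0 < t ->
  is_derive t 1 (A x) ((2 * N x - N (x + t) - N (x - t)) * t `^ (- (p + 2))).
Proof.
move=> x0 t0.
have d1 : is_derive t 1 (fun t => Th (1 * t + x)) (1 * ((p + 1) * `|1 * t + x| `^ p)).
  by apply: is_derive_affine; exact: Theta_derive.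
have d2 : is_derive t 1 (fun t => Th (-1 * t + x)) (-1 * ((p + 1) * `|-1 * t + x| `^ p)).
  by apply: is_derive_affine; exact: Theta_derive.
have d3 := is_deriveDr (is_deriveDr d1 d2) (is_derive_cst (- (2 * Th x)) t 1).
have d4 := is_derive1_powR (- (p + 1)) t0.
have := is_deriveZr ((p + 1) * x)^-1 (is_deriveMr d3 d4).
have -> : - (p + 1) - 1 = - (p + 2) by ring.
have -> : t `^ (- (p + 1)) = t * t `^ (- (p + 2)).
  rewrite -{2}(powRr1 (ltW t0)) -powRD; last by rewrite (gt_eqF t0) implybT.
  by congr powR; ring.
rewrite !mul1r !mulN1r [t + x]addrC [- t + x]addrC addr0 /cst -/(N (x + t)) -/(N (x - t)).
set v := (X in is_derive _ _ _ X -> _); set w := (X in _ -> is_derive _ _ _ X).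
have -> : v = w.
  by rewrite /v /w /Theta -/(N (x + t)) -/(N (x - t)) -/(N x); field; rewrite x0 pn.
apply: is_derive_ext => u.
rewrite /A /Theta mul1r mulN1r [u + x]addrC [- u + x]addrC; congr (_ * _); ring.
Qed.

Lemma A_bound x (t : R) : 1 <= t ->
  `|A x t| <= `|((p + 1) * x)^-1| * (4 * `|x| * N x + 2 * `|x| + N (2 * x)) * t `^ (- p).
Proof.
move=> t1; have t0 := lt_le_trans ltr01 t1.
rewrite /A normrM -mulrA ler_wpM2l// normrM [`|_ `^ _|]ger0_norm ?powR_ge0//.
have -> : t `^ (- p) = t * t `^ (- (p + 1)).
  rewrite -{2}(powRr1 (ltW t0)) -powRD; last by rewrite (gt_eqF t0) implybT.
  by congr powR; ring.
rewrite [leRHS]mulrA ler_wpM2r ?powR_ge0//.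
have -> : Th (x + t) + Th (x - t) - 2 * Th x = x * (N (x + t) + N (x - t)) + t * (N (x + t) - N (x - t)) - 2 * x * N x.
  by rewrite /Theta /Nker; ring.
have Nt : N t <= t.
  rewrite /Nker gtr0_norm// -[leRHS](powRr1 (ltW t0)); apply: ler_powR => //; exact: ltW.
have h1 : `|x * (N (x + t) + N (x - t))| <= `|x| * (2 * N x + 2 * t).
  rewrite normrM ler_wpM2l// ger0_norm ?addr_ge0 ?Nker_ge0//.
  have := NkerD hp x t; have := NkerD hp x (- t); rewrite NkerN; lra.
have h2 : `|t * (N (x + t) - N (x - t))| <= t * N (2 * x).
  rewrite normrM gtr0_norm// ler_wpM2l ?(ltW t0)//.
  rewrite -[N (x - t)]NkerN; apply: le_trans (Nker_dist hp _ _) _.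
  by rewrite /Nker (_ : x + t - - (x - t) = 2 * x)//; ring.
have h3 : `|2 * x * N x| = 2 * `|x| * N x.
  by rewrite !normrM (ger0_norm (Nker_ge0 _ _)) ger0_norm.
apply: le_trans (ler_normB _ _) _; rewrite h3.
apply: le_trans (lerD (le_trans (ler_normD _ _) (lerD h1 h2)) (lexx _)) _.
have : 0 <= `|x| * N x by rewrite mulr_ge0 ?Nker_ge0.
have : 0 <= `|x| by []. have := Nker_ge0 p (2 * x).
nra.
Qed.

(** The primitive [A x] is O(t^(-p)) at infinity, so the integral over t > 1 is minus its value at
    1. *)
Lemma gfunE x : x != 0 ->
  gfun x = - (((p + 1) * x)^-1 * (Th (x + 1) + Th (x - 1) - 2 * Th x)).
Proof.
move=> x0; rewrite /gfun (Dop_sym hp x ltr01 hN).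
set f := (fun t : R => (2 * N x - N (x + t) - N (x - t)) * t `^ (- (p + 2))).
have mNk := Nker_meas p.
have mf : measurable_fun setT f.
  by rewrite /f /Nker; mfun.
(* The cutoff of the kernel is strict at 1, so the compact intervals must approach 1 from the
   right. *)
pose fn n t := if 1 + en n <= t <= n.+2%:R then f t else 0.
have f_le t : 2^-1 < t -> `|f t| <= 2 * cut 2 2^-1 t.
  move=> t12; have t0 : 0 < t by rewrite (lt_trans _ t12).
  rewrite /f normrM /cut (gtr0_norm t0) t12 [`|_ `^ _|]ger0_norm ?powR_ge0//.
  have -> : t `^ (- 2) = N t * t `^ (- (p + 2)).
    rewrite /Nker gtr0_norm// -powRD; last by rewrite (gt_eqF t0) implybT.
    by congr powR; ring.
  rewrite [leRHS]mulrA ler_wpM2r ?powR_ge0//.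
  have := hN x (x + t); have := hN x (x - t); rewrite !mul1r.
  have -> : x - (x + t) = - t by ring.
  have -> : x - (x - t) = t by ring.
  rewrite normrN -/(N t) !ler_norml; lra.
have [fi] : intg (fun t => if 1 < t then f t else 0) /\
    \int[mu]_t fn n t @[n --> \oo] --> \int[mu]_t (if 1 < t then f t else 0).
  apply: (@dct _ fn _ (fun t => 2 * cut 2 2^-1 t)).
  - by move=> n; rewrite /fn; mfun.
  - by apply: intgZ; apply: intg_cut; [lra|rewrite invr_gt0].
  - move=> n t; rewrite /fn; case: ifPn => [/andP[h _]|_].
      by apply: f_le; have := en_gt0 n; lra.
    by rewrite normr0 mulr_ge0// cut_ge0.
  - move=> t; case: ifPn => t1; apply: cvg_near_cst.
      near=> n; rewrite /fn; have -> // : 1 + en n <= t <= n.+2%:R.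
      apply/andP; split.
        rewrite -lerBrDl; apply: ltW; near: n.
        have t10 : 0 < t - 1 by rewrite subr_gt0.
        move/cvgrPdist_lt/(_ _ t10): en_cvg; apply: filterS => n.
        by rewrite sub0r normrN ger0_norm// ltW// en_gt0.
      apply: (@le_trans _ _ n%:R); last by rewrite ler_nat -addn2 leq_addr.
      by near: n; exact: nbhs_infty_ger.
    apply: nearW => n; rewrite /fn; case: ifPn => // /andP[h _].
    by exfalso; move: t1; rewrite -leNgt => t1; have := en_gt0 n; lra.
have E n : \int[mu]_t fn n t = A x n.+2%:R - A x (1 + en n).
  have e2 : 1 + en n <= n.+2%:R.
    apply: (@le_trans _ _ 2); first by have := en_le1 n; lra.
    by rewrite ler_nat.
  apply: (ftc e2) => t /andP[t1 _]; have t0 : 0 < t by have := en_gt0 n; lra.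
    exact: A_derive.
  rewrite /f; apply: (@continuousM R R (fun t => 2 * N x - N (x + t) - N (x - t)) (fun t => t `^ (- (p + 2)))); last exact: powR_cont.
  have cN : continuous N by exact: Nker_cont.
  apply: continuousB; first apply: continuousB.
  - exact: cvg_cst.
  - apply: (@continuous_comp _ _ _ (fun t => x + t) N); last exact: cN.
    by apply: continuousD; [exact: cvg_cst|exact: cvg_id].
  - apply: (@continuous_comp _ _ _ (fun t => x - t) N); last exact: cN.
    by apply: continuousB; [exact: cvg_cst|exact: cvg_id].
under eq_fun do rewrite E.
move=> H1.
have H2 : A x n.+2%:R - A x (1 + en n) @[n --> \oo] --> 0 - A x 1.
  apply: cvgB.
    apply/cvgrPdist_le => eps eps0.
    set C := `|((p + 1) * x)^-1| * (4 * `|x| * N x + 2 * `|x| + N (2 * x)).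
    have HC : C * (n.+2%:R : R) `^ (- p) @[n --> \oo] --> C * 0.
      apply: cvgM; first exact: cvg_cst.
      by have := en_powN_cvg; rewrite -cvg_shiftS.
    rewrite mulr0 in HC; move/cvgrPdist_le/(_ eps eps0): HC; apply: filterS => n.
    rewrite !sub0r !normrN => h; apply: le_trans (A_bound x _) _; first by rewrite ler1n.
    exact: le_trans (ler_norm _) h.
  have cA : {for 1, continuous (A x)} by apply: is_derive_cont; exact: (A_derive x0 ltr01).
  have e1 : 1 + en n @[n --> \oo] --> (1 : R).
    rewrite -[X in _ --> X](addr0 1); apply: cvgD; [exact: cvg_cst|exact: en_cvg].
  exact: (cvg_comp _ _ e1 cA).
have := cvg_unique _ H1 H2; move=> ->//.
by rewrite sub0r /A powR1 mulr1.
Unshelve. all: by end_near. Qed.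

Lemma ThN x : Th (- x) = - Th x.
Proof. by rewrite /Theta normrN mulNr. Qed.

Lemma gfunN x : gfun (- x) = gfun x.
Proof.
have [->|x0] := eqVneq x 0; first by rewrite oppr0.
rewrite !gfunE ?oppr_eq0//.
have -> : - x + 1 = - (x - 1) by ring.
have -> : - x - 1 = - (x + 1) by ring.
rewrite !ThN mulrN invrN; ring.
Qed.

Lemma Th_pos x : 0 <= x -> Th x = x `^ (p + 1).
Proof.
rewrite le_eqVlt => /predU1P[<-|x0].
  by rewrite /Theta mul0r powR0// gt_eqF// addr_gt0.
rewrite /Theta gtr0_norm// -{1}(powRr1 (ltW x0)) -powRD; last by rewrite (gt_eqF x0) implybT.
by rewrite addrC.
Qed.

Let q1 : 1 < p + 1. Proof. by move: p0; lra. Qed.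

(** Bernoulli for (1 + x)^(p + 1), together with Th (x - 1) >= x - 1 and Th x <= x, leaves at least
    p x in the numerator of [gfunE]. *)
Lemma gfun_neg x : 0 < x <= 1 -> gfun x <= - (p / (p + 1)).
Proof.
move=> /andP[x0 x1]; rewrite gfunE ?gt_eqF// lerN2.
have h1 : 1 + (p + 1) * x <= Th (x + 1).
  rewrite Th_pos; last by rewrite addr_ge0// ltW.
  have := @bernoulli_powR R (p + 1) (x + 1) q1; rewrite addrK; apply.
  by rewrite addr_ge0// ltW.
have h2 : x - 1 <= Th (x - 1).
  rewrite -opprB ThN lerN2 Th_pos ?subr_ge0//.
  have [->|x1'] := eqVneq x 1; first by rewrite subrr powR0// gt_eqF// (lt_trans ltr01).
  apply: ge1r_powR; last exact: ltW.
  by rewrite subr_gt0 lt_def eq_sym x1' x1/= gerBl ltW.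
have h3 : Th x <= x.
  rewrite (Th_pos (ltW x0)); apply: ge1r_powR; [by rewrite x0|exact: ltW].
rewrite -[p / _](_ : ((p + 1) * x)^-1 * (p * x) = _); last by field; rewrite pn gt_eqF.
rewrite ler_wpM2l//; first by rewrite invr_ge0 mulr_ge0// ltW.
lra.
Qed.

(** For x > 1, factor out x^(p + 1): the linear terms of Bernoulli at 1 + 1/x and at 1 - 1/x cancel,
    so the second difference of Th is nonnegative. *)
Lemma gfun_le0 x : gfun x <= 0.
Proof.
wlog x0 : x / 0 <= x => [H|].
  have [|/ltW] := leP 0 x; first exact: H.
  by rewrite -oppr_ge0 -gfunN; exact: H.
move: x0; rewrite le_eqVlt => /predU1P[<-|x0].
  rewrite /gfun /Dop -oppr_ge0 -IN; last exact: (Dop_intg hp hN _ ltr01).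
  apply: I_ge0 => t; rewrite add0r Nker0// sub0r mulNr opprK.
  by rewrite mulr_ge0 ?Nker_ge0 ?cut_ge0.
have [x1|/ltW x1] := leP x 1.
  by apply: le_trans (gfun_neg _) _; rewrite ?x0// oppr_le0 divr_ge0 ?ltW// (lt_trans ltr01).
rewrite gfunE ?gt_eqF// oppr_le0 mulr_ge0//; first by rewrite invr_ge0 mulr_ge0// ltW.
have xp : 0 < x `^ (p + 1) by rewrite powR_gt0.
have E y : 0 <= y -> Th (x * y) = x `^ (p + 1) * y `^ (p + 1).
  by move=> y0; rewrite Th_pos ?mulr_ge0 ?(ltW x0)// powRM// ltW.
have xi : x^-1 <= 1 by rewrite invf_le1.
have xi0 : 0 < x^-1 by rewrite invr_gt0.
have -> : x + 1 = x * (1 + x^-1) by rewrite mulrDr mulr1 divff// gt_eqF.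
have -> : x - 1 = x * (1 - x^-1) by rewrite mulrBr mulr1 divff// gt_eqF.
rewrite !E ?subr_ge0 ?addr_ge0 ?(ltW xi0)// (Th_pos (ltW x0)).
have h1 := @bernoulli_powR R (p + 1) (1 + x^-1) q1.
have h2 := @bernoulli_powR R (p + 1) (1 - x^-1) q1.
have {}h1 := h1 (addr_ge0 ler01 (ltW xi0)).
have {}h2 : 1 + (p + 1) * (1 - x^-1 - 1) <= (1 - x^-1) `^ (p + 1) by apply: h2; rewrite subr_ge0.
nra.
Qed.

Lemma gfun_cont : continuous gfun.
Proof. exact: (Dop_cont hp hN ltr01). Qed.

Lemma gfun_meas : measurable_fun setT gfun.
Proof. by apply: continuous_measurable_fun; exact: gfun_cont. Qed.

(** For x > 2 the second difference of Th is bounded by its second derivative at x / 2, of order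
    x^(p - 1); the division by x in [gfunE] gives x^(p - 2), an integrable rate since p < 1. *)
Lemma gfun_decay : exists c, forall x, `|gfun x| <= c * wt (2 - p) x.
Proof.
set c1 := 1 * \int[mu]_t (`|t| `^ p * ker p 1 t).
have c10 : 0 <= c1.
  by apply: le_trans (Dop_le hp hN 0 ltr01).
exists (c1 * 3 `^ (2 - p) + p * 4 `^ (2 - p)) => x.
wlog x0 : x / 0 <= x => [H|].
  have [|/ltW] := leP 0 x; first exact: H.
  by rewrite -oppr_ge0 -gfunN => /H; rewrite /wt normrN.
have w0 := wt_gt0 (2 - p) x.
have p20 : 0 <= 2 - p by move: p1; lra.
have [x2|x2] := leP x 2.
  apply: le_trans (Dop_le hp hN x ltr01) _; rewrite -/c1 mulrDl.
  rewrite ler_wpDr ?mulr_ge0 ?powR_ge0 ?(ltW p0) ?(ltW w0)// -mulrA ler_peMr//.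
  rewrite /wt powRN ler_pdivlMr ?powR_gt0 ?ltr_wpDr// mul1r le_powRr//.
  by rewrite ger0_norm//; apply/andP; split; lra.
have xp : 0 < x by lra.
rewrite gfunE ?gt_eqF// normrN.
apply: (@le_trans _ _ (p * 4 `^ (2 - p) * wt (2 - p) x)); last first.
  rewrite [leRHS]mulrDl lerDr mulr_ge0 ?(ltW w0)// mulr_ge0// powR_ge0//.
have H : `|Th (x + 1) + Th (x - 1) - 2 * Th x| <= 2 * ((p + 1) * p * (x / 2) `^ (p - 1)) * 1 ^+ 2.
  apply: (@sdiff_le R Th (fun y => (p + 1) * `|y| `^ p) (fun y => (p + 1) * (p * (y * `|y| `^ (p - 2))))) => //.
  - by move=> y _; exact: Theta_derive.
  - move=> y /andP[y1 _]; apply: is_deriveZr; apply: powR_abs_derive.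
    by rewrite gt_eqF//; lra.
  - move=> y /andP[y1 _]; have y0 : 0 < y by lra.
    have -> : y * `|y| `^ (p - 2) = y `^ (- (1 - p)).
      rewrite gtr0_norm// -{1}(powRr1 (ltW y0)) -powRD; last by rewrite (gt_eqF y0) implybT.
      by congr powR; ring.
    have pp : 0 <= (p + 1) * p by rewrite mulr_ge0// ltW.
    rewrite mulrA ger0_norm; last by rewrite mulr_ge0 ?powR_ge0.
    rewrite ler_wpM2l//.
    have -> : p - 1 = - (1 - p) by ring.
    by apply: le_powRN; [rewrite subr_ge0 ltW|apply/andP; split; lra].
rewrite normrM; apply: le_trans (ler_wpM2l (normr_ge0 _) H) _.
rewrite ger0_norm; last by rewrite invr_ge0 mulr_ge0// ltW.
have x20 : 0 < x / 2 by rewrite divr_gt0.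
have -> : ((p + 1) * x)^-1 * (2 * ((p + 1) * p * (x / 2) `^ (p - 1)) * 1 ^+ 2) = p * ((x / 2) `^ (p - 1) * (x / 2) `^ (-1)).
  rewrite (powR_inv1 (ltW x20)).
  by field; rewrite pn gt_eqF.
rewrite -powRD; last by rewrite (gt_eqF x20) implybT.
rewrite -mulrA; apply: (ler_wpM2l (ltW p0)).
have -> : p - 1 + -1 = - (2 - p) by ring.
rewrite /wt (ger0_norm x0).
have -> : (x / 2) `^ (- (2 - p)) = 4 `^ (2 - p) * (2 * x) `^ (- (2 - p)).
  have -> : (2 * x) = 4 * (x / 2) by field.
  rewrite [in RHS]powRM ?(ltW x20)// mulrA -powRD; last by rewrite pnatr_eq0 implybT.
  by rewrite subrr powRr0 mul1r.
apply: ler_wpM2l; first exact: powR_ge0.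
by apply: le_powRN => //; apply/andP; split; lra.
Qed.

Lemma intg_gfun : intg gfun.
Proof.
have [c hc] := gfun_decay.
have p2 : 1 < 2 - p by move: p1; lra.
exact: (intg_le gfun_meas hc (intgZ c (intg_wt p2))).
Qed.

Definition Gc := \int[mu]_x gfun x.

Lemma Gc_lt0 : Gc < 0.
Proof.
have h : intg (fun x : R => if 2^-1 <= x <= 1 then - (p / (p + 1)) else 0).
  by apply: (@intg_itv _ _ _ (`|- (p / (p + 1))|) (fun=> _)) => //; exact: mfC.
apply: (@le_lt_trans _ _ (\int[mu]_x (if 2^-1 <= x <= 1 then - (p / (p + 1)) else 0))).
  apply: I_le => //; first exact: intg_gfun.
  move=> x; case: ifPn => [/andP[h1 h2]|_]; last exact: gfun_le0.
  by apply: gfun_neg; rewrite h2 andbT; lra.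
rewrite I_itv_cst; last by lra.
have : 0 < p / (p + 1) by rewrite divr_gt0.
lra.
Qed.

Lemma Dop_N_scale e x : 0 < e -> D e N x = e^-1 * gfun (e^-1 * x).
Proof.
move=> e0; have en0 := lt0r_neq0 e0.
have hi : intg (fun t => (N (e^-1 * x) - N (e^-1 * x + t)) * ker p (e^-1 * e) t).
  by rewrite mulVf//; exact: (Dop_intg hp hN _ ltr01).
have := Dop_scale e0 hi; rewrite mulVf// => H.
have {}H : N (e^-1) * D e N x = e `^ (- (p + 1)) * gfun (e^-1 * x).
  rewrite -H /Dop -IZ; last exact: (Dop_intg hp hN _ e0).
  by apply: eq_I => t; rewrite !NkerM mulrA mulrBr.
have NE : N (e^-1) = e `^ (- p).
  by rewrite /Nker gtr0_norm ?invr_gt0// -powR_inv1 ?(ltW e0)// -powRrM mulN1r.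
have Nn : N (e^-1) != 0 by rewrite NE gt_eqF// powR_gt0.
apply: (mulfI Nn); rewrite H mulrA; congr (_ * _).
rewrite NE -(powR_inv1 (ltW e0)) -powRD; last by rewrite en0 implybT.
by congr powR; ring.
Qed.

(** The substitution x = e y + z turns the integral into one of phi (e y + z) against the fixed
    density [gfun], where dominated convergence applies. *)
Lemma gfun_approx phi z c : continuous phi -> (forall x, `|phi x| <= c) ->
  \int[mu]_x (phi x * D (en n) N (x - z)) @[n --> \oo] --> Gc * phi z.
Proof.
move=> cphi phic; have mphi : measurable_fun setT phi by exact: continuous_measurable_fun.
have E n : \int[mu]_x (phi x * D (en n) N (x - z)) =
    \int[mu]_y (phi (en n * y + z) * gfun y).
  have e0 := en_gt0 n; have en0 := lt0r_neq0 e0.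
  have h : intg (fun x => phi x * D (en n) N (x - z)).
    apply: (@intgMb _ c) => //.
    apply: eq_intg (intgZ (en n)^-1 (intg_affine (- ((en n)^-1 * z)) (invr_neq0 en0) intg_gfun)) => x.
    by rewrite [in RHS](Dop_N_scale (x - z) e0) mulrBr.
  rewrite (I_affine z en0 h) gtr0_norm// -IZ; last exact: (intg_affine z en0 h).
  apply: eq_I => y; rewrite addrK (Dop_N_scale (en n * y) e0) (mulKf en0).
  by rewrite mulrCA (mulVKf en0).
under eq_fun do rewrite E.
have -> : Gc * phi z = \int[mu]_y (phi z * gfun y).
  by rewrite (IZ (phi z) intg_gfun) [RHS]mulrC.
have mg := gfun_meas.
apply: (proj2 (@dct _ _ _ (fun y => c * `|gfun y|) _ _ _ _)).
- move=> n; apply: mfM => //; apply: (mfcomp mphi); mfun.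
- by apply/intgZ/intg_norm; exact: intg_gfun.
- by move=> n y; rewrite normrM ler_wpM2r.
- move=> y; apply: cvgM; last exact: cvg_cst.
  have H : en n * y + z @[n --> \oo] --> z.
    rewrite -[X in _ --> X]add0r; apply: cvgD; last exact: cvg_cst.
    rewrite -[X in _ --> X](mul0r y); apply: cvgM; [exact: en_cvg|exact: cvg_cst].
  exact: (cvg_comp _ _ H (cphi z)).
Qed.

End Fundamental.

(** * Symmetry of the truncated operator and its action on decaying functions *)

Section Duality.
Context {R : realType}.
Local Notation mu := (@lebesgue_measure R).
Implicit Types (f g h F W phi rho : R -> R) (a b c r x y z e : R).

Variable p : R.
Hypothesis hp : 0 < p < 1.

Let p0 : 0 < p. Proof. by case/andP: hp. Qed.
Let p1 : p < 1. Proof. by case/andP: hp. Qed.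
Let r1 : 1 < p + 2. Proof. by move: p0; lra. Qed.

Local Notation N := (Nker p).
Local Notation D := (Dop p).

Lemma ker_bnd e t : 0 < e -> `|ker p e t| <= e `^ (- (p + 2)).
Proof. by move=> e0; rewrite ger0_norm ?cut_ge0// cut_le// ltW// (lt_trans ltr01). Qed.

Lemma Dop_intgL e phi x : 0 < e -> intg phi ->
  intg (fun t => (phi x - phi (x + t)) * ker p e t).
Proof.
move=> e0 iphi; have mk := cut_meas (p + 2) e.
have h : intg (fun t => phi (x + t)).
  by apply: eq_intg (intg_shift x iphi) => t; rewrite addrC.
have h1 := intgMb h mk (fun t => ker_bnd t e0).
have h2 := intgZ (phi x) (intg_ker hp e0).
apply: eq_intg (intgB h2 h1) => t; rewrite /ker; ring.
Qed.

(** Fubini moves the translation by t from [phi] to [W]. The function [W] may grow, but W (x + t) -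
    W x is at most c |t|^p, which the truncated kernel integrates. *)
Lemma dualW W phi c e : 0 < e -> (forall x y, `|W x - W y| <= c * `|x - y| `^ p) ->
  intg phi -> intg (fun x => W x * phi x) ->
  intg (fun x => W x * D e phi x) /\
  \int[mu]_x (W x * D e phi x) = \int[mu]_x (phi x * D e W x).
Proof.
move=> e0 hW iphi iWphi.
have mphi := intg_meas iphi.
have mW : measurable_fun setT W by apply: continuous_measurable_fun; exact: hold_cont p0 hW.
have mk : measurable_fun setT (ker p e) by exact: cut_meas.
have k0 t : 0 <= ker p e t by exact: cut_ge0.
pose F t x := W x * ((phi x - phi (x + t)) * ker p e t).
pose F2 t x := phi x * ((W x - W (x - t)) * ker p e t).
have iA t : intg (fun x => W x * phi (x + t)).
  have h1 := intg_shift t iWphi; have h2 := intg_shift t iphi.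
  have h3 : intg (fun x => (W (x + t) - W x) * phi (x + t)).
    apply: (@intgMb _ (c * `|t| `^ p) _ _ h2).
      by mfun; apply: (mfcomp mW); mfun.
    by move=> x; apply: le_trans (hW _ _) _; rewrite addrC addKr.
  by apply: eq_intg (intgB h1 h3) => x; ring.
have iF t : intg (F t).
  apply: eq_intg (intgZ (ker p e t) (intgB iWphi (iA t))) => x; rewrite /F; ring.
have bF2 t x : `|F2 t x| <= c * `|t| `^ p * ker p e t * `|phi x|.
  rewrite /F2 normrM mulrC ler_wpM2r// normrM (ger0_norm (k0 t)) ler_wpM2r//.
  by apply: le_trans (hW _ _) _; rewrite opprD addNKr opprK.
have iF2 t : intg (F2 t).
  apply: (@intg_le _ _ (fun x => c * `|t| `^ p * ker p e t * `|phi x|)).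
  - rewrite /F2; mfun; apply: (mfcomp mW); mfun.
  - exact: bF2.
  - exact/intgZ/intg_norm.
set A := \int[mu]_x `|W x * phi x|; set B := \int[mu]_x `|phi x|.
pose g t := 2 * A * ker p e t + c * B * (`|t| `^ p * ker p e t).
have ig : intg g by apply: intgD; apply: intgZ; [exact: intg_ker|exact: intg_powker].
have Fg t : \int[mu]_x `|F t x| <= g t.
  have h0 := intg_norm iWphi; have h1 := intg_shift t h0.
  have h2 := intg_shift t (intg_norm iphi).
  apply: (@le_trans _ _ (\int[mu]_x (ker p e t * (`|W x * phi x| + (`|W (x + t) * phi (x + t)| + c * `|t| `^ p * `|phi (x + t)|))))).
    apply: I_le; first exact: intg_norm.
      by apply: intgZ; apply: intgD => //; apply: intgD => //; exact: intgZ.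
    move=> x; rewrite /F mulrA normrM (ger0_norm (k0 t)) mulrC ler_wpM2l//.
    rewrite mulrBr; apply: le_trans (ler_normB _ _) _; rewrite lerD2l.
    have -> : W x * phi (x + t) = W (x + t) * phi (x + t) - (W (x + t) - W x) * phi (x + t) by ring.
    apply: le_trans (ler_normB _ _) _; rewrite lerD2l normrM ler_wpM2r//.
    by apply: le_trans (hW _ _) _; rewrite addrC addKr.
  have h3 := intgZ (c * `|t| `^ p) h2; have h4 := intgD h1 h3.
  rewrite (IZ _ (intgD h0 h4)) (ID h0 h4) (ID h1 h3) (I_shift t h0) (IZ _ h2) (I_shift t (intg_norm iphi)) -/A -/B /g.
  by rewrite le_eqVlt; apply/orP; left; apply/eqP; ring.
have mF : measurable_fun setT (fun z : R * R => F z.1 z.2).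
  by rewrite /F; mfun.
have mF2 : measurable_fun setT (fun z : R * R => F2 z.1 z.2).
  by rewrite /F2; mfun.
have [_ _ i2 E] := fub mF iF ig Fg.
have E1 x : \int[mu]_t F t x = W x * D e phi x.
  exact: (IZ (W x) (Dop_intgL x e0 iphi)).
have E2 t : \int[mu]_x F t x = \int[mu]_x F2 t x.
  have -> : \int[mu]_x F t x = \int[mu]_x (ker p e t * (W x * phi x - W x * phi (x + t))).
    by apply: eq_I => x; rewrite /F; ring.
  have iA' : intg (fun x => W (x - t) * phi x).
    by apply: eq_intg (intg_shift (- t) (iA t)) => x; rewrite subrK.
  have -> : \int[mu]_x F2 t x = \int[mu]_x (ker p e t * (W x * phi x - W (x - t) * phi x)).
    by apply: eq_I => x; rewrite /F2; ring.
  rewrite (IZ _ (intgB iWphi (iA t))) (IZ _ (intgB iWphi iA')).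
  rewrite (IB iWphi (iA t)) (IB iWphi iA'); congr (_ * (_ - _)).
  by rewrite -(I_shift (- t) (iA t)); apply: eq_I => x; rewrite subrK.
have E3 x : \int[mu]_t F2 t x = phi x * D e W x.
  have h := Dop_intg hp hW x e0.
  have h' : intg (fun t => (W x - W (x - t)) * ker p e t).
    by apply: eq_intg (intg_refl 0 h) => t; rewrite sub0r /ker cutN.
  rewrite /F2 (IZ (phi x) h').
  congr (_ * _); rewrite /Dop -(I_refl 0 h); apply: eq_I => t.
  by rewrite sub0r /ker cutN.
have ig2 : intg (fun t => c * B * (`|t| `^ p * ker p e t)) by apply: intgZ; exact: intg_powker.
have Fg2 t : \int[mu]_x `|F2 t x| <= c * B * (`|t| `^ p * ker p e t).
  have -> : c * B * (`|t| `^ p * ker p e t) = \int[mu]_x (c * `|t| `^ p * ker p e t * `|phi x|).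
    by rewrite IZ; [rewrite /B; ring|exact: intg_norm].
  exact: (I_le (intg_norm (iF2 t)) (intgZ _ (intg_norm iphi)) (bF2 t)).
have [_ _ _ E'] := fub mF2 iF2 ig2 Fg2.
split.
  by apply: eq_intg i2 => x; rewrite E1.
transitivity (\int[mu]_x \int[mu]_t F t x); first by apply: eq_I => x; rewrite E1.
rewrite -E (eq_I E2) E'; apply: eq_I => x; exact: E3.
Qed.

Lemma Dop_conv f rho c e x : 0 < e -> (forall x y, `|f x - f y| <= c * `|x - y| `^ p) ->
  intg rho -> (forall x, intg (fun y => f (x - y) * rho y)) ->
  D e (fun x => \int[mu]_y (f (x - y) * rho y)) x = \int[mu]_y (D e f (x - y) * rho y).
Proof.
move=> e0 hf irho ifr.
have mrho := intg_meas irho.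
have mf : measurable_fun setT f by apply: continuous_measurable_fun; exact: hold_cont p0 hf.
have mk : measurable_fun setT (ker p e) by exact: cut_meas.
have k0 t : 0 <= ker p e t by exact: cut_ge0.
pose F t y := (f (x - y) - f (x - y + t)) * ker p e t * rho y.
have iE t : intg (fun y => f (x - y + t) * rho y).
  by apply: eq_intg (ifr (x + t)) => y; rewrite addrAC.
have bF t y : `|F t y| <= c * `|t| `^ p * ker p e t * `|rho y|.
  rewrite /F normrM ler_wpM2r// normrM (ger0_norm (k0 t)) ler_wpM2r//.
  by apply: le_trans (hf _ _) _; rewrite opprD addNKr normrN.
have iF t : intg (F t).
  by apply: eq_intg (intgZ (ker p e t) (intgB (ifr x) (iE t))) => y; rewrite /F; ring.
set B := \int[mu]_x `|rho x|.
have ig : intg (fun t => c * B * (`|t| `^ p * ker p e t)) by apply: intgZ; exact: intg_powker.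
have Fg t : \int[mu]_y `|F t y| <= c * B * (`|t| `^ p * ker p e t).
  have -> : c * B * (`|t| `^ p * ker p e t) = \int[mu]_x (c * `|t| `^ p * ker p e t * `|rho x|).
    by rewrite IZ; [rewrite /B; ring|exact: intg_norm].
  exact: (I_le (intg_norm (iF t)) (intgZ _ (intg_norm irho)) (bF t)).
have mF : measurable_fun setT (fun z : R * R => F z.1 z.2).
  by rewrite /F; mfun.
have [_ _ _ E] := fub mF iF ig Fg.
transitivity (\int[mu]_t \int[mu]_y F t y).
  have ifxt t : intg (fun y => f (x + t - y) * rho y) by exact: ifr.
  apply: eq_I => t; rewrite -(IB (ifr x) (ifxt t)) -(IZr _ (intgB (ifr x) (ifxt t))).
  by apply: eq_I => y; rewrite /F [x + t - y]addrAC; ring.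
rewrite E; apply: eq_I => y.
exact: (IZr (rho y) (Dop_intg hp hf (x - y) e0)).
Qed.

Definition sdiff F x t := 2 * F x - F (x + t) - F (x - t).

Lemma Dop_half e F x : 0 < e -> intg F ->
  D e F x = 2^-1 * \int[mu]_t (sdiff F x t * ker p e t).
Proof.
move=> e0 iF; have h := Dop_intgL x e0 iF.
have h' : intg (fun t => (F x - F (x - t)) * ker p e t).
  by apply: eq_intg (intg_refl 0 h) => t; rewrite sub0r /ker cutN.
have E : D e F x = \int[mu]_t ((F x - F (x - t)) * ker p e t).
  rewrite /Dop -(I_refl 0 h); apply: eq_I => t; by rewrite sub0r /ker cutN.
have -> : \int[mu]_t (sdiff F x t * ker p e t) = D e F x + D e F x.
  by rewrite {2}E /Dop -(ID h h'); apply: eq_I => t; rewrite /sdiff; ring.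
by field.
Qed.

(** The rates 2 - p and 4 - p are those of a second difference of a smooth copy of |x|^p and of the
    second derivative of that difference; compactly supported smooth functions satisfy every such
    rate. *)
Definition nice c F := exists F1 F2,
  [/\ forall x, is_derive x 1 F (F1 x), forall x, is_derive x 1 F1 (F2 x),
      forall x, `|F x| <= c * wt (2 - p) x & forall x, `|F2 x| <= c * wt (4 - p) x].

Definition sing a (t : R) : R := if `|t| <= a then `|t| `^ (- p) else 0.

Lemma sing_ge0 a t : 0 <= sing a t.
Proof. by rewrite /sing; case: ifP => // _; exact: powR_ge0. Qed.

Lemma sing_scale a t : 0 < a -> sing a (a * t) = a `^ (- p) * sing 1 t.
Proof.
move=> a0; rewrite /sing normrM gtr0_norm// -{2}[a]mulr1 ler_pM2l//.
by case: ifP => _; rewrite ?mulr0// powRM// ltW.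
Qed.

Lemma intg_sing1 : intg (sing 1).
Proof. exact: intg_sing. Qed.

Lemma intg_singa a : 0 < a -> intg (sing a) /\
  \int[mu]_t sing a t = a `^ (1 - p) * \int[mu]_t sing 1 t.
Proof.
move=> a0; have an0 := lt0r_neq0 a0.
have ai : a^-1 != 0 by rewrite invr_eq0.
have E t : sing a t = a `^ (- p) * sing 1 (a^-1 * t + 0).
  by rewrite -sing_scale// addr0 mulVKf.
have i1 := intgZ (a `^ (- p)) (intg_affine 0 ai intg_sing1).
have i2 : intg (sing a) by apply: eq_intg i1 => t; rewrite -E.
split => //; rewrite (eq_I E) (IZ _ (intg_affine 0 ai intg_sing1)).
rewrite [in RHS](I_affine 0 ai intg_sing1) mulrA; congr (_ * _).
rewrite gtr0_norm ?invr_gt0// -(powR_inv1 (ltW a0)) -powRD; last by rewrite an0 implybT.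
by congr powR; ring.
Qed.

Lemma I_cut a : 0 < a -> \int[mu]_t ker p a t = a `^ (- (p + 1)) * \int[mu]_t ker p 1 t.
Proof.
move=> a0; have an0 := lt0r_neq0 a0.
have ai : a^-1 != 0 by rewrite invr_eq0.
have E t : ker p a t = a `^ (- (p + 2)) * ker p 1 (a^-1 * t + 0).
  by rewrite /ker -cut_scale// addr0 mulr1 mulVKf.
rewrite (eq_I E) (IZ _ (intg_affine 0 ai (intg_ker hp ltr01))).
rewrite [in RHS](I_affine 0 ai (intg_ker hp ltr01)) mulrA; congr (_ * _).
rewrite gtr0_norm ?invr_gt0// -(powR_inv1 (ltW a0)) -powRD; last by rewrite an0 implybT.
by congr powR; ring.
Qed.

(** The splitting radius. For |t| at most X x every y between x - t and x + t has 1 + |y| >= X x, so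
    the decay of the second derivative is available; for larger |t| the kernel itself is at most (X
    x)^(-p-2). *)
Let X x := (1 + `|x|) / 2.
Let X0 x : 0 < X x. Proof. by rewrite /X divr_gt0// ltr_wpDr. Qed.

(** Three contributions: the near part, where t^2 |t|^(-p-2) = |t|^(-p); the far part of F x; and
    the far parts of F (x + t) and F (x - t), whose integrability comes from [F] rather than from
    the kernel. *)
Let dom x t := 2 * X x `^ (- (4 - p)) * sing (X x) t +
  (2 * X x `^ (- (2 - p)) * ker p (X x) t +
   X x `^ (- (p + 2)) * (wt (2 - p) (x + t) + wt (2 - p) (x - t))).

Let p2 : 1 < 2 - p. Proof. by move: p1; lra. Qed.

Let iwp x : intg (fun t => wt (2 - p) (x + t)).
Proof. by apply: eq_intg (intg_shift x (intg_wt p2)) => t; rewrite [t + x]addrC. Qed.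
Let iwm x : intg (fun t => wt (2 - p) (x - t)).
Proof. exact: (intg_refl x (intg_wt p2)). Qed.

Let idom x : intg (dom x).
Proof.
apply: intgD; first by apply: intgZ; have [] := intg_singa (X0 x).
apply: intgD; first by apply: intgZ; exact: intg_ker.
exact: (intgZ _ (intgD (iwp x) (iwm x))).
Qed.

Let Cdom := 4 * (\int[mu]_t sing 1 t) + 4 * (\int[mu]_t ker p 1 t) +
  2 * \int[mu]_t wt (2 - p) t.

Let Idom x : \int[mu]_t dom x t <= 2 `^ (p + 2) * Cdom * wt (p + 2) x.
Proof.
have [i1 E1] := intg_singa (X0 x).
have i2 := intg_ker hp (X0 x).
have i3 := intgD (iwp x) (iwm x).
have j1 := intgZ (2 * X x `^ (- (4 - p))) i1.
have j2 := intgZ (2 * X x `^ (- (2 - p))) i2.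
have j3 := intgZ (X x `^ (- (p + 2))) i3.
rewrite /dom (ID j1 (intgD j2 j3)) (ID j2 j3) (IZ _ i1) (IZ _ i2) (IZ _ i3) (ID (iwp x) (iwm x)) E1 (I_cut (X0 x)).
have -> : \int[mu]_t wt (2 - p) (x + t) = \int[mu]_t wt (2 - p) t.
  by rewrite -(I_shift x (intg_wt p2)); apply: eq_I => t; rewrite [t + x]addrC.
rewrite (I_refl x (intg_wt p2)).
have s0 : 0 <= \int[mu]_t sing 1 t by apply: I_ge0 => t; exact: sing_ge0.
have k0 : 0 <= \int[mu]_t ker p 1 t by apply: I_ge0 => t; exact: cut_ge0.
have w0 : 0 <= \int[mu]_t wt (2 - p) t by apply: I_ge0 => t; exact: wt_ge0.
have Xn : X x != 0 by rewrite gt_eqF.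
have -> : wt (p + 2) x = 2 `^ (- (p + 2)) * X x `^ (- (p + 2)).
  by rewrite /wt /X -powRM ?(ltW (X0 x))//; congr powR; field.
have -> : 2 `^ (p + 2) * Cdom * (2 `^ (- (p + 2)) * X x `^ (- (p + 2))) = Cdom * X x `^ (- (p + 2)).
  rewrite mulrACA -powRD; last by rewrite pnatr_eq0 implybT.
  by rewrite subrr powRr0 mul1r.
(* Since X x >= 1/2 and 3 exceeds p + 2 by 1 - p < 1, the surplus power costs at most a factor 2. *)
have X3 : X x `^ (- 3) <= 2 * X x `^ (- (p + 2)).
  have -> : - 3 = - (1 - p) + - (p + 2) :> R by ring.
  rewrite powRD; last by rewrite Xn implybT.
  apply: ler_wpM2r; first exact: powR_ge0.
  apply: (@le_trans _ _ (2^-1 `^ (- (1 - p)))).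
    apply: le_powRN; first by rewrite subr_ge0 ltW.
    rewrite invr_gt0 ltr0n /= /X; have : 0 <= `|x| by []. lra.
  rewrite -powR_inv1// -powRrM mulN1r opprK -[leRHS](@powRr1 R 2)//.
  apply: ler_powR; first by rewrite ler1n.
  by rewrite lerBlDr lerDl ltW.
have e1 : X x `^ (- (4 - p)) * X x `^ (1 - p) = X x `^ (- 3).
  rewrite -powRD; last by rewrite Xn implybT.
  by congr powR; ring.
have e2 : X x `^ (- (2 - p)) * X x `^ (- (p + 1)) = X x `^ (- 3).
  rewrite -powRD; last by rewrite Xn implybT.
  by congr powR; ring.
rewrite [X in X + _](_ : _ = 2 * (X x `^ (- 3) * \int[mu]_t sing 1 t)); last by rewrite -e1; ring.
rewrite [X in _ + (X + _)](_ : _ = 2 * (X x `^ (- 3) * \int[mu]_t ker p 1 t)); last by rewrite -e2; ring.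
have h1 := ler_wpM2r s0 X3; have h2 := ler_wpM2r k0 X3.
rewrite /Cdom; set J1 := \int[mu]_t sing 1 t in s0 h1 *.
set J2 := \int[mu]_t ker p 1 t in k0 h2 *.
lra.
Qed.

Let sdom c F x t : 0 <= c -> nice c F -> `|sdiff F x t * `|t| `^ (- (p + 2))| <= c * dom x t.
Proof.
move=> c0 [F1 [F2 [d1 d2 b0 b2]]].
have w0 := wt_ge0 (2 - p).
have X0' := X0 x.
rewrite normrM [X in _ * X]ger0_norm ?powR_ge0//.
have nn1 : 0 <= X x `^ (- (4 - p)) * sing (X x) t by rewrite mulr_ge0 ?powR_ge0 ?sing_ge0.
have nn2 : 0 <= X x `^ (- (2 - p)) * ker p (X x) t by rewrite mulr_ge0 ?powR_ge0 ?cut_ge0.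
have nn3 : 0 <= X x `^ (- (p + 2)) * (wt (2 - p) (x + t) + wt (2 - p) (x - t)).
  by rewrite mulr_ge0 ?powR_ge0 ?addr_ge0.
have [tX|tX] := leP `|t| (X x).
  have H : `|F (x + `|t|) + F (x - `|t|) - 2 * F x| <= 2 * (c * X x `^ (- (4 - p))) * `|t| ^+ 2.
    apply: (sdiff_le (normr_ge0 t) (fun y _ => d1 y) (fun y _ => d2 y)) => y /andP[y1 y2].
    apply: le_trans (b2 y) _; apply: ler_wpM2l => //.
    apply: le_powRN; first by move: p1; lra.
    rewrite X0' /=; have : `|x| <= `|y| + `|t|.
      case: (lerP 0 x) => x0; [rewrite (ger0_norm x0)|rewrite (ltr0_norm x0)];
      by case: (lerP 0 y) => y0; [rewrite (ger0_norm y0)|rewrite (ltr0_norm y0)]; lra.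
    by move: tX; rewrite /X; lra.
  have -> : `|sdiff F x t| = `|F (x + `|t|) + F (x - `|t|) - 2 * F x|.
    rewrite -normrN; congr (`| _ |); rewrite /sdiff; case: (lerP 0 t) => t0.
      by rewrite (ger0_norm t0); ring.
    by rewrite (ltr0_norm t0) opprK; ring.
  (* At t = 0 both sides are 0, because 0 raised to a nonzero real power is 0. *)
  have E : `|t| ^+ 2 * `|t| `^ (- (p + 2)) = sing (X x) t.
    rewrite /sing tX; have [->|t0] := eqVneq t 0.
      rewrite normr0 expr0n mul0r powR0// oppr_eq0 gt_eqF//.
    rewrite -(powR_mulrn 2 (normr_ge0 t)) -powRD; last by rewrite normr_eq0 t0 implybT.
    by congr powR; ring.
  apply: le_trans (ler_wpM2r (powR_ge0 _ _) H) _.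
  rewrite -[leLHS]mulrA E /dom; move: nn1 nn2 nn3; set a := X x `^ _ * sing _ _; set b := X x `^ _ * ker _ _ _.
  set d := X x `^ _ * (_ + _) => nn1 nn2 nn3.
  have -> : 2 * (c * X x `^ (- (4 - p))) * sing (X x) t = c * (2 * a) by rewrite /a; ring.
  apply: ler_wpM2l => //; rewrite -!mulrA -/a -/b; lra.
have kE : `|t| `^ (- (p + 2)) = ker p (X x) t by rewrite /ker /cut tX.
have kX : `|t| `^ (- (p + 2)) <= X x `^ (- (p + 2)).
  by apply: le_powRN; [exact: ltW (lt_trans ltr01 r1)|rewrite X0' ltW].
have wX : wt (2 - p) x <= X x `^ (- (2 - p)).
  apply: le_powRN; first by move: p1; lra.
  by rewrite X0' /= /X; have : 0 <= `|x| by []; lra.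
have H : `|sdiff F x t| <= c * (2 * X x `^ (- (2 - p)) + (wt (2 - p) (x + t) + wt (2 - p) (x - t))).
  rewrite /sdiff; apply: le_trans (ler_normB _ _) _.
  apply: le_trans (lerD (ler_normB _ _) (lexx _)) _.
  rewrite normrM ger0_norm//; have := b0 x; have := b0 (x + t); have := b0 (x - t).
  have := ler_wpM2l c0 wX; lra.
apply: le_trans (ler_wpM2r (powR_ge0 _ _) H) _.
rewrite -mulrA; apply: ler_wpM2l => //.
rewrite mulrDl {1}kE /dom; apply: ler_wpDl; first by rewrite -mulrA mulr_ge0.
apply: lerD; first by [].
by rewrite mulrC; apply: ler_wpM2r => //; rewrite addr_ge0.
Qed.

Lemma nice_intg c F : nice c F -> intg F.
Proof.
move=> [F1 [F2 [d1 d2 b0 b2]]].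
have mF : measurable_fun setT F.
  by apply: continuous_measurable_fun => x; exact: is_derive_cont (d1 x).
exact: (intg_le mF b0 (intgZ c (intg_wt p2))).
Qed.

(** The full operator without C_s. In second-difference form the integral converges absolutely for
    [nice] functions, so the principal value becomes an ordinary integral. *)
Definition Lop F x := 2^-1 * \int[mu]_t (sdiff F x t * `|t| `^ (- (p + 2))).

(** The constant depends neither on [F] nor on the truncation: one [C] serves all rescaled
    potentials in [liouville_test], and the bound is a majorant for the passage to the limit e ->
    0. *)
Lemma nice_bound : exists C, forall c F, 0 <= c -> nice c F ->
  (forall e x, 0 < e -> `|D e F x| <= C * c * wt (p + 2) x) /\
  (forall x, D e F x @[e --> 0^'+] --> Lop F x).
Proof.
exists (2^-1 * (2 `^ (p + 2) * Cdom)) => c F c0 nF; have iF := nice_intg nF.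
have mF := intg_meas iF.
have kle e x t : `|sdiff F x t * ker p e t| <= c * dom x t.
  apply: le_trans (sdom x t c0 nF).
  rewrite /ker /cut; case: ifP => _ //; by rewrite mulr0 normr0.
have mk e x : measurable_fun setT (fun t => sdiff F x t * ker p e t).
  have mk := cut_meas (p + 2) e; rewrite /sdiff /ker; mfun.
have id x := intgZ c (idom x).
have ik e x := intg_le (mk e x) (kle e x) (id x).
split=> [e x e0|x].
  rewrite (Dop_half x e0 iF) normrM ger0_norm ?invr_ge0//.
  have H := I_norm_le (ik e x) (id x) (kle e x).
  have H2 : \int[mu]_t (c * dom x t) <= c * (2 `^ (p + 2) * Cdom * wt (p + 2) x).
    by rewrite (IZ _ (idom x)); apply: ler_wpM2l => //; exact: Idom.
  have -> : 2^-1 * (2 `^ (p + 2) * Cdom) * c * wt (p + 2) x = 2^-1 * (c * (2 `^ (p + 2) * Cdom * wt (p + 2) x)) by ring.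
  by rewrite ler_pM2l ?invr_gt0//; exact: le_trans H H2.
apply/cvg_at_rightP => u [u0 ucv].
rewrite (_ : (fun n => _) = (fun n => 2^-1 * \int[mu]_t (sdiff F x t * ker p (u n) t))); last first.
  by apply/funext => n; rewrite Dop_half.
apply: cvgM; first exact: cvg_cst.
apply: (proj2 (@dct _ _ _ (fun t => c * dom x t) _ _ _ _)).
- by move=> n; exact: mk.
- exact: id.
- by move=> n t; exact: kle.
move=> t; have [->|t0] := eqVneq t 0.
  by apply: cvg_near_cst; apply: nearW => n; rewrite /sdiff addr0 subr0 mulr_natl mulr2n addrK subrr !mul0r.
apply: cvg_near_cst.
have tn : 0 < `|t| by rewrite normr_gt0.
move/cvgrPdist_lt/(_ _ tn): ucv; apply: filterS => n.
by rewrite sub0r normrN gtr0_norm// /ker /cut => ->.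
Qed.

End Duality.

(** * Smooth compactly supported functions *)

Section TestFunctions.
Context {R : realType}.
Local Notation mu := (@lebesgue_measure R).
Implicit Types (f g h phi rho theta : R -> R) (a b c r x y z L : R).

(** A smooth function is carried along with all its derivatives, so that closure under translation,
    dilation or convolution is proved one level at a time. *)
Definition tower (F : nat -> R -> R) := forall n x, is_derive x 1 (F n) (F n.+1 x).

Definition vanish L f := forall x, L < `|x| -> f x = 0.

Lemma is_derive_c (k : R) x : is_derive x 1 (fun=> k) 0.
Proof. exact: (is_derive_cst (k : R^o) x 1). Qed.

Lemma tower_derive1n F : tower F -> forall n, derive1n n (F 0%N) = F n.
Proof.
move=> tF; elim=> [//|n IH]; rewrite derive1nS IH; apply/funext => x.
by rewrite derive1E; exact: (@derive_val _ _ _ _ _ _ _ (tF n x)).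
Qed.

Lemma tower_cont F n : tower F -> continuous (F n).
Proof. by move=> tF x; exact: is_derive_cont (tF n x). Qed.

Lemma tower_test F L : tower F -> vanish L (F 0%N) -> test_fun (F 0%N).
Proof.
move=> tF vF; split.
  move=> n; split.
    by move=> i _ x; rewrite tower_derive1n//; have [] := tF i x.
  by rewrite tower_derive1n//; exact: tower_cont.
apply: (subclosed_compact (@closed_closure _ _) (@segment_compact R (- L) L)).
rewrite (closure_id `[- L, L]).1; last exact: itv_closed.
apply: closure_subset => x /= fx; rewrite in_itv /= -ler_norml leNgt; apply/negP => Lx.
by rewrite (vF x Lx) eqxx in fx.
Qed.

Lemma test_tower phi : test_fun phi ->
  exists F L, [/\ tower F, F 0%N = phi & vanish L phi].
Proof.
move=> [Ck cpt].
have [M [Mr HM]] := compact_bounded cpt.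
exists (fun n => derive1n n phi), (M + 1); split; [|exact: erefl|].
- move=> n x; have [d _] := Ck n.+1; have dn := d n (ltnSn n) x.
  by rewrite derive1nS derive1E; exact: derivableP.
- move=> x Mx; apply/eqP/negP => /negP fx.
  have /HM : M < M + 1 by rewrite ltrDl.
  move=> /(_ x) h; have : `|x| <= M + 1 by apply: h; apply: subset_closure.
  by rewrite leNgt Mx.
Qed.

Lemma vanish_derive L f g : (forall x, is_derive x 1 f (g x)) -> vanish L f -> vanish L g.
Proof.
move=> df vf x Lx.
have h : is_derive x 1 f 0.
  apply: (@is_derive_near _ (fun=> 0)).
  have : continuous (fun y : R => `|y|) by move=> ?; exact: norm_continuous.
  move=> /(_ x) /cvgrPdist_lt /(_ (`|x| - L)); rewrite subr_gt0 => /(_ Lx) H.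
  apply: filterS H => y; rewrite ltr_norml => /andP[_] h; rewrite vf//; lra.
have := @derive_val _ _ _ _ _ _ _ h.
by rewrite (@derive_val _ _ _ _ _ _ _ (df x)).
Unshelve. all: by end_near. Qed.

Lemma tower_vanish F L n : tower F -> vanish L (F 0%N) -> vanish L (F n).
Proof.
move=> tF v0; elim: n => [//|n IH]; exact: (vanish_derive (tF n) IH).
Qed.

Lemma vanish_bounded L f : continuous f -> vanish L f ->
  exists2 c, 0 <= c & forall x, `|f x| <= c.
Proof.
move=> cf vf; pose K := `|L|.
have K0 : - K <= K by rewrite /K; have : 0 <= `|L| by []; lra.
have cfn : {within `[- K, K], continuous (fun x => `|f x|)}.
  apply: continuous_subspaceT => x; apply: continuous_comp; [exact: cf|exact: norm_continuous].
have [x0 _ hx0] := EVT_max K0 cfn.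
exists `|f x0| => // x; have [Kx|Kx] := leP `|x| K.
  by apply: hx0; rewrite in_itv/= -ler_norml.
by rewrite vf ?normr0//; apply: le_lt_trans Kx; rewrite /K ler_norm.
Qed.

Lemma vanish_wt L f r : 0 <= r -> continuous f -> vanish L f ->
  exists2 c, 0 <= c & forall x, `|f x| <= c * wt r x.
Proof.
move=> r0 cf vf; have [c c0 hc] := vanish_bounded cf vf.
exists (c * (1 + `|L|) `^ r) => [|x]; first by rewrite mulr_ge0 ?powR_ge0.
have [Lx|Lx] := leP `|x| L; last by rewrite vf// normr0 !mulr_ge0 ?powR_ge0.
apply: le_trans (hc x) _; rewrite -mulrA ler_peMr//.
rewrite /wt powRN ler_pdivlMr ?powR_gt0 ?ltr_wpDr// mul1r le_powRr//.
by rewrite addr_ge0//= lerD2l (le_trans Lx)// ler_norm.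
Qed.

(** A class closed under differentiation consists of smooth functions; choice selects the successive
    derivatives. *)
Lemma tower_of (S : (R -> R) -> Prop) :
  (forall f, S f -> exists g, S g /\ forall x, is_derive x 1 f (g x)) ->
  forall f, S f -> exists F, [/\ tower F, F 0%N = f & forall n, S (F n)].
Proof.
move=> HS f Sf.
have H (u : {f : R -> R | S f}) : exists v : {f : R -> R | S f},
    forall x, is_derive x 1 (sval u) (sval v x).
  by have [g [Sg dg]] := HS _ (svalP u); exists (exist _ g Sg).
have [nx hnx] := choice H.
exists (fun n => sval (iter n nx (exist _ f Sf))); split => //.
by move=> n; exact: svalP.
Qed.

(** The difference quotients of [f] are bounded by [c] by the mean value theorem, so c |theta|
    dominates. *)
Lemma conv_derive theta f f1 c : intg theta ->
  (forall x, is_derive x 1 f (f1 x)) -> (forall x, `|f x| <= c) -> (forall x, `|f1 x| <= c) ->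
  continuous f1 -> forall x,
  is_derive x 1 (fun x => \int[mu]_y (f (x - y) * theta y))
    (\int[mu]_y (f1 (x - y) * theta y)).
Proof.
move=> ith df fc f1c cf1 x.
have cf : continuous f by move=> y; exact: is_derive_cont (df y).
have mf : measurable_fun setT f by exact: continuous_measurable_fun.
have mf1 : measurable_fun setT f1 by exact: continuous_measurable_fun.
have mth := intg_meas ith.
have if0 z : intg (fun y => f (z - y) * theta y).
  by apply: (@intgMb _ c) => //; mfun.
set d := \int[mu]_y _.
have H : (h^-1 *: ((fun x => \int[mu]_y (f (x - y) * theta y)) (h *: 1 + x) -
    (fun x => \int[mu]_y (f (x - y) * theta y)) x)) @[h --> 0^'] --> d.
  apply/cvgr_dnbhsP => u [u0 ucv].
  pose fn n y := (u n)^-1 * (f (u n + x - y) - f (x - y)) * theta y.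
  have E n : (u n)^-1 *: ((fun x => \int[mu]_y (f (x - y) * theta y)) (u n *: 1 + x) -
      (fun x => \int[mu]_y (f (x - y) * theta y)) x) = \int[mu]_y fn n y.
    rewrite /GRing.scale/= mulr1 -(IB (if0 _) (if0 _)) -(IZ _ (intgB (if0 _) (if0 _))).
    by apply: eq_I => y; rewrite /fn; ring.
  rewrite (_ : (fun n => _) = (fun n => \int[mu]_y fn n y)); last by apply/funext => n; exact: E.
  have bnd n y : `|fn n y| <= c * `|theta y|.
    rewrite /fn normrM ler_wpM2r// normrM normfV ler_pdivrMl ?normr_gt0// mulrC.
    have -> : u n + x - y = (x - y) + u n by ring.
    have [un|un] := ltP 0 (u n).
      have le1 : x - y <= x - y + u n by rewrite lerDl ltW.
      apply: le_trans (mvt_le le1 (fun z _ => df z) (fun z _ => f1c z)) _.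
      by rewrite gtr0_norm// addrAC subrr add0r.
    have le1 : x - y + u n <= x - y by rewrite gerDl.
    rewrite distrC; apply: le_trans (mvt_le le1 (fun z _ => df z) (fun z _ => f1c z)) _.
    by rewrite ler0_norm// opprD addNKr.
  apply: (proj2 (@dct _ fn _ (fun y => c * `|theta y|) _ _ bnd _)).
  - by move=> n; rewrite /fn; mfun; apply: (mfcomp mf); mfun.
  - exact/intgZ/intg_norm.
  - move=> y; rewrite /fn; apply: cvgM; last exact: cvg_cst.
    have [dd vv] := df (x - y).
    have {dd} := dd; rewrite /derivable => /cvg_ex[l hl].
    have hv : h^-1 *: (f (h *: 1 + (x - y)) - f (x - y)) @[h --> 0^'] --> f1 (x - y).
      by rewrite -vv /derive; apply/cvg_ex; exists l; exact: hl.
    move/cvgr_dnbhsP: hv => /(_ u (conj u0 ucv)).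
    rewrite /GRing.scale /=; apply: cvg_trans; apply: near_eq_cvg; apply: nearW => n.
    by rewrite mulr1 addrA.
split; first by apply/cvg_ex; exists d.
exact/cvg_lim.
Qed.

Lemma conv_test theta rho L : intg theta -> vanish L theta -> test_fun rho ->
  test_fun (fun x => \int[mu]_y (rho (x - y) * theta y)).
Proof.
move=> ith vth /test_tower[F [L' [tF F0 vF]]].
rewrite -F0 in vF *.
have tG : tower (fun n x => \int[mu]_y (F n (x - y) * theta y)).
  move=> n x.
  have [c c0 hc] := vanish_bounded (@tower_cont F n tF) (tower_vanish n tF vF).
  have [c' c0' hc'] := vanish_bounded (@tower_cont F n.+1 tF) (tower_vanish n.+1 tF vF).
  apply: (@conv_derive theta (F n) (F n.+1) (c + c')) => //.
  - by move=> y; apply: le_trans (hc y) _; rewrite lerDl.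
  - by move=> y; apply: le_trans (hc' y) _; rewrite lerDr.
  - exact: tower_cont.
apply: (@tower_test (fun n x => \int[mu]_y (F n (x - y) * theta y)) (L' + L)) => //.
move=> x Lx; rewrite -[RHS]I0; apply: eq_I => y.
have [Ly|Ly] := leP `|y| L; last by rewrite vth// mulr0.
rewrite vF ?mul0r//; have : `|x| <= `|x - y| + `|y|.
  by apply: le_trans (ler_normD _ _); rewrite subrK.
by lra.
Qed.

(** The flat functions P (1/x) e^(-1/x). Admitting all polynomials makes the class stable under
    differentiation; P = 1 is the classical example. *)
Definition psi (P : {poly R}) x : R := if 0 < x then P.[x^-1] * expR (- x^-1) else 0.

Lemma poly_exp_bnd (P : {poly R}) a : 0 < a ->
  exists2 c, 0 <= c & forall z, 0 <= z -> `|P.[z]| * expR (- (a * z)) <= c.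
Proof.
elim/poly_ind: P a => [a a0|P k IH a a0].
  by exists 0 => // z _; rewrite horner0 normr0 mul0r.
have a2 : 0 < a / 2 by rewrite divr_gt0.
have [c c0 hc] := IH _ a2.
exists (c * (2 / a) + `|k|) => [|z z0].
  by rewrite addr_ge0// mulr_ge0// divr_ge0// ltW.
rewrite hornerMXaddC.
have e1 : expR (- (a * z)) <= 1 by rewrite -expR0 ler_expR oppr_le0 mulr_ge0// ltW.
apply: (@le_trans _ _ (`|P.[z] * z| * expR (- (a * z)) + `|k| * expR (- (a * z)))).
  by rewrite -mulrDl ler_wpM2r ?expR_ge0// ler_normD.
apply: lerD; last by rewrite ler_piMr.
have -> : - (a * z) = - (a / 2 * z) + - (a / 2 * z) by field.
rewrite expRD normrM (ger0_norm z0) mulrACA.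
apply: ler_pM (hc z z0) _ => //; first by rewrite mulr_ge0 ?expR_ge0.
rewrite expRN ler_pdivrMr ?expR_gt0//.
apply: (@le_trans _ _ (2 / a * (1 + a / 2 * z))).
  have -> : 2 / a * (1 + a / 2 * z) = 2 / a + z by field; rewrite gt_eqF.
  by rewrite lerDr divr_ge0// ltW.
by rewrite ler_wpM2l ?divr_ge0 ?(ltW a0)// expR_ge1Dx.
Qed.

(** The only delicate point is the origin: z^2 P (z) e^(-z) is bounded for z >= 0, so with z = 1/h
    the function is O(h^2). *)
Lemma psi_derive P x : is_derive x 1 (psi P) (psi ('X^2 * (P - P^`())) x).
Proof.
have [x0|x0|<-] := ltgtP 0 x.
- rewrite /psi x0.
  have d1 : is_derive x 1 (fun y => y^-1) (- x ^- 2).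
    have xn : (id x : R) != 0 by rewrite gt_eqF.
    split; first exact: (@derivableV R R id x 1 xn).
    rewrite (@deriveV R R id x 1 xn)// derive_id /GRing.scale /= mulr1 //.
  have d2 : is_derive x 1 (fun y => P.[y^-1]) (- x ^- 2 * P^`().[x^-1]).
    rewrite mulrC; exact: (@is_derive1_comp R (horner P) (fun y => y^-1) x _ _ (is_derive_poly P x^-1) d1).
  have d3 : is_derive x 1 (fun y => expR (- y^-1)) (x ^- 2 * expR (- x^-1)).
    have d3' := is_deriveZr (-1) d1.
    have := @is_derive1_comp R expR (fun y => -1 * y^-1) x _ _ (is_derive_expR _) d3'.
    have -> : expR (-1 * x^-1) * (-1 * - x ^- 2) = x ^- 2 * expR (- x^-1).
      by rewrite !mulN1r opprK mulrC.
    by apply: is_derive_ext => y; rewrite /comp /= mulN1r.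
  have := is_deriveMr d2 d3.
  set v := (X in is_derive _ _ _ X -> _); set w := (X in _ -> is_derive _ _ _ X).
  have -> : v = w.
    by rewrite /v /w !hornerE /= exprVn; ring.
  apply: is_derive_near; near=> y.
  by have -> : 0 < y by near: y; exact: lt_nbhsr.
- rewrite /psi ltNge (ltW x0) /=.
  apply: (@is_derive_near _ (fun=> 0)).
  near=> y; rewrite ltNge ltW//; near: y; exact: lt_nbhsl.
- have [c c0 hc] := poly_exp_bnd ('X^2 * P) ltr01.
  have psi0 : psi ('X^2 * (P - P^`())) 0 = 0 by rewrite /psi ltxx.
  have bnd (h : R) : `|psi P h| <= c * h ^+ 2.
    rewrite /psi; case: ifPn => [h0|_]; last by rewrite normr0 mulr_ge0// sqr_ge0.
    have := hc h^-1; rewrite invr_ge0 (ltW h0) => /(_ isT).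
    rewrite mul1r !hornerE /= normrM [`|h^-1 ^+ 2|]ger0_norm ?sqr_ge0// => H.
    rewrite normrM [`|expR _|]ger0_norm ?expR_ge0//.
    have -> : `|P.[h^-1]| * expR (- h^-1) = (h^-1 ^+ 2 * `|P.[h^-1]| * expR (- h^-1)) * h ^+ 2.
      by field; rewrite gt_eqF.
    have -> : c * h * h = c * h ^+ 2 by ring.
    by apply: ler_wpM2r => //; exact: sqr_ge0.
  have H : (h^-1 *: (psi P (h *: 1 + 0) - psi P 0)) @[h --> 0^'] --> (0 : R).
    rewrite {2}/psi ltxx.
    apply/cvgrPdist_le => e e0; near=> h.
    have h0 : h != 0 by near: h; exact: nbhs_dnbhs_neq.
    rewrite sub0r normrN subr0 addr0 /GRing.scale /= mulr1 normrM normfV.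
    rewrite ler_pdivrMl ?normr_gt0//; apply: le_trans (bnd h) _.
    rewrite -real_normK ?num_real// expr2 mulrCA ler_wpM2l// mulrC.
    apply: (@le_trans _ _ (`|h| * (c + 1))); first by rewrite ler_wpM2l// lerDl.
    rewrite -ler_pdivlMr; last by rewrite ltr_wpDl.
    near: h; apply: nbhs_dnbhs; apply/nbhs_ballP; exists (e / (c + 1)) => /=.
      by rewrite divr_gt0// ltr_wpDl.
    by move=> h; rewrite /ball /= sub0r normrN => /ltW.
  rewrite psi0; split; first by apply/cvg_ex; exists 0.
  exact/cvg_lim.
Unshelve. all: by end_near. Qed.

(** A class containing the bump and closed under the Leibniz rule; [tower_of] then yields smoothness
    without formulas for higher derivatives. *)
Inductive bumpalg : (R -> R) -> Prop :=
| bump_l P : bumpalg (fun x => psi P (1 * x + 1))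
| bump_r P : bumpalg (fun x => psi P (-1 * x + 1))
| bump_mul f g : bumpalg f -> bumpalg g -> bumpalg (fun x => f x * g x)
| bump_add f g : bumpalg f -> bumpalg g -> bumpalg (fun x => f x + g x).

Lemma bumpalg_derive f : bumpalg f -> exists g, bumpalg g /\ forall x, is_derive x 1 f (g x).
Proof.
elim=> [P|P|u v bu [u' [bu' du]] bv [v' [bv' dv]]|u v bu [u' [bu' du]] bv [v' [bv' dv]]].
- exists (fun x => psi ('X^2 * (P - P^`())) (1 * x + 1)); split; first exact: bump_l.
  by move=> x; have := is_derive_affine (psi_derive P (1 * x + 1)); rewrite [X in is_derive _ _ _ X -> _]mul1r.
- exists (fun x => psi ('X^2 * (- P - (- P)^`())) (-1 * x + 1)); split; first exact: bump_r.
  move=> x; have := is_derive_affine (psi_derive P (-1 * x + 1)).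
  rewrite (_ : -1 * psi _ _ = psi ('X^2 * (- P - (- P)^`())) (-1 * x + 1))//.
  rewrite /psi; case: ifP => _; last by rewrite mulr0.
  by rewrite derivN !hornerE /=; ring.
- exists (fun x => u' x * v x + u x * v' x); split.
    by apply: bump_add; exact: bump_mul.
  by move=> x; exact: is_deriveMr.
- exists (fun x => u' x + v' x); split; first exact: bump_add.
  by move=> x; exact: is_deriveDr.
Qed.

Definition bump x : R := psi 1 (1 * x + 1) * psi 1 (-1 * x + 1).

Lemma bump_test : test_fun bump.
Proof.
have [F [tF F0 _]] := tower_of bumpalg_derive (bump_mul (bump_l 1) (bump_r 1)).
have -> : bump = F 0%N by rewrite F0.
apply: (@tower_test F 1) => //; rewrite F0 => x.
rewrite ltr_normr /psi => /orP[h|h].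
  by rewrite [X in _ * (if X then _ else _)](_ : _ = false) ?mulr0//; apply/negbTE; rewrite -leNgt; lra.
by rewrite [X in (if X then _ else _) * _](_ : _ = false) ?mul0r//; apply/negbTE; rewrite -leNgt; lra.
Qed.

Lemma bump_ge0 x : 0 <= bump x.
Proof.
have h z : 0 <= psi 1 z by rewrite /psi; case: ifP => // _; rewrite hornerE mul1r expR_ge0.
exact: mulr_ge0.
Qed.

Lemma bump_vanish : vanish 1 bump.
Proof.
move=> x; rewrite /bump ltr_normr /psi => /orP[h|h].
  by rewrite [X in _ * (if X then _ else _)](_ : _ = false) ?mulr0//; apply/negbTE; rewrite -leNgt; lra.
by rewrite [X in (if X then _ else _) * _](_ : _ = false) ?mul0r//; apply/negbTE; rewrite -leNgt; lra.
Qed.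

Lemma bump0_gt0 : 0 < bump 0.
Proof. by rewrite /bump /psi !mulr0 add0r ltr01 !hornerE /= mulr_gt0 ?expR_gt0. Qed.

End TestFunctions.

(** * The fractional Laplacian of test functions *)

Section FracLap.
Context {R : realType}.
Local Notation mu := (@lebesgue_measure R).
Implicit Types (f g F W phi rho theta : R -> R) (a b c r x y z : R).

Lemma lim_uniq (u : nat -> R) a b : u n @[n --> \oo] --> a -> u n @[n --> \oo] --> b -> a = b.
Proof. by move=> h1 h2; have := cvg_unique _ h1 h2; move=> ->. Qed.

Lemma lim_le (u : nat -> R) a b : u n @[n --> \oo] --> a -> (forall n, u n <= b) -> a <= b.
Proof.
move=> h ub; have <- : lim (u n @[n --> \oo]) = a by apply/cvg_lim.
by apply: limr_le; [apply/cvg_ex; exists a|exact: nearW].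
Qed.

Lemma lim_ge (u : nat -> R) a b : u n @[n --> \oo] --> a -> (forall n, b <= u n) -> b <= a.
Proof.
move=> h ub; have <- : lim (u n @[n --> \oo]) = a by apply/cvg_lim.
by apply: limr_ge; [apply/cvg_ex; exists a|exact: nearW].
Qed.

(** With k the exponent, e^y = (e^(y/k))^k >= (1 + y/k)^k >= ((1 + y)/k)^k, hence the constant
    k^k. *)
Lemma exp_wt n : exists2 c, 0 < c & forall y : R, 0 <= y -> expR (- y) <= c * (1 + y) `^ (- n%:R).
Proof.
case: n => [|n].
  by exists 1 => // y y0; rewrite oppr0 powRr0 mulr1 -expR0 ler_expR oppr_le0.
set k : R := n.+1%:R; have k0 : 0 < k by rewrite ltr0n.
have k1 : 1 <= k by rewrite ler1n.
exists (k ^+ n.+1) => [|y y0]; first exact: exprn_gt0.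
have y1 : 0 < 1 + y by rewrite ltr_wpDr.
rewrite powRN powR_mulrn ?(ltW y1)// expRN -(invrK (k ^+ _)) -invfM.
rewrite lef_pV2 ?posrE ?expR_gt0 ?mulr_gt0 ?invr_gt0 ?exprn_gt0//.
have -> : y = n.+1%:R * (y / k) by rewrite -/k mulrC divfK// gt_eqF.
rewrite expRM_natl -exprVn -exprMn lerXn2r ?nnegrE ?mulr_ge0 ?invr_ge0 ?expR_ge0 ?(ltW k0)//.
  by rewrite addr_ge0// mulr_ge0 ?divr_ge0// ltW.
apply: le_trans (expR_ge1Dx _).
rewrite -/k [k * _]mulrC divfK ?gt_eqF// mulrDr mulr1 [k^-1 * y]mulrC lerD2r.
by rewrite invf_le1.
Qed.

(** The range covers the two arguments 1/2 + s and 1 - s that occur in C_s. Integrability has to be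
    shown, since a divergent integral would be read as 0. *)
Lemma euler_gt0 (t : R) : 0 < t < 2 -> 0 < euler_integral t.
Proof.
move=> /andP[t0 t2].
pose E x := if 0 < x then x `^ (t - 1) * expR (- x) else 0.
have -> : euler_integral t = \int[mu]_x E x.
  rewrite /euler_integral Rintegral_mkcond; apply: eq_Rintegral => x _.
  rewrite patchE /E; case: ifPn => h; case: ifPn => h' //.
    by move: h; rewrite inE /= in_itv /= andbT (negbTE h').
  by move: h; rewrite notin_setE /= in_itv /= andbT h'.
have mE : measurable_fun setT E by rewrite /E; mfun.
have [c c0 hc] := exp_wt 4.
have iE : intg E.
  (* For t >= 1 there is no singularity and the exponent 1 - t is not positive; replacing t by min t
     1/2 keeps the exponent in the range of [intg_sing]. *)
  pose sg x := if `|x| <= 1 then `|x| `^ (- (1 - Num.min t 2^-1)) else 0.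
  have m0 : 0 < Num.min t 2^-1 by rewrite lt_min t0 invr_gt0 ltr0n.
  have m1 : Num.min t 2^-1 <= 2^-1 by rewrite ge_min lexx orbT.
  have isg : intg sg by apply: intg_sing; apply/andP; split; lra.
  have w2 : intg (wt (2 : R)) by apply: intg_wt; lra.
  apply: intg_le mE _ (intgD isg (intgZ c w2)) => x.
  have n1 : 0 <= sg x by rewrite /sg; case: ifP => // _; exact: powR_ge0.
  have n2 : 0 <= c * wt 2 x by rewrite mulr_ge0 ?wt_ge0// ltW.
  rewrite /E; case: ifPn => x0; last by rewrite normr0 addr_ge0.
  rewrite ger0_norm ?mulr_ge0 ?powR_ge0 ?expR_ge0//.
  have e1 : expR (- x) <= 1 by rewrite -expR0 ler_expR oppr_le0 ltW.
  have [x1|x1] := leP x 1.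
    apply: ler_wpDr => //; rewrite /sg gtr0_norm// x1.
    apply: (@le_trans _ _ (x `^ (t - 1))); first by rewrite ler_piMr ?powR_ge0.
    have mt : Num.min t 2^-1 <= t by rewrite ge_min lexx.
    by rewrite opprB; apply: ger_powR; [rewrite x0 x1|lra].
  apply: ler_wpDl => //.
  apply: (@le_trans _ _ ((1 + x) `^ 2 * (c * (1 + x) `^ (- 4)))).
    apply: ler_pM; rewrite ?powR_ge0 ?expR_ge0//; last by apply: hc; exact: ltW.
    apply: (@le_trans _ _ (x `^ 2)); first by apply: ler_powR; lra.
    by apply: le_powRr => //; apply/andP; split; lra.
  have y1 : 0 < 1 + x by lra.
  rewrite mulrCA -powRD; last by rewrite (gt_eqF y1) implybT.
  by rewrite /wt gtr0_norm//; have -> : 2 + - 4 = - 2 :> R by ring.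
apply: (@lt_le_trans _ _ (\int[mu]_x (if 1 <= x <= 2 then 2^-1 * expR (- 2) else 0))).
  rewrite I_itv_cst; last by lra.
  have := @expR_gt0 R (-2); lra.
apply: I_le => //.
  by apply: (@intg_itv _ _ _ (`|2^-1 * expR (- 2)|) (fun=> _)) => //; exact: mfC.
move=> x; rewrite /E; case: ifPn => [/andP[x1 x2]|_]; last first.
  by case: ifPn => // _; rewrite mulr_ge0 ?powR_ge0 ?expR_ge0.
have x0 : 0 < x by lra.
rewrite x0; apply: ler_pM; rewrite ?expR_ge0 ?invr_ge0 ?ler_expR//; last by lra.
apply: (@le_trans _ _ (x `^ (-1))); last by apply: ler_powR => //; lra.
by rewrite powR_inv1 ?(ltW x0)// lef_pV2 ?posrE.
Qed.

Variable s : R.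
Hypothesis hs : 2^-1 < s < 1.

Let s1 : 2^-1 < s. Proof. by case/andP: hs. Qed.
Let s2 : s < 1. Proof. by case/andP: hs. Qed.

Definition pp := 2 * s - 1.

Lemma pp01 : 0 < pp < 1.
Proof. by rewrite /pp; apply/andP; split; move: s1 s2; lra. Qed.

Let hp := pp01.
Let p0 : 0 < pp. Proof. by case/andP: hp. Qed.
Let p1 : pp < 1. Proof. by case/andP: hp. Qed.

Local Notation N := (Nker pp).
Local Notation D := (Dop pp).
Local Notation L := (Lop pp).

Lemma frac_const_gt0 : 0 < frac_lap_const s.
Proof.
have sp : 0 < s by move: s1; lra.
rewrite /frac_lap_const mulr_gt0//.
  by rewrite divr_gt0 ?powR_gt0// sqrtr_gt0 pi_gt0.
apply: divr_gt0.
  rewrite /Gamma ifT; last by move: s1; lra.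
  by apply: euler_gt0; apply/andP; split; move: s1 s2; lra.
rewrite normr_gt0 /Gamma ifF; last by apply/negbTE; rewrite -leNgt; lra.
(* One step of the recursion suffices: Gamma (-s) is Euler's integral at 1 - s divided by -s. *)
have -> : Num.truncn (- - s) = 0%N.
  by apply: truncn_def; rewrite opprK (ltW sp).
rewrite big_ord1 /= mulf_neq0 ?invr_eq0//.
  by rewrite gt_eqF//; apply: euler_gt0; apply/andP; split; move: s1 s2; lra.
by rewrite lt_eqF//; lra.
Qed.

Lemma test_nice phi : test_fun phi -> exists2 c, 0 <= c & nice pp c phi.
Proof.
move=> /test_tower[F [l [tF F0 vF]]]; rewrite -F0 in vF *.
have q2 : 0 <= 2 - pp by move: p1; lra.
have q4 : 0 <= 4 - pp by move: p1; lra.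
have [c c0 hc] := vanish_wt q2 (@tower_cont R F 0 tF) vF.
have [d d0 hd] := vanish_wt q4 (@tower_cont R F 2 tF) (tower_vanish 2 tF vF).
exists (c + d); first exact: addr_ge0.
exists (F 1%N), (F 2%N); split; [exact: tF|exact: tF| |] => x.
  by apply: le_trans (hc x) _; rewrite ler_wpM2r ?wt_ge0// lerDl.
by apply: le_trans (hd x) _; rewrite ler_wpM2r ?wt_ge0// lerDr.
Qed.

Lemma trunc_int_eq phi x e : 0 < e -> intg phi ->
  \int[mu]_(y in [set y | e < `|x - y|]) ((phi x - phi y) / `|x - y| `^ (1 + 2 * s)) =
  D e phi x.
Proof.
move=> e0 iphi.
have h := Dop_intgL hp x e0 iphi.
rewrite Rintegral_mkcond /Dop -(I_shift (- x) h); apply: eq_Rintegral => y _.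
rewrite patchE [x + (y - x)]addrC subrK /ker /cut [`|y - x|]distrC.
have -> : 1 + 2 * s = pp + 2 by rewrite /pp; ring.
case: ifPn; rewrite ?inE ?notin_setE /= => H.
  by rewrite H powRN.
by case: ifPn => // H'; rewrite mulr0.
Qed.

Lemma frac_lapE phi x : test_fun phi -> frac_lap s phi x = frac_lap_const s * L phi x.
Proof.
move=> tphi; have [c c0 nphi] := test_nice tphi.
have [C HC] := nice_bound hp; have [_ cv] := HC c phi c0 nphi.
rewrite /frac_lap; congr (_ * _); apply/cvg_lim => //.
have iphi := nice_intg hp nphi.
apply: cvg_trans (cv x); apply: near_eq_cvg; near=> e.
by rewrite trunc_int_eq//; near: e; exact: nbhs_right_gt.
Unshelve. all: by end_near. Qed.

Section NiceFun.
Variables (c : R) (F : R -> R).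
Hypotheses (c0 : 0 <= c) (nF : nice pp c F).

Let iF := nice_intg hp nF.

Lemma Dop_L_cvg x : D (en n) F x @[n --> \oo] --> L F x.
Proof.
have [C HC] := nice_bound hp; have [_ cv] := HC c F c0 nF.
have /cvg_at_rightP := cv x; apply; split => [n|]; [exact: en_gt0|exact: en_cvg].
Qed.

Lemma Dop_meas e : 0 < e -> measurable_fun setT (D e F).
Proof.
move=> e0.
have h1 : forall x y, `|(fun=> 1 : R) x - (fun=> 1 : R) y| <= 0 * `|x - y| `^ pp.
  by move=> x y; rewrite subrr normr0 mul0r.
have i1 : intg (fun x => (fun=> 1 : R) x * F x) by apply: eq_intg iF => x; rewrite mul1r.
have [i _] := dualW hp e0 h1 iF i1.
by apply: intg_meas; apply: eq_intg i => x; rewrite mul1r.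
Qed.

Lemma Lop_meas : measurable_fun setT (L F).
Proof.
apply: (measurable_fun_cvg (fun n => Dop_meas (en_gt0 n))) => x _; exact: Dop_L_cvg.
Qed.

Lemma Lop_bound : exists2 d, 0 <= d & (forall x, `|L F x| <= d * wt (pp + 2) x) /\
  forall n x, `|D (en n) F x| <= d * wt (pp + 2) x.
Proof.
have [C HC] := nice_bound hp; have [bd _] := HC c F c0 nF.
have C0 : 0 <= C * c.
  have := bd 1 0 ltr01; have := wt_gt0 (pp + 2) (0 : R).
  set w := wt _ _ => w0 h; have : 0 <= C * c * w by exact: le_trans h.
  by rewrite pmulr_lge0.
exists (C * c) => //; split=> [x|n x]; last by apply: bd; exact: en_gt0.
have h := cvg_norm (@Dop_L_cvg x).
by apply: (lim_le (h _)) => n; apply: bd; exact: en_gt0.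
Qed.

Let q1 : 1 < pp + 2. Proof. by move: p0; lra. Qed.

Lemma Lop_intg : intg (L F).
Proof.
have [d d0 [hd _]] := Lop_bound.
exact: (intg_le Lop_meas hd (intgZ d (intg_wt q1))).
Qed.

Lemma Nshift_wt z x : N (x - z) <= (1 + N z) * wt (- pp) x.
Proof.
have h1 := NkerD hp x (- z); rewrite NkerN in h1.
have h2 : N x <= wt (- pp) x by apply: powR_lt_wt; exact: ltW.
have h3 : 1 <= wt (- pp) x.
  rewrite /wt opprK -[leLHS](powRr0 (1 + `|x|)); apply: ler_powR; first by rewrite lerDl.
  exact: ltW.
have h4 := Nker_ge0 pp z.
have := ler_wpM2l h4 h3; lra.
Qed.

Let w2 : intg (wt (2 : R)). Proof. by apply: intg_wt; lra. Qed.

Let Nbound d z x v : 0 <= d -> `|v| <= d * wt (pp + 2) x ->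
  `|N (x - z) * v| <= d * (1 + N z) * wt 2 x.
Proof.
move=> d0 hv; rewrite normrM ger0_norm ?Nker_ge0//.
apply: le_trans (ler_pM (Nker_ge0 _ _) (normr_ge0 _) (Nshift_wt z x) hv) _.
have -> : wt 2 x = wt (- pp) x * wt (pp + 2) x by rewrite wtM; congr wt; ring.
by rewrite le_eqVlt; apply/orP; left; apply/eqP; ring.
Qed.

Lemma Nshift_meas z : measurable_fun setT (fun x => N (x - z)).
Proof. by rewrite /Nker; mfun. Qed.

Lemma NLop_intg z : intg (fun x => N (x - z) * L F x).
Proof.
have [d d0 [hd _]] := Lop_bound.
have mN := Nshift_meas z; have mL := Lop_meas.
apply: (intg_le _ (fun x => Nbound z d0 (hd x)) (intgZ _ w2)).
exact: mfM.
Qed.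

End NiceFun.

Lemma test_intgM W phi : test_fun phi -> continuous W -> intg (fun x => W x * phi x).
Proof.
move=> /test_tower[F [l [tF F0 vF]]] cW; rewrite -F0 in vF *.
have cF := @tower_cont R F 0 tF.
have cWF : continuous (fun x => W x * F 0%N x) by move=> x; apply: cvgM; [exact: cW|exact: cF].
have vWF : vanish l (fun x => W x * F 0%N x) by move=> x lx; rewrite vF// mulr0.
have [c c0 hc] := @vanish_wt R l _ 2 (ler0n _ 2) cWF vWF.
have w2 : intg (wt (2 : R)) by apply: intg_wt; lra.
apply: (intg_le _ hc (intgZ c w2)).
exact: continuous_measurable_fun.
Qed.

Lemma test_cont phi : test_fun phi -> continuous phi.
Proof. by move=> /test_tower[F [l [tF F0 _]]]; rewrite -F0; exact: tower_cont. Qed.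

Lemma test_bounded phi : test_fun phi -> exists2 c, 0 <= c & forall x, `|phi x| <= c.
Proof.
move=> /test_tower[F [l [tF F0 vF]]]; rewrite -F0 in vF *.
exact: vanish_bounded (tower_cont tF) vF.
Qed.

(** [dualW] moves the truncated operator onto N, where it is an approximate identity of mass [Gc];
    both sides then pass to the limit. *)
Lemma fundamental phi z : test_fun phi ->
  \int[mu]_x (N (x - z) * L phi x) = Gc pp * phi z.
Proof.
move=> tphi; have [c c0 nphi] := test_nice tphi; have iphi := nice_intg hp nphi.
have [d d0 [_ hd]] := Lop_bound c0 nphi.
have [b b0 hb] := test_bounded tphi.
have cN : continuous (fun x => N (x - z)).
  move=> x; apply: (@continuous_comp _ _ _ (fun x => x - z) N); last exact: Nker_cont.
  by apply: continuousB; [exact: cvg_id|exact: cvg_cst].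
have iN := test_intgM tphi cN.
have hN x y : `|N (x - z) - N (y - z)| <= 1 * `|x - y| `^ pp.
  rewrite mul1r; apply: le_trans (Nker_dist hp _ _) _.
  by rewrite opprB addrA subrK.
have w2 : intg (wt (2 : R)) by apply: intg_wt; lra.
have mN := Nshift_meas z.
have cv1 : \int[mu]_x (N (x - z) * D (en n) phi x) @[n --> \oo] --> \int[mu]_x (N (x - z) * L phi x).
  apply: (proj2 (@dct _ _ _ (fun x => d * (1 + N z) * wt 2 x) _ _ _ _)).
  - by move=> n; apply: mfM => //; exact: (Dop_meas nphi (en_gt0 n)).
  - exact: intgZ.
  - move=> n x; rewrite normrM ger0_norm ?Nker_ge0//.
    apply: le_trans (ler_pM (Nker_ge0 _ _) (normr_ge0 _) (Nshift_wt z x) (hd n x)) _.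
    have -> : wt 2 x = wt (- pp) x * wt (pp + 2) x by rewrite wtM; congr wt; ring.
    by rewrite le_eqVlt; apply/orP; left; apply/eqP; ring.
  - by move=> x; apply: cvgM; [exact: cvg_cst|exact: (Dop_L_cvg c0 nphi)].
have E n : \int[mu]_x (N (x - z) * D (en n) phi x) = \int[mu]_x (phi x * D (en n) N (x - z)).
  have [_ ->] := dualW hp (en_gt0 n) hN iphi iN.
  apply: eq_I => x; rewrite /Dop; congr *%R; apply: eq_I => t; by rewrite (addrAC x t).
rewrite (_ : (fun n => _) = (fun n => \int[mu]_x (phi x * D (en n) N (x - z)))) in cv1; last first.
  by apply/funext => n; exact: E.
have cv2 := @gfun_approx R pp hp phi z b (test_cont tphi) hb.
exact: (lim_uniq cv1 cv2).
Qed.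

(** Duality with the constant function 1, which every truncated operator annihilates. *)
Lemma Lop_mean0 phi : test_fun phi -> \int[mu]_x L phi x = 0.
Proof.
move=> tphi; have [c c0 nphi] := test_nice tphi; have iphi := nice_intg hp nphi.
have [d d0 [_ hd]] := Lop_bound c0 nphi.
have q1 : 1 < pp + 2 by move: p0; lra.
have cv1 : \int[mu]_x (D (en n) phi x) @[n --> \oo] --> \int[mu]_x (L phi x).
  apply: (proj2 (@dct _ _ _ (fun x => d * wt (pp + 2) x) _ _ _ _)).
  - by move=> n; exact: (Dop_meas nphi (en_gt0 n)).
  - by apply: intgZ; exact: intg_wt.
  - exact: hd.
  - by move=> x; exact: (Dop_L_cvg c0 nphi).
have h1 : forall x y, `|(fun=> 1 : R) x - (fun=> 1 : R) y| <= 0 * `|x - y| `^ pp.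
  by move=> x y; rewrite subrr normr0 mul0r.
have i1 : intg (fun x => (fun=> 1 : R) x * phi x) by apply: eq_intg iphi => x; rewrite mul1r.
have E n : \int[mu]_x (D (en n) phi x) = 0.
  have [_ H] := dualW hp (en_gt0 n) h1 iphi i1.
  transitivity (\int[mu]_x (1 * D (en n) phi x)); first by apply: eq_I => x; rewrite mul1r.
  rewrite H -[RHS]I0; apply: eq_I => x; rewrite (_ : D _ _ _ = 0) ?mulr0//.
  by rewrite /Dop -[RHS]I0; apply: eq_I => t; rewrite subrr mul0r.
rewrite (_ : (fun n => _) = (fun=> 0)) in cv1; last by apply/funext => n; exact: E.
exact: (lim_uniq cv1 (cvg_cst _)).
Qed.

End FracLap.

(** * The Liouville theorem *)

Section SmoothPotential.
Context {R : realType}.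
Local Notation mu := (@lebesgue_measure R).
Implicit Types (f g F W phi rho theta : R -> R) (a b c r x y z : R).

(** The normalised indicator of [-2, 2] convolved with the bump, which is supported in [-1, 1]: this
    gives 1 on [-1, 1] and 0 beyond 3. *)
Lemma cutoff : exists chi : nat -> R -> R,
  [/\ tower chi, vanish 3 (chi 0%N) & forall x, `|x| <= 1 -> chi 0%N x = 1].
Proof.
have cb : continuous (@bump R).
  by have [F [l [tF F0 _]]] := test_tower (@bump_test R); rewrite -F0; exact: tower_cont.
have ib : intg (@bump R).
  have [c c0 hc] := @vanish_wt R 1 _ 2 (ler0n _ 2) cb (@bump_vanish R).
  have w2 : intg (wt (2 : R)) by apply: intg_wt; lra.
  have mb : measurable_fun setT (@bump R) by exact: continuous_measurable_fun.
  exact: (intg_le mb hc (intgZ c w2)).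
set A := \int[mu]_x bump x.
have A0 : 0 < A by exact: (I_gt0 cb ib (@bump_ge0 R) (@bump0_gt0 R)).
pose th x : R := if -2 <= x <= 2 then A^-1 else 0.
have ith : intg th.
  by apply: (@intg_itv _ _ _ (`|A^-1|) (fun=> A^-1)) => //; exact: mfC.
have vth : vanish 2 th.
  by move=> x x2; rewrite /th -ler_norml leNgt x2.
have tc := conv_test ith vth (@bump_test R).
have [F [l [tF F0 _]]] := test_tower tc.
exists F; split=> //; rewrite F0.
  move=> x x3; rewrite -[RHS]I0; apply: eq_I => y.
  have [y2|y2] := leP `|y| 2; last by rewrite vth// mulr0.
  rewrite bump_vanish ?mul0r//.
  have : `|x| <= `|x - y| + `|y| by apply: le_trans (ler_normD _ _); rewrite subrK.
  by lra.
move=> x x1.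
have -> : \int[mu]_y (bump (x - y) * th y) = \int[mu]_y (A^-1 * bump (x - y)).
  apply: eq_I => y; rewrite /th -ler_norml; case: ifPn => [_|]; first by rewrite mulrC.
  rewrite -ltNge => y2; rewrite bump_vanish ?mul0r ?mulr0//.
  have : `|y| <= `|x - y| + `|x| by rewrite [`|x - y|]distrC; apply: le_trans (ler_normD _ _); rewrite subrK.
  by lra.
by rewrite (IZ _ (intg_refl x ib)) (I_refl x ib) mulVf// gt_eqF.
Qed.

Variable p : R.
Hypothesis hp : 0 < p < 1.
Let p0 : 0 < p. Proof. by case/andP: hp. Qed.
Let p1 : p < 1. Proof. by case/andP: hp. Qed.

Local Notation N := (Nker p).

(** The derivatives of |x|^p away from the origin. Order four is reached because [nice] asks for two
    derivatives of a second difference, which itself consumes two. *)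
Definition Nd (k : nat) x : R :=
  match k with
  | 0 => `|x| `^ p
  | 1 => p * (x * `|x| `^ (p - 2))
  | 2 => p * (p - 1) * `|x| `^ (p - 2)
  | 3 => p * (p - 1) * (p - 2) * (x * `|x| `^ (p - 4))
  | _ => p * (p - 1) * (p - 2) * (p - 3) * `|x| `^ (p - 4)
  end.

Lemma Nd_derive k x : (k < 4)%N -> x != 0 -> is_derive x 1 (Nd k) (Nd k.+1 x).
Proof.
move=> k4 x0; case: k k4 => [|[|[|[|//]]]] _ /=.
- exact: powR_abs_derive.
- have := is_deriveZr p (xpowR_abs_derive (p - 2) x0).
  by rewrite (_ : p - 2 + 1 = p - 1) ?mulrA//; ring.
- have := is_deriveZr (p * (p - 1)) (powR_abs_derive (p - 2) x0).
  have -> : p - 2 - 2 = p - 4 by ring.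
  by rewrite mulrA.
- have := is_deriveZr (p * (p - 1) * (p - 2)) (xpowR_abs_derive (p - 4) x0).
  by rewrite (_ : p - 4 + 1 = p - 3) ?mulrA//; ring.
Qed.

Lemma Nd_bound : exists2 c, 0 <= c & forall k x, (k <= 4)%N -> 1 <= `|x| ->
  `|Nd k x| <= c * wt (k%:R - p) x.
Proof.
(* The coefficients in [Nd] are at most 6 in absolute value, so 24 is ample; replacing |x| by 1 +
   |x| when |x| >= 1 costs at most 2^4. *)
exists (24 * 2 `^ 4); first by rewrite mulr_ge0// powR_ge0.
move=> k x k4 x1; have x0 : 0 < `|x| by rewrite (lt_le_trans ltr01).
have P4 : (1 : R) <= 2 `^ 4 by rewrite -[leLHS](powRr0 2); apply: ler_powR; lra.
have H (d q : R) : 0 <= q -> q <= 4 -> `|d| <= 24 -> `|d * `|x| `^ (- q)| <= 24 * 2 `^ 4 * wt q x.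
  move=> q0 q4 d24; rewrite normrM [`|_ `^ _|]ger0_norm ?powR_ge0// -mulrA.
  apply: ler_pM => //.
  apply: le_trans (powR_le_split q0 x1) _; rewrite ler_wpM2r ?wt_ge0//.
  by apply: ler_powR; lra.
have e1 (q : R) : x * `|x| `^ (q - 1) = Num.sg x * `|x| `^ q.
  rewrite {1}(numEsg x) -mulrA; congr (_ * _).
  rewrite -{1}(powRr1 (normr_ge0 x)) -powRD; last by rewrite (gt_eqF x0) implybT.
  by congr powR; ring.
have sgx : `|Num.sg x| = 1 by rewrite normr_sg -normr_gt0 x0.
have b1 : `|p - 1| <= 1 by rewrite ler_norml; apply/andP; split; move: p0 p1; lra.
have b2 : `|p - 2| <= 2 by rewrite ler_norml; apply/andP; split; move: p0 p1; lra.
have b3 : `|p - 3| <= 3 by rewrite ler_norml; apply/andP; split; move: p0 p1; lra.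
have b0 : `|p| <= 1 by rewrite ger0_norm ltW.
have c1 : `|p * (p - 1)| <= 1 by rewrite normrM -[leRHS]mulr1 ler_pM.
have c2 : `|p * (p - 1) * (p - 2)| <= 2 by rewrite normrM -[leRHS]mul1r ler_pM.
have c3 : `|p * (p - 1) * (p - 2) * (p - 3)| <= 6.
  by rewrite normrM (_ : 6 = 2 * 3) ?ler_pM//; ring.
case: k k4 => [|[|[|[|[|//]]]]] _ /=.
- rewrite ger0_norm ?powR_ge0// sub0r.
  apply: le_trans (powR_lt_wt x (ltW p0)) _.
  rewrite -[leLHS]mul1r ler_wpM2r ?wt_ge0//; lra.
- have -> : p - 2 = (p - 1) - 1 by ring.
  rewrite e1 mulrA -[p - 1]opprB; apply: H; [by rewrite subr_ge0 ltW|by move: p0; lra|].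
  by rewrite normrM sgx mulr1; lra.
- rewrite -[p - 2]opprB; apply: H; move: p0 p1; lra.
- have -> : p - 4 = (p - 3) - 1 by ring.
  rewrite e1 mulrA -[p - 3]opprB; apply: H; [by move: p1; lra|by move: p0; lra|].
  by rewrite normrM sgx mulr1; lra.
- rewrite -[p - 4]opprB; apply: H; move: p0 p1; lra.
Qed.

(** [M] is (1 - chi) N for the cutoff chi. It vanishes near the origin, so the singularity of [Nd]
    is never met, and the Leibniz terms with a derivative on chi have compact support. *)
Lemma smooth_potential : exists (M M1 M2 M3 M4 : R -> R) (c : R), 0 <= c /\
  [/\ forall x, [/\ is_derive x 1 M (M1 x), is_derive x 1 M1 (M2 x),
        is_derive x 1 M2 (M3 x) & is_derive x 1 M3 (M4 x)],
      forall x, `|M2 x| <= c * wt (2 - p) x,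
      forall x, `|M4 x| <= c * wt (4 - p) x,
      vanish 3 (fun x => N x - M x) &
      forall x y, `|M x - M y| <= c * `|x - y| `^ p].
Proof.
have [chi [tchi vchi chi1]] := cutoff.
(* The i-th derivative of 1 - chi. *)
pose a (i : nat) x := (i == 0%N)%:R - chi i x.
have da i x : is_derive x 1 (a i) (a i.+1 x).
  have := is_deriveDr (is_derive_c ((i == 0%N)%:R) x) (is_deriveZr (-1) (tchi i x)).
  rewrite add0r mulN1r /a /= sub0r; apply: is_derive_ext => y; by rewrite mulN1r.
have va i x : `|x| < 1 -> a i x = 0.
  elim: i x => [x x1|i IH x x1]; first by rewrite /a chi1 ?subrr// ltW.
  have h : is_derive x 1 (a i) 0.
    apply: (@is_derive_near _ (fun=> 0)).
    have : continuous (fun y : R => `|y|) by move=> ?; exact: norm_continuous.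
    move=> /(_ x) /cvgrPdist_lt /(_ (1 - `|x|)); rewrite subr_gt0 => /(_ x1).
    apply: filterS => y; rewrite ltr_norml => /andP[h _]; rewrite IH//; lra.
  have := @derive_val _ _ _ _ _ _ _ h.
  by rewrite (@derive_val _ _ _ _ _ _ _ (da i x)).
have ba i : exists2 c, 0 <= c & forall x, `|a i x| <= c * wt i%:R x.
  have i0 : 0 <= i%:R :> R by [].
  have [c c0 hc] := vanish_wt i0 (@tower_cont R chi i tchi) (tower_vanish i tchi vchi).
  exists (c + (i == 0%N)%:R) => [|x]; first exact: addr_ge0.
  rewrite /a; apply: le_trans (ler_normB _ _) _; rewrite addrC mulrDl lerD//.
  by case: i {i0 hc} => [|i]; rewrite /= ?normr0 ?mul0r// mul1r normr1 /wt oppr0 powRr0.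
have [cN cN0 hN] := Nd_bound.
pose t (i k : nat) x := a i x * Nd k x.
have dt i k x : (k < 4)%N -> is_derive x 1 (t i k) (t i.+1 k x + t i k.+1 x).
  move=> k4; have [x1|x1] := ltP `|x| 1.
    rewrite /t !va// !mul0r addr0; apply: (@is_derive_near _ (fun=> 0)).
    have : continuous (fun y : R => `|y|) by move=> ?; exact: norm_continuous.
    move=> /(_ x) /cvgrPdist_lt /(_ (1 - `|x|)); rewrite subr_gt0 => /(_ x1).
    apply: filterS => y; rewrite ltr_norml => /andP[h _]; rewrite va ?mul0r//; lra.
  have xn : x != 0 by rewrite -normr_gt0 (lt_le_trans ltr01).
  exact: (is_deriveMr (da i x) (Nd_derive k4 xn)).
have bt i k : (k <= 4)%N -> exists2 c, 0 <= c & forall x, `|t i k x| <= c * wt ((i + k)%:R - p) x.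
  move=> k4; have [c c0 hc] := ba i.
  exists (c * cN) => [|x]; first exact: mulr_ge0.
  have [x1|x1] := ltP `|x| 1.
    by rewrite /t va// mul0r normr0 !mulr_ge0// wt_ge0.
  rewrite /t normrM; apply: le_trans (ler_pM _ _ (hc x) (hN k x k4 x1)) _ => //.
  rewrite mulrACA wtM natrD.
  by have -> : i%:R + (k%:R - p) = i%:R + k%:R - p by ring.
pose M1 x := t 1%N 0%N x + t 0%N 1%N x.
pose M2 x := t 2%N 0%N x + (2 * t 1%N 1%N x + t 0%N 2%N x).
pose M3 x := t 3%N 0%N x + (3 * t 2%N 1%N x + (3 * t 1%N 2%N x + t 0%N 3%N x)).
pose M4 x := t 4%N 0%N x + (4 * t 3%N 1%N x + (6 * t 2%N 2%N x + (4 * t 1%N 3%N x + t 0%N 4%N x))).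
have d0 x : is_derive x 1 (t 0%N 0%N) (M1 x) by exact: dt.
have d1 x : is_derive x 1 M1 (M2 x).
  have := is_deriveDr (dt 1%N 0%N x isT) (dt 0%N 1%N x isT).
  by congr is_derive; rewrite /M2; ring.
have d2 x : is_derive x 1 M2 (M3 x).
  have := is_deriveDr (dt 2%N 0%N x isT) (is_deriveDr (is_deriveZr 2 (dt 1%N 1%N x isT)) (dt 0%N 2%N x isT)).
  by congr is_derive; rewrite /M3; ring.
have d3 x : is_derive x 1 M3 (M4 x).
  have := is_deriveDr (dt 3%N 0%N x isT) (is_deriveDr (is_deriveZr 3 (dt 2%N 1%N x isT))
    (is_deriveDr (is_deriveZr 3 (dt 1%N 2%N x isT)) (dt 0%N 3%N x isT))).
  by congr is_derive; rewrite /M4; ring.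
have b2 : exists2 c, 0 <= c & forall x, `|M2 x| <= c * wt (2 - p) x.
  have [c1 c10 h1] := bt 2%N 0%N isT; have [c2 c20 h2] := bt 1%N 1%N isT.
  have [c3 c30 h3] := bt 0%N 2%N isT.
  exists (c1 + 2 * c2 + c3) => [|x]; first by rewrite !addr_ge0 ?mulr_ge0.
  rewrite /M2; apply: le_trans (ler_normD _ _) _.
  apply: le_trans (lerD (lexx _) (ler_normD _ _)) _; rewrite [`|2 * _|]normrM (ger0_norm (ler0n R 2)).
  by have := h1 x; have := h2 x; have := h3 x; rewrite !addn0 !add0n addn1; lra.
have b4 : exists2 c, 0 <= c & forall x, `|M4 x| <= c * wt (4 - p) x.
  have [c1 c10 h1] := bt 4%N 0%N isT; have [c2 c20 h2] := bt 3%N 1%N isT.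
  have [c3 c30 h3] := bt 2%N 2%N isT; have [c4 c40 h4] := bt 1%N 3%N isT.
  have [c5 c50 h5] := bt 0%N 4%N isT.
  exists (c1 + 4 * c2 + 6 * c3 + 4 * c4 + c5) => [|x]; first by rewrite !addr_ge0 ?mulr_ge0.
  rewrite /M4; apply: le_trans (ler_normD _ _) _.
  apply: le_trans (lerD (lexx _) (ler_normD _ _)) _.
  apply: le_trans (lerD (lexx _) (lerD (lexx _) (ler_normD _ _))) _.
  apply: le_trans (lerD (lexx _) (lerD (lexx _) (lerD (lexx _) (ler_normD _ _)))) _.
  rewrite [`|4 * t 3%N _ _|]normrM [`|6 * _|]normrM [`|4 * t 1%N _ _|]normrM (ger0_norm (ler0n R 4)) (ger0_norm (ler0n R 6)).
  have := h1 x; have := h2 x; have := h3 x; have := h4 x; have := h5 x.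
  by rewrite (_ : (3 + 1 = 4)%N)// (_ : (2 + 2 = 4)%N)// (_ : (1 + 3 = 4)%N)//; lra.
have [c2 c20 h2] := b2; have [c4 c40 h4] := b4.
have vNM : vanish 3 (fun x => N x - t 0%N 0%N x).
  by move=> x x3; rewrite /t /a /= vchi// subr0 mul1r subrr.
pose e x := N x - t 0%N 0%N x.
have eE x : e x = chi 0%N x * N x by rewrite /e /t /a /Nker /=; ring.
have holder_chi : exists2 c, 0 <= c & forall x y, `|e x - e y| <= c * `|x - y| `^ p.
  have [k0 k00 hk0] := vanish_bounded (@tower_cont R chi 0 tchi) vchi.
  have [k1 k10 hk1] := vanish_bounded (@tower_cont R chi 1 tchi) (tower_vanish 1 tchi vchi).
  pose K := k0 + (k1 + 2 * k0) * 3 `^ p.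
  have chiH x y : `|chi 0%N x - chi 0%N y| <= (k1 + 2 * k0) * `|x - y| `^ p.
    have [xy|xy] := leP `|x - y| 1.
      have : `|chi 0%N x - chi 0%N y| <= k1 * `|x - y|.
        wlog le : x y xy / x <= y => [H|].
          have [|/ltW] := leP x y; first exact: H.
          by rewrite distrC [`|x - y|]distrC; apply: H; rewrite distrC.
        rewrite distrC; apply: le_trans (mvt_le le (fun z _ => tchi 0%N z) (fun z _ => hk1 z)) _.
        by rewrite distrC ger0_norm ?subr_ge0.
      have xp : `|x - y| <= `|x - y| `^ p.
        have [->|n0] := eqVneq (x - y) 0; first by rewrite normr0 powR_ge0.
        by apply: ger1_powR; [rewrite normr_gt0 n0 xy|exact: ltW].
      have := ler_wpM2l k10 xp; have : 0 <= k0 * `|x - y| `^ p by rewrite mulr_ge0// powR_ge0.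
      by lra.
    have xp : 1 <= `|x - y| `^ p.
      by rewrite -[leLHS](powRr0 `|x - y|); apply: ler_powR; exact: ltW.
    apply: le_trans (ler_normB _ _) _.
    have := hk0 x; have := hk0 y; have := ler_wpM2l k00 xp.
    have k1x : 0 <= k1 * `|x - y| `^ p by rewrite mulr_ge0// powR_ge0.
    lra.
  have c3 : 0 <= 3 `^ p :> R by exact: powR_ge0.
  have k12 : 0 <= k1 + 2 * k0 by rewrite addr_ge0 ?mulr_ge0.
  (* In the product rule only N y appears without a difference, so it is enough that y lies in
     [-3, 3]; the case of x follows by symmetry. *)
  have main x y : `|y| <= 3 -> `|e x - e y| <= K * `|x - y| `^ p.
    move=> y3; rewrite !eE.
    have -> : chi 0%N x * N x - chi 0%N y * N y = chi 0%N x * (N x - N y) + (chi 0%N x - chi 0%N y) * N y by ring.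
    apply: le_trans (ler_normD _ _) _; rewrite !normrM (ger0_norm (Nker_ge0 p y)).
    have q1 := ler_pM (normr_ge0 _) (normr_ge0 _) (hk0 x) (Nker_dist hp x y).
    have Ny : N y <= 3 `^ p by apply: le_powRr; [exact: ltW | rewrite normr_ge0].
    have q2 := ler_pM (normr_ge0 _) (Nker_ge0 p y) (chiH x y) Ny.
    apply: le_trans (lerD q1 q2) _.
    by rewrite le_eqVlt; apply/orP; left; apply/eqP; rewrite /K; ring.
  exists K => [|x y]; first by rewrite addr_ge0// mulr_ge0.
  have [y3|y3] := leP `|y| 3; first exact: main.
  have [x3|x3] := leP `|x| 3; first by rewrite distrC [`|x - y|]distrC; exact: main.
  by rewrite !eE !vchi// !mul0r subrr normr0 mulr_ge0 ?powR_ge0// addr_ge0// mulr_ge0.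
have [ce ce0 he] := holder_chi.
exists (t 0%N 0%N), M1, M2, M3, M4, (c2 + c4 + (1 + ce)); split.
  by rewrite !addr_ge0.
split => // [x|x|x y].
- by apply: le_trans (h2 x) _; rewrite ler_wpM2r ?wt_ge0//; lra.
- by apply: le_trans (h4 x) _; rewrite ler_wpM2r ?wt_ge0//; lra.
have -> : t 0%N 0%N x - t 0%N 0%N y = (N x - N y) - (e x - e y) by rewrite /e; ring.
apply: le_trans (ler_normB _ _) _.
apply: le_trans (lerD (Nker_dist hp x y) (he x y)) _.
rewrite -[X in X + _]mul1r -mulrDl ler_wpM2r ?powR_ge0//; lra.
Qed.

End SmoothPotential.

(** * Test functions whose image is almost a second difference *)

Section Liouville.
Context {R : realType}.
Local Notation mu := (@lebesgue_measure R).
Implicit Types (f g F W phi rho theta h : R -> R) (a b c r x y z : R).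

(** Peetre's inequality, from 1 + |x| <= (1 + l) (1 + |y|). *)
Lemma wt_shift r l x y : 0 <= r -> `|x - y| <= l -> wt r y <= (1 + l) `^ r * wt r x.
Proof.
move=> r0 xy; have l0 : 0 <= l by exact: le_trans (normr_ge0 _) xy.
have l1 : 0 < 1 + l by rewrite ltr_wpDr.
have y1 : 0 < 1 + `|y| by rewrite ltr_wpDr.
have x1 : 0 < 1 + `|x| by rewrite ltr_wpDr.
have -> : wt r y = (1 + l) `^ r * ((1 + l) * (1 + `|y|)) `^ (- r).
  rewrite powRM ?(ltW l1) ?(ltW y1)// mulrA -powRD; last by rewrite (gt_eqF l1) implybT.
  by rewrite subrr powRr0 mul1r.
apply: ler_wpM2l; first exact: powR_ge0.
apply: le_powRN => //; rewrite x1 /=.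
have : `|x| <= `|x - y| + `|y| by apply: le_trans (ler_normD _ _); rewrite subrK.
have : 0 <= l * `|y| by exact: mulr_ge0.
lra.
Qed.

Lemma test_sdiff rho b : test_fun rho ->
  test_fun (fun x => rho (x + b) + rho (x - b) - 2 * rho x).
Proof.
move=> /test_tower[F [l [tF F0 vF]]]; rewrite -F0 in vF *.
have tG : tower (fun n x => F n (x + b) + F n (x - b) - 2 * F n x).
  move=> n x.
  have h1 : is_derive (1 * x + b) 1 (F n) (F n.+1 (x + b)) by rewrite mul1r; exact: tF.
  have h2 : is_derive (1 * x - b) 1 (F n) (F n.+1 (x - b)) by rewrite mul1r; exact: tF.
  have := is_deriveDr (is_deriveDr (is_derive_affine h1) (is_derive_affine h2)) (is_deriveZr (-2) (tF n x)).
  rewrite !mul1r mulNr; apply: is_derive_ext => y; by rewrite mul1r mulNr.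
apply: (@tower_test R (fun n x => F n (x + b) + F n (x - b) - 2 * F n x) (l + `|b|)) => // x lx.
have h1 : `|x| <= `|x + b| + `|b|.
  by apply: le_trans (ler_normB _ _); rewrite addrK.
have h2 : `|x| <= `|x - b| + `|b| by apply: le_trans (ler_normD _ _); rewrite subrK.
have b0 : 0 <= `|b| by [].
have e1 : F 0%N (x + b) = 0 by apply: vF; lra.
have e2 : F 0%N (x - b) = 0 by apply: vF; lra.
have e3 : F 0%N x = 0 by apply: vF; lra.
by rewrite e1 e2 e3 addr0 mulr0 subr0.
Qed.

Lemma test_affine rho a b : a != 0 -> test_fun rho -> test_fun (fun x => rho (a * x + b)).
Proof.
move=> a0 /test_tower[F [l [tF F0 vF]]]; rewrite -F0 in vF *.
have tG : tower (fun n x => a ^+ n * F n (a * x + b)).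
  move=> n x; have := is_deriveZr (a ^+ n) (is_derive_affine (tF n (a * x + b))).
  by rewrite mulrA -exprSr.
have -> : (fun x => F 0%N (a * x + b)) = (fun x => a ^+ 0 * F 0%N (a * x + b)).
  by apply/funext => x; rewrite expr0 mul1r.
apply: (@tower_test R (fun n x => a ^+ n * F n (a * x + b)) ((l + `|b|) / `|a|)) => // x.
rewrite ltr_pdivrMr ?normr_gt0// => lx; rewrite vF ?mulr0//.
have : `|a * x| <= `|a * x + b| + `|b| by apply: le_trans (ler_normB _ _); rewrite addrK.
by rewrite normrM mulrC; lra.
Qed.

Variable s : R.
Hypothesis hs : 2^-1 < s < 1.
Local Notation p := (pp s).
Let hp := pp01 hs.
Let p0 : 0 < p. Proof. by case/andP: hp. Qed.
Let p1 : p < 1. Proof. by case/andP: hp. Qed.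

Local Notation N := (Nker p).
Local Notation D := (Dop p).
Local Notation L := (Lop p).

(** The factor 32 is 2 from [sdiff_le] times 16 = (1 + 1)^4 from shifting weights of exponent at
    most 4 by at most 1. The gain tau^2 is the point of the estimate. *)
Lemma sdiff_nice (M M1 M2 M3 M4 : R -> R) c (tau : R) : 0 <= c -> 0 <= tau <= 1 ->
  (forall x, [/\ is_derive x 1 M (M1 x), is_derive x 1 M1 (M2 x),
        is_derive x 1 M2 (M3 x) & is_derive x 1 M3 (M4 x)]) ->
  (forall x, `|M2 x| <= c * wt (2 - p) x) -> (forall x, `|M4 x| <= c * wt (4 - p) x) ->
  nice p (c * 32 * tau ^+ 2) (fun x => M (x + tau) + M (x - tau) - 2 * M x).
Proof.
move=> c0 /andP[t0 t1] dM b2 b4.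
have dS f f1 x : (forall y, is_derive y 1 f (f1 y)) ->
    is_derive x 1 (fun x => f (x + tau) + f (x - tau) - 2 * f x) (f1 (x + tau) + f1 (x - tau) - 2 * f1 x).
  move=> df.
  have h1 : is_derive (1 * x + tau) 1 f (f1 (x + tau)) by rewrite mul1r; exact: df.
  have h2 : is_derive (1 * x - tau) 1 f (f1 (x - tau)) by rewrite mul1r; exact: df.
  have := is_deriveDr (is_deriveDr (is_derive_affine h1) (is_derive_affine h2)) (is_deriveZr (-2) (df x)).
  rewrite !mul1r mulNr; apply: is_derive_ext => y; by rewrite mul1r mulNr.
have dM0 y : is_derive y 1 M (M1 y) by have [] := dM y.
have dM1 y : is_derive y 1 M1 (M2 y) by have [] := dM y.
have dM2 y : is_derive y 1 M2 (M3 y) by have [] := dM y.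
have dM3 y : is_derive y 1 M3 (M4 y) by have [] := dM y.
have W (q : R) x y : 0 <= q <= 4 -> x - tau <= y <= x + tau -> wt q y <= 16 * wt q x.
  move=> /andP[q0 q4] /andP[y1 y2].
  have xy : `|x - y| <= 1 by rewrite ler_norml; apply/andP; split; lra.
  apply: le_trans (wt_shift q0 xy) _; apply: ler_wpM2r; first exact: wt_ge0.
  apply: (@le_trans _ _ ((1 + 1) `^ 4)); first by apply: ler_powR => //; lra.
  by rewrite (powR_mulrn 4)//; lra.
have E (q : R) x : 2 * (c * (16 * wt q x)) * tau ^+ 2 = c * 32 * tau ^+ 2 * wt q x by ring.
exists (fun x => M1 (x + tau) + M1 (x - tau) - 2 * M1 x),
  (fun x => M2 (x + tau) + M2 (x - tau) - 2 * M2 x); split.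
- by move=> x; exact: dS.
- by move=> x; exact: dS.
- move=> x; rewrite -E; apply: (sdiff_le t0 (fun y _ => dM0 y) (fun y _ => dM1 y)) => y hy.
  apply: le_trans (b2 y) _; apply: ler_wpM2l => //; apply: W => //.
  by apply/andP; split; move: p0 p1; lra.
- move=> x; rewrite -E; apply: (sdiff_le t0 (fun y _ => dM2 y) (fun y _ => dM3 y)) => y hy.
  apply: le_trans (b4 y) _; apply: ler_wpM2l => //; apply: W => //.
  by apply/andP; split; move: p0 p1; lra.
Qed.

Lemma wt_scale r k x : 0 <= r -> 1 <= k -> wt r (k^-1 * x) <= k `^ r * wt r x.
Proof.
move=> r0 k1; have k0 : 0 < k by rewrite (lt_le_trans ltr01).
have -> : wt r (k^-1 * x) = k `^ r * (k * (1 + `|k^-1 * x|)) `^ (- r).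
  rewrite powRM ?(ltW k0)// mulrA -powRD; last by rewrite (gt_eqF k0) implybT.
  by rewrite subrr powRr0 mul1r.
apply: ler_wpM2l; first exact: powR_ge0.
apply: le_powRN => //; rewrite ltr_wpDr//= normrM gtr0_norm ?invr_gt0//.
by rewrite mulrDr mulr1 mulrA divff ?gt_eqF// mul1r; lra.
Qed.

Lemma DopN e x y : 0 < e -> D e N (x - y) = D e N (y - x).
Proof.
move=> e0; rewrite !(Dop_N_scale hp _ e0) -[in RHS]opprB mulrN.
by rewrite (gfunN hp).
Qed.

(* the test function (N - M_k) * psi, where M_k = k^p M(x/k) removes the growth
   of the kernel N at scale k *)
Lemma liouville_test rho b : 0 <= b -> test_fun rho -> exists2 C, 0 <= C &
  forall k, 1 + b <= k -> exists phi, test_fun phi /\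
    forall x, `|L phi x - Gc p * (rho (x + b) + rho (x - b) - 2 * rho x)| <=
      C * k `^ (- (1 - p)) * wt (p + 2) x.
Proof.
move=> b0 trho.
have [F [l [tF F0 vF]]] := test_tower trho.
have [M [M1 [M2 [M3 [M4 [c [c0 [dM b2 b4 vM hM]]]]]]]] := smooth_potential hp.
have [C0 HC0] := nice_bound hp.
have irho : intg (fun y => `|rho y|).
  have [d d0 nr] := test_nice hs trho; exact/intg_norm/(nice_intg hp nr).
have q2 : 0 <= p + 2 by move: p0; lra.
set I := \int[mu]_y `|rho y|.
have I0 : 0 <= I by exact: I_ge0.
pose K := `|C0| * (c * 32 * b ^+ 2).
have K0 : 0 <= K by rewrite !mulr_ge0 ?sqr_ge0.
exists (K * (1 + `|l|) `^ (p + 2) * I); first by rewrite !mulr_ge0 ?powR_ge0.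
move=> k kb; have k1 : 1 <= k by lra. have k0 : 0 < k by lra.
have kn := lt0r_neq0 k0.
pose tau := k^-1 * b.
have t01 : 0 <= tau <= 1.
  rewrite /tau mulr_ge0 ?invr_ge0 ?(ltW k0)//=.
  by rewrite mulrC ler_pdivrMr// mul1r; lra.
pose Ft x := M (x + tau) + M (x - tau) - 2 * M x.
have nFt : nice p (c * 32 * tau ^+ 2) Ft by exact: (sdiff_nice c0 t01 dM b2 b4).
have ct0 : 0 <= c * 32 * tau ^+ 2 by rewrite mulr_ge0 ?sqr_ge0// mulr_ge0.
have iFt := nice_intg hp nFt.
have [bFt _] := HC0 _ _ ct0 nFt.
(* N is homogeneous of degree p, so this copy agrees with N for |x| > 3 k. *)
pose Mk x := k `^ p * M (k^-1 * x).
have Nk x : N x = k `^ p * N (k^-1 * x).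
  rewrite NkerM mulrA {2}/Nker gtr0_norm ?invr_gt0// -powRM ?invr_ge0 ?(ltW k0)//.
  by rewrite mulfV// powR1 mul1r.
have kp0 : 0 <= k `^ p by exact: powR_ge0.
have hMk x y : `|Mk x - Mk y| <= c * `|x - y| `^ p.
  rewrite /Mk -mulrBr normrM (ger0_norm kp0).
  apply: le_trans (ler_wpM2l kp0 (hM _ _)) _.
  rewrite mulrCA -mulrBr -/(N (k^-1 * (x - y))) -Nk.
  by [].
pose Nkk x := N x - Mk x.
have hNk x y : `|Nkk x - Nkk y| <= (1 + c) * `|x - y| `^ p.
  have -> : Nkk x - Nkk y = (N x - N y) - (Mk x - Mk y) by rewrite /Nkk; ring.
  apply: le_trans (ler_normB _ _) _; rewrite mulrDl mul1r; apply: lerD => //.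
  exact: Nker_dist.
have vNk : vanish (3 * k) Nkk.
  move=> x x3; rewrite /Nkk Nk /Mk -mulrBr vM ?mulr0// normrM gtr0_norm ?invr_gt0//.
  by rewrite ltr_pdivlMl// mulrC.
have cNk : continuous Nkk by exact: (hold_cont p0 hNk).
have iNk : intg Nkk.
  have [d d0 hd] := vanish_wt (ler0n R 2) cNk vNk.
  have w2 : intg (wt (2 : R)) by apply: intg_wt; lra.
  have mNk : measurable_fun setT Nkk by exact: continuous_measurable_fun.
  exact: (intg_le mNk hd (intgZ d w2)).
pose psi0 x := rho (x + b) + rho (x - b) - 2 * rho x.
have tpsi : test_fun psi0 by exact: test_sdiff.
pose phi x := \int[mu]_y (psi0 (x - y) * Nkk y).
have tphi : test_fun phi by exact: (conv_test iNk vNk tpsi).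
exists phi; split => // x.
have [d d0 nphi] := test_nice hs tphi.
have [bpsi bpsi0 hbpsi] := test_bounded tpsi.
have ipsi : intg psi0 by have [dd _ nr] := test_nice hs tpsi; exact: (nice_intg hp nr).
have cM e : 0 < e -> continuous (D e Mk) by move=> e0; exact: (Dop_cont hp hMk e0).
have cN e : 0 < e -> continuous (D e N).
  by move=> e0; apply: (Dop_cont hp (c := 1) _ e0) => u v; rewrite mul1r; exact: Nker_dist.
have csub (f : R -> R) u : continuous f -> continuous (fun y => f (u - y)).
  move=> cf y; apply: (@continuous_comp _ _ _ (fun y => u - y) f); last exact: cf.
  by apply: continuousB; [exact: cvg_cst|exact: cvg_id].
have phiE u : phi u = \int[mu]_y (Nkk (u - y) * psi0 y).
  have ii : intg (fun y => psi0 (u - y) * Nkk y).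
    have mp : measurable_fun setT psi0 by exact: intg_meas ipsi.
    have mps : measurable_fun setT (fun y => psi0 (u - y)) by apply: (mfcomp mp); mfun.
    exact: (intgMb iNk mps (fun y => hbpsi (u - y))).
  rewrite /phi -(I_refl u ii); apply: eq_I => y; by rewrite subKr mulrC.
have iNpsi u : intg (fun y => Nkk (u - y) * psi0 y) by exact: (test_intgM tpsi (csub _ u cNk)).
(* The part with N tends to Gc [psi0] by [gfun_approx]; the part with M_k is the error to be
   estimated. *)
have DphiE e : 0 < e -> D e phi x =
    \int[mu]_y (psi0 y * D e N (y - x)) - \int[mu]_y (D e Mk (x - y) * psi0 y).
  move=> e0; have -> : phi = (fun u => \int[mu]_y (Nkk (u - y) * psi0 y)).
    by apply/funext.
  rewrite (Dop_conv hp x e0 hNk ipsi iNpsi).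
  have i1 : intg (fun y => D e N (x - y) * psi0 y) by exact: (test_intgM tpsi (csub _ x (cN e e0))).
  have i2 : intg (fun y => D e Mk (x - y) * psi0 y) by exact: (test_intgM tpsi (csub _ x (cM e e0))).
  transitivity (\int[mu]_y (D e N (x - y) * psi0 y - D e Mk (x - y) * psi0 y)).
    apply: eq_I => y; rewrite -mulrBl; congr (_ * _).
    have hN u v : `|N u - N v| <= 1 * `|u - v| `^ p by rewrite mul1r; exact: Nker_dist.
    rewrite /Dop -(IB (Dop_intg hp hN (x - y) e0) (Dop_intg hp hMk (x - y) e0)).
    by apply: eq_I => t; rewrite /Nkk; ring.
  rewrite (IB i1 i2); congr (_ - _); apply: eq_I => y; by rewrite (DopN x y e0) mulrC.
(* A second difference of M_k at step b is k^p times one of M at step tau = b / k. The powers of k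
   are p from the amplitude, -(p + 1) from scaling the operator, -2 from tau^2 and p + 2 from
   scaling the weight: p - 1 in total. *)
have Qdiff e u : 0 < e -> `|D e Mk (u + b) + D e Mk (u - b) - 2 * D e Mk u| <= K * k `^ (- (1 - p)) * wt (p + 2) u.
  move=> e0.
  have j1 := Dop_intg hp hMk (u + b) e0; have j2 := Dop_intg hp hMk (u - b) e0.
  have j3 := Dop_intg hp hMk u e0.
  have ke0 : 0 < k^-1 * e by rewrite mulr_gt0 ?invr_gt0.
  have jt := Dop_intgL hp (k^-1 * u) ke0 iFt.
  have -> : D e Mk (u + b) + D e Mk (u - b) - 2 * D e Mk u = k `^ p * D e (fun y => Ft (k^-1 * y)) u.
    rewrite /Dop -(IZ 2 j3) -(ID j1 j2) -(IB (intgD j1 j2) (intgZ 2 j3)).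
    have jf : intg (fun t => (Ft (k^-1 * u) - Ft (k^-1 * (u + t))) * ker p e t).
      apply: eq_intg (intgZ (k `^ (- p)) (intgB (intgD j1 j2) (intgZ 2 j3))) => t.
      have kpn : k `^ p != 0 by rewrite gt_eqF// powR_gt0.
      rewrite powRN /Ft /Mk.
      have -> : k^-1 * (u + b) = k^-1 * u + tau by rewrite /tau; ring.
      have -> : k^-1 * (u - b) = k^-1 * u - tau by rewrite /tau; ring.
      have -> : k^-1 * (u + b + t) = k^-1 * (u + t) + tau by rewrite /tau; ring.
      have -> : k^-1 * (u - b + t) = k^-1 * (u + t) - tau by rewrite /tau; ring.
      by move: (M _) (M _) (M _) (M _) (M _) (M _) (k `^ p) kpn => *; field.
    rewrite -(IZ _ jf); apply: eq_I => t.
    rewrite /Ft /Mk.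
    have -> : k^-1 * (u + b) = k^-1 * u + tau by rewrite /tau; ring.
    have -> : k^-1 * (u - b) = k^-1 * u - tau by rewrite /tau; ring.
    have -> : k^-1 * (u + b + t) = k^-1 * (u + t) + tau by rewrite /tau; ring.
    have -> : k^-1 * (u - b + t) = k^-1 * (u + t) - tau by rewrite /tau; ring.
    by ring.
  rewrite (Dop_scale (x := u) k0 jt) mulrA -powRD; last by rewrite kn implybT.
  have -> : p + - (p + 1) = -1 by ring.
  rewrite powR_inv1 ?(ltW k0)// normrM gtr0_norm ?invr_gt0//.
  apply: le_trans (ler_wpM2l _ (bFt _ (k^-1 * u) ke0)) _; first by rewrite invr_ge0 ltW.
  apply: (@le_trans _ _ (k^-1 * (`|C0| * (c * 32 * tau ^+ 2) * (k `^ (p + 2) * wt (p + 2) u)))).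
    apply: ler_wpM2l; first by rewrite invr_ge0 ltW.
    apply: ler_pM; [|exact: wt_ge0| |exact: wt_scale].
      have := bFt 1 0 ltr01; have := wt_gt0 (p + 2) (0 : R).
      set w := wt _ _ => w0 hh; have : 0 <= C0 * (c * 32 * tau ^+ 2) * w by exact: le_trans hh.
      by rewrite pmulr_lge0.
    by apply: ler_wpM2r => //; exact: ler_norm.
  rewrite le_eqVlt; apply/orP; left; apply/eqP.
  have -> : k `^ (- (1 - p)) = k `^ (p + 2) * k^-1 ^+ 3.
    rewrite exprVn -(powR_mulrn 3 (ltW k0)) -powRN -powRD; last by rewrite kn implybT.
    by congr powR; ring.
  by rewrite /K /tau; ring.
(* Summation by parts moves the second difference from [rho] to the operator applied to M_k, where
   [Qdiff] applies. *)
have Jbound e : 0 < e -> `|\int[mu]_y (D e Mk (x - y) * psi0 y)| <=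
    K * (1 + `|l|) `^ (p + 2) * I * k `^ (- (1 - p)) * wt (p + 2) x.
  move=> e0; pose Q := D e Mk; have cQ : continuous Q := cM e e0.
  have t1 : test_fun (fun y => rho (1 * y + b)) by exact: (test_affine b (oner_neq0 R) trho).
  have t2 : test_fun (fun y => rho (1 * y - b)) by exact: (test_affine (- b) (oner_neq0 R) trho).
  have i1 : intg (fun y => Q (x - y) * rho (y + b)).
    by apply: eq_intg (test_intgM t1 (csub _ x cQ)) => y; rewrite mul1r.
  have i2 : intg (fun y => Q (x - y) * rho (y - b)).
    by apply: eq_intg (test_intgM t2 (csub _ x cQ)) => y; rewrite mul1r.
  have i3 : intg (fun y => Q (x - y) * rho y) by exact: (test_intgM trho (csub _ x cQ)).
  have i4 : intg (fun y => Q (x + b - y) * rho y) by exact: (test_intgM trho (csub _ _ cQ)).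
  have i5 : intg (fun y => Q (x - b - y) * rho y) by exact: (test_intgM trho (csub _ _ cQ)).
  have E1 : \int[mu]_y (Q (x - y) * rho (y + b)) = \int[mu]_y (Q (x + b - y) * rho y).
    rewrite -(I_shift (- b) i1); apply: eq_I => y; rewrite subrK; congr (Q _ * _); ring.
  have E2 : \int[mu]_y (Q (x - y) * rho (y - b)) = \int[mu]_y (Q (x - b - y) * rho y).
    rewrite -(I_shift b i2); apply: eq_I => y; rewrite addrK; congr (Q _ * _); ring.
  have -> : \int[mu]_y (D e Mk (x - y) * psi0 y) =
      \int[mu]_y ((Q (x - y + b) + Q (x - y - b) - 2 * Q (x - y)) * rho y).
    transitivity (\int[mu]_y (Q (x - y) * rho (y + b) + Q (x - y) * rho (y - b) - 2 * (Q (x - y) * rho y))).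
      by apply: eq_I => y; rewrite /psi0 -/Q; ring.
    rewrite (IB (intgD i1 i2) (intgZ 2 i3)) (ID i1 i2) E1 E2 -(ID i4 i5) -(IB (intgD i4 i5) (intgZ 2 i3)).
    apply: eq_I => y.
    have -> : x + b - y = x - y + b by ring.
    have -> : x - b - y = x - y - b by ring.
    by ring.
  pose B := K * k `^ (- (1 - p)) * ((1 + `|l|) `^ (p + 2) * wt (p + 2) x).
  have -> : K * (1 + `|l|) `^ (p + 2) * I * k `^ (- (1 - p)) * wt (p + 2) x = B * I.
    by rewrite /B; ring.
  rewrite -(IZ B irho).
  have Kk : 0 <= K * k `^ (- (1 - p)) by rewrite mulr_ge0 ?powR_ge0.
  have bd y : `|(Q (x - y + b) + Q (x - y - b) - 2 * Q (x - y)) * rho y| <= B * `|rho y|.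
    have [yl|yl] := leP `|y| `|l|; last first.
      by rewrite (vF y (le_lt_trans (ler_norm l) yl)) mulr0 normr0 mulr0.
    rewrite normrM ler_wpM2r//; apply: le_trans (Qdiff e (x - y) e0) _.
    rewrite /B; apply: ler_wpM2l => //; apply: wt_shift => //.
    by rewrite subKr.
  apply: (I_norm_le _ (intgZ B irho) bd).
  apply: (intg_le _ bd (intgZ B irho)).
  have mQ : measurable_fun setT Q by exact: continuous_measurable_fun.
  have mr : measurable_fun setT rho by apply: continuous_measurable_fun; exact: test_cont.
  by mfun; apply: (mfcomp mQ); mfun.
have cv1 := gfun_approx (z := x) hp (test_cont tpsi) hbpsi.
have cv2 := Dop_L_cvg (x := x) hs d0 nphi.
have cv3 : `|D (en n) phi x - \int[mu]_y (psi0 y * D (en n) N (y - x))| @[n --> \oo] --> `|L phi x - Gc p * psi0 x|.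
  by apply: cvg_norm; exact: (cvgB cv2 cv1).
have Eps : Gc p * (rho (x + b) + rho (x - b) - 2 * rho x) = Gc p * psi0 x by [].
rewrite Eps; apply: (lim_le cv3) => n /=.
have -> : (D (en n) phi x - \int[mu]_y (psi0 y * D (en n) N (y - x))) = - \int[mu]_y (D (en n) Mk (x - y) * psi0 y).
  by rewrite (DphiE _ (en_gt0 n)); ring.
by rewrite normrN; exact: (Jbound _ (en_gt0 n)).
Qed.

End Liouville.

(** * Local integrability and Lebesgue points *)

Section LebesguePoints.
Context {R : realType}.
Local Notation mu := (@lebesgue_measure R).
Implicit Types (f g F phi rho h : R -> R) (a b c r x y z : R).

Lemma locally_integrableP h : measurable_fun setT h ->
  (forall M : R, intg (fun x => if `|x| <= M then h x else 0)) -> locally_integrable setT h.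
Proof.
move=> mh hM; split => //; first exact: openT.
move=> K _ cK; have [M [_ hMK]] := compact_bounded cK.
have KM x : K x -> `|x| <= M + 1 by move=> Kx; apply: (hMK (M + 1)) => //; rewrite ltrDl.
have mK : measurable K by exact: compact_measurable.
have /integrableP[_] := hM (M + 1); apply: le_lt_trans.
rewrite [leLHS]integral_mkcond; apply: ge0_le_integral => //.
- by move=> x _; rewrite patchE; case: ifP.
- apply/(measurable_restrictT _ _).1 => //; apply/measurable_EFinP.
  by apply: measurableT_comp => //; apply: measurable_funTS.
- by apply: measurableT_comp => //; apply/measurable_EFinP; exact: intg_meas (hM (M + 1)).
- move=> x _ /=; rewrite patchE; case: ifPn => [xK|_]; last by rewrite lee_fin.
  by rewrite KM// -in_setE.
Qed.

Lemma intg_locally h a b : locally_integrable setT h ->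
  intg (fun x => if a <= x <= b then h x else 0).
Proof.
move=> [mh _ hK].
have mg : measurable_fun setT (fun x => if a <= x <= b then h x else 0).
  by apply: mfif => //; mfun.
apply/integrableP; split; first exact/measurable_EFinP.
have fin := hK _ (@subsetT _ _) (@segment_compact _ a b).
apply: le_lt_trans fin.
rewrite [leRHS]integral_mkcond; apply: ge0_le_integral => //.
- by apply: measurableT_comp => //; exact/measurable_EFinP.
- apply/(measurable_restrictT _ _).1 => //; apply/measurable_EFinP.
  by apply: measurableT_comp => //; apply: measurable_funTS.
- move=> x _ /=; rewrite patchE mem_setE in_itv/=; case: ifP => //= _.
  by rewrite normr0.
Qed.

Lemma intg_avg h x (e : R) : locally_integrable setT h ->
  intg (fun y => if `|y - x| < e then `|h y - h x| else 0).
Proof.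
move=> lh; have mh : measurable_fun setT h by case: lh.
have i1 : intg (fun y => if x - e <= y <= x + e then h y else 0) by exact: intg_locally.
have i2 : intg (fun y => if x - e <= y <= x + e then (fun=> h x) y else 0).
  by apply: (@intg_itv R _ _ `|h x|) => // y _.
have := intg_norm (intgB i1 i2); apply: intg_le; first by apply: mfif; mfun.
move=> y; case: ifPn => [yx|_]; last by rewrite normr0.
have -> : x - e <= y <= x + e.
  by move: yx; rewrite ltr_norml => /andP[? ?]; apply/andP; split; lra.
by rewrite normr_id.
Qed.

Lemma cvg_bound (u v : nat -> R) (l : R) : (forall n, `|u n - l| <= v n) ->
  v n @[n --> \oo] --> (0 : R) -> u n @[n --> \oo] --> l.
Proof.
move=> uv v0; apply/cvgrPdist_lt => e e0.
have /cvgrPdist_lt/(_ e e0)[k _ hk] := v0; exists k => // n kn.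
rewrite distrC; apply: le_lt_trans (uv n) _.
by have := hk n kn; rewrite /= sub0r normrN; apply: le_lt_trans; exact: ler_norm.
Qed.

Lemma cvgZ0 (u : nat -> R) a : u n @[n --> \oo] --> (0 : R) -> a * u n @[n --> \oo] --> (0 : R).
Proof. by move=> h; rewrite -(mulr0 a); exact: cvgMl_tmp. Qed.

(** Lebesgue differentiation along the radii [en n]. The ball has length 2 [en n]; the factor 2 is
    removed at the end. *)
Lemma lebesgue_avg h : locally_integrable setT h ->
  {ae mu, forall x, (en n)^-1 * \int[mu]_y (if `|y - x| < en n then `|h y - h x| else 0)
     @[n --> \oo] --> (0 : R)}.
Proof.
move=> lh; have mh : measurable_fun setT h by case: lh.
apply: ae_sub (lebesgue_differentiation lh) => x lx.
have cv : davg h x (en n) @[n --> \oo] --> 0%E.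
  apply: (cvg_comp en (davg h x) _ lx) => A [e /= e0 eA].
  have /cvgrPdist_lt/(_ e e0)[k _ hk] := @en_cvg R.
  by exists k => // n kn; apply: eA; [exact: hk n kn|exact: en_gt0].
have E n : davg h x (en n) =
    (2^-1 * ((en n)^-1 * \int[mu]_y (if `|y - x| < en n then `|h y - h x| else 0)))%:E.
  have e0 : 0 < en n :> R := en_gt0 n.
  have ii : intg (fun y => if `|y - x| < en n then `|h y - h x| else 0).
    exact: intg_avg.
  rewrite /davg /iavg lebesgue_measure_ball ?(ltW e0)//.
  rewrite mulrA EFinM (EFin_I ii) inver mulrn_eq0/= gt_eqF//=.
  have -> : (en n *+ 2)^-1 = 2^-1 / en n :> R by rewrite -mulr_natr; field; rewrite gt_eqF.
  congr (_ * _)%E.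
  rewrite integral_mkcond; apply: eq_integral => y _ /=.
  rewrite patchE; have [xy|xy] := ltP `|y - x| (en n).
    by rewrite mem_set//= /ball/= /ball_/= distrC.
  by rewrite memNset// /ball/= /ball_/= distrC => /lt_geF; rewrite xy.
have cv2 : 2^-1 * ((en n)^-1 * \int[mu]_y (if `|y - x| < en n then `|h y - h x| else 0))
     @[n --> \oo] --> (0 : R).
  have /fine_cvgP[_] : davg h x (en n) @[n --> \oo] --> (0 : R)%:E by exact: cv.
  by apply: cvg_trans; apply: near_eq_cvg; apply: nearW => n /=; rewrite E.
have := cvgZ0 2 cv2; apply: cvg_trans; apply: near_eq_cvg; apply: nearW => n /=.
by rewrite mulVKf.
Qed.

End LebesguePoints.

(** * Functions annihilated by the operator are affine *)

Section Liouville2.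
Context {R : realType}.
Local Notation mu := (@lebesgue_measure R).
Implicit Types (f g F phi rho h A : R -> R) (a b c r x y z : R).

(** Cauchy's functional equation: after subtraction of the affine interpolant at 0 and 1 the rest is
    additive and vanishes on the integers, hence is bounded by its values on [0, 1]; a bounded
    additive function is zero. *)
Lemma midpoint_affine A c : (forall x b, 0 <= b -> A (x + b) + A (x - b) = 2 * A x) ->
  (forall x, `|x| <= 1 -> `|A x| <= c) -> forall x, A x = A 0 + (A 1 - A 0) * x.
Proof.
move=> mid bd.
have mid2 x y : A x + A y = A (x + y) + A 0.
  have h (u v : R) : u <= v -> A u + A v = 2 * A ((u + v) / 2).
    move=> uv; rewrite -(mid _ ((v - u) / 2)); last by rewrite divr_ge0 ?subr_ge0.
    by rewrite addrC; congr (A _ + A _); field.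
  have h' (u v : R) : A u + A v = 2 * A ((u + v) / 2).
    by have [uv|/ltW uv] := leP u v; [exact: h|rewrite addrC (h _ _ uv) (addrC u)].
  by rewrite h' (h' (x + y)) addr0.
pose B x := A x - A 0 - (A 1 - A 0) * x.
have BD x y : B (x + y) = B x + B y by rewrite /B; have := mid2 x y; lra.
have B0 : B 0 = 0 by rewrite /B; ring.
have B1 : B 1 = 0 by rewrite /B; ring.
have BN x : B (- x) = - B x by have := BD x (- x); rewrite subrr B0; lra.
have Bn x n : B (x *+ n) = B x *+ n.
  by elim: n => [|n IH]; rewrite ?mulr0n ?B0// !mulrS BD IH.
have Bz x (k : int) : B (x + k%:~R) = B x.
  have Bn1 n : B n%:R = 0 by rewrite Bn B1 mul0rn.
  case: k => n; first by rewrite BD Bn1 addr0.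
  by rewrite NegzE mulrNz BD BN Bn1 oppr0 addr0.
have c0 : 0 <= c by apply: le_trans (bd 0 _); rewrite ?normr0.
have Bbd x : `|B x| <= 4 * c.
  rewrite -(subrK (Num.floor x)%:~R x) Bz; set y := x - _.
  have /andP[y0 y1] : 0 <= y <= 1.
    have := floor_itv x; rewrite intrD => /andP[z1 z2]; rewrite /y; apply/andP; split; move: z1 z2; rewrite mulr1z; lra.
  have a0 := bd 0; rewrite normr0 ler01 in a0; have {}a0 := a0 isT.
  have a1 := bd 1; rewrite normr1 lexx in a1; have {}a1 := a1 isT.
  have ay := bd y; rewrite ger0_norm// y1 in ay; have {}ay := ay isT.
  move: a0 a1 ay; rewrite /B !ler_norml => /andP[q1 q2] /andP[q3 q4] /andP[q5 q6].
  by apply/andP; split; nra.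
have BE x : B x = 0.
  have [//|n0] := eqVneq (B x) 0.
  have nb : 0 < `|B x| by rewrite normr_gt0.
  have := Bbd (x *+ (Num.truncn (4 * c / `|B x|)).+1).
  rewrite Bn normrMn -mulr_natl leNgt => /negP[].
  by rewrite -[`|B x| *+ _]mulr_natl -ltr_pdivrMr// truncnS_gt.
by move=> x; have := BE x; rewrite /B; lra.
Qed.

Lemma ae_point (P : R -> Prop) a b : a < b -> {ae mu, forall x, P x} ->
  exists x, a <= x <= b /\ P x.
Proof.
move=> ab [N [mN N0 sub]]; apply: contrapT => nex.
have : `[a, b]%classic `<=` N.
  move=> x; rewrite /= in_itv/= => xab; apply: sub => Px; apply: nex; by exists x.
move=> /(le_measure mu (mem_set (measurable_itv _)) (mem_set mN)) H.
have {H} : (mu `[a, b]%classic <= 0)%E by rewrite -N0; exact: H.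
rewrite lebesgue_measure_itv/= lte_fin ab -EFinB lee_fin leNgt subr_gt0 ab => /negP; exact.
Qed.

Variable s : R.
Hypothesis hs : 2^-1 < s < 1.
Local Notation p := (pp s).
Let hp := pp01 hs.
Let p0 : 0 < p. Proof. by case/andP: hp. Qed.
Let p1 : p < 1. Proof. by case/andP: hp. Qed.
Local Notation L := (Lop p).

Lemma test_wt phi r : test_fun phi -> 0 <= r -> exists2 c, 0 <= c & forall x, `|phi x| <= c * wt r x.
Proof.
move=> tphi r0; have [F [l [tF F0 vF]]] := test_tower tphi; rewrite -F0 in vF *.
exact: vanish_wt r0 (tower_cont tF) vF.
Qed.

Variable h : R -> R.
Hypothesis mh : measurable_fun setT h.
Hypothesis ih : intg (fun x => `|h x| * wt (p + 2) x).
Hypothesis hh : forall phi, test_fun phi -> \int[mu]_x (h x * L phi x) = 0.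
Let q0 : 0 <= p + 2. Proof. by move: p0; lra. Qed.

Lemma intg_wtd f c : measurable_fun setT f -> (forall x, `|f x| <= c * wt (p + 2) x) ->
  intg (fun x => h x * f x).
Proof.
move=> mf hf; have b x : `|h x * f x| <= c * (`|h x| * wt (p + 2) x).
  by rewrite normrM mulrCA; apply: ler_wpM2l.
have m : measurable_fun setT (fun x => h x * f x) by mfun.
exact: intg_le m b (intgZ c ih).
Qed.

(** The pairing of [h] with L phi is zero for the test function phi of each scale k, and it differs
    from Gc times the integral in question by O(k^(p - 1)); [Gc] is nonzero. *)
Lemma sdiff_test0 rho b : 0 <= b -> test_fun rho ->
  \int[mu]_x (h x * (rho (x + b) + rho (x - b) - 2 * rho x)) = 0.
Proof.
move=> b0 trho; have [C C0 HC] := liouville_test hs b0 trho.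
pose psi x := rho (x + b) + rho (x - b) - 2 * rho x.
have tpsi : test_fun psi by exact: test_sdiff.
have mpsi : measurable_fun setT psi by apply: continuous_measurable_fun; exact: test_cont.
have [d d0 hd] := test_wt tpsi q0.
have ipsi : intg (fun x => h x * psi x) := intg_wtd mpsi hd.
pose J := \int[mu]_x (`|h x| * wt (p + 2) x).
have G0 : Gc p < 0 by exact: Gc_lt0.
have bnd n : `|Gc p * \int[mu]_x (h x * psi x)| <= (C * J) * (b + n.+1%:R) `^ (- (1 - p)).
  have [|phi [tphi hphi]] := HC (b + n.+1%:R).
    by rewrite addrC lerD2l ler1n.
  have [e e0 nphi] := test_nice hs tphi.
  have [d' d'0 [hd' _]] := Lop_bound hs e0 nphi.
  have mL := Lop_meas hs e0 nphi.
  have iL : intg (fun x => h x * L phi x) := intg_wtd mL hd'.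
  have dif x : `|h x * L phi x - Gc p * (h x * psi x)| <= C * (b + n.+1%:R) `^ (- (1 - p)) * (`|h x| * wt (p + 2) x).
    have -> : h x * L phi x - Gc p * (h x * psi x) = h x * (L phi x - Gc p * psi x) by ring.
    by rewrite normrM mulrCA; apply: ler_wpM2l.
  have -> : Gc p * \int[mu]_x (h x * psi x) = - \int[mu]_x (h x * L phi x - Gc p * (h x * psi x)).
    by rewrite (IB iL (intgZ (Gc p) ipsi)) (IZ _ ipsi) (hh tphi) sub0r opprK.
  rewrite normrN; apply: le_trans (I_norm_le (intgB iL (intgZ (Gc p) ipsi)) (intgZ _ ih) dif) _.
  by rewrite (IZ _ ih) -/J mulrAC.
have cv : (C * J) * (n.+1%:R) `^ (- (1 - p)) @[n --> \oo] --> (C * J) * 0.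
  by apply: cvgMl_tmp; apply: en_powN_cvg; apply/andP; split; move: p0 p1; lra.
have J0 : 0 <= J by apply: I_ge0 => x; rewrite mulr_ge0 ?wt_ge0.
have := lim_ge cv (b := `|Gc p * \int[mu]_x (h x * psi x)|); rewrite mulr0 normr_le0 mulf_eq0.
rewrite (lt_eqF G0)/= => H; apply/eqP; apply: H => n.
apply: le_trans (bnd n) _; apply: ler_wpM2l; first exact: mulr_ge0.
apply: le_powRN; first by move: p1; lra.
by rewrite ltr0n/= lerDr.
Qed.

(** A second difference of the mollification in y is the pairing of [h] with a second difference of
    a translate of [rho], so [sdiff_test0] is the midpoint equation. *)
Lemma mollify_affine rho : test_fun rho ->
  exists a b, forall y, \int[mu]_x (h x * rho (y - x)) = a + b * y.
Proof.
move=> trho; pose A y := \int[mu]_x (h x * rho (y - x)).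
have mrho : measurable_fun setT rho by apply: continuous_measurable_fun; exact: test_cont.
have tr y : test_fun (fun x => rho (y - x)).
  have m1 : -1 != 0 :> R by rewrite oppr_eq0 oner_eq0.
  have := test_affine y m1 trho; congr test_fun; apply/funext => x.
  by rewrite mulN1r addrC.
have mr y : measurable_fun setT (fun x => rho (y - x)).
  by apply: continuous_measurable_fun; exact: test_cont (tr y).
have ir y : intg (fun x => h x * rho (y - x)).
  have [d d0 hd] := test_wt (tr y) q0; exact: intg_wtd (mr y) hd.
have [d d0 hd] := test_wt trho q0.
pose J := \int[mu]_x (`|h x| * wt (p + 2) x).
exists (A 0), (A 1 - A 0); apply: (@midpoint_affine A (d * (1 + 1) `^ (p + 2) * J)) => [y b b0|y y1].
  apply/eqP; rewrite -subr_eq0; apply/eqP; rewrite -[RHS](sdiff_test0 b0 (tr y)).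
  rewrite /A -(IZ 2 (ir y)) -(ID (ir (y + b)) (ir (y - b))) -(IB (intgD (ir (y + b)) (ir (y - b))) (intgZ 2 (ir y))).
  apply: eq_I => x.
  have -> : y - (x + b) = y - b - x by ring.
  have -> : y - (x - b) = y + b - x by ring.
  by ring.
rewrite /J -(IZ _ ih); apply: (I_norm_le (ir y) (intgZ _ ih)) => x.
rewrite normrM mulrCA; apply: ler_wpM2l => //.
apply: le_trans (hd _) _; rewrite -mulrA; apply: ler_wpM2l => //.
have -> : wt (p + 2) (y - x) = wt (p + 2) (x - y) by rewrite /wt distrC.
 apply: wt_shift => //.
by rewrite subKr.
Qed.

Lemma intg_loc_wtd M : intg (fun x => if `|x| <= M then h x else 0).
Proof.
have c0 : 0 <= (1 + `|M|) `^ (p + 2) by exact: powR_ge0.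
apply: intg_le (intgZ ((1 + `|M|) `^ (p + 2)) ih); first by apply: mfif => //; mfun.
move=> x; case: ifPn => xM.
  rewrite mulrCA ler_peMr//.
  apply: le_trans (@wt_shift _ (p + 2) `|M| x 0 q0 _); last by rewrite subr0 (le_trans xM)// ler_norm.
  by rewrite /wt normr0 addr0 powR1.
rewrite normr0; apply: mulr_ge0; first exact: c0.
by apply: mulr_ge0; [exact: normr_ge0|exact: wt_ge0].
Qed.

(** Mollifications of [h] at scale [dn n] are affine and converge to [h] at every Lebesgue point. *)
Lemma liouville : exists a b, {ae mu, forall x, h x = a + b * x}.
Proof.
have lh : locally_integrable setT h := locally_integrableP mh intg_loc_wtd.
pose Z := \int[mu]_x bump x.
have tb : test_fun (@bump R) by exact: bump_test.
have ib : intg (@bump R) by have [d d0 nb] := test_nice hs tb; exact: (nice_intg hp nb).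
have Z0 : 0 < Z by exact: (I_gt0 (x := 0) (test_cont tb) ib (@bump_ge0 R) (@bump0_gt0 R)).
have [c c0 hc] := test_bounded tb.
(* Half the radius of the averages, so that the mollifier vanishes wherever |x - y| >= [en n]
   although [bump_vanish] is stated beyond 1 only. *)
pose dn n : R := en n / 2.
have dn0 n : 0 < dn n by rewrite divr_gt0 ?en_gt0.
pose rho n x := (Z * dn n)^-1 * bump ((dn n)^-1 * x).
have trho n : test_fun (rho n).
  have en0 : (dn n)^-1 != 0 :> R by rewrite invr_eq0 gt_eqF.
  have [F [l [tF F0 vF]]] := test_tower (test_affine 0 en0 tb).
  have tG : tower (fun k x => (Z * dn n)^-1 * F k x).
    by move=> k x; exact: is_deriveZr (tF k x).
  have -> : rho n = (fun x => (Z * dn n)^-1 * F 0%N x).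
    by apply/funext => x; rewrite F0 addr0.
  apply: (@tower_test R (fun k x => (Z * dn n)^-1 * F k x) l) => // x lx.
  by rewrite F0 (vF x lx) mulr0.
have irho n : intg (rho n) by have [d d0 nb] := test_nice hs (trho n); exact: (nice_intg hp nb).
have Irho n : \int[mu]_x rho n x = 1.
  have en0 : (dn n)^-1 != 0 :> R by rewrite invr_eq0 gt_eqF.
  have ib2 : intg (fun x => bump ((dn n)^-1 * x)).
    by apply: eq_intg (intg_affine 0 en0 ib) => x; rewrite addr0.
  rewrite (IZ _ ib2).
  have E : Z = (dn n)^-1 * \int[mu]_x bump ((dn n)^-1 * x).
    rewrite /Z (I_affine 0 en0 ib) gtr0_norm; last by rewrite invr_gt0; exact: dn0.
    congr (_ * _).
    by apply: eq_I => x; rewrite addr0.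
  have -> : \int[mu]_x bump ((dn n)^-1 * x) = Z * dn n.
    by rewrite E mulrAC mulVf ?mul1r// gt_eqF.
  by rewrite mulVf// gt_eqF// mulr_gt0.
pose A n y := \int[mu]_x (h x * rho n (y - x)).
have key : {ae mu, forall y, A n y @[n --> \oo] --> h y}.
  apply: ae_sub (lebesgue_avg lh) => y ly.
  have cv : 2 * Z^-1 * c * ((en n)^-1 * \int[mu]_x (if `|x - y| < en n then `|h x - h y| else 0)) @[n --> \oo] --> (0 : R).
    exact: cvgZ0 ly.
  apply: (cvg_bound _ cv) => n.
  have e0 : 0 < en n :> R := en_gt0 n.
  have bd x : `|(h x - h y) * rho n (y - x)| <=
      2 * Z^-1 * c * (en n)^-1 * (if `|x - y| < en n then `|h x - h y| else 0).
    case: ifPn => [xy|].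
      rewrite normrM mulrC; apply: ler_wpM2r => //.
      have zd : 0 <= (Z * dn n)^-1 by rewrite invr_ge0 mulr_ge0// ltW.
      rewrite /rho normrM (ger0_norm zd).
      have := ler_wpM2l zd (hc ((dn n)^-1 * (y - x))).
      have -> : (Z * dn n)^-1 * c = 2 / Z * c / en n.
        by rewrite /dn; field; rewrite gt_eqF//= gt_eqF.
      by [].
    rewrite -leNgt distrC => xy; rewrite /rho bump_vanish ?mulr0 ?normr0//.
    rewrite normrM gtr0_norm ?invr_gt0// ltr_pdivlMl// mulr1 /dn.
    by apply: lt_le_trans xy; move: e0; lra.
  have im : intg (fun x => (2 * Z^-1 * c * (en n)^-1) * (if `|x - y| < en n then `|h x - h y| else 0)).
    exact/intgZ/intg_avg.
  have mr : measurable_fun setT (rho n) by apply: continuous_measurable_fun; exact: test_cont.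
  have mF : measurable_fun setT (fun x => (h x - h y) * rho n (y - x)).
    have m2 : measurable_fun setT (fun x => rho n (y - x)) by apply: (mfcomp mr); mfun.
    by mfun.
  have iF := intg_le mF bd im.
  have i3 : intg (fun x => rho n (y - x)) by exact: intg_refl.
  have E : A n y - h y = \int[mu]_x ((h x - h y) * rho n (y - x)).
    have iA : intg (fun x => h x * rho n (y - x)).
      by apply: eq_intg (intgD iF (intgZ (h y) i3)) => x; ring.
    have I3 : \int[mu]_x rho n (y - x) = 1 by rewrite (I_refl y (irho n)).
    rewrite -[X in _ - X]mulr1 -I3 -(IZ _ i3) /A -(IB iA (intgZ (h y) i3)).
    by apply: eq_I => x; ring.
  rewrite E; apply: le_trans (I_norm_le iF im bd) _.
  have i5 : intg (fun x => if `|x - y| < en n then `|h x - h y| else 0).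
    exact: intg_avg.
  by rewrite (IZ _ i5) mulrA.
(* Lebesgue points taken from disjoint intervals are distinct. Affine functions that converge at two
   points converge everywhere, to the affine function through the two limits. *)
have [x1 [/andP[x1a x1b] c1]] := ae_point (ltr01 : (0 : R) < 1) key.
have [x2 [/andP[x2a x2b] c2]] := ae_point (ltac:(lra) : (2 : R) < 3) key.
pose b := (h x2 - h x1) / (x2 - x1).
exists (h x1 - b * x1), b; apply: ae_sub key => y cy.
apply: (lim_uniq cy).
have x12 : x2 - x1 != 0 by rewrite gt_eqF// subr_gt0; lra.
have E n : A n y = A n x1 + (A n x2 - A n x1) * ((y - x1) / (x2 - x1)).
  have [a' [b' hab]] := mollify_affine (trho n).
  by rewrite /A !hab; field.
have -> : h x1 - b * x1 + b * y = h x1 + (h x2 - h x1) * ((y - x1) / (x2 - x1)).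
  by rewrite /b; field.
rewrite (funext E); apply: cvgD => //; apply: cvgM; last exact: cvg_cst.
exact: cvgB.
Qed.

End Liouville2.

(** * The integral equation *)

Section Potential.
Context {R : realType}.
Local Notation mu := (@lebesgue_measure R).
Implicit Types (f g F phi rho h u : R -> R) (a b c r x y z : R).

Lemma cont_ae_eq f g : continuous f -> continuous g ->
  {ae mu, forall x, f x = g x} -> f =1 g.
Proof.
move=> cf cg fg x; apply: contrapT => nx.
have n0 : f x - g x != 0 by rewrite subr_eq0; apply/eqP.
have cfg : {for x, continuous (fun y => f y - g y)} by apply: continuousB; [exact: cf|exact: cg].
have np : 0 < `|f x - g x| by rewrite normr_gt0.
have /cvgrPdist_lt/(_ _ np)[d /= d0 hd] := cfg.
have xd : x < x + d / 2 by rewrite ltrDl divr_gt0.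
have [y [/andP[xy yd] Ey]] := ae_point xd fg.
have /(hd y)/= : `|x - y| < d.
  by rewrite ler0_norm ?subr_le0// opprB; move: yd d0; lra.
by rewrite Ey subrr subr0 ltxx.
Qed.

Lemma cvg_shift_nat (u : nat -> R) (l : R) k : u n @[n --> \oo] --> l ->
  u (n + k)%N @[n --> \oo] --> l.
Proof. by move=> h; rewrite (cvg_shiftn k u (nbhs l)). Qed.

Lemma powR_ge1 x a : 0 <= a -> 1 <= x -> 1 <= x `^ a.
Proof.
move=> a0 x1; have : 1 `^ a <= x `^ a by apply: le_powRr => //; rewrite ler01.
by rewrite powR1.
Qed.

Variable s : R.
Hypothesis hs : 2^-1 < s < 1.
Local Notation p := (pp s).
Let hp := pp01 hs.
Let p0 : 0 < p. Proof. by case/andP: hp. Qed.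
Let p1 : p < 1. Proof. by case/andP: hp. Qed.
Local Notation N := (Nker p).
Local Notation L := (Lop p).

(** Subtracting N y bounds the kernel by N x, so the potential exists for every integrable [f]
    without any moment; it is normalised to vanish at 0. *)
Definition Pot f x := \int[mu]_y ((N (x - y) - N y) * f y).

Lemma Ndiff_le x y : `|N (x - y) - N y| <= N x.
Proof. by have := Nker_dist hp (x - y) (- y); rewrite NkerN opprK subrK. Qed.

Lemma Ndiff_meas x : measurable_fun setT (fun y => N (x - y) - N y).
Proof. by rewrite /Nker; mfun. Qed.

Lemma pot_intg f x : intg f -> intg (fun y => (N (x - y) - N y) * f y).
Proof. by move=> fi; exact: (intgMb fi (Ndiff_meas x) (Ndiff_le x)). Qed.

Lemma pot_dist f x x' : intg f -> `|Pot f x - Pot f x'| <= (\int[mu]_y `|f y|) * `|x - x'| `^ p.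
Proof.
move=> fi; have i1 := pot_intg x fi; have i2 := pot_intg x' fi; have i3 := intg_norm fi.
rewrite /Pot -(IB i1 i2) mulrC -(IZ _ i3).
apply: (I_norm_le (intgB i1 i2) (intgZ _ i3)) => y.
rewrite -mulrBl normrM; apply: ler_wpM2r => //.
have -> : N (x - y) - N y - (N (x' - y) - N y) = N (x - y) - N (x' - y) by ring.
have -> : x - x' = (x - y) - (x' - y) by ring.
exact: Nker_dist.
Qed.

Lemma pot0 f : Pot f 0 = 0.
Proof. by rewrite /Pot -[RHS](I0 (R := R)); apply: eq_I => y; rewrite sub0r NkerN subrr mul0r. Qed.

Lemma pot_le f x : intg f -> `|Pot f x| <= N x * \int[mu]_y `|f y|.
Proof. by move=> fi; have := pot_dist x 0 fi; rewrite pot0 !subr0 mulrC. Qed.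

Lemma pot_cont f : intg f -> continuous (Pot f).
Proof. by move=> fi; apply: (hold_cont p0) => x y; exact: pot_dist fi. Qed.

Lemma pot_even f : intg f -> even_fun f -> even_fun (Pot f).
Proof.
move=> fi ef x; rewrite /Pot -(I_refl 0 (pot_intg (- x) fi)); apply: eq_I => y.
rewrite sub0r ef; have -> : - x - - y = - (x - y) by ring.
by rewrite !NkerN.
Qed.

(** After Fubini the subtracted term N y is killed by [Lop_mean0] and the other is evaluated by
    [fundamental]. *)
Lemma pot_weak f phi : intg f -> test_fun phi ->
  intg (fun x => Pot f x * L phi x) /\
  \int[mu]_x (Pot f x * L phi x) = Gc p * \int[mu]_x (f x * phi x).
Proof.
move=> fi tphi; have mf := intg_meas fi.
have [c c0 nphi] := test_nice hs tphi.
have iL := Lop_intg hs c0 nphi; have mL := Lop_meas hs c0 nphi.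
have iNL0 := intg_norm (NLop_intg hs c0 nphi 0).
pose F x y := L phi x * ((N (x - y) - N y) * f y).
have mF : measurable_fun setT (fun z : R * R => F z.1 z.2).
  have m1 : measurable_fun setT (fun z : R * R => L phi z.1) by apply: (mfcomp mL); exact: measurable_fst.
  have m2 : measurable_fun setT (fun z : R * R => f z.2) by apply: (mfcomp mf); exact: measurable_snd.
  by rewrite /F /Nker; mfun.
have iF x : intg (F x) by apply: intgZ; exact: pot_intg.
pose I := \int[mu]_y `|f y|.
have bF x : \int[mu]_y `|F x y| <= I * `|N (x - 0) * L phi x|.
  rewrite mulrC -(IZ _ (intg_norm fi)); apply: (I_le (intg_norm (iF x)) (intgZ _ (intg_norm fi))) => y.
  rewrite /F !normrM subr0 mulrA [`|N x| * _]mulrC; apply: ler_wpM2r => //; apply: ler_wpM2l => //.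
  by rewrite (ger0_norm (Nker_ge0 p x)); exact: Ndiff_le.
have [_ j1 j2 E] := fub mF iF (intgZ I iNL0) bF.
have E1 x : \int[mu]_y F x y = Pot f x * L phi x by rewrite (IZ _ (pot_intg x fi)) mulrC.
split; first by apply: eq_intg j1 => x; exact: E1.
rewrite -(eq_I E1) E.
have ifp : intg (fun y => f y * phi y).
  have [b b0 hb] := test_bounded tphi.
  have mphi : measurable_fun setT phi by apply: continuous_measurable_fun; exact: test_cont.
  by apply: eq_intg (intgMb fi mphi hb) => x; rewrite mulrC.
rewrite -(IZ _ ifp); apply: eq_I => y.
have i1 := NLop_intg hs c0 nphi y.
transitivity (\int[mu]_x (f y * (N (x - y) * L phi x) - f y * N y * L phi x)).
  by apply: eq_I => x; rewrite /F; ring.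
rewrite (IB (intgZ (f y) i1) (intgZ (f y * N y) iL)) (IZ _ i1) (IZ _ iL) (Lop_mean0 hs tphi) (fundamental hs y tphi).
by ring.
Qed.

(** The normalisation for which -sig [Pot f] solves (-Delta)^s v = f weakly; positive because [Gc]
    is negative. *)
Definition sig : R := - (frac_lap_const s * Gc p)^-1.

Lemma sig_gt0 : 0 < sig.
Proof.
rewrite /sig oppr_gt0 invr_lt0 pmulr_rlt0; [exact: Gc_lt0|exact: frac_const_gt0].
Qed.

(** Compares the weight in [in_Ls] with [wt (p + 2)], in which all estimates are written. *)
Lemma wtL (x : R) : (1 + `|x| `^ (p + 2)) <= 2 * (1 + `|x|) `^ (p + 2) /\
  (1 + `|x|) `^ (p + 2) <= 2 `^ (p + 2) * (1 + `|x| `^ (p + 2)).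
Proof.
have q0 : 0 <= p + 2 by move: p0; lra.
have h1 : 1 <= (1 + `|x|) `^ (p + 2).
  by apply: powR_ge1 => //; rewrite lerDl.
have h2 : `|x| `^ (p + 2) <= (1 + `|x|) `^ (p + 2).
  by apply: le_powRr => //; rewrite normr_ge0/= lerDr.
split; first by lra.
have x0 : 0 <= `|x| `^ (p + 2) by exact: powR_ge0.
have [x1|x1] := leP `|x| 1.
  apply: (@le_trans _ _ (2 `^ (p + 2))).
    by apply: le_powRr => //; rewrite addr_ge0//=; lra.
  by rewrite ler_peMr ?powR_ge0//; lra.
apply: (@le_trans _ _ ((2 * `|x|) `^ (p + 2))).
  by apply: le_powRr => //; rewrite addr_ge0//=; lra.
by rewrite powRM//; apply: ler_wpM2l; [exact: powR_ge0|rewrite lerDr].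
Qed.

Lemma in_LsP u : in_Ls s u -> measurable_fun setT u /\ intg (fun x => `|u x| * wt (p + 2) x).
Proof.
move=> [[mu' _ _] Iu]; split => //.
have E : 1 + 2 * s = p + 2 by rewrite /pp; ring.
rewrite E in Iu.
have d0 x : 0 < 1 + `|x| `^ (p + 2) by rewrite ltr_wpDr ?powR_ge0.
have m1 : measurable_fun setT (fun x => `|u x| / (1 + `|x| `^ (p + 2))).
  apply: mfM; first by mfun.
  have : measurable_fun setT (fun x : R => (1 + `|x| `^ (p + 2)) `^ (-1)) by mfun.
  congr measurable_fun; apply/funext => x.
  by rewrite powR_inv1// ltW.
have p1' x : 0 <= `|u x| / (1 + `|x| `^ (p + 2)) by rewrite divr_ge0// ltW.
have ii := intg_ge0P m1 p1' Iu.
have b x : `| `|u x| * wt (p + 2) x| <= 2 * (`|u x| / (1 + `|x| `^ (p + 2))).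
  rewrite normrM normr_id (ger0_norm (wt_ge0 _ _)) mulrCA; apply: ler_wpM2l => //.
  rewrite /wt powRN; have [h _] := wtL x.
  have w0 : 0 < (1 + `|x|) `^ (p + 2) by rewrite powR_gt0// ltr_wpDr.
  by rewrite ler_pdivlMr// ler_pdivrMl// mulrC.
have m2 : measurable_fun setT (fun x => `|u x| * wt (p + 2) x) by have := @wt_meas R (p + 2) => ?; mfun.
exact: intg_le m2 b (intgZ 2 ii).
Qed.

Lemma in_Ls_of u c : continuous u -> (forall x, `|u x| <= c * wt (- p) x) -> in_Ls s u.
Proof.
move=> cu hu; have mu' : measurable_fun setT u by exact: continuous_measurable_fun.
have c0 : 0 <= c.
  by have := le_trans (normr_ge0 _) (hu 0); rewrite pmulr_lge0// wt_gt0.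
split.
  apply: locally_integrableP => // M.
  have := @intg_itv R (- M) M (c * (1 + `|M|) `^ p) u mu'.
  have E : (fun x => if - M <= x <= M then u x else 0) = (fun x => if `|x| <= M then u x else 0).
    by apply/funext => x; rewrite -ler_norml.
  rewrite E; apply => x; rewrite -ler_norml => xM; apply: le_trans (hu x) _.
  apply: ler_wpM2l => //; rewrite /wt opprK; apply: le_powRr; first exact: ltW.
  by rewrite addr_ge0//= lerD2l (le_trans xM)// ler_norm.
have E : 1 + 2 * s = p + 2 by rewrite /pp; ring.
rewrite E.
have d0 x : 0 < 1 + `|x| `^ (p + 2) by rewrite ltr_wpDr ?powR_ge0.
have m1 : measurable_fun setT (fun x => `|u x| / (1 + `|x| `^ (p + 2))).
  apply: mfM; first by mfun.
  have : measurable_fun setT (fun x : R => (1 + `|x| `^ (p + 2)) `^ (-1)) by mfun.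
  congr measurable_fun; apply/funext => x.
  by rewrite powR_inv1// ltW.
have b x : `| `|u x| / (1 + `|x| `^ (p + 2))| <= c * 2 `^ (p + 2) * wt 2 x.
  rewrite ger0_norm; last by rewrite divr_ge0// ltW.
  have -> : wt 2 x = wt (- p) x * wt (p + 2) x by rewrite wtM; congr wt; ring.
  rewrite [leRHS]mulrACA; apply: ler_pM; [exact: normr_ge0|by rewrite invr_ge0 ltW|exact: hu|].
  rewrite /wt powRN; have [_ h] := wtL x.
  have w0 : 0 < (1 + `|x|) `^ (p + 2) by rewrite powR_gt0// ltr_wpDr.
  by rewrite ler_pdivlMr// ler_pdivrMl// mulrC.
have w2 : intg (wt (2 : R)) by apply: intg_wt; lra.
exact: intg_lty (intg_le m1 b (intgZ _ w2)).
Qed.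

Variable K : R -> R.
Hypothesis K0 : forall x, 0 < K x.
Hypothesis cK : continuous K.
Let mK : measurable_fun setT K. Proof. exact: continuous_measurable_fun. Qed.

(** The sum of [u] and sig [Pot f] is annihilated by L, and the potential grows only like |x|^p, so
    the sum still has the integrability that [liouville] asks for. *)
Lemma representation u : liouville_solution s K u ->
  [/\ measurable_fun setT u, intg (fun x => K x * expR (u x)) &
   exists a b, {ae mu, forall x, u x = a + b * x - sig * Pot (fun x => K x * expR (u x)) x}].
Proof.
move=> [[uLs _ uw] fin]; have [mu' iu] := in_LsP uLs.
set f := fun x => K x * expR (u x).
have mf : measurable_fun setT f by rewrite /f; mfun.
have f0 x : 0 <= f x by rewrite mulr_ge0 ?expR_ge0// ltW.
have fi : intg f by exact: intg_ge0P.
split => //.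
pose h x := u x + sig * Pot f x.
have mP : measurable_fun setT (Pot f) by apply: continuous_measurable_fun; exact: pot_cont.
have mh : measurable_fun setT h by rewrite /h; mfun.
have w2 : intg (wt (2 : R)) by apply: intg_wt; lra.
pose I := \int[mu]_y `|f y|.
have I_0 : 0 <= I by exact: I_ge0.
have bP x : `|Pot f x| * wt (p + 2) x <= I * wt 2 x.
  have -> : wt 2 x = wt (- p) x * wt (p + 2) x by rewrite wtM; congr wt; ring.
  rewrite mulrA; apply: ler_wpM2r; first exact: wt_ge0.
  apply: le_trans (pot_le x fi) _; rewrite mulrC; apply: ler_wpM2l => //.
  by apply: powR_lt_wt; exact: ltW.
have bh x : `| `|h x| * wt (p + 2) x| <= `|u x| * wt (p + 2) x + sig * I * wt 2 x.
  have w0 := wt_ge0 (p + 2) x.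
  rewrite normrM normr_id (ger0_norm w0).
  apply: (@le_trans _ _ ((`|u x| + sig * `|Pot f x|) * wt (p + 2) x)).
    apply: ler_wpM2r => //; apply: le_trans (ler_normD _ _) _.
    by rewrite normrM (gtr0_norm sig_gt0).
  by rewrite mulrDl lerD2l -!mulrA; apply: ler_wpM2l; [exact/ltW/sig_gt0|exact: bP].
have mhw : measurable_fun setT (fun x => `|h x| * wt (p + 2) x).
  by have := @wt_meas R (p + 2) => ?; mfun.
have ih := intg_le mhw bh (intgD iu (intgZ (sig * I) w2)).
have hh phi : test_fun phi -> \int[mu]_x (h x * L phi x) = 0.
  move=> tphi; have [iPL EPL] := pot_weak fi tphi.
  have [c c0 nphi] := test_nice hs tphi.
  have mL := Lop_meas hs c0 nphi.
  have [d d0 [hd _]] := Lop_bound hs c0 nphi.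
  have iuL : intg (fun x => u x * L phi x) := intg_wtd mu' iu mL hd.
  have := uw phi tphi; rewrite -/f.
  have -> : \int[mu]_x (u x * frac_lap s phi x) = frac_lap_const s * \int[mu]_x (u x * L phi x).
    by rewrite -(IZ _ iuL); apply: eq_I => x; rewrite (frac_lapE hs x tphi); ring.
  move=> E; transitivity (\int[mu]_x (u x * L phi x + sig * (Pot f x * L phi x))).
    by apply: eq_I => x; rewrite /h; ring.
  rewrite (ID iuL (intgZ sig iPL)) (IZ _ iPL) EPL -E /sig.
  have C0 := frac_const_gt0 hs; have G0 := Gc_lt0 hp.
  by field; rewrite (gt_eqF C0) (lt_eqF G0).
have [a [b hab]] := liouville hs mh ih hh.
exists a, b; apply: ae_sub hab => x; rewrite /h => <-; by rewrite addrK.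
Qed.

Lemma solution_of_potential u a : continuous u -> intg (fun x => K x * expR (u x)) ->
  (forall x, u x = a - sig * Pot (fun x => K x * expR (u x)) x) -> cont_liouville_solution s K u.
Proof.
set f := fun x => K x * expR (u x).
move=> cu fi uE; split => //; split; last exact: intg_lty.
have f0 x : 0 <= f x by rewrite mulr_ge0 ?expR_ge0// ltW.
have mu' : measurable_fun setT u by exact: continuous_measurable_fun.
pose I := \int[mu]_y `|f y|.
have I_0 : 0 <= I by exact: I_ge0.
have bu x : `|u x| <= (`|a| + sig * I) * wt (- p) x.
  have w1 : 1 <= wt (- p) x.
    by rewrite /wt opprK; apply: powR_ge1; [exact: ltW|rewrite lerDl].
  rewrite uE mulrDl; apply: le_trans (ler_normB _ _) _; apply: lerD; first by rewrite ler_peMr.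
  rewrite normrM (gtr0_norm sig_gt0) -mulrA; apply: ler_wpM2l; first exact/ltW/sig_gt0.
  apply: le_trans (pot_le x fi) _; rewrite mulrC; apply: ler_wpM2l => //.
  by apply: powR_lt_wt; exact: ltW.
split; first exact: in_Ls_of cu bu.
  have ceu : continuous (fun x => expR (u x)).
    by move=> x; apply: (@continuous_comp _ _ _ u expR); [exact: cu|exact: continuous_expR].
  apply: locally_integrableP; first exact: continuous_measurable_fun.
  move=> M; have mE : measurable_fun setT (fun x => expR (u x)) by mfun.
  have := @intg_itv R (- M) M (expR ((`|a| + sig * I) * (1 + `|M|) `^ p)) _ mE.
  have E : (fun x => if - M <= x <= M then expR (u x) else 0) = (fun x => if `|x| <= M then expR (u x) else 0).
    by apply/funext => x; rewrite -ler_norml.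
  rewrite E; apply => x; rewrite -ler_norml => xM.
  rewrite ger0_norm ?expR_ge0// ler_expR; apply: le_trans (ler_norm _) _; apply: le_trans (bu x) _.
  have c0 : 0 <= `|a| + sig * I by rewrite addr_ge0// mulr_ge0//; exact/ltW/sig_gt0.
  apply: ler_wpM2l => //; rewrite /wt opprK; apply: le_powRr; first exact: ltW.
  by rewrite addr_ge0//= lerD2l (le_trans xM)// ler_norm.
move=> phi tphi; rewrite -/f; have [iPL EPL] := pot_weak fi tphi.
have [c c0 nphi] := test_nice hs tphi.
have iL := Lop_intg hs c0 nphi.
have C0 := frac_const_gt0 hs; have G0 := Gc_lt0 hp.
transitivity (frac_lap_const s * \int[mu]_x (a * L phi x - sig * (Pot f x * L phi x))).
  rewrite -(IZ _ (intgB (intgZ a iL) (intgZ sig iPL))).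
  by apply: eq_I => x; rewrite (frac_lapE hs x tphi) uE; ring.
rewrite (IB (intgZ a iL) (intgZ sig iPL)) (IZ _ iL) (IZ _ iPL) EPL (Lop_mean0 hs tphi) /sig.
by field; rewrite (gt_eqF C0) (lt_eqF G0).
Qed.

Lemma cont_representation u : cont_liouville_solution s K u ->
  intg (fun x => K x * expR (u x)) /\
  exists a b, forall x, u x = a + b * x - sig * Pot (fun x => K x * expR (u x)) x.
Proof.
move=> [cu /representation[_ fi [a [b hab]]]]; split => //; exists a, b.
apply: (cont_ae_eq cu _ hab) => x.
apply: cvgB; first by apply: cvgD; [exact: cvg_cst|apply: cvgM; [exact: cvg_cst|exact: cvg_id]].
by apply: cvgM; [exact: cvg_cst|exact: (pot_cont fi)].
Qed.

(** All terms other than b x are O(x^p) along the positive half line, and p < 1. *)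
Lemma slope0 u a b c M f : intg f -> (forall x, u x = a + b * x - sig * Pot f x) ->
  (forall x, M <= x -> `|u x| <= c * N x) -> b = 0.
Proof.
move=> fi uE hu; pose I := \int[mu]_y `|f y|.
have I_0 : 0 <= I by exact: I_ge0.
pose d := `|c| + `|a| + sig * I.
have d0 : 0 <= d by rewrite !addr_ge0// mulr_ge0//; exact/ltW/sig_gt0.
have bd x : 1 <= x -> M <= x -> `|b| * x <= d * x `^ p.
  move=> x1 xM; have x0 : 0 <= x by lra.
  have Nx : N x = x `^ p by rewrite /Nker ger0_norm.
  have N1 : 1 <= x `^ p by apply: powR_ge1 => //; exact: ltW.
  have -> : `|b| * x = `|u x - a + sig * Pot f x|.
    by rewrite uE -{1}(ger0_norm x0) -normrM; congr (`| _ |); ring.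
  apply: le_trans (ler_normD _ _) _; rewrite /d !mulrDl.
  apply: lerD.
    apply: le_trans (ler_normB _ _) _; apply: lerD; last by rewrite ler_peMr.
    apply: le_trans (hu x xM) _; rewrite Nx; apply: ler_wpM2r; [exact: powR_ge0|exact: ler_norm].
  rewrite normrM (gtr0_norm sig_gt0) -mulrA; apply: ler_wpM2l; first exact/ltW/sig_gt0.
  by apply: le_trans (pot_le x fi) _; rewrite Nx mulrC.
apply/eqP; rewrite -normr_le0.
have cv : d * (n.+1%:R) `^ (- (1 - p)) @[n --> \oo] --> (0 : R).
  by apply: cvgZ0; apply: en_powN_cvg; apply/andP; split; move: p0 p1; lra.
apply: (lim_ge (cvg_shift_nat (Num.truncn `|M|) cv)) => n /=.
set x : R := _%:R.
have x1 : 1 <= x by rewrite ler1n.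
have xM : M <= x.
  apply: le_trans (ler_norm _) _; apply: ltW; apply: lt_le_trans (truncnS_gt _) _.
  by rewrite ler_nat ltnS leq_addl.
have x0 : 0 < x by lra.
have := bd x x1 xM; rewrite -ler_pdivlMr// => h; apply: le_trans h _.
have -> : - (1 - p) = p - 1 by ring.
have -> : x `^ (p - 1) = x `^ p / x.
  by rewrite powRD; [rewrite powR_inv1// ltW|rewrite (gt_eqF x0) implybT].
by rewrite mulrA.
Qed.

End Potential.

(** * Conditional negativity of |x|^p *)

Section PositiveDefinite.
Context {R : realType}.
Local Notation mu := (@lebesgue_measure R).
Implicit Types (f g F phi rho h u : R -> R) (a b c r x y z t : R).

Lemma sin_le_id x : `|sin x| <= `|x|.
Proof.
wlog x0 : x / 0 <= x.
  move=> H; have [/H//|/ltW x0] := leP 0 x.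
  by rewrite -normrN -sinN -[leRHS]normrN; apply: H; rewrite oppr_ge0.
have h : `|sin x - sin 0| <= 1 * (x - 0).
  by apply: (mvt_le (df := cos) x0) => y _; exact: cos_max.
by rewrite (ger0_norm x0); move: h; rewrite sin0 !subr0 mul1r.
Qed.

Definition c1 t : R := 1 - cos t.

Lemma c1_ge0 t : 0 <= c1 t. Proof. by rewrite subr_ge0 cos_le1. Qed.

Lemma c1_le2 t : c1 t <= 2.
Proof. by rewrite /c1; have := cos_max t; rewrite ler_norml => /andP[h _]; lra. Qed.

Lemma c1_sqr t : c1 t <= t ^+ 2.
Proof.
have E : c1 t = 2 * sin (t / 2) ^+ 2.
  rewrite /c1 {1}(splitr t) cosD -!expr2 cos2sin2; ring.
have h : sin (t / 2) ^+ 2 <= (t / 2) ^+ 2.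
  rewrite -[leLHS]real_normK ?num_real// -[leRHS]real_normK ?num_real//.
  by rewrite ler_sqr ?nnegrE//; exact: sin_le_id.
rewrite E; have -> : t ^+ 2 = 4 * (t / 2) ^+ 2 by field.
have : 0 <= (t / 2) ^+ 2 by exact: sqr_ge0.
lra.
Qed.

Lemma c1_meas : measurable_fun setT c1.
Proof. by rewrite /c1; mfun. Qed.

Variable p : R.
Hypothesis hp : 0 < p < 1.
Let p0 : 0 < p. Proof. by case/andP: hp. Qed.
Let p1 : p < 1. Proof. by case/andP: hp. Qed.
Local Notation N := (Nker p).

Definition wk t : R := `|t| `^ (- (1 + p)).

Lemma wk_ge0 t : 0 <= wk t. Proof. exact: powR_ge0. Qed.

Lemma wk_meas : measurable_fun setT wk.
Proof. by rewrite /wk; mfun. Qed.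

Lemma wkM a t : wk (a * t) = `|a| `^ (- (1 + p)) * wk t.
Proof. by rewrite /wk normrM powRM. Qed.

Lemma intg_c1wk : intg (fun t => c1 t * wk t).
Proof.
have q1 : 1 < 1 + p by move: p0; lra.
have m : measurable_fun setT (fun t => c1 t * wk t) by have := c1_meas; have := wk_meas => *; mfun.
have b t : `|c1 t * wk t| <= 2 * 2 `^ (1 + p) * wt (1 + p) t.
  rewrite ger0_norm ?mulr_ge0 ?c1_ge0 ?wk_ge0//.
  have q0 : 0 <= 1 + p by lra.
  have [t1|t1] := leP 1 `|t|.
    rewrite -mulrA; apply: ler_pM; [exact: c1_ge0|exact: wk_ge0|exact: c1_le2|].
    exact: powR_le_split.
  have w1 : 1 <= 2 `^ (1 + p) * wt (1 + p) t.
    rewrite /wt powRN.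
    have w0 : 0 < (1 + `|t|) `^ (1 + p) by rewrite powR_gt0// ltr_wpDr.
    rewrite ler_pdivlMr// mul1r; apply: le_powRr => //.
    by rewrite addr_ge0//=; move: t1; lra.
  apply: (@le_trans _ _ 1); last by rewrite -mulrA; lra.
  have [->|t0] := eqVneq t 0.
    by rewrite /wk normr0 powR0 ?mulr0// oppr_eq0 gt_eqF//; lra.
  have at0 : 0 < `|t| by rewrite normr_gt0.
  apply: (@le_trans _ _ (`|t| `^ 2 * wk t)).
    apply: ler_wpM2r; first exact: wk_ge0.
    by rewrite (powR_mulrn 2)// real_normK ?num_real//; exact: c1_sqr.
  rewrite /wk -powRD; last by rewrite (gt_eqF at0) implybT.
  have : `|t| `^ (2 + - (1 + p)) <= 1 `^ (2 + - (1 + p)).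
    by apply: le_powRr; [move: p1; lra|rewrite ltW//= ltW].
  by rewrite powR1.
exact: intg_le m b (intgZ _ (intg_wt q1)).
Qed.

Definition Ic := \int[mu]_t (c1 t * wk t).

Lemma Ic_gt0 : 0 < Ic.
Proof.
pose m := (1 - cos 1) * 2 `^ (- (1 + p)) : R.
have c11 : cos 1 < 1 :> R.
  rewrite -[X in _ < X]cos0 ltr_cos ?ltr01// in_itv/= ?lexx ?pi_ge0//.
  by rewrite ler01/= (le_trans _ (@pi_ge2 R))//; lra.
have m0 : 0 < m by rewrite mulr_gt0 ?subr_gt0// powR_gt0.
apply: (@lt_le_trans _ _ (\int[mu]_t (if 1 <= t <= 2 then m else 0))).
  by rewrite I_itv_cst; [rewrite mulr_gt0//; lra|lra].
have i1 : intg (fun t => if 1 <= t <= 2 then m else 0).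
  by apply: (@intg_itv R 1 2 `|m| (fun=> m)) => // ; exact: mfC.
apply: (I_le i1 intg_c1wk) => t; case: ifPn => [/andP[t1 t2]|_]; last by rewrite mulr_ge0 ?c1_ge0 ?wk_ge0.
apply: ler_pM; [by rewrite subr_ge0 ltW|exact: powR_ge0| |].
  rewrite lerD2l lerN2; move: t1; rewrite le_eqVlt => /predU1P[<-//|t1].
  apply: ltW; rewrite ltr_cos// in_itv/=.
    by rewrite ler01/= (le_trans _ (@pi_ge2 R))//; lra.
  by rewrite (le_trans t2 (@pi_ge2 R)) andbT; lra.
rewrite /wk ger0_norm; last lra.
by apply: le_powRN; [move: p0; lra|apply/andP; split; lra].
Qed.

(** The representation of |x|^p as a positive superposition of the functions 1 - cos (x t), obtained
    by rescaling t; conditional negativity of N rests on it. *)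
Lemma c1wk_scale x : intg (fun t => c1 (x * t) * wk t) /\
  \int[mu]_t (c1 (x * t) * wk t) = Ic * N x.
Proof.
have [->|x0] := eqVneq x 0.
  have E : (fun t => c1 (0 * t) * wk t) = (fun=> 0 : R).
    by apply/funext => t; rewrite mul0r /c1 cos0 subrr mul0r.
  by rewrite E (Nker0 hp) mulr0 I0; split => //; exact: intg0.
have ax : 0 < `|x| by rewrite normr_gt0.
have E t : c1 (x * t) * wk t = `|x| `^ (1 + p) * (c1 (x * t + 0) * wk (x * t + 0)).
  have PP : `|x| `^ (1 + p) * `|x| `^ (- (1 + p)) = 1.
    by rewrite -powRD; [rewrite subrr powRr0|rewrite (gt_eqF ax) implybT].
  rewrite !addr0 wkM.
  transitivity (`|x| `^ (1 + p) * `|x| `^ (- (1 + p)) * (c1 (x * t) * wk t)); last by ring.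
  by rewrite PP mul1r.
have i1 := intg_affine 0 x0 intg_c1wk.
rewrite (funext E); split; first exact: intgZ.
rewrite (IZ _ i1) /Ic (I_affine 0 x0 intg_c1wk) /Nker.
rewrite powRD; last by rewrite (gt_eqF ax) implybT.
by rewrite powRr1//; ring.
Qed.

Lemma intg_NB d x : intg d -> intg (fun y => N y * d y) -> intg (fun y => N (x - y) * d y).
Proof.
move=> i1 i2.
have m : measurable_fun setT (fun y => N (x - y) * d y).
  by have := intg_meas i1 => ?; rewrite /Nker; mfun.
have b y : `|N (x - y) * d y| <= N x * `|d y| + `|N y * d y|.
  rewrite !normrM !(ger0_norm (Nker_ge0 _ _)) -mulrDl; apply: ler_wpM2r => //.
  by rewrite -(NkerN p y); exact: NkerD.
exact: intg_le m b (intgD (intgZ _ (intg_norm i1)) (intg_norm i2)).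
Qed.

Section Form.
Variable d : R -> R.
Hypotheses (id : intg d) (iNd : intg (fun x => N x * d x)) (d0 : \int[mu]_x d x = 0).

Let md : measurable_fun setT d. Proof. exact: intg_meas id. Qed.

(** The sign makes the form nonnegative on densities of integral zero: up to [Ic] it is a weighted
    L^2 norm of the cosine and sine transforms [A] and [B] of [d]. *)
Definition nform : R := - \int[mu]_x (d x * \int[mu]_y (N (x - y) * d y)).

Let A t := \int[mu]_y (cos (y * t) * d y).
Let B t := \int[mu]_y (sin (y * t) * d y).

Let icos t : intg (fun y => cos (y * t) * d y).
Proof. by apply: (intgMb (c := 1) id); [mfun|move=> x; exact: cos_max]. Qed.
Let isin t : intg (fun y => sin (y * t) * d y).
Proof. by apply: (intgMb (c := 1) id); [mfun|move=> x; exact: sin_max]. Qed.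

(** [fub] gives measurability only together with integrability, whereas the transforms are merely
    bounded; they are multiplied by an integrable weight and divided again. *)
Let wt_inv (F : R -> R) : measurable_fun setT (fun t => wt 2 t * F t) -> measurable_fun setT F.
Proof.
move=> mF; have -> : F = (fun t => wt (- 2) t * (wt 2 t * F t)).
  by apply/funext => t; rewrite mulrA wtM addNr /wt oppr0 powRr0 mul1r.
by have := @wt_meas R (- 2) => ?; mfun.
Qed.

Let mtrans (e : R -> R) : measurable_fun setT e -> (forall x, `|e x| <= 1) ->
  measurable_fun setT (fun t => \int[mu]_y (e (y * t) * d y)).
Proof.
move=> me e1; apply: wt_inv.
pose F t y := wt 2 t * (e (y * t) * d y).
have mF : measurable_fun setT (fun z : R * R => F z.1 z.2).
  have m2 : measurable_fun setT (fun z : R * R => e (z.2 * z.1)) by apply: (mfcomp me); mfun.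
  by rewrite /F /wt; mfun.
have ie t : intg (fun y => e (y * t) * d y).
  have mt : measurable_fun setT (fun y => e (y * t)) by apply: (mfcomp me); mfun.
  by apply: (intgMb id mt) => x; exact: e1.
have iF t : intg (F t) by exact: intgZ.
have w2 : intg (wt (2 : R)) by apply: intg_wt; lra.
have bF t : \int[mu]_y `|F t y| <= (\int[mu]_y `|d y|) * wt 2 t.
  rewrite mulrC -(IZ _ (intg_norm id)).
  apply: (I_le (intg_norm (iF t)) (intgZ _ (intg_norm id))) => y.
  rewrite /F normrM (ger0_norm (wt_ge0 _ _)) normrM; apply: ler_wpM2l; first exact: wt_ge0.
  by rewrite ler_piMl.
have [_ j1 _ _] := fub mF iF (intgZ _ w2) bF.
by apply: intg_meas; apply: eq_intg j1 => t; rewrite /F (IZ _ (ie t)).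
Qed.

Let mA : measurable_fun setT A.
Proof. by apply: mtrans => [|x]; [by mfun|exact: cos_max]. Qed.
Let mB : measurable_fun setT B.
Proof. by apply: mtrans => [|x]; [by mfun|exact: sin_max]. Qed.

Let H x t := wk t * (cos (x * t) * A t + sin (x * t) * B t).

(** The addition formula for the cosine; the constant term 1 disappears because [d] has integral
    zero. *)
Let HE x t : \int[mu]_y (d y * (c1 ((x - y) * t) * wk t)) = - H x t.
Proof.
have j1 : intg (fun y => wk t * d y) by exact: intgZ.
have j2 : intg (fun y => wk t * cos (x * t) * (cos (y * t) * d y)) by exact: intgZ.
have j3 : intg (fun y => wk t * sin (x * t) * (sin (y * t) * d y)) by exact: intgZ.
transitivity (\int[mu]_y (wk t * d y - wk t * cos (x * t) * (cos (y * t) * d y) -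
     wk t * sin (x * t) * (sin (y * t) * d y))).
  apply: eq_I => y; have -> : (x - y) * t = x * t - y * t by ring.
  by rewrite /c1 cosB; ring.
rewrite (IB (intgB j1 j2) j3) (IB j1 j2) (IZ _ id) (IZ _ (icos t)) (IZ _ (isin t)) d0 /H -/(A t) -/(B t); ring.
Qed.

Let step1 x : [/\ intg (H x), \int[mu]_t H x t = - (Ic * \int[mu]_y (N (x - y) * d y)) &
  \int[mu]_t `|H x t| <= Ic * \int[mu]_y (N (x - y) * `|d y|)].
Proof.
have iN1 := intg_NB x id iNd.
have iN2 : intg (fun y => N (x - y) * `|d y|).
  by apply: eq_intg (intg_norm iN1) => y; rewrite normrM (ger0_norm (Nker_ge0 _ _)).
(* Applied to [d] for the identity and to |d| for the absolute bound. *)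
have gen (e : R -> R) : intg e -> (forall y, `|e y| = `|d y|) ->
  [/\ {ae mu, forall t, intg (fun y => e y * (c1 ((x - y) * t) * wk t))},
    intg (fun t => \int[mu]_y (e y * (c1 ((x - y) * t) * wk t))) &
   \int[mu]_t (\int[mu]_y (e y * (c1 ((x - y) * t) * wk t))) =
     Ic * \int[mu]_y (N (x - y) * e y)].
  move=> ie ed; have me := intg_meas ie.
  pose F y t := e y * (c1 ((x - y) * t) * wk t).
  have mF : measurable_fun setT (fun z : R * R => F z.1 z.2).
    have m2 : measurable_fun setT (fun z : R * R => e z.1) by apply: (mfcomp me); mfun.
    have m3 : measurable_fun setT (fun z : R * R => wk z.2) by apply: (mfcomp wk_meas); mfun.
    by rewrite /F /c1; mfun.
  have iF y : intg (F y) by apply: intgZ; have [] := c1wk_scale (x - y).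
  have bF y : \int[mu]_t `|F y t| <= Ic * (N (x - y) * `|d y|).
    have [i1 E1] := c1wk_scale (x - y).
    have -> : Ic * (N (x - y) * `|d y|) = `|d y| * (Ic * N (x - y)) by ring.
    rewrite -E1 -(IZ _ i1); apply: (I_le (intg_norm (iF y)) (intgZ _ i1)) => t.
    by rewrite /F normrM ed (ger0_norm (mulr_ge0 (c1_ge0 _) (wk_ge0 _))).
  have [j0 _ j2 j3] := fub mF iF (intgZ Ic iN2) bF.
  split; [exact: j0|exact: j2|rewrite -j3].
  have iN3 : intg (fun y => N (x - y) * e y).
    have mm : measurable_fun setT (fun y => N (x - y) * e y) by rewrite /Nker; mfun.
    apply: (intg_le mm _ iN2) => y.
    by rewrite normrM (ger0_norm (Nker_ge0 _ _)) ed.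
  rewrite -(IZ _ iN3); apply: eq_I => y.
  by have [i1 E1] := c1wk_scale (x - y); rewrite /F (IZ _ i1) E1; ring.
have [_ j2 j3] := gen d id (fun=> erefl).
have [aei j4 j5] := gen _ (intg_norm id) (fun y => normr_id _).
have iH : intg (H x) by apply: eq_intg (intgN j2) => t; rewrite HE opprK.
split; [exact: iH|by rewrite -j3 -(IN j2); apply: eq_I => t; rewrite HE opprK|].
rewrite -j5; apply: (I_le (intg_norm iH) j4) => t.
rewrite -normrN -HE.
have ii : intg (fun y => d y * (c1 ((x - y) * t) * wk t)).
  have mc : measurable_fun setT (fun y => c1 ((x - y) * t) * wk t) by rewrite /c1; mfun.
  apply: eq_intg (intgMb (c := 2 * wk t) id mc _) => y; first by rewrite mulrC.
  rewrite ger0_norm ?mulr_ge0 ?c1_ge0 ?wk_ge0//; apply: ler_wpM2r; [exact: wk_ge0|exact: c1_le2].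
apply: le_trans (I_norm ii) _; rewrite le_eqVlt; apply/orP; left; apply/eqP; apply: eq_I => y.
by rewrite normrM (ger0_norm (mulr_ge0 (c1_ge0 _) (wk_ge0 _))).
Qed.

(** A Parseval identity for the form, by a second use of Fubini. The majorant comes from N (x - y)
    <= N x + N y, which is where the p-th moment of [d] is used. *)
Let step2 : intg (fun t => wk t * (A t ^+ 2 + B t ^+ 2)) /\
  \int[mu]_t (wk t * (A t ^+ 2 + B t ^+ 2)) = Ic * nform.
Proof.
have i1 := intg_norm id.
have iNa : intg (fun y => N y * `|d y|).
  by apply: eq_intg (intg_norm iNd) => y; rewrite normrM (ger0_norm (Nker_ge0 _ _)).
pose I := \int[mu]_y `|d y|; pose M := \int[mu]_y (N y * `|d y|).
pose F x t := d x * H x t.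
have mF : measurable_fun setT (fun z : R * R => F z.1 z.2).
  have m2 : measurable_fun setT (fun z : R * R => d z.1) by apply: (mfcomp md); mfun.
  have m3 : measurable_fun setT (fun z : R * R => wk z.2) by apply: (mfcomp wk_meas); mfun.
  have m4 : measurable_fun setT (fun z : R * R => A z.2) by apply: (mfcomp mA); mfun.
  have m5 : measurable_fun setT (fun z : R * R => B z.2) by apply: (mfcomp mB); mfun.
  by rewrite /F /H; mfun.
have iF x : intg (F x) by apply: intgZ; have [] := step1 x.
have ig : intg (fun x => Ic * (I * (N x * `|d x|) + M * `|d x|)).
  exact: (intgZ Ic (intgD (intgZ I iNa) (intgZ M i1))).
have bF x : \int[mu]_t `|F x t| <= Ic * (I * (N x * `|d x|) + M * `|d x|).
  have [iH _ bH] := step1 x.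
  have -> : \int[mu]_t `|F x t| = `|d x| * \int[mu]_t `|H x t|.
    by rewrite -(IZ _ (intg_norm iH)); apply: eq_I => t; rewrite normrM.
  apply: le_trans (ler_wpM2l (normr_ge0 _) bH) _.
  have -> : Ic * (I * (N x * `|d x|) + M * `|d x|) = `|d x| * (Ic * (N x * I + M)) by ring.
  apply: ler_wpM2l => //; apply: ler_wpM2l; first exact: (ltW Ic_gt0).
  rewrite /I /M -(IZ _ i1) -(ID (intgZ _ i1) iNa).
  apply: (I_le (intg_NB x i1 iNa) (intgD (intgZ _ i1) iNa)) => y.
  by rewrite -mulrDl; apply: ler_wpM2r => //; rewrite -(NkerN p y); exact: NkerD.
have [_ j1 j2 j3] := fub mF iF ig bF.
have E t : \int[mu]_x F x t = wk t * (A t ^+ 2 + B t ^+ 2).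
  have k1 : intg (fun x => wk t * A t * (cos (x * t) * d x)) by exact: intgZ.
  have k2 : intg (fun x => wk t * B t * (sin (x * t) * d x)) by exact: intgZ.
  transitivity (\int[mu]_x (wk t * A t * (cos (x * t) * d x) + wk t * B t * (sin (x * t) * d x))).
    by apply: eq_I => x; rewrite /F /H; ring.
  by rewrite (ID k1 k2) (IZ _ (icos t)) (IZ _ (isin t)) -/(A t) -/(B t); ring.
split; first by apply: eq_intg j2 => t; exact: E.
rewrite -(eq_I E) -j3 /nform mulrN.
have E2 x : \int[mu]_t F x t = - Ic * (d x * \int[mu]_y (N (x - y) * d y)).
  by have [iH EH _] := step1 x; rewrite (IZ _ iH) EH; ring.
have iG : intg (fun x => d x * \int[mu]_y (N (x - y) * d y)).
  apply: eq_intg (intgZ (- Ic^-1) j1) => x; rewrite E2.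
  have I0' := Ic_gt0; by field; rewrite gt_eqF.
by rewrite (eq_I E2) (IZ _ iG); ring.
Qed.

(** Cauchy-Schwarz against the difference of the point masses at x and y, whose own energy is 2 N (x
    - y). The polynomial [q] is the energy of [d] plus tau times that difference, and tau = T / (2 N
    (x - y)) minimises it. *)
Lemma nform_dist x y :
  (\int[mu]_z ((N (x - z) - N (y - z)) * d z)) ^+ 2 <= 2 * N (x - y) * nform.
Proof.
set T := \int[mu]_z _.
have I0' := Ic_gt0.
have TE : T = \int[mu]_z (N (x - z) * d z) - \int[mu]_z (N (y - z) * d z).
  rewrite -(IB (intg_NB x id iNd) (intg_NB y id iNd)); apply: eq_I => z; ring.
have [iAB EAB] := step2.
have [iHx EHx _] := step1 x. have [iHy EHy _] := step1 y.
have [iN EN] := c1wk_scale (x - y).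
have q tau : 0 <= nform - 2 * tau * T + 2 * tau ^+ 2 * N (x - y).
  rewrite -(pmulr_rge0 _ I0').
  have -> : Ic * (nform - 2 * tau * T + 2 * tau ^+ 2 * N (x - y)) =
     \int[mu]_t (wk t * (A t ^+ 2 + B t ^+ 2) + 2 * tau * (H x t - H y t) +
       2 * tau ^+ 2 * (c1 ((x - y) * t) * wk t)).
    rewrite (ID (intgD iAB (intgZ (2 * tau) (intgB iHx iHy))) (intgZ (2 * tau ^+ 2) iN)).
    rewrite (ID iAB (intgZ (2 * tau) (intgB iHx iHy))) (IZ _ (intgB iHx iHy)) (IB iHx iHy).
    rewrite EAB EHx EHy (IZ _ iN) EN TE.
    by move: nform (\int[mu]_z (N (x - z) * d z)) (\int[mu]_z (N (y - z) * d z)) (N (x - y)) Ic => *; ring.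
  apply: I_ge0 => t.
  have -> : wk t * (A t ^+ 2 + B t ^+ 2) + 2 * tau * (H x t - H y t) +
       2 * tau ^+ 2 * (c1 ((x - y) * t) * wk t) =
     wk t * ((A t + tau * (cos (x * t) - cos (y * t))) ^+ 2 +
             (B t + tau * (sin (x * t) - sin (y * t))) ^+ 2).
    have -> : (x - y) * t = x * t - y * t by ring.
    rewrite /c1 cosB /H.
    have hx := cos2Dsin2 (x * t); have hy := cos2Dsin2 (y * t).
    move: (cos (x * t)) (sin (x * t)) (cos (y * t)) (sin (y * t)) hx hy => cx sx cy sy hx hy.
    have -> : (A t + tau * (cx - cy)) ^+ 2 + (B t + tau * (sx - sy)) ^+ 2 =
        A t ^+ 2 + B t ^+ 2 + 2 * tau * ((cx * A t + sx * B t) - (cy * A t + sy * B t)) +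
        tau ^+ 2 * ((cx ^+ 2 + sx ^+ 2) + (cy ^+ 2 + sy ^+ 2) - 2 * (cx * cy + sx * sy)) by ring.
    by rewrite hx hy; ring.
  by rewrite mulr_ge0 ?wk_ge0// addr_ge0// sqr_ge0.
have [xy|xy] := eqVneq x y.
  have -> : T = 0 by rewrite TE xy subrr.
  by rewrite xy subrr (Nker0 hp) mulr0 mul0r expr0n.
have N0 : 0 < N (x - y) by rewrite powR_gt0// normr_gt0 subr_eq0.
have := q (T / (2 * N (x - y))).
have -> : nform - 2 * (T / (2 * N (x - y))) * T + 2 * (T / (2 * N (x - y))) ^+ 2 * N (x - y) =
    nform - T ^+ 2 / (2 * N (x - y)) by field; rewrite gt_eqF.
by rewrite subr_ge0 ler_pdivrMr ?mulr_gt0// mulrC.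
Qed.

Lemma nform_ge0 : 0 <= nform.
Proof.
have N1 : N 1 = 1 by rewrite /Nker normr1 powR1.
have := nform_dist 1 0; rewrite (subr0 1) N1 mulr1 => h.
by have := le_trans (sqr_ge0 _) h; rewrite pmulr_rge0.
Qed.

End Form.
End PositiveDefinite.

(** * Decay of solutions and finiteness of the Morse index *)

Section Decay.
Context {R : realType}.
Local Notation mu := (@lebesgue_measure R).
Implicit Types (f g F phi rho h u : R -> R) (a b c r x y z t : R).

Lemma tail_small g e : intg g -> 0 < e -> exists n : nat,
  \int[mu]_y (if n%:R < `|y| then `|g y| else 0) <= e.
Proof.
move=> ig e0; have mg := intg_meas ig.
pose fn (n : nat) y := if n%:R < `|y| then `|g y| else 0.
have mfn n : measurable_fun setT (fn n) by apply: mfif; mfun.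
have bfn n y : `|fn n y| <= `|g y| by rewrite /fn; case: ifP => _; rewrite ?normr_id// normr0.
have cv y : fn n y @[n --> \oo] --> (0 : R).
  apply: (@cvg_near_cst _ _ _ _ _ _).
  exists (Num.truncn `|y|).+1 => // n /= kn.
  rewrite /fn ltNge; have -> // : `|y| <= n%:R.
  by apply: ltW; apply: lt_le_trans (truncnS_gt _) _; rewrite ler_nat.
have [_ ] := dct mfn (intg_norm ig) bfn cv.
rewrite I0 => /cvgrPdist_le/(_ e e0)[n _ hn]; exists n.
have := hn n (leqnn n); rewrite /= sub0r normrN; apply: le_trans; exact: ler_norm.
Qed.

(** The mesh of step 1 / (j + 1) starting at -X; the origin is the point of index X (j + 1). *)
Definition grid (X j i : nat) : R := (i%:R - X%:R * j.+1%:R) / j.+1%:R.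

Lemma grid_dist (X j : nat) x : `|x| <= X%:R ->
  exists i : 'I_(2 * X * j.+1).+1, `|x - grid X j i| <= j.+1%:R^-1.
Proof.
rewrite /grid; set J : R := j.+1%:R; have J0 : 0 < J by rewrite ltr0n.
rewrite ler_norml => /andP[x1 x2].
have y0 : 0 <= J * (x + X%:R) by rewrite mulr_ge0 ?(ltW J0)//; lra.
have /andP[t1 t2] := truncn_itv y0.
have lti : (Num.truncn (J * (x + X%:R)) < (2 * X * j.+1).+1)%N.
  rewrite ltnS -(ler_nat R); apply: le_trans t1 _.
  by rewrite !natrM -/J mulrC; apply: ler_wpM2r; [exact: ltW|lra].
exists (Ordinal lti) => /=; set i := Num.truncn _ in t1 t2 lti *.
have -> : x - (i%:R - X%:R * J) / J = (J * (x + X%:R) - i%:R) / J by field; rewrite gt_eqF.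
rewrite normrM (gtr0_norm (_ : 0 < J^-1)) ?invr_gt0// ler_piMl ?invr_ge0 ?(ltW J0)//.
by rewrite -natr1 in t2; rewrite ger0_norm ?subr_ge0//; move: t2; lra.
Qed.

Variable s : R.
Hypothesis hs : 2^-1 < s < 1.
Local Notation p := (pp s).
Let hp := pp01 hs.
Let p0 : 0 < p. Proof. by case/andP: hp. Qed.
Let p1 : p < 1. Proof. by case/andP: hp. Qed.
Local Notation N := (Nker p).
Local Notation L := (Lop p).

(** For |y| <= M the kernel is at least N x - 2 N M, and on the tail, of mass at most a quarter, it
    is still at least -N x. The tail thus costs twice a quarter, which leaves one half of the
    mass. *)
Lemma pot_lower f : intg f -> (forall x, 0 <= f x) -> 0 < \int[mu]_x f x ->
  exists C, forall x, (\int[mu]_x f x) / 2 * N x - C <= Pot s f x.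
Proof.
move=> fi f0 m0; set m := \int[mu]_x f x.
have m4 : 0 < m / 4 by rewrite divr_gt0.
have [M hM] := tail_small fi m4.
pose T y := if M%:R < `|y| then `|f y| else 0.
have mf := intg_meas fi.
have iT : intg T.
  have mT : measurable_fun setT T by apply: mfif; mfun.
  by apply: (intg_le mT _ (intg_norm fi)) => y; rewrite /T; case: ifP => _; rewrite ?normr_id// normr0.
exists (2 * N M%:R * m) => x.
have iL : intg (fun y => (N x - 2 * N M%:R) * f y - 2 * N x * T y).
  exact: (intgB (intgZ _ fi) (intgZ _ iT)).
apply: (@le_trans _ _ (\int[mu]_y ((N x - 2 * N M%:R) * f y - 2 * N x * T y))).
  rewrite (IB (intgZ _ fi) (intgZ _ iT)) (IZ _ fi) (IZ _ iT) -/m.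
  have Nx := Nker_ge0 p x.
  have : 2 * N x * \int[mu]_x T x <= 2 * N x * (m / 4).
    by apply: ler_wpM2l => //; rewrite mulr_ge0.
  by lra.
apply: (I_le iL (pot_intg hs x fi)) => y; rewrite /T.
have fy := f0 y.
case: ifPn => [yM|].
  have h := Ndiff_le hs x y; rewrite ler_norml in h; have /andP[h1 _] := h.
  rewrite ger0_norm//; have NM := Nker_ge0 p (M%:R : R).
  have q1 := ler_wpM2r fy h1; have q2 := mulr_ge0 NM fy.
  by move: q1 q2; move: (N x) (N M%:R) (N (x - y)) (N y) (f y) => *; lra.
rewrite -leNgt => yM; rewrite mulr0 subr0; apply: ler_wpM2r => //.
have h1 : N x <= N (x - y) + N y by have := NkerD hp (x - y) y; rewrite subrK.
have h2 : N y <= N M%:R by apply: le_Nker => //; rewrite (le_trans yM)// ler_norm.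
by lra.
Qed.

Lemma expN_wt a r : 0 < a -> exists2 c, 0 <= c & forall x, expR (- (a * N x)) <= c * wt r x.
Proof.
(* The exponential of -a N x is bounded by a power of order -n of 1 + a N x, that is of order -p n
   in x, so p n must be at least r. *)
move=> a0; pose n := (Num.truncn (`|r| / p)).+1.
have nr : r <= p * n%:R.
  apply: le_trans (ler_norm _) _; rewrite mulrC -ler_pdivrMr//.
  by apply: ltW; exact: truncnS_gt.
have [c c0 hc] := @exp_wt R n.
pose b := Num.min 1 a.
have b0 : 0 < b by rewrite lt_min ltr01.
exists (c * b `^ (- n%:R)) => [|x]; first by rewrite mulr_ge0 ?powR_ge0// ltW.
have aN : 0 <= a * N x by rewrite mulr_ge0 ?Nker_ge0// ltW.
apply: le_trans (hc _ aN) _; rewrite -mulrA; apply: ler_wpM2l; first exact: ltW.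
have w0 : 0 < 1 + `|x| by rewrite ltr_wpDr.
have h1 : b * (1 + `|x|) `^ p <= 1 + a * N x.
  apply: (@le_trans _ _ (b * (1 + N x))).
    apply: ler_wpM2l; first exact: ltW.
    have := @powRD_le R p 1 `|x|; rewrite powR1; apply => //.
    by rewrite p0 ltW.
  rewrite mulrDr mulr1; apply: lerD; first by rewrite ge_min lexx.
  by apply: ler_wpM2r; [exact: Nker_ge0|rewrite ge_min lexx orbT].
apply: le_trans (le_powRN _ _) _; [exact: ler0n| |].
  by apply/andP; split; [|exact: h1]; rewrite mulr_gt0// powR_gt0.
rewrite powRM ?powR_ge0 ?(ltW b0)//; apply: ler_wpM2l; first exact: powR_ge0.
rewrite -powRrM mulrN /wt; apply: ler_powR; first by rewrite lerDl.
by rewrite lerN2.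
Qed.

Variable K : R -> R.
Hypothesis K0 : forall x, 0 < K x.
Hypothesis cK : continuous K.
Hypothesis dK : decreasing_in_abs K.

Lemma Kexp_cont u : continuous u -> continuous (fun x => K x * expR (u x)).
Proof.
move=> cu x; apply: cvgM; first exact: cK.
by apply: (@continuous_comp _ _ _ u expR); [exact: cu|exact: continuous_expR].
Qed.

(** Any rate is available; r = p + 2 is used for the p-th moment and r = 0 for boundedness. *)
Lemma solution_decay u a r : continuous u -> intg (fun x => K x * expR (u x)) ->
  (forall x, u x = a - sig s * Pot s (fun x => K x * expR (u x)) x) ->
  exists2 c, 0 <= c & forall x, K x * expR (u x) <= c * wt r x.
Proof.
set f := fun x => K x * expR (u x).
move=> cu fi uE.
have f0 x : 0 < f x by rewrite mulr_gt0 ?expR_gt0.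
have m0 : 0 < \int[mu]_x f x.
  by apply: (I_gt0 (x := 0) (Kexp_cont cu) fi); [move=> y; exact/ltW/f0|exact: f0].
have [C hC] := pot_lower fi (fun x => ltW (f0 x)) m0.
set m := \int[mu]_x f x in m0 hC.
have s0 := sig_gt0 hs.
have sm : 0 < sig s * (m / 2) by rewrite mulr_gt0// divr_gt0.
have [c c0 hc] := expN_wt r sm.
pose B := K 0 * expR (a + sig s * C).
have B0 : 0 <= B by rewrite mulr_ge0 ?expR_ge0// ltW.
exists (B * c) => [|x]; first exact: mulr_ge0.
rewrite -mulrA; apply: le_trans (ler_wpM2l B0 (hc x)).
rewrite /B -[leRHS]mulrA -expRD; apply: ler_pM; [exact: ltW|exact: expR_ge0| |].
  by apply: dK; rewrite normr0.
rewrite ler_expR uE -/f.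
have := ler_wpM2l (ltW s0) (hC x).
by rewrite -/m; lra.
Qed.

(** [nform_dist] for the density L phi, whose potential is Gc phi by [fundamental] and whose energy
    is therefore a multiple of the quadratic form of phi. *)
Lemma test_form_dist phi x y : test_fun phi ->
  (phi x - phi y) ^+ 2 <= 2 / - Gc p * N (x - y) * \int[mu]_x (phi x * L phi x).
Proof.
move=> tphi; have [c c0 nphi] := test_nice hs tphi.
have iL := Lop_intg hs c0 nphi.
have iNL : intg (fun x => N x * L phi x).
  by apply: eq_intg (NLop_intg hs c0 nphi 0) => z; rewrite subr0.
have G0 : 0 < - Gc p by rewrite oppr_gt0; exact: Gc_lt0.
have Fz z : \int[mu]_y (N (z - y) * L phi y) = Gc p * phi z.
  rewrite -(fundamental hs z tphi); apply: eq_I => t.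
  by rewrite -(NkerN p (z - t)) opprB.
have h := nform_dist hp iL iNL (Lop_mean0 hs tphi) x y.
have TE : \int[mu]_z ((N (x - z) - N (y - z)) * L phi z) = Gc p * (phi x - phi y).
  rewrite mulrBr -!Fz -(IB (intg_NB hp x iL iNL) (intg_NB hp y iL iNL)).
  by apply: eq_I => t; ring.
have DE : nform p (L phi) = - Gc p * \int[mu]_x (phi x * L phi x).
  rewrite /nform; have ii : intg (fun x => phi x * L phi x).
    have [b b0 hb] := test_bounded tphi.
    have mphi : measurable_fun setT phi by apply: continuous_measurable_fun; exact: test_cont.
    exact: (intgMb iL mphi hb).
  rewrite mulNr -(IZ _ ii); congr (- _); apply: eq_I => t; rewrite Fz; ring.
rewrite TE DE in h; move: h.
set E := \int[mu]_x _; set D := phi x - phi y; set n := N (x - y); set g := Gc p in G0 * => h.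
rewrite -(ler_pM2l G0) -(ler_pM2l G0).
have -> : - g * (- g * D ^+ 2) = (g * D) ^+ 2 by ring.
apply: le_trans h _; rewrite le_eqVlt; apply/orP; left; apply/eqP.
by field; rewrite lt_eqF// -oppr_gt0.
Qed.

Lemma test_form_ge0 phi : test_fun phi -> 0 <= \int[mu]_x (phi x * L phi x).
Proof.
move=> tphi; have G0 : 0 < - Gc p by rewrite oppr_gt0; exact: Gc_lt0.
have N1 : N 1 = 1 by rewrite /Nker normr1 powR1.
have := le_trans (sqr_ge0 _) (test_form_dist 1 0 tphi).
by rewrite subr0 N1 mulr1 pmulr_rge0// divr_gt0.
Qed.

Lemma linearized_formE u phi : test_fun phi -> linearized_form s K u phi =
  frac_lap_const s * \int[mu]_x (phi x * L phi x) - \int[mu]_x (K x * expR (u x) * phi x ^+ 2).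
Proof.
move=> tphi; rewrite /linearized_form; congr (_ - _).
have [c c0 nphi] := test_nice hs tphi.
have ii : intg (fun x => phi x * L phi x).
  have [b b0 hb] := test_bounded tphi.
  have mphi : measurable_fun setT phi by apply: continuous_measurable_fun; exact: test_cont.
  exact: (intgMb (Lop_intg hs c0 nphi) mphi hb).
by rewrite -(IZ _ ii); apply: eq_I => x; rewrite (frac_lapE hs x tphi); ring.
Qed.

(** Inside [-X, X] a function vanishing on the grid is compared with the nearest grid point, outside
    with the origin, which also lies on the grid. Both comparisons are in terms of the form
    itself. *)
Lemma grid_form_ge0 u : intg (fun x => K x * expR (u x)) ->
  intg (fun x => N x * (K x * expR (u x))) -> exists (m : nat) (X : 'I_m -> R),
  forall phi, test_fun phi -> (forall i, phi (X i) = 0) -> 0 <= linearized_form s K u phi.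
Proof.
set f := fun x => K x * expR (u x); move=> fi iNf.
have f0 x : 0 <= f x by rewrite mulr_ge0 ?expR_ge0// ltW.
have Cs := frac_const_gt0 hs.
have G0 : 0 < - Gc p by rewrite oppr_gt0; exact: Gc_lt0.
pose k := 2 / - Gc p; have k0 : 0 < k by rewrite divr_gt0.
(* The mesh error and the tail each contribute at most k e times the form; together they amount
   exactly to C_s times the form. *)
pose e := frac_lap_const s / (2 * k); have e0 : 0 < e by rewrite divr_gt0// mulr_gt0.
have [X hX] := tail_small iNf e0.
have cv : (\int[mu]_x f x) * (n.+1%:R : R) `^ (- p) @[n --> \oo] --> (0 : R).
  by apply: cvgZ0; exact: en_powN_cvg.
have /cvgrPdist_le/(_ e e0)[j _ hj] := cv.
have {}hj := hj j (leqnn j); rewrite /= sub0r normrN in hj.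
pose J : R := j.+1%:R. have J0 : 0 < J by rewrite ltr0n.
exists (2 * X * j.+1).+1, (fun i => grid X j i) => phi tphi hphi.
have p00 : phi 0 = 0.
  have lt0 : (X * j.+1 < (2 * X * j.+1).+1)%N by rewrite ltnS leq_mul2r leq_pmull ?orbT.
  have := hphi (Ordinal lt0) => /=.
  by rewrite /grid natrM subrr mul0r.
set E := \int[mu]_x (phi x * L phi x).
have E0 : 0 <= E by exact: test_form_ge0.
have bphi x : phi x ^+ 2 <= k * E * (J `^ (- p) + if X%:R < `|x| then N x else 0).
  have kE : 0 <= k * E by rewrite mulr_ge0// ltW.
  case: ifPn => [xX|]; last rewrite -leNgt => xX.
    have := test_form_dist x 0 tphi; rewrite p00 !subr0 -/k -/E => h; apply: le_trans h _.
    rewrite mulrAC; apply: ler_wpM2l => //; rewrite lerDr; exact: powR_ge0.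
  rewrite addr0; have [i hi] := grid_dist j xX.
  have := test_form_dist x (grid X j i) tphi; rewrite hphi subr0 -/k -/E => h; apply: le_trans h _.
  rewrite mulrAC; apply: ler_wpM2l => //.
  have -> : J `^ (- p) = J^-1 `^ p by rewrite -(powR_inv1 (ltW J0)) -powRrM mulN1r.
  by apply: le_powRr; [exact: ltW|rewrite normr_ge0].
have mf := intg_meas fi.
pose T x := if X%:R < `|x| then `|N x * f x| else 0.
have iT : intg T.
  have mNf := intg_meas iNf.
  have mT : measurable_fun setT T by apply: mfif; mfun.
  by apply: (intg_le mT _ (intg_norm iNf)) => y; rewrite /T; case: ifP => _; rewrite ?normr_id// normr0.
have mphi : measurable_fun setT phi by apply: continuous_measurable_fun; exact: test_cont.
have iS : intg (fun x => k * E * (J `^ (- p) * f x + T x)).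
  exact: (intgZ _ (intgD (intgZ _ fi) iT)).
have bS x : f x * phi x ^+ 2 <= k * E * (J `^ (- p) * f x + T x).
  have -> : k * E * (J `^ (- p) * f x + T x) = f x * (k * E * (J `^ (- p) + if X%:R < `|x| then N x else 0)).
    rewrite /T; case: ifP => _; last by ring.
    rewrite (ger0_norm (mulr_ge0 (Nker_ge0 p x) (f0 x))).
    by move: (f x) (N x) (J `^ (- p)) => *; ring.
  exact: ler_wpM2l.
have iF : intg (fun x => f x * phi x ^+ 2).
  have mF : measurable_fun setT (fun x => f x * phi x ^+ 2) by mfun.
  apply: (intg_le mF _ iS) => x; rewrite ger0_norm//.
  by rewrite mulr_ge0// sqr_ge0.
rewrite (linearized_formE u tphi) -/E subr_ge0.
apply: le_trans (I_le iF iS bS) _.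
rewrite (IZ _ (intgD (intgZ _ fi) iT)) (ID (intgZ _ fi) iT) (IZ _ fi).
apply: (@le_trans _ _ (k * E * (e + e))).
  apply: ler_wpM2l; first by rewrite mulr_ge0// ltW.
  apply: lerD; last exact: hX.
  by apply: le_trans hj; rewrite mulrC; exact: ler_norm.
rewrite le_eqVlt; apply/orP; left; apply/eqP; rewrite /e; field.
by rewrite !gt_eqF.
Qed.

Lemma subspace_sum (V : set (R -> R)) n (c : 'I_n -> R) (phi : 'I_n -> R -> R) :
  linear_subspace V -> (forall i, V (phi i)) -> V (fun x => \sum_(i < n) c i * phi i x).
Proof.
move=> [V0 VD] Vphi; elim: (index_enum _) => [|i r IH].
  have -> : (fun x => \sum_(i <- [::]) c i * phi i x) = cst 0 by apply/funext => x; rewrite big_nil.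
  exact: V0.
have -> : (fun x => \sum_(i <- i :: r) c i * phi i x) =
   (fun x => c i * phi i x + \sum_(i <- r) c i * phi i x).
  by apply/funext => x; rewrite big_cons.
exact: VD.
Qed.

Lemma kernel_vector n m (A : 'M[R]_(n, m)) : (m < n)%N ->
  exists2 v : 'rV[R]_n, v != 0 & v *m A = 0.
Proof.
move=> mn; have rk : (0 < \rank (kermx A))%N.
  by rewrite mxrank_ker subn_gt0 (leq_ltn_trans (rank_leq_col A)).
have [i hi] : exists i, row i (kermx A) != 0.
  apply/existsP; rewrite -negb_forall; apply: contraTN rk => /forallP h.
  rewrite -leqNgt leqn0 mxrank_eq0; apply/eqP/row_matrixP => i.
  by rewrite row0; apply/eqP.
exists (row i (kermx A)) => //.
by rewrite -row_mul mulmx_ker row0.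
Qed.

Lemma finite_morse u a : continuous u -> intg (fun x => K x * expR (u x)) ->
  (forall x, u x = a - sig s * Pot s (fun x => K x * expR (u x)) x) ->
  (morse_index s K u < +oo)%E.
Proof.
move=> cu fi uE.
have iNf : intg (fun x => N x * (K x * expR (u x))).
  have [c c0 hc] := solution_decay (p + 2) cu fi uE.
  have w2 : intg (wt (2 : R)) by apply: intg_wt; lra.
  have mf := intg_meas fi.
  have m : measurable_fun setT (fun x => N x * (K x * expR (u x))).
    by have := Nker_meas p => mN; exact: mfM.
  have b x : `|N x * (K x * expR (u x))| <= c * wt 2 x.
    have f0 : 0 <= K x * expR (u x) by rewrite mulr_ge0 ?expR_ge0// ltW.
    rewrite ger0_norm; last by rewrite mulr_ge0 ?Nker_ge0.
    have -> : wt 2 x = wt (- p) x * wt (p + 2) x by rewrite wtM; congr wt; ring.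
    rewrite [leRHS]mulrCA; apply: ler_pM => //; first exact: Nker_ge0.
    by apply: powR_lt_wt; exact: ltW.
  exact: intg_le m b (intgZ c w2).
have [m [X hX]] := grid_form_ge0 fi iNf.
apply: (@le_lt_trans _ _ (m%:R%:E)); last exact: ltry.
apply: ub_ereal_sup => _ [V [linV Vtest Vneg] <-].
apply: ub_ereal_sup => _ [n [phi [Vphi lphi]] <-].
rewrite lee_fin ler_nat leqNgt; apply/negP => mn.
(* More than m independent functions admit a nontrivial combination that vanishes at all m grid
   points, where the form cannot be negative. *)
have [v v0 vA] := kernel_vector (\matrix_(i < n, j < m) phi i (X j)) mn.
pose psi x := \sum_(i < n) v 0 i * phi i x.
have Vpsi : V psi by exact: subspace_sum.
have psiX j : psi (X j) = 0.
  have := congr1 (fun M : 'rV[R]_m => M 0 j) vA; rewrite !mxE => <-.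
  by apply: eq_bigr => i _; rewrite mxE.
have psi0 : psi <> cst 0.
  move=> E; move: v0; rewrite (_ : v = 0) ?eqxx//; apply/rowP => i; rewrite mxE.
  by apply: (lphi (fun i => v 0 i)) => x; have := congr1 (@^~ x) E.
have := Vneg psi Vpsi psi0; rewrite ltNge => /negP; apply.
by apply: hX => //; exact: Vtest.
Qed.

End Decay.

(** * Existence *)

Section EquicontinuousSubsequence.
Context {R : realType}.
Variable p : R.
Hypothesis hp : 0 < p < 1.
Let p0 : 0 < p. Proof. by case/andP: hp. Qed.
Local Notation N := (Nker p).

(* Tychonoff gives a pointwise cluster point, equicontinuity on finite grids a subsequence. *)
Lemma equicontinuous_subsequence (v : nat -> R -> R) :
  (forall n x y, `|v n x - v n y| <= N (x - y)) -> (forall n x, `|v n x| <= N x) ->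
  exists w (k : nat -> nat), (forall j, (j <= k j)%N) /\
    forall x, v (k j) x @[j --> \oo] --> (w x : R).
Proof.
move=> hv bv.
pose T := prod_topology (fun _ : R => R : topologicalType).
have cA (x : R) : compact `[- N x, N x]%classic by exact: segment_compact.
pose F : set_system T := fmap (fun n => (v n : T)) \oo.
have FA : F [set f : R -> R | forall x, `[- N x, N x]%classic (f x)].
  by exists 0%N => // n _ x /=; rewrite in_itv/= -ler_norml.
have PF : ProperFilter F by exact: fmap_proper_filter.
have [w [wA cw]] := tychonoff cA PF FA.
have nb (e : R) (r : seq R) : 0 < e -> nbhs (w : T) [set f : T | forall x, x \in r -> `|f x - w x| < e].
  move=> e0; elim: r => [|x r IH]; first by apply: filterS filterT => f _ x; rewrite in_nil.
  have h : nbhs (w : T) [set f : T | `|f x - w x| < e].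
    have hb : nbhs (w x) [set t : R | `|t - w x| < e].
      by apply/nbhs_ballP; exists e => //= t; rewrite /ball/= distrC.
    exact: (@proj_continuous R (fun _ => R : topologicalType) x w _ hb).
  apply: filterS2 h IH => f h1 h2 y; rewrite in_cons => /predU1P[->//|]; exact: h2.
have hw x y : `|w x - w y| <= N (x - y).
  apply/ler_addgt0Pr => e e0.
  have e2 : 0 < e / 2 by rewrite divr_gt0.
  have FT : F [set f | exists n, f = v n] by exists 0%N => // n _ /=; exists n.
  have [f [[n ->] hn]] := cw _ _ FT (nb (e / 2) [:: x; y] e2).
  have h1 := hn x (mem_head _ _); have h2 : `|v n y - w y| < e / 2 by apply: hn; rewrite !inE eqxx orbT.
  have -> : w x - w y = (v n x - v n y) - (v n x - w x) + (v n y - w y) by ring.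
  apply: le_trans (ler_normD _ _) _; apply: le_trans (lerD (ler_normB _ _) (lexx _)) _.
  by have := hv n x y; lra.
pose gr j : seq R := map (fun i : 'I_(2 * j * j.+1).+1 => grid j j i) (enum 'I_(2 * j * j.+1).+1).
(* The cluster point is close to infinitely many terms on any finite set; at stage j the set is the
   grid of step 1 / (j + 1) on [-j, j], and equicontinuity covers the points in between. *)
have ex j : exists n, (j <= n)%N /\ forall x, x \in gr j -> `|v n x - w x| < en j.
  have FT : F [set f | exists2 n, (j <= n)%N & f = v n] by exists j => // n jn /=; exists n.
  by have [f [[n jn ->] hn]] := cw _ _ FT (nb (en j) (gr j) (en_gt0 j)); exists n.
have [k hk] := choice ex.
exists w, k; split => [j|x]; first by have [] := hk j.
have cv : en j + 2 * (j.+1%:R : R) `^ (- p) @[j --> \oo] --> (0 : R).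
  have -> : (0 : R) = 0 + 0 by rewrite addr0.
  by apply: cvgD; [exact: en_cvg|apply: cvgZ0; exact: en_powN_cvg].
pose X := (Num.truncn `|x|).+1.
suff h : v (k (j + X)%N) x @[j --> \oo] --> w x.
  by move: h; rewrite (cvg_shiftn X (fun j => v (k j) x) (nbhs (w x))).
apply: (cvg_bound _ (cvg_shift_nat X cv)) => n /=; set j := (n + X)%N.
have [_ hj] := hk j.
have xj : `|x| <= j%:R.
  apply: ltW; apply: lt_le_trans (truncnS_gt _) _; by rewrite ler_nat leq_addl.
have [i hi] := grid_dist j xj; set g := grid j j i in hi.
have gin : g \in gr j by apply/mapP; exists i => //; rewrite mem_enum.
have h1 := hj g gin.
have Ng : N (x - g) <= j.+1%:R `^ (- p).
  have -> : j.+1%:R `^ (- p) = j.+1%:R^-1 `^ p :> R.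
    by rewrite -(powR_inv1 (ler0n R j.+1)) -powRrM mulN1r.
  by apply: le_powRr; [exact: ltW|rewrite normr_ge0].
have -> : v (k j) x - w x = (v (k j) x - v (k j) g) + (v (k j) g - w g) - (w x - w g) by ring.
apply: le_trans (ler_normB _ _) _; apply: le_trans (lerD (ler_normD _ _) (lexx _)) _.
have := hv (k j) x g; have := hw x g; move: h1 Ng.
by lra.
Qed.

End EquicontinuousSubsequence.

Section Sequences.
Context {R : realType}.
Implicit Types (u a : nat -> R) (l : R).

Lemma cvg_sub u l (k : nat -> nat) : u n @[n --> \oo] --> l -> (forall j, (j <= k j)%N) ->
  u (k j) @[j --> \oo] --> l.
Proof.
move=> cu hk; apply/cvgrPdist_lt => e e0.
have /cvgrPdist_lt/(_ e e0)[m _ hm] := cu; exists m => // j mj.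
by apply: hm => /=; exact: leq_trans mj (hk j).
Qed.

Lemma cvg_sqr u a l : (forall n, (u n - l) ^+ 2 <= a n) -> a n @[n --> \oo] --> (0 : R) ->
  u n @[n --> \oo] --> l.
Proof.
move=> ua a0; apply/cvgrPdist_lt => e e0.
have e2 : 0 < e ^+ 2 by exact: exprn_gt0.
have /cvgrPdist_lt/(_ _ e2)[m _ hm] := a0; exists m => // n mn.
have := hm n mn; rewrite /= sub0r normrN => h.
rewrite distrC -(@ltr_pXn2r _ 2)// ?nnegrE ?(ltW e0)// real_normK ?num_real//.
by apply: le_lt_trans (ua n) _; apply: le_lt_trans (ler_norm _) h.
Qed.

End Sequences.

Section Lyapunov.
Context {R : realType}.

(** A nonincreasing sequence bounded below converges, so its decrements, which control [D], tend to
    0. *)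
Lemma lyapunov_seq (g D M : nat -> R) (C : R) :
  (forall n, 0 <= D n) -> (forall n, g n.+1 <= g n - 2^-1 * D n) ->
  (forall n, 8^-1 * M n - C <= g n - 2^-1 * D n) -> (forall n, 0 <= M n) ->
  exists B, (forall n, M n <= B) /\ D n @[n --> \oo] --> (0 : R).
Proof.
move=> D0 gD MD M0.
have gdec n : g n <= g 0%N.
  by elim: n => [|n IH]; [exact: lexx|have := D0 n; have := gD n; lra].
have gni : nonincreasing_seq g.
  by apply/nonincreasing_seqP => n; have := D0 n; have := gD n; lra.
have glb n : - C <= g n by have := D0 n; have := MD n; have := M0 n; lra.
have cg : cvgn g.
  by apply: nonincreasing_is_cvgn => //; exists (- C) => _ [n _ <-]; exact: glb.
exists (8 * (g 0%N + C)); split => [n|].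
  by have := D0 n; have := MD n; have := gdec n; lra.
have cv : 2 * (g n - g (n + 1)%N) @[n --> \oo] --> (0 : R).
  apply: cvgZ0; rewrite -(subrr (limn g)); apply: cvgB; first exact: cg.
  exact: cvg_shift_nat.
apply: (cvg_bound _ cv) => n.
by rewrite subr0 addn1 ger0_norm//; have := gD n; lra.
Qed.

End Lyapunov.

(** * The free energy and the Gibbs iteration *)

Section Existence.
Context {R : realType}.
Local Notation mu := (@lebesgue_measure R).
Implicit Types (f g F phi rho h u W : R -> R) (a b c r x y z t : R).

Variable s : R.
Hypothesis hs : 2^-1 < s < 1.
Local Notation p := (pp s).
Let hp := pp01 hs.
Let p0 : 0 < p. Proof. by case/andP: hp. Qed.
Let p1 : p < 1. Proof. by case/andP: hp. Qed.
Local Notation N := (Nker p).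

Variable K : R -> R.
Hypothesis K0 : forall x, 0 < K x.
Hypothesis cK : continuous K.
Hypothesis dK : decreasing_in_abs K.
Hypothesis eK : even_fun K.

(** Evenness is part of the definition because it is what makes the convolution with N coercive, see
    [conv_lower]. *)
Definition dens rho := [/\ intg rho, forall x, 0 <= rho x, \int[mu]_x rho x = 1,
  even_fun rho & intg (fun x => N x * rho x)].

(** The lower bound makes the Gibbs density decay faster than any power; the upper bound makes [W]
    integrable against densities with a p-th moment. *)
Definition adm W := continuous W /\ exists a c, [/\ 0 < a, forall x, a * N x - c <= W x &
   forall x, `|W x| <= c * (1 + N x)].

Definition part W := \int[mu]_x (K x * expR (- W x)).
Definition gibbs W x := K x * expR (- W x) / part W.

Let w2 : intg (wt (2 : R)). Proof. by apply: intg_wt; lra. Qed.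
Let mN : measurable_fun setT N. Proof. exact: Nker_meas. Qed.

Lemma adm_decay W : adm W -> exists2 c, 0 <= c & forall x, K x * expR (- W x) <= c * wt (p + 2) x.
Proof.
move=> [cW [a [c [a0 h _]]]]; have [d d0 hd] := expN_wt hs (p + 2) a0.
have B0 : 0 <= K 0 * expR c by rewrite mulr_ge0 ?expR_ge0// ltW.
exists (K 0 * expR c * d) => [|x]; first exact: mulr_ge0.
rewrite -[leRHS]mulrA; apply: le_trans (ler_wpM2l B0 (hd x)).
rewrite -[leRHS]mulrA -expRD; apply: ler_pM; [exact/ltW/K0|exact: expR_ge0| |].
  by apply: dK; rewrite normr0.
by rewrite ler_expR; have := h x; lra.
Qed.

Lemma adm_meas W : adm W -> measurable_fun setT (fun x => K x * expR (- W x)).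
Proof.
move=> [cW _]; have mW : measurable_fun setT W by exact: continuous_measurable_fun.
have mK : measurable_fun setT K by exact: continuous_measurable_fun.
by mfun.
Qed.

Let wt_N x : N x * wt (p + 2) x <= wt 2 x.
Proof.
have -> : wt 2 x = wt (- p) x * wt (p + 2) x by rewrite wtM; congr wt; ring.
by apply: ler_wpM2r; [exact: wt_ge0|apply: powR_lt_wt; exact: ltW].
Qed.

Lemma intg_adm W : adm W -> intg (fun x => K x * expR (- W x)) /\
  intg (fun x => N x * (K x * expR (- W x))).
Proof.
move=> aW; have [c c0 hc] := adm_decay aW; have m := adm_meas aW.
have pos x : 0 <= K x * expR (- W x) by rewrite mulr_ge0 ?expR_ge0// ltW.
have q1 : 1 < p + 2 by move: p0; lra.
split.
  have b x : `|K x * expR (- W x)| <= c * wt (p + 2) x by rewrite (ger0_norm (pos x)).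
  exact: intg_le m b (intgZ c (intg_wt q1)).
have b x : `|N x * (K x * expR (- W x))| <= c * wt 2 x.
  rewrite normrM (ger0_norm (pos x)) (ger0_norm (Nker_ge0 p x)).
  apply: le_trans (ler_wpM2l (Nker_ge0 p x) (hc x)) _.
  by rewrite mulrCA; apply: ler_wpM2l => //; exact: wt_N.
have m2 : measurable_fun setT (fun x => N x * (K x * expR (- W x))) by exact: mfM.
exact: intg_le m2 b (intgZ c w2).
Qed.

Lemma part_gt0 W : adm W -> 0 < part W.
Proof.
move=> aW; have [cW _] := aW.
have cf : continuous (fun x => K x * expR (- W x)).
  by apply: Kexp_cont => // x; apply: cvgN; exact: cW.
have pos x : 0 < K x * expR (- W x) by rewrite mulr_gt0 ?expR_gt0.
by apply: (I_gt0 (x := 0) cf (intg_adm aW).1); [move=> y; exact/ltW/pos|exact: pos].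
Qed.

Lemma gibbs_dens W : adm W -> even_fun W -> dens (gibbs W).
Proof.
move=> aW eW; have [i1 i2] := intg_adm aW; have Z0 := part_gt0 aW.
split.
- exact: intgZr.
- by move=> x; rewrite divr_ge0 ?(ltW Z0)// mulr_ge0 ?expR_ge0// ltW.
- by rewrite /gibbs (IZr _ i1) divff// gt_eqF.
- by move=> x; rewrite /gibbs eK eW.
- by apply: eq_intg (intgZr (part W)^-1 i2) => x; rewrite /gibbs; ring.
Qed.

Lemma gibbs_shift W c : adm W -> gibbs (fun x => W x + c) = gibbs W.
Proof.
move=> aW; have [i1 _] := intg_adm aW; have Z0 := part_gt0 aW; apply/funext => x.
have E y : K y * expR (- (W y + c)) = expR (- c) * (K y * expR (- W y)).
  by rewrite opprD expRD; ring.
rewrite /gibbs /part (eq_I E) (IZ _ i1) -/(part W) E.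
by field; rewrite !gt_eqF ?expR_gt0.
Qed.

Lemma intg_adm_dens rho W : dens rho -> adm W -> intg (fun x => rho x * W x).
Proof.
move=> [i1 r0 _ _ i2] [cW [a [c [_ _ bW]]]].
have mr := intg_meas i1; have mW : measurable_fun setT W by exact: continuous_measurable_fun.
have m : measurable_fun setT (fun x => rho x * W x) by mfun.
have b x : `|rho x * W x| <= c * (rho x + N x * rho x).
  rewrite normrM (ger0_norm (r0 x)); apply: le_trans (ler_wpM2l (r0 x) (bW x)) _.
  by rewrite le_eqVlt; apply/orP; left; apply/eqP; ring.
exact: intg_le m b (intgZ c (intgD i1 i2)).
Qed.

Lemma jensen_exp rho h : dens rho -> intg (fun x => rho x * h x) ->
  intg (fun x => rho x * expR (h x)) ->
  expR (\int[mu]_x (rho x * h x)) <= \int[mu]_x (rho x * expR (h x)).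
Proof.
move=> [i1 r0 r1 _ _] ih ie; set m := \int[mu]_x _.
have ii : intg (fun x => expR m * (1 - m) * rho x + expR m * (rho x * h x)).
  exact: (intgD (intgZ _ i1) (intgZ _ ih)).
have b x : expR m * (1 - m) * rho x + expR m * (rho x * h x) <= rho x * expR (h x).
  have -> : expR m * (1 - m) * rho x + expR m * (rho x * h x) = rho x * (expR m * (1 + (h x - m))) by ring.
  apply: ler_wpM2l => //; rewrite -[in leRHS](subrK m (h x)) expRD [leRHS]mulrC.
  by apply: ler_wpM2l; [exact: expR_ge0|exact: expR_ge1Dx].
apply: le_trans (I_le ii ie b).
rewrite (ID (intgZ _ i1) (intgZ _ ih)) (IZ _ i1) (IZ _ ih) r1 -/m.
by rewrite le_eqVlt; apply/orP; left; apply/eqP; ring.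
Qed.

(** The ratio of the two partition functions is the mean of e^(W - W') under the Gibbs density of
    [W]; Jensen's inequality does the rest. *)
Lemma gibbs_jensen W W' : adm W -> adm W' -> even_fun W ->
  \int[mu]_x (gibbs W x * W x) - \int[mu]_x (gibbs W x * W' x) <= ln (part W') - ln (part W).
Proof.
move=> aW aW' eW; have dW := gibbs_dens aW eW.
have j1 := intg_adm_dens dW aW; have j2 := intg_adm_dens dW aW'.
have Z0 := part_gt0 aW; have Z0' := part_gt0 aW'.
have [i1 _] := intg_adm aW'.
have E x : gibbs W x * expR (W x - W' x) = (part W)^-1 * (K x * expR (- W' x)).
  rewrite /gibbs; have -> : K x * expR (- W x) / part W * expR (W x - W' x) =
    (part W)^-1 * (K x * (expR (- W x) * expR (W x - W' x))) by ring.
  by rewrite -expRD addKr.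
have ie : intg (fun x => gibbs W x * expR (W x - W' x)).
  by apply: eq_intg (intgZ (part W)^-1 i1) => x; rewrite E.
have ih : intg (fun x => gibbs W x * (W x - W' x)).
  by apply: eq_intg (intgB j1 j2) => x; rewrite mulrBr.
have := jensen_exp dW ih ie; rewrite (eq_I E) (IZ _ i1) -/(part W').
have -> : \int[mu]_x (gibbs W x * (W x - W' x)) = \int[mu]_x (gibbs W x * W x) - \int[mu]_x (gibbs W x * W' x).
  by rewrite -(IB j1 j2); apply: eq_I => x; rewrite mulrBr.
rewrite -ln_div ?posrE// mulrC -ler_ln ?posrE ?expR_gt0 ?divr_gt0//.
by rewrite expRK.
Qed.

Definition mom rho := \int[mu]_x (N x * rho x).
(** The convolution of N with [rho], written through [Pot] so that the estimates of potentials
    apply; [convE] is the usual formula. *)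
Definition conv rho x := Pot s rho x + mom rho.

Lemma convE rho x : dens rho -> conv rho x = \int[mu]_y (N (x - y) * rho y).
Proof.
move=> [i1 _ _ _ i2]; rewrite /conv /Pot /mom -(ID (pot_intg hs x i1) i2).
by apply: eq_I => y; ring.
Qed.

Lemma Nker_max x y : N x <= N (x - y) + N (- x - y).
Proof.
have n1 := Nker_ge0 p (x - y); have n2 := Nker_ge0 p (- x - y).
have : `|x| <= `|x - y| \/ `|x| <= `| - x - y|.
  have h : 2 * `|x| <= `|x - y| + `| - x - y|.
    have -> : 2 * `|x| = `|(x - y) - (- x - y)|.
      have -> : (x - y) - (- x - y) = 2 * x by ring.
      by rewrite normrM ger0_norm.
    exact: ler_normB.
  by have [h1|h2] := leP `|x| `|x - y|; [left|right; lra].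
case=> /(le_Nker hp) h; first by apply: le_trans h _; rewrite lerDl.
by apply: le_trans h _; rewrite lerDr.
Qed.

(** For an even density the value at x is the average of the values at x and -x, and for each y one
    of the distances |x - y|, |-x - y| is at least |x|. *)
Lemma conv_lower rho x : dens rho -> 2^-1 * N x <= conv rho x.
Proof.
move=> dr; have [i1 r0 r1 er i2] := dr.
have ec : conv rho (- x) = conv rho x by rewrite /conv (pot_even hs i1 er).
have E : conv rho x = 2^-1 * (\int[mu]_y (N (x - y) * rho y) + \int[mu]_y (N (- x - y) * rho y)).
  by rewrite -!(convE _ dr) ec; field.
rewrite E; apply: ler_wpM2l; first by rewrite invr_ge0.
have j1 := intg_NB hp x i1 i2; have j2 := intg_NB hp (- x) i1 i2.
rewrite -(ID j1 j2) -[leLHS]mulr1 -r1 -(IZ _ i1).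
apply: (I_le (intgZ _ i1) (intgD j1 j2)) => y; rewrite -mulrDl.
by apply: ler_wpM2r; [exact: r0|exact: Nker_max].
Qed.

Lemma conv_adm rho : dens rho -> adm (conv rho).
Proof.
move=> dr; have [i1 r0 r1 er i2] := dr; split.
  by move=> x; apply: cvgD; [exact: (pot_cont hs i1)|exact: cvg_cst].
exists 2^-1, (1 + `|mom rho|); split => // [x|x].
  by apply: le_trans (conv_lower x dr); have := normr_ge0 (mom rho); lra.
have h := pot_le hs x i1.
have a1 : \int[mu]_y `|rho y| = 1 by rewrite -r1; apply: eq_I => y; rewrite ger0_norm.
rewrite a1 mulr1 in h; apply: le_trans (ler_normD _ _) _.
have n0 := Nker_ge0 p x; have := mulr_ge0 (normr_ge0 (mom rho)) n0.
lra.
Qed.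

Lemma conv_even rho : dens rho -> even_fun (conv rho).
Proof. by move=> [i1 _ _ er _] x; rewrite /conv (pot_even hs i1 er). Qed.

Definition energy rho rho' := \int[mu]_x (rho x * conv rho' x).

Lemma energy_sym rho rho' : dens rho -> dens rho' -> energy rho rho' = energy rho' rho.
Proof.
move=> dr dr'; have [i1 r0 r1 er i2] := dr; have [i1' r0' r1' er' i2'] := dr'.
have mr := intg_meas i1; have mr' := intg_meas i1'.
pose F x y := rho x * (N (x - y) * rho' y).
have mF : measurable_fun setT (fun z : R * R => F z.1 z.2).
  have m1 : measurable_fun setT (fun z : R * R => rho z.1) by apply: (mfcomp mr); mfun.
  have m2 : measurable_fun setT (fun z : R * R => rho' z.2) by apply: (mfcomp mr'); mfun.
  by rewrite /F /Nker; mfun.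
have iF x : intg (F x) by exact: (intgZ _ (intg_NB hp x i1' i2')).
have bF x : \int[mu]_y `|F x y| <= rho x * conv rho' x.
  rewrite (convE _ dr') -(IZ _ (intg_NB hp x i1' i2')) le_eqVlt; apply/orP; left; apply/eqP.
  by apply: eq_I => y; rewrite ger0_norm// mulr_ge0// mulr_ge0// Nker_ge0.
have [_ _ _ E] := fub mF iF (intg_adm_dens dr (conv_adm dr')) bF.
transitivity (\int[mu]_x \int[mu]_y F x y).
  by apply: eq_I => x; rewrite (convE _ dr') -(IZ _ (intg_NB hp x i1' i2')).
rewrite E; apply: eq_I => y; rewrite (convE _ dr) -(IZ _ (intg_NB hp y i1 i2)).
by apply: eq_I => x; rewrite /F -(NkerN p (x - y)) opprB; ring.
Qed.

Let dif rho rho' x := rho' x - rho x.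

Lemma nform_dif rho rho' : dens rho -> dens rho' ->
  [/\ intg (dif rho rho'), intg (fun x => N x * dif rho rho' x), \int[mu]_x dif rho rho' x = 0 &
   nform p (dif rho rho') = 2 * energy rho' rho - energy rho' rho' - energy rho rho].
Proof.
move=> dr dr'; have [i1 r0 r1 er i2] := dr; have [i1' r0' r1' er' i2'] := dr'.
split.
- exact: intgB.
- by apply: eq_intg (intgB i2' i2) => x; rewrite mulrBr.
- by rewrite (IB i1' i1) r1 r1' subrr.
rewrite /nform.
have a11 := intg_adm_dens dr (conv_adm dr); have a12 := intg_adm_dens dr (conv_adm dr').
have a21 := intg_adm_dens dr' (conv_adm dr); have a22 := intg_adm_dens dr' (conv_adm dr').
have -> : \int[mu]_x (dif rho rho' x * \int[mu]_y (N (x - y) * dif rho rho' y)) =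
  \int[mu]_x ((rho' x * conv rho' x - rho' x * conv rho x) - (rho x * conv rho' x - rho x * conv rho x)).
  apply: eq_I => x.
  have -> : \int[mu]_y (N (x - y) * dif rho rho' y) = conv rho' x - conv rho x.
    rewrite (convE _ dr) (convE _ dr') -(IB (intg_NB hp x i1' i2') (intg_NB hp x i1 i2)).
    by apply: eq_I => y; rewrite mulrBr.
  by rewrite /dif; ring.
rewrite (IB (intgB a22 a21) (intgB a12 a11)) (IB a22 a21) (IB a12 a11).
rewrite -/(energy rho' rho') -/(energy rho' rho) -/(energy rho rho') -/(energy rho rho).
rewrite (energy_sym dr dr').
by move: (energy _ _) (energy _ _) (energy _ _) => *; ring.
Qed.

Definition lyap rho := - ln (part (conv rho)) - 2^-1 * energy rho rho.

Lemma admN8 : adm (fun x => 8^-1 * N x).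
Proof.
split; first by move=> x; apply: cvgM; [exact: cvg_cst|exact: Nker_cont].
exists 8^-1, 1; split => // x; have n0 := Nker_ge0 p x; first by lra.
by rewrite ger0_norm ?mulr_ge0//; lra.
Qed.

(** [gibbs_jensen] with comparison potential [conv rho'] gives the decrease: the energy terms left
    over are exactly half of [nform]. With comparison potential N / 8 it gives coercivity: half the
    energy of rho' is at least a quarter of its moment, of which the comparison consumes an
    eighth. *)
Lemma lyap_step rho rho' : dens rho -> rho' = gibbs (conv rho) ->
  [/\ dens rho', 0 <= nform p (dif rho rho'), lyap rho' <= lyap rho - 2^-1 * nform p (dif rho rho') &
   8^-1 * mom rho' - ln (part (fun x => 8^-1 * N x)) <= lyap rho - 2^-1 * nform p (dif rho rho')].
Proof.
have A1 (a b c d e : R) : c - d <= b - a -> - b - 2^-1 * d <= - a - 2^-1 * e - 2^-1 * (2 * c - d - e).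
  by lra.
have A2 (a b c d e m : R) : c - 8^-1 * m <= b - a -> 2^-1 * m <= d -> 
    8^-1 * m - b <= - a - 2^-1 * e - 2^-1 * (2 * c - d - e).
  by lra.
move=> dr rE; have aC := conv_adm dr; have eC := conv_even dr.
have dr' : dens rho' by rewrite rE; exact: gibbs_dens.
have [j1 j2 j3 nE] := nform_dif dr dr'.
have [i1 r0 r1 er i2] := dr'.
have J1 := gibbs_jensen aC (conv_adm dr') eC; rewrite -rE in J1.
have J2 := gibbs_jensen aC admN8 eC; rewrite -rE in J2.
have mE : \int[mu]_x (rho' x * (8^-1 * N x)) = 8^-1 * mom rho'.
  by rewrite /mom -(IZ _ i2); apply: eq_I => x; ring.
have h : 2^-1 * mom rho' <= energy rho' rho'.
  rewrite /mom -(IZ _ i2).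
  apply: (I_le (intgZ _ i2) (intg_adm_dens dr' (conv_adm dr'))) => x.
  rewrite mulrA mulrC; apply: ler_wpM2l; [exact: r0|exact: conv_lower].
rewrite mE in J2; split; [exact: dr'|exact: (nform_ge0 hp j1 j2 j3)| |].
  by rewrite nE; exact: A1 J1.
by rewrite nE; exact: A2 J2 h.
Qed.

Fixpoint iter_dens n := if n is m.+1 then gibbs (conv (iter_dens m)) else gibbs (fun x => 8^-1 * N x).

Lemma iter_densP n : dens (iter_dens n).
Proof.
elim: n => [|n IH] /=.
  by apply: gibbs_dens; [exact: admN8|move=> x; rewrite NkerN].
by apply: gibbs_dens; [exact: conv_adm|exact: conv_even].
Qed.

Lemma iter_dens_bounds : exists B, (forall n, mom (iter_dens n.+1) <= B) /\
  nform p (dif (iter_dens n) (iter_dens n.+1)) @[n --> \oo] --> (0 : R).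
Proof.
have st n := lyap_step (iter_densP n) (erefl (iter_dens n.+1)).
have mom0 n : 0 <= mom (iter_dens n).
  have [_ r0 _ _ _] := iter_densP n; apply: I_ge0 => x; apply: mulr_ge0; [exact: Nker_ge0|exact: r0].
apply: (@lyapunov_seq R (fun n => lyap (iter_dens n)) _ (fun n => mom (iter_dens n.+1))
  (ln (part (fun x => 8^-1 * N x)))) => n; first by have [] := st n.
- by have [] := st n.
- by have [] := st n.
- exact: mom0.
Qed.

Theorem existence : exists u, cont_liouville_solution s K u /\ even_fun u.
Proof.
have [B [hB cD]] := iter_dens_bounds.
pose rho n := iter_dens n.+1; pose v n := Pot s (rho n).
have dr n : dens (rho n) by exact: iter_densP.
have ir n : intg (rho n) by have [] := dr n.
have r1 n : \int[mu]_y `|rho n y| = 1.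
  by have [_ r0 <- _ _] := dr n; apply: eq_I => y; rewrite ger0_norm.
have hv n x y : `|v n x - v n y| <= N (x - y).
  by have := pot_dist hs x y (ir n); rewrite r1 mul1r.
have bv n x : `|v n x| <= N x by have := pot_le hs x (ir n); rewrite r1 mulr1.
have [w [k [hk cw]]] := equicontinuous_subsequence hp hv bv.
have ev n : even_fun (v n) by have [_ _ _ er _] := dr n; exact: (pot_even hs (ir n) er).
have ew : even_fun w.
  by move=> x; apply: (lim_uniq (cw (- x))); rewrite (eq_cvg _ _ (fun j => ev (k j) x)); exact: cw.
have lv n x : 2^-1 * N x - B <= v n x.
  by have := conv_lower x (dr n); rewrite /conv -/(v n x); have := hB n; rewrite -/(rho n); lra.
have lw x : 2^-1 * N x - B <= w x by apply: (lim_ge (cw x)) => j; exact: lv.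
have bw x : `|w x| <= N x.
  rewrite ler_norml; apply/andP; split; [apply: (lim_ge (cw x))|apply: (lim_le (cw x))] => j;
    by have := bv (k j) x; rewrite ler_norml => /andP[].
have hw x y : `|w x - w y| <= 1 * `|x - y| `^ p.
  rewrite mul1r ler_norml.
  have cvd : v (k j) x - v (k j) y @[j --> \oo] --> w x - w y by apply: cvgB; exact: cw.
  by apply/andP; split; [apply: (lim_ge cvd)|apply: (lim_le cvd)] => j;
    have := hv (k j) x y; rewrite ler_norml => /andP[].
have cW : continuous w := hold_cont p0 hw.
have admc W : continuous W -> (forall x, 2^-1 * N x - B <= W x) -> (forall x, `|W x| <= N x) -> adm W.
  move=> c1 h1 h2; split => //; exists 2^-1, (1 + `|B|); split => // x.
    by apply: le_trans (h1 x); have := ler_norm B; lra.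
  apply: le_trans (h2 x) _; have n0 := Nker_ge0 p x.
  by have := mulr_ge0 (normr_ge0 B) n0; have := normr_ge0 B; lra.
have av n : adm (v n) by apply: admc => //; exact: (pot_cont hs (ir n)).
have aw : adm w by exact: admc.
(* The moments inside [conv] are additive constants, which the normalisation removes; only the
   potentials [v n] matter. *)
have rhoS n : rho n.+1 = gibbs (v n).
  by rewrite -(gibbs_shift (mom (rho n)) (av n)).
pose E0 x := K 0 * expR (B - 2^-1 * N x).
have bE W x : (forall x, 2^-1 * N x - B <= W x) -> `|K x * expR (- W x)| <= E0 x.
  move=> h; rewrite ger0_norm ?mulr_ge0 ?expR_ge0 ?(ltW (K0 x))//.
  apply: ler_pM; [exact/ltW/K0|exact: expR_ge0|by apply: dK; rewrite normr0|].
  by rewrite ler_expR; have := h x; lra.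
have iE : intg E0.
  have aE : adm (fun x => 2^-1 * N x).
    split; first by move=> x; apply: cvgM; [exact: cvg_cst|exact: Nker_cont].
    exists 2^-1, 1; split => // x; have n0 := Nker_ge0 p x; first by lra.
    by rewrite ger0_norm ?mulr_ge0//; lra.
  have [d d0 hd] := expN_wt hs (p + 2) (ltac:(lra) : 0 < 2^-1 :> R).
  have q1 : 1 < p + 2 by move: p0; lra.
  have m : measurable_fun setT E0 by rewrite /E0; mfun.
  have b x : `|E0 x| <= K 0 * expR B * d * wt (p + 2) x.
    rewrite ger0_norm; last by rewrite mulr_ge0 ?expR_ge0// ltW.
    rewrite /E0 expRD -!mulrA; apply: ler_wpM2l; first exact/ltW.
    by apply: ler_wpM2l; [exact: expR_ge0|exact: hd].
  exact: intg_le m b (intgZ _ (intg_wt q1)).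
have cexp x : K x * expR (- v (k j) x) @[j --> \oo] --> K x * expR (- w x).
  apply: cvgMl_tmp; apply: (cvg_comp (fun j => - v (k j) x) expR); last exact: continuous_expR.
  by apply: cvgN; exact: cw.
have cZ : part (v (k j)) @[j --> \oo] --> part w.
  have [_] := dct (fun j => adm_meas (av (k j))) iE (fun j x => bE (v (k j)) x (lv (k j))) cexp.
  by [].
have Zw := part_gt0 aw.
have iN' : adm N.
  split; first exact: Nker_cont.
  exists 1, 1; split => // x; have n0 := Nker_ge0 p x; first by lra.
  by rewrite ger0_norm//; lra.
(* A lower bound for the partition functions that does not depend on n, from v n <= N, so that all
   densities share one integrable majorant. *)
have Zlow n : part N <= part (v n).
  apply: (I_le (intg_adm iN').1 (intg_adm (av n)).1) => x.
  apply: ler_wpM2l; first exact/ltW/K0.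
  by rewrite ler_expR lerN2; apply: le_trans (ler_norm _) (bv n x).
have ZN := part_gt0 iN'.
have dw : dens (gibbs w) by exact: gibbs_dens.
have cg x : rho (k j).+1 x @[j --> \oo] --> gibbs w x.
  under eq_cvg do rewrite rhoS; rewrite /gibbs; apply: cvgM; first exact: cexp.
  by apply: cvgV; [rewrite gt_eqF|exact: cZ].
have bg n x : `|rho n.+1 x| <= (part N)^-1 * E0 x.
  have pn := part_gt0 (av n); have {}Zlow := Zlow n.
  rewrite rhoS /gibbs normrM mulrC normfV (gtr0_norm pn).
  apply: ler_pM; [rewrite invr_ge0; exact: ltW pn|exact: normr_ge0| |exact: bE (lv n)].
  by rewrite lef_pV2 ?posrE; [exact: Zlow|exact: pn|exact: ZN].
have cP x : Pot s (rho (k j).+1) x @[j --> \oo] --> Pot s (gibbs w) x.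
  have mm j : measurable_fun setT (fun y => (N (x - y) - N y) * rho (k j).+1 y).
    by have := intg_meas (ir (k j).+1); have := Ndiff_meas s x => *; mfun.
  have ig : intg (fun y => N x * ((part N)^-1 * E0 y)) by exact: (intgZ _ (intgZ _ iE)).
  have bb j y : `|(N (x - y) - N y) * rho (k j).+1 y| <= N x * ((part N)^-1 * E0 y).
    by rewrite normrM; apply: ler_pM => //; exact: Ndiff_le.
  have cc y : (N (x - y) - N y) * rho (k j).+1 y @[j --> \oo] --> (N (x - y) - N y) * gibbs w y.
    by apply: cvgMl_tmp; exact: cg.
  by have [_] := dct mm ig bb cc.
have wE x : w x = Pot s (gibbs w) x.
  apply: (lim_uniq (cw x)).
  (* The subsequence need not contain consecutive indices. [nform_dist] at the points x and 0, where
     potentials vanish, turns the vanishing energy of the increments into pointwise merging of v n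
     and v (n + 1). *)
  have cd : v (k j) x - v (k j).+1 x @[j --> \oo] --> (0 : R).
    have cD' := cvgZ0 (2 * N x) (cvg_sub (k := fun j => (k j).+1) cD (fun j => leqW (hk j))).
    apply: (cvg_sqr _ cD') => j; rewrite subr0.
    have [h1 h2 h3 _] := nform_dif (dr (k j)) (dr (k j).+1).
    have := nform_dist hp h1 h2 h3 x 0; rewrite subr0; apply: le_trans.
    rewrite le_eqVlt; apply/orP; left; apply/eqP; rewrite -sqrrN; congr (_ ^+ 2).
    rewrite opprB /v /Pot -(IB (pot_intg hs x (ir _)) (pot_intg hs x (ir _))); apply: eq_I => z.
    by rewrite sub0r NkerN mulrBr.
  have h : (v (k j) x - v (k j).+1 x) + v (k j).+1 x @[j --> \oo] --> 0 + Pot s (gibbs w) x.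
    by apply: cvgD; [exact: cd|exact: cP].
  rewrite add0r in h.
  have -> : (fun j => v (k j) x) = (fun j => (v (k j) x - v (k j).+1 x) + v (k j).+1 x).
    by apply/funext => j; rewrite subrK.
  exact: h.
(* The constant is chosen so that K e^u equals [gibbs w] divided by sig; sig times its potential is
   then w itself. *)
pose u x := - ln (sig s * part w) - w x.
have s0 := sig_gt0 hs.
have fE x : K x * expR (u x) = (sig s)^-1 * gibbs w x.
  rewrite /u expRB expRN lnK ?posrE ?mulr_gt0// /gibbs.
  rewrite expRN; field; rewrite !gt_eqF ?expR_gt0//.
exists u; split; last by move=> x; rewrite /u ew.
have [igw _ _ _ _] := dw.
have cu : continuous u by move=> x; apply: cvgB; [exact: cvg_cst|exact: cW].
have iu : intg (fun x => K x * expR (u x)).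
  by apply: eq_intg (intgZ (sig s)^-1 igw) => x; rewrite fE.
refine (solution_of_potential hs K0 (a := - ln (sig s * part w)) cu iu _) => x.
have E y : (N (x - y) - N y) * (K y * expR (u y)) = (sig s)^-1 * ((N (x - y) - N y) * gibbs w y).
  by rewrite fE; ring.
rewrite [in RHS]/Pot (eq_I E) (IZ _ (pot_intg hs x igw)) mulVKf; last by rewrite gt_eqF.
by rewrite /u {1}wE.
Qed.

End Existence.

(** * Symmetry *)

Section MovingPlanes.
Context {R : realType}.
Local Notation mu := (@lebesgue_measure R).
Implicit Types (f g F phi rho h : R -> R) (a b c r x y z t lam : R).

Variable s : R.
Hypothesis hs : 2^-1 < s < 1.
Local Notation p := (pp s).
Let hp := pp01 hs.
Let p0 : 0 < p. Proof. by case/andP: hp. Qed.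
Let p1 : p < 1. Proof. by case/andP: hp. Qed.
Local Notation N := (Nker p).

(** The difference of the kernels at a point and at its reflection in [lam]: antisymmetric under
    reflection of either variable, positive when both lie to the right of [lam]. *)
Definition Gk lam x y := N (2 * lam - x - y) - N (x - y).

Lemma GkN lam x y : Gk lam x (2 * lam - y) = - Gk lam x y.
Proof.
rewrite /Gk; have -> : 2 * lam - x - (2 * lam - y) = - (x - y) by ring.
have -> : x - (2 * lam - y) = - (2 * lam - x - y) by ring.
by rewrite !NkerN opprB.
Qed.

Lemma Gk_abs lam x y : lam < x -> lam < y -> `|x - y| < `|2 * lam - x - y|.
Proof.
move=> lx ly; have -> : `|2 * lam - x - y| = x + y - 2 * lam by rewrite ler0_norm; lra.
by rewrite ltr_norml; apply/andP; split; lra.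
Qed.

Lemma Gk_gt0 lam x y : lam < x -> lam < y -> 0 < Gk lam x y.
Proof.
move=> lx ly; rewrite subr_gt0; apply: gt0_ltr_powR => //; rewrite ?nnegrE//.
exact: Gk_abs.
Qed.

(** The two arguments of N, up to sign, differ by 2 (y - lam). A bound free of x is what allows an
    argument in the sup norm. *)
Lemma Gk_le lam x y : Gk lam x y <= 2 `^ p * N (y - lam).
Proof.
have := Nker_dist hp (2 * lam - x - y) (- (x - y)); rewrite NkerN => h.
apply: le_trans (ler_norm _) _; apply: le_trans h _.
have -> : 2 * lam - x - y - - (x - y) = (- 2) * (y - lam) by ring.
by rewrite -/(N _) NkerM {1}/Nker normrN ger0_norm.
Qed.

Lemma Gk_abs_le lam x y : `|Gk lam x y| <= N (2 * (lam - x)).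
Proof.
have := Nker_dist hp (2 * lam - x - y) (x - y).
by have -> : 2 * lam - x - y - (x - y) = 2 * (lam - x) by ring.
Qed.

Lemma Gk_cont lam x : continuous (Gk lam x).
Proof.
have c (e : R) : continuous (fun y => N (e - y)).
  move=> y; apply: (@continuous_comp _ _ _ (fun y => e - y) N); last exact: Nker_cont.
  by apply: cvgB; [exact: cvg_cst|exact: cvg_id].
by move=> y; apply: cvgB; exact: c.
Qed.

Variable K : R -> R.
Hypothesis K0 : forall x, 0 < K x.
Hypothesis cK : continuous K.
Hypothesis dK : decreasing_in_abs K.
Hypothesis eK : even_fun K.
Hypothesis ncK : ~ exists c, forall x, K x = c.

Section Fixed.
Variables (u : R -> R) (a : R).
Hypothesis cu : continuous u.
Local Notation f := (fun x => K x * expR (u x)).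
Hypothesis fi : intg f.
Hypothesis uE : forall x, u x = a - sig s * Pot s f x.

Let f0 x : 0 < f x. Proof. by rewrite mulr_gt0 ?expR_gt0. Qed.
Let s0 := sig_gt0 hs.
Let mf : measurable_fun setT f. Proof. exact: intg_meas fi. Qed.
Let mu' : measurable_fun setT u. Proof. exact: continuous_measurable_fun. Qed.

Definition gap lam x := u x - u (2 * lam - x).

Let iGf lam x : intg (fun y => Gk lam x y * f y).
Proof. exact: (intgMb fi (continuous_measurable_fun (@Gk_cont lam x)) (Gk_abs_le lam x)). Qed.

Let iGfr lam x : intg (fun y => Gk lam x y * f (2 * lam - y)).
Proof.
by apply: eq_intg (intgN (intg_refl (2 * lam) (iGf lam x))) => y; rewrite GkN; ring.
Qed.

(** The integral equation gives sig times the integral of Gk f; averaging with its reflection in y,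
    where [Gk] changes sign, produces the difference of [f] and the factor 1/2. *)
Lemma gapE lam x : gap lam x = sig s / 2 * \int[mu]_y (Gk lam x y * (f y - f (2 * lam - y))).
Proof.
have i1 := pot_intg hs x fi; have i2 := pot_intg hs (2 * lam - x) fi.
have E1 : gap lam x = sig s * \int[mu]_y (Gk lam x y * f y).
  have -> : gap lam x = sig s * (Pot s f (2 * lam - x) - Pot s f x).
    rewrite /gap (uE x) (uE (2 * lam - x)).
    by move: (sig s) (Pot s f x) (Pot s f (2 * lam - x)) => ? ? ?; ring.
  rewrite /Pot -(IB i2 i1); congr (_ * _); apply: eq_I => y.
  by rewrite /Gk; ring.
have E2 : \int[mu]_y (Gk lam x y * f (2 * lam - y)) = - \int[mu]_y (Gk lam x y * f y).
  rewrite -(I_refl (2 * lam) (iGf lam x)) -(IN (intg_refl (2 * lam) (iGf lam x))).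
  by apply: eq_I => y; rewrite GkN; ring.
have -> : \int[mu]_y (Gk lam x y * (f y - f (2 * lam - y))) =
    \int[mu]_y (Gk lam x y * f y) - \int[mu]_y (Gk lam x y * f (2 * lam - y)).
  by rewrite -(IB (iGf lam x) (iGfr lam x)); apply: eq_I => y; rewrite mulrBr.
rewrite E2 E1; move: (\int[mu]_y _) => I; by field.
Qed.

Lemma intg_Nf : intg (fun y => N y * f y).
Proof.
have [c c0 hc] := solution_decay hs K0 cK dK (p + 2) cu fi uE.
have w2 : intg (wt (2 : R)) by apply: intg_wt; lra.
have m : measurable_fun setT (fun y => N y * f y) by have := Nker_meas p => ?; exact: mfM.
have b x : `|N x * f x| <= c * wt 2 x.
  rewrite ger0_norm; last by rewrite mulr_ge0 ?Nker_ge0// ltW.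
  have -> : wt 2 x = wt (- p) x * wt (p + 2) x by rewrite wtM; congr wt; ring.
  rewrite [leRHS]mulrCA; apply: ler_pM; [exact: Nker_ge0|exact/ltW/f0| |exact: hc].
  by apply: powR_lt_wt; exact: ltW.
exact: intg_le m b (intgZ c w2).
Qed.

Lemma K_refl lam y : 0 <= lam -> lam < y -> K y <= K (2 * lam - y).
Proof.
move=> l0 ly; apply: dK; rewrite (ger0_norm (_ : 0 <= y)); last lra.
by rewrite ler_norml; apply/andP; split; lra.
Qed.

(** The bound of [Gk_le] times f, restricted to where the gap is positive; sig times its integral is
    the contraction factor for the positive part of the gap. *)
Definition excess lam y := if (lam < y) && (0 < gap lam y) then 2 `^ p * N (y - lam) * f y else 0.

Lemma gap_meas lam : measurable_fun setT (gap lam).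
Proof.
have : measurable_fun setT (fun y => u (2 * lam - y)) by apply: (mfcomp mu'); mfun.
by move=> ?; rewrite /gap; mfun.
Qed.

Lemma excess_le lam y : 0 <= lam -> `|excess lam y| <= 2 `^ p * (N y * f y).
Proof.
move=> l0; have p2 : 0 <= 2 `^ p :> R by exact: powR_ge0.
have nf : 0 <= N y * f y by rewrite mulr_ge0 ?Nker_ge0// ltW.
rewrite /excess; case: ifPn => [/andP[ly _]|_]; last by rewrite normr0 mulr_ge0.
rewrite ger0_norm; last by rewrite !mulr_ge0 ?Nker_ge0// ltW.
rewrite -mulrA; apply: ler_wpM2l => //; apply: ler_wpM2r; first exact/ltW/f0.
by apply: (le_Nker hp); rewrite !ger0_norm; lra.
Qed.

Lemma excess_meas lam : measurable_fun setT (excess lam).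
Proof.
have := gap_meas lam; have := Nker_meas p => mN mg.
have mNl : measurable_fun setT (fun y => N (y - lam)) by apply: (mfcomp mN); mfun.
rewrite /excess; apply: mfif; [|by mfun|exact: mfC].
by apply: mfand; mfun.
Qed.

Lemma excess_intg lam : 0 <= lam -> intg (excess lam).
Proof.
move=> l0; exact: (intg_le (excess_meas lam) (fun y => excess_le y l0) (intgZ _ intg_Nf)).
Qed.

(* 1 - e^(-t) <= t turns the integral equation for the gap into a contraction for its positive part *)
Lemma excess_bound lam x y S : 0 <= lam -> lam < x -> lam < y -> gap lam y <= S ->
  Gk lam x y * (f y - f (2 * lam - y)) <= S * excess lam y.
Proof.
move=> l0 lx ly gS; have G0 := Gk_gt0 lx ly.
have fr : f y * expR (- gap lam y) <= f (2 * lam - y).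
  have -> : f y * expR (- gap lam y) = K y * expR (u (2 * lam - y)).
    by rewrite -mulrA -expRD /gap; congr (_ * expR _); ring.
  by apply: ler_wpM2r; [exact: expR_ge0|exact: K_refl].
have h : f y - f (2 * lam - y) <= f y * gap lam y.
  have := expR_ge1Dx (- gap lam y) => /(ler_wpM2l (ltW (f0 y))); move: fr; lra.
rewrite /excess ly /=; case: ifPn => [g0|]; last first.
  rewrite -leNgt mulr0 => g0; rewrite pmulr_rle0//.
  by apply: le_trans h _; rewrite pmulr_rle0// f0.
apply: le_trans (ler_wpM2l (ltW G0) h) _.
have -> : S * (2 `^ p * N (y - lam) * f y) = 2 `^ p * N (y - lam) * (f y * S) by ring.
apply: ler_pM; [exact: ltW|by rewrite mulr_ge0// ltW|exact: Gk_le|].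
by apply: ler_wpM2l => //; exact/ltW/f0.
Qed.

Lemma excess_ge0 lam y : 0 <= excess lam y.
Proof.
rewrite /excess; case: ifP => // _.
by rewrite !mulr_ge0 ?powR_ge0 ?Nker_ge0// ltW.
Qed.

Lemma gap_le lam x S : 0 <= lam -> lam < x -> 0 <= S -> (forall y, lam < y -> gap lam y <= S) ->
  gap lam x <= S * (sig s * \int[mu]_y excess lam y).
Proof.
move=> l0 lx S0 hS; have ie := excess_intg l0.
have ier := intg_refl (2 * lam) ie.
have iS : intg (fun y => S * (excess lam y + excess lam (2 * lam - y))).
  exact: (intgZ S (intgD ie ier)).
have iG : intg (fun y => Gk lam x y * (f y - f (2 * lam - y))).
  by apply: eq_intg (intgB (iGf lam x) (iGfr lam x)) => y; rewrite mulrBr.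
have b y : Gk lam x y * (f y - f (2 * lam - y)) <= S * (excess lam y + excess lam (2 * lam - y)).
  have e1 := mulr_ge0 S0 (excess_ge0 lam y); have e2 := mulr_ge0 S0 (excess_ge0 lam (2 * lam - y)).
  rewrite [leRHS]mulrDr; have [yl|ly|<-] := ltgtP y lam.
  - have ly : lam < 2 * lam - y by lra.
    have := excess_bound l0 lx ly (hS _ ly); rewrite GkN subKr => h.
    by apply: (@le_trans _ _ (- Gk lam x y * (f (2 * lam - y) - f y))); [lra|lra].
  - by have := excess_bound l0 lx ly (hS _ ly); lra.
  have -> : 2 * y - y = y by ring.
  rewrite subrr mulr0; have e3 := mulr_ge0 S0 (excess_ge0 y y); exact: addr_ge0.
rewrite gapE; have := I_le iG iS b.
rewrite (IZ _ (intgD ie ier)) (ID ie ier) (I_refl (2 * lam) ie) => h.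
have := ler_wpM2l (_ : 0 <= sig s / 2) h; rewrite divr_ge0 ?(ltW s0)// => /(_ isT).
move: (\int[mu]_y _) (\int[mu]_y _) => A B; lra.
Qed.

(** By [gap_le] the supremum S of the positive part satisfies S <= S th with th < 1. The argument
    requires S to be finite, which the moment bound [C] supplies. *)
Lemma gap_contract lam : 0 <= lam -> sig s * \int[mu]_y excess lam y < 1 ->
  forall x, lam < x -> gap lam x <= 0.
Proof.
move=> l0 th1 x lx; set th := sig s * _ in th1.
have ie := excess_intg l0.
pose C := sig s * \int[mu]_y (2 `^ p * (N y * f y)).
(* Including 0 makes the supremum that of the positive part. *)
pose T := [set t | t = 0 \/ exists2 y, lam < y & t = gap lam y].
have p2 : 0 <= 2 `^ p :> R by exact: powR_ge0.
have bd y : lam < y -> gap lam y <= C.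
  move=> ly; rewrite gapE.
  have i1 := intgZ (2 `^ p) intg_Nf.
  have iG : intg (fun z => Gk lam y z * (f z - f (2 * lam - z))).
    by apply: eq_intg (intgB (iGf lam y) (iGfr lam y)) => z; rewrite mulrBr.
  have ier := intg_refl (2 * lam) i1.
  have bb z : lam < z -> Gk lam y z * (f z - f (2 * lam - z)) <= 2 `^ p * (N z * f z).
    move=> lz; have G0 := Gk_gt0 ly lz.
    apply: (@le_trans _ _ (2 `^ p * N (z - lam) * f z)).
      apply: (@le_trans _ _ (Gk lam y z * f z)).
        apply: ler_wpM2l; first exact: ltW.
        by rewrite lerBlDr lerDl; exact/ltW/f0.
      by apply: ler_wpM2r; [exact/ltW/f0|exact: Gk_le].
    rewrite -mulrA; apply: ler_wpM2l => //; apply: ler_wpM2r; first exact/ltW/f0.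
    by apply: (le_Nker hp); rewrite !ger0_norm; lra.
  have nn z : 0 <= 2 `^ p * (N z * f z) by rewrite !mulr_ge0 ?Nker_ge0// ltW.
  have b z : Gk lam y z * (f z - f (2 * lam - z)) <=
     2 `^ p * (N z * f z) + 2 `^ p * (N (2 * lam - z) * f (2 * lam - z)).
    have n1 := nn z; have n2 := nn (2 * lam - z).
    have [zl|lz|<-] := ltgtP z lam.
    - have lz : lam < 2 * lam - z by lra.
      have := bb _ lz; rewrite GkN subKr => h.
      by apply: (@le_trans _ _ (- Gk lam y z * (f (2 * lam - z) - f z))); [lra|lra].
    - by have := bb _ lz; lra.
    have -> : 2 * z - z = z by ring.
    by rewrite subrr mulr0 addr_ge0.
  have h := I_le iG (intgD i1 ier) b.
  rewrite (ID i1 ier) (I_refl (2 * lam) i1) in h.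
  have := ler_wpM2l (_ : 0 <= sig s / 2) h; rewrite divr_ge0 ?(ltW s0)// => /(_ isT).
  by rewrite /C; move: (\int[mu]_y _) (\int[mu]_y _) => A B; lra.
have C0 : 0 <= C.
  rewrite mulr_ge0 ?(ltW s0)//; apply: I_ge0 => y.
  by rewrite !mulr_ge0 ?Nker_ge0// ltW.
have supT : has_sup T.
  split; first by exists 0; left.
  by exists C => _ [->//|[y ly ->]]; exact: bd.
have ub t : T t -> t <= sup T by move=> Tt; exact: sup_upper_bound supT _ Tt.
have S0 : 0 <= sup T by apply: ub; left.
have th0 : 0 <= th by rewrite mulr_ge0 ?(ltW s0)//; apply: I_ge0 => y; exact: excess_ge0.
have Sle : sup T <= sup T * th.
  apply: ge_sup; first by exists 0; left.
  move=> _ [->|[y ly ->]]; first exact: mulr_ge0.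
  by apply: gap_le => // z lz; apply: ub; right; exists z.
have : sup T <= 0.
  rewrite leNgt; apply/negP => Sp; move: Sle.
  by rewrite leNgt gtr_pMr// th1.
by apply: le_trans; apply: ub; right; exists x.
Qed.

(** A zero of the gap forces f to be symmetric about [lam]. Since K and e^u each compare in the same
    direction under the reflection, K alone is symmetric about [lam]; being even, it has period 2
    [lam] on the half line and is constant by monotonicity. *)
Lemma gap_lt0 lam : 0 < lam -> (forall x, lam < x -> gap lam x <= 0) ->
  forall x, lam < x -> gap lam x < 0.
Proof.
move=> l0 gl x lx; rewrite lt_neqAle gl// andbT; apply/negP => /eqP g0.
(* Both factors change sign under reflection in [lam], so [g] is nonnegative on the whole line; its
   integral is a negative multiple of the gap at x, which is 0. *)
pose g y := Gk lam x y * (f (2 * lam - y) - f y).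
have frefl y : lam < y -> f y <= f (2 * lam - y).
  move=> ly; apply: ler_pM; [exact: ltW|exact: expR_ge0|by apply: K_refl => //; exact: ltW|].
  by rewrite ler_expR -subr_le0; exact: gl.
have cf : continuous f by exact: Kexp_cont.
have cg : continuous g.
  move=> y; apply: cvgM; first exact: Gk_cont.
  apply: cvgB; last exact: cf.
  apply: (@continuous_comp _ _ _ (fun y => 2 * lam - y) f); last exact: cf.
  by apply: cvgB; [exact: cvg_cst|exact: cvg_id].
have g_ge0 y : 0 <= g y.
  have [yl|ly|yE] := ltgtP y lam.
  - have ly : lam < 2 * lam - y by lra.
    have := frefl _ ly; rewrite subKr => h; have := Gk_gt0 lx ly; rewrite GkN => G0.
    by rewrite /g -mulrNN mulr_ge0//; [exact: ltW|rewrite opprB subr_ge0].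
  - by rewrite /g; apply: mulr_ge0; [exact: ltW (Gk_gt0 lx ly)|rewrite subr_ge0; exact: frefl].
  have yy : 2 * lam - y = y by rewrite yE; ring.
  by rewrite /g yy subrr mulr0.
have ig : intg g.
  by apply: eq_intg (intgB (iGfr lam x) (iGf lam x)) => y; rewrite /g mulrBr.
have Ig : \int[mu]_y g y = 0.
  move: g0; rewrite gapE => /eqP; rewrite mulf_eq0 gt_eqF ?divr_gt0//= => /eqP h.
  rewrite -[RHS]oppr0 -h -IN.
    by apply: eq_I => y; rewrite /g; ring.
  by apply: eq_intg (intgN ig) => y; rewrite /g; ring.
have gz := I_eq0 cg ig g_ge0 Ig.
have Keq y : lam < y -> K (2 * lam - y) = K y.
  move=> ly; have /eqP := gz y; rewrite mulf_eq0 (gt_eqF (Gk_gt0 lx ly))/= subr_eq0 => /eqP fE.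
  apply/eqP; rewrite eq_le (K_refl (ltW l0) ly) andbT leNgt; apply/negP => Klt.
  have : f y < f (2 * lam - y).
    apply: lt_le_trans (_ : K (2 * lam - y) * expR (u y) <= _).
      by rewrite ltr_pM2r ?expR_gt0.
    apply: ler_wpM2l; first exact: ltW.
    by rewrite ler_expR -subr_le0; exact: gl.
  by rewrite fE ltxx.
(* Reflecting 2 lam + y about lam gives -y, and evenness of K turns the symmetry into a period. *)
have Kper z n : 0 <= z -> K (z + n%:R * (2 * lam)) = K z.
  move=> z0; elim: n => [|n IH]; first by rewrite mul0r addr0.
  have zn : 0 <= n%:R * (2 * lam) by rewrite mulr_ge0// mulr_ge0// ltW.
  have ly : lam < 2 * lam + (z + n%:R * (2 * lam)) by lra.
  have := Keq _ ly; have -> : 2 * lam - (2 * lam + (z + n%:R * (2 * lam))) = - (z + n%:R * (2 * lam)) by ring.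
  rewrite eK IH => ->; congr K; rewrite -natr1; ring.
apply: ncK; exists (K 0).
suff h z : 0 <= z -> K z = K 0.
  move=> z; have [/h//|/ltW z0] := leP 0 z.
  by rewrite -eK; apply: h; rewrite oppr_ge0.
move=> z0; apply/eqP; rewrite eq_le; apply/andP; split; first by apply: dK; rewrite normr0.
pose n := (Num.truncn (z / (2 * lam))).+1.
rewrite -(Kper 0 n (lexx 0)) add0r; apply: dK.
have l2 : 0 < 2 * lam by rewrite mulr_gt0.
have n0 : 0 <= n%:R * (2 * lam) by apply: mulr_ge0; [exact: ler0n|exact: ltW].
rewrite (ger0_norm z0) (ger0_norm n0) -ler_pdivrMr; last exact: l2.
by apply: ltW; exact: truncnS_gt.
Qed.

(** Let [B] be the set of bad planes. At each of them the contraction factor is at least 1, so [B]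
    is bounded by the smallness of tails. At its supremum M the gap is nonpositive by continuity and
    then strictly negative; hence the excess along bad planes tending to M converges pointwise to 0,
    and dominated convergence contradicts the factor being at least 1. *)
Lemma gap_le0 lam x : 0 <= lam -> lam < x -> gap lam x <= 0.
Proof.
move=> l0 lx; rewrite leNgt; apply/negP => gpos.
pose B := [set l | 0 <= l /\ exists2 y, l < y & 0 < gap l y].
have Bl : B lam by split => //; exists x.
have p2 : 0 < 2 `^ p :> R by rewrite powR_gt0.
have e0 : 0 < (2 * (sig s * 2 `^ p))^-1 by rewrite invr_gt0 mulr_gt0// mulr_gt0.
have [n hn] := tail_small intg_Nf e0.
have thB l : B l -> 1 <= sig s * \int[mu]_y excess l y.
  move=> [l_0 [y ly gy]]; rewrite leNgt; apply/negP => th.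
  by have := gap_contract l_0 th ly; rewrite leNgt gy.
have ubB : ubound B n%:R.
  move=> l Bl'; have [l_0 _] := Bl'; rewrite leNgt; apply/negP => nl.
  have := thB _ Bl'; rewrite leNgt => /negP; apply.
  pose T y := if n%:R < `|y| then `|N y * f y| else 0.
  have iT : intg T.
    have mNf := intg_meas intg_Nf.
    have mT : measurable_fun setT T by apply: mfif; mfun.
    by apply: (intg_le mT _ (intg_norm intg_Nf)) => y; rewrite /T; case: ifP => _; rewrite ?normr_id// normr0.
  have b y : excess l y <= 2 `^ p * T y.
    have [ly|yl] := ltP l y.
      apply: le_trans (ler_norm _) _; apply: le_trans (excess_le y l_0) _.
      rewrite /T ger0_norm ?(lt_trans nl ly)//; last by lra.
      by apply: ler_wpM2l; [exact: ltW|exact: ler_norm].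
    rewrite /excess ltNge yl /= mulr_ge0 ?(ltW p2)// /T.
    by case: ifP.
  have := I_le (excess_intg l_0) (intgZ _ iT) b; rewrite (IZ _ iT) => h.
  apply: le_lt_trans (ler_wpM2l (ltW s0) h) _.
  rewrite mulrA; apply: le_lt_trans (ler_wpM2l (_ : 0 <= sig s * 2 `^ p) hn) _.
    by rewrite mulr_ge0 ?(ltW s0)// ltW.
  rewrite invfM mulrCA divff ?mulr1; first by rewrite invf_lt1//; lra.
  by rewrite gt_eqF// mulr_gt0.
have supB : has_sup B by split; [exists lam|exists n%:R].
set M := sup B.
have BM l : B l -> l <= M by move=> Bl'; exact: sup_upper_bound supB _ Bl'.
have M0 : 0 <= M by apply: le_trans l0 (BM _ Bl).
have gM y : M < y -> gap M y <= 0.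
  move=> My; pose ln n := M + (y - M) / 2 * en n.
  have yM : 0 < (y - M) / 2 by rewrite divr_gt0// subr_gt0.
  have cln : ln n @[n --> \oo] --> M.
    rewrite -[X in _ --> X]addr0; apply: cvgD; first exact: cvg_cst.
    by apply: cvgZ0; exact: en_cvg.
  have cg : gap (ln n) y @[n --> \oo] --> gap M y.
    apply: cvgB; first exact: cvg_cst.
    apply: (cvg_comp (fun n => 2 * ln n - y) u); last exact: cu.
    by apply: cvgB; [apply: cvgM; [exact: cvg_cst|exact: cln]|exact: cvg_cst].
  apply: (lim_le cg) => k; rewrite leNgt; apply/negP => gk.
  have e1 : 0 < (y - M) / 2 * en k by rewrite mulr_gt0// en_gt0.
  have e2 : (y - M) / 2 * en k <= (y - M) / 2 by rewrite ler_piMr ?(ltW yM)// en_le1.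
  have : ln k <= M.
    apply: BM; split; first by rewrite /ln; lra.
    by exists y => //; rewrite /ln; lra.
  by rewrite /ln; lra.
have BltM l : B l -> l < M.
  move=> Bl'; rewrite lt_neqAle BM// andbT; apply/negP => /eqP lM.
  by case: Bl' => _ [y]; rewrite lM => /gM; rewrite leNgt => /negP.
have Mp : 0 < M by apply: le_lt_trans l0 (BltM _ Bl).
have gM' := gap_lt0 Mp gM.
have ex k : exists l, B l /\ M - en k < l.
  by have [l Bl' h] := sup_adherent (en_gt0 k) supB; exists l.
have [be hbe] := choice ex.
have cbe : be k @[k --> \oo] --> M.
  apply: (cvg_bound _ (@en_cvg R)) => k; have [/BltM h1 h2] := hbe k.
  by rewrite ler0_norm; lra.
have be0 k : 0 <= be k by have [[]] := hbe k.
have cv y : excess (be k) y @[k --> \oo] --> (0 : R).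
  have [yM|My|yM] := ltgtP y M.
  - apply: cvg_near_cst; have e : 0 < M - y by rewrite subr_gt0.
    have /cvgrPdist_lt/(_ _ e)[m _ hm] := cbe; exists m => // k mk; rewrite /excess.
    have := hm k mk; rewrite /= ltr_norml => /andP[_ h].
    by rewrite ltNge (_ : y <= be k)//; lra.
  - have gy := gM' y My; apply: cvg_near_cst.
    have cg : gap (be n) y @[n --> \oo] --> gap M y.
      apply: cvgB; first exact: cvg_cst.
      apply: (cvg_comp (fun n => 2 * be n - y) u); last exact: cu.
      by apply: cvgB; [apply: cvgM; [exact: cvg_cst|exact: cbe]|exact: cvg_cst].
    have e : 0 < - gap M y by rewrite oppr_gt0.
    have /cvgrPdist_lt/(_ _ e)[m _ hm] := cg; exists m => // k mk; rewrite /excess.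
    have := hm k mk; rewrite /= ltr_norml => /andP[h _].
    by rewrite (_ : 0 < gap (be k) y = false) ?andbF//; apply/negbTE; rewrite -leNgt; lra.
  (* At y = M the gap gives no strict sign; here the weight N (y - lam) in [excess] vanishes in the
     limit. *)
  have cN : (2 `^ p * f y) * N (y - be k) @[k --> \oo] --> (2 `^ p * f y) * N (y - M).
    apply: cvgMl_tmp; apply: (cvg_comp (fun n => y - be n) N); last exact: Nker_cont.
    by apply: cvgB; [exact: cvg_cst|exact: cbe].
  rewrite yM subrr (Nker0 hp) mulr0 -yM in cN.
  apply: (cvg_bound _ cN) => k; rewrite subr0 ger0_norm ?excess_ge0// /excess.
  case: ifP => _; first by rewrite mulrAC.
  by rewrite !mulr_ge0 ?Nker_ge0 ?(ltW p2)// ltW.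
have [_ cI] := dct (fun k => excess_meas (be k)) (intgZ (2 `^ p) intg_Nf)
  (fun k y => excess_le y (be0 k)) cv.
rewrite I0 in cI.
have := lim_ge (cvgZ0 (sig s) cI) (fun k => thB _ (hbe k).1).
by rewrite leNgt ltr01.
Qed.

Lemma half_monotone :
  (forall x, 0 < x -> u x <= u (- x)) /\ (forall x y, 0 <= y < x -> u x < u y).
Proof.
split=> [x x0|x y /andP[y0 yx]].
  by have := gap_le0 (lexx 0) x0; rewrite /gap mulr0 sub0r subr_le0.
have l0 : 0 < (x + y) / 2 by rewrite divr_gt0//; lra.
have lx : (x + y) / 2 < x by lra.
have := gap_lt0 l0 (fun z => @gap_le0 _ z (ltW l0)) lx.
rewrite /gap (_ : 2 * ((x + y) / 2) - x = y); last by field.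
by rewrite subr_lt0.
Qed.

End Fixed.

(** The reflection of [u] solves the same equation, so the comparison at the plane 0 holds in both
    directions and yields evenness. *)
Lemma symmetry u a : continuous u -> intg (fun x => K x * expR (u x)) ->
  (forall x, u x = a - sig s * Pot s (fun x => K x * expR (u x)) x) ->
  even_fun u /\ (forall x y, `|x| < `|y| -> u y < u x).
Proof.
move=> cu fi uE; have [h1 h2] := half_monotone cu fi uE.
pose v x := u (- x).
have cv : continuous v.
  move=> x; apply: (@continuous_comp _ _ _ (fun x => - x) u); last exact: cu.
  by apply: cvgN; exact: cvg_id.
have fvE x : K x * expR (v x) = K (0 - x) * expR (u (0 - x)) by rewrite sub0r eK.
have iv : intg (fun x => K x * expR (v x)).
  by apply: eq_intg (intg_refl 0 fi) => x; rewrite fvE.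
have vE x : v x = a - sig s * Pot s (fun x => K x * expR (v x)) x.
  rewrite /v uE; congr (_ - _ * _); rewrite /Pot -(I_refl 0 (pot_intg hs (- x) fi)).
  apply: eq_I => y; rewrite fvE !sub0r NkerN; congr ((_ - _) * _).
  have -> : - x - - y = - (x - y) by ring.
  by rewrite NkerN.
have [h3 _] := half_monotone cv iv vE.
have eu : even_fun u.
  have e x : 0 < x -> u (- x) = u x.
    move=> x0; apply/eqP; rewrite eq_le h1// andbT.
    by have := h3 x x0; rewrite /v opprK.
  move=> x; have [x0|x0|<-] := ltgtP 0 x; [exact: e| |by rewrite oppr0].
  by have := e (- x); rewrite oppr_gt0 opprK => /(_ x0) ->.
split => // x y xy.
have ua z : u z = u `|z|.
  by have [z0|z0] := leP 0 z; [rewrite ger0_norm|rewrite ltr0_norm// eu].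
by rewrite (ua x) (ua y); apply: h2; rewrite normr_ge0.
Qed.

End MovingPlanes.

(** * Regularity *)

Section LocalLipschitz.
Context {R : realType}.
Implicit Types (f g h : R -> R) (a b c x y z M : R).

Definition lip_loc f := forall M, exists2 c, 0 <= c &
  forall x y, `|x| <= M -> `|y| <= M -> `|f x - f y| <= c * `|x - y|.

Lemma bounded_loc f M : continuous f -> exists2 c, 0 <= c & forall x, `|x| <= M -> `|f x| <= c.
Proof.
move=> cf; pose K := `|M|.
have K0 : - K <= K by rewrite /K; have : 0 <= `|M| by []; lra.
have cfn : {within `[- K, K], continuous (fun x => `|f x|)}.
  apply: continuous_subspaceT => x; apply: continuous_comp; [exact: cf|exact: norm_continuous].
have [x0 _ hx0] := EVT_max K0 cfn.
exists `|f x0| => // x xM; apply: hx0; rewrite in_itv/= -ler_norml.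
by apply: le_trans xM _; exact: ler_norm.
Qed.

Lemma lip_locW f M : lip_loc f -> exists c, [/\ 0 <= c, (forall x, `|x| <= M -> `|f x| <= c) &
  forall x y, `|x| <= M -> `|y| <= M -> `|f x - f y| <= c * `|x - y|].
Proof.
move=> /(_ `|M|)[c c0 hc]; exists (`|f 0| + c * `|M| + c).
have MM x : `|x| <= M -> `|x| <= `|M| by move=> /le_trans; apply; exact: ler_norm.
have b0 : 0 <= `|f 0| + c * `|M| by rewrite addr_ge0// mulr_ge0.
split=> [|x /MM xM|x y /MM xM /MM yM]; first by rewrite addr_ge0.
  have := hc x 0 xM; rewrite normr0 subr0 => /(_ (normr_ge0 M)) h.
  rewrite -[f x](subrK (f 0)); apply: le_trans (ler_normD _ _) _.
  by have := ler_wpM2l c0 xM; lra.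
by apply: le_trans (hc x y xM yM) _; apply: ler_wpM2r => //; rewrite lerDr.
Qed.

Lemma lip_loc_cont f : lip_loc f -> continuous f.
Proof.
move=> lf x; have [c c0 hc] := lf (`|x| + 1).
apply/cvgrPdist_lt => e e0.
have c1 : 0 < c + 1 by rewrite ltr_wpDl.
pose d := Num.min 1 (e / (c + 1)).
have d0 : 0 < d by rewrite lt_min ltr01 divr_gt0.
apply/nbhs_ballP; exists d => //= y; rewrite /ball/= lt_min => /andP[y1 y2].
have x1 : `|x| <= `|x| + 1 by rewrite lerDl.
have yM : `|y| <= `|x| + 1.
  have -> : y = x - (x - y) by ring.
  by apply: le_trans (ler_normB _ _) _; rewrite lerD2l ltW.
apply: le_lt_trans (hc x y x1 yM) _.
apply: (@le_lt_trans _ _ ((c + 1) * `|x - y|)); first by rewrite ler_wpM2r// lerDl.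
by rewrite mulrC -ltr_pdivlMr.
Qed.

Lemma lip_locM f g : lip_loc f -> lip_loc g -> lip_loc (fun x => f x * g x).
Proof.
move=> lf lg M; have [c [c0 bf hf]] := lip_locW M lf; have [d [d0 bg hg]] := lip_locW M lg.
exists (c * d + c * d) => [|x y xM yM]; first by rewrite addr_ge0// mulr_ge0.
have -> : f x * g x - f y * g y = f x * (g x - g y) + (f x - f y) * g y by ring.
apply: le_trans (ler_normD _ _) _; rewrite !normrM.
have h1 := ler_pM (normr_ge0 _) (normr_ge0 _) (bf x xM) (hg x y xM yM).
have h2 := ler_pM (normr_ge0 _) (normr_ge0 _) (hf x y xM yM) (bg y yM).
apply: le_trans (lerD h1 h2) _; rewrite le_eqVlt; apply/orP; left; apply/eqP; ring.
Qed.

Lemma lip_of_derive f df : (forall x, is_derive x 1 f (df x)) ->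
  (forall M, exists2 c, 0 <= c & forall x, `|x| <= M -> `|df x| <= c) -> lip_loc f.
Proof.
move=> hf hb M; have [c c0 hc] := hb M; exists c => //.
have main x y : `|x| <= M -> `|y| <= M -> x <= y -> `|f y - f x| <= c * `|y - x|.
  move=> xM yM xy; rewrite [`|y - x|]ger0_norm ?subr_ge0//; apply: (mvt_le xy) => // z /andP[z1 z2].
  apply: hc; move: xM yM; rewrite !ler_norml => /andP[x1 x2] /andP[y1 y2].
  by apply/andP; split; lra.
move=> x y xM yM; have [xy|/ltW yx] := leP x y; last exact: main.
by rewrite distrC [`|x - y|]distrC; exact: main.
Qed.

Lemma lip_loc_exp f : lip_loc f -> lip_loc (fun x => expR (f x)).
Proof.
move=> lf M; have [c [c0 bf hf]] := lip_locW M lf.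
have lexp : lip_loc (@expR R).
  apply: (lip_of_derive (df := expR)) => B.
  exact: bounded_loc (@continuous_expR R).
have [d d0 hd] := lexp c; exists (d * c) => [|x y xM yM]; first exact: mulr_ge0.
apply: le_trans (hd _ _ (bf x xM) (bf y yM)) _.
by rewrite -mulrA; apply: ler_wpM2l => //; exact: hf.
Qed.

(** Derivatives tested along sequences, the form in which dominated convergence applies. *)
Lemma seq_derive f x d :
  (forall h : nat -> R, (forall n, h n != 0) -> h n @[n --> \oo] --> (0 : R) ->
    (h n)^-1 * (f (x + h n) - f x) @[n --> \oo] --> d) -> is_derive x 1 f d.
Proof.
move=> H; have cv : h^-1 *: (f (h *: (1 : R) + x) - f x) @[h --> 0^'] --> d.
  apply/cvgr_dnbhsP => h [h0 ch]; have := H h h0 ch.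
  apply: cvg_trans; apply: near_eq_cvg; apply: nearW => n /=.
  by rewrite /GRing.scale/= mulr1 (addrC (h n) x).
have df : derivable f x 1 by apply/cvg_ex; exists d.
by split => //; rewrite /derive; exact/cvg_lim.
Qed.

Lemma derive_seq f x d (h : nat -> R) : is_derive x 1 f d -> (forall n, h n != 0) ->
  h n @[n --> \oo] --> (0 : R) -> (h n)^-1 * (f (x + h n) - f x) @[n --> \oo] --> d.
Proof.
move=> [df <-] h0 ch.
have cv : h^-1 *: (f (h *: (1 : R) + x) - f x) @[h --> 0^'] --> 'D_1 f x.
  by rewrite /derive; exact: df.
move/cvgr_dnbhsP: cv => /(_ h (conj h0 ch)).
apply: cvg_trans; apply: near_eq_cvg; apply: nearW => n /=.
by rewrite /GRing.scale/= mulr1 (addrC (h n) x).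
Qed.

End LocalLipschitz.

(** * The derivative of the potential *)

Section PotentialDerivative.
Context {R : realType}.
Local Notation mu := (@lebesgue_measure R).
Implicit Types (f g F phi rho h : R -> R) (a b c r x y z t M : R).

Variable s : R.
Hypothesis hs : 2^-1 < s < 1.
Local Notation p := (pp s).
Let hp := pp01 hs.
Let p0 : 0 < p. Proof. by case/andP: hp. Qed.
Let p1 : p < 1. Proof. by case/andP: hp. Qed.
Local Notation N := (Nker p).

(** Up to the factor p, the derivative of N away from the origin; this way of writing sgn t |t|^(p -
    1) gives 0 at t = 0. *)
Definition kd t : R := t * `|t| `^ (p - 2).

Lemma kd_norm t : `|kd t| = `|t| `^ (p - 1).
Proof.
have [->|t0] := eqVneq t 0.
  rewrite /kd mul0r normr0 powR0//; apply/eqP => h; move: p1; lra.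
have n0 : 0 < `|t| by rewrite normr_gt0.
rewrite /kd normrM (ger0_norm (powR_ge0 _ _)) -{1}(powRr1 (ltW n0)) -powRD.
  by congr powR; ring.
by rewrite (gt_eqF n0) implybT.
Qed.

Lemma kdN t : kd (- t) = - kd t.
Proof. by rewrite /kd normrN mulNr. Qed.

Lemma kd_meas : measurable_fun setT kd.
Proof. by rewrite /kd; mfun. Qed.

(** With q = |t + h| / |t| the claim reduces to |q^p - 1| <= |q - 1|. The bound carries no condition
    on the size of h, so it dominates all difference quotients at once. *)
Lemma Nker_quot t (h : R) : t != 0 -> `|N (t + h) - N t| <= `|h| * `|t| `^ (p - 1).
Proof.
move=> t0; have a0 : 0 < `|t| by rewrite normr_gt0.
rewrite /Nker; set a := `|t| in a0 *; set b := `|t + h|.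
have b0 : 0 <= b by exact: normr_ge0.
have bh : `|b - a| <= `|h|.
  by apply: le_trans (ler_dist_dist _ _) _; rewrite addrAC subrr add0r.
have a' : a `^ (p - 1) = a `^ p / a.
  by rewrite powRD; [rewrite powR_inv1// ltW|rewrite (gt_eqF a0) implybT].
have ap : 0 < a `^ p by rewrite powR_gt0.
rewrite a'; suff H : `|b `^ p - a `^ p| <= `|b - a| * (a `^ p / a).
  by apply: le_trans H _; apply: ler_wpM2r; [apply: divr_ge0; exact: ltW|exact: bh].
have bE : b `^ p = (b / a) `^ p * a `^ p.
  by rewrite -powRM ?divr_ge0 ?(ltW a0)// divfK// gt_eqF.
have baE : b - a = (b / a - 1) * a by field; rewrite gt_eqF.
have q0 : 0 <= b / a by rewrite divr_ge0// ltW.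
rewrite bE -{2}[a `^ p]mul1r -mulrBl normrM (gtr0_norm ap) baE normrM (gtr0_norm a0).
have -> : `|b / a - 1| * a * (a `^ p / a) = `|b / a - 1| * a `^ p by field; rewrite gt_eqF.
apply: ler_wpM2r; first exact: ltW.
set q := b / a in q0 *; have [q1|q1] := leP 1 q.
  have h1 : 1 <= q `^ p by apply: powR_ge1 => //; exact: ltW.
  have h2 : q `^ p <= q by apply: ler1_powR => //; exact: ltW.
  by rewrite !ger0_norm; lra.
have h1 : q `^ p <= 1.
  have : q `^ p <= 1 `^ p by apply: le_powRr; [exact: ltW|rewrite q0/=; exact: ltW].
  by rewrite powR1.
have h2 : q <= q `^ p.
  have [->|qn] := eqVneq q 0; first exact: powR_ge0.
  by apply: ger1_powR; [rewrite lt_neqAle eq_sym qn q0 ltW|exact: ltW].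
by rewrite !ler0_norm; lra.
Qed.

Definition sng t : R := if `|t| <= 1 then `|t| `^ (- (1 - p)) else 0.

Lemma intg_sng : intg sng.
Proof. by apply: intg_sing; apply/andP; split; move: p0 p1; lra. Qed.

Lemma sng_ge0 t : 0 <= sng t.
Proof. by rewrite /sng; case: ifP => // _; exact: powR_ge0. Qed.

Lemma kd_sng t : `|kd t| <= sng t + 1.
Proof.
rewrite kd_norm /sng; have -> : p - 1 = - (1 - p) by ring.
case: ifPn => [t1|]; first by rewrite lerDl.
rewrite -ltNge => t1; rewrite add0r powRV_le1//; first by move: p1; lra.
exact: ltW.
Qed.

Lemma kd_bound g c x y : 0 <= c -> (forall z, `|x - z| <= 1 -> `|g z| <= c) ->
  `|kd (x - y)| * `|g y| <= c * sng (x - y) + `|g y|.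
Proof.
move=> c0 hc; apply: le_trans (ler_wpM2r (normr_ge0 _) (kd_sng _)) _.
rewrite mulrDl mul1r lerD2r /sng; case: ifPn => [xy|_]; last by rewrite mul0r mulr0.
by rewrite mulrC; apply: ler_wpM2r; [exact: powR_ge0|exact: hc].
Qed.

Section OneDensity.
Variable g : R -> R.
Hypotheses (cg : continuous g) (ig : intg g).

Definition Qk x := \int[mu]_y (kd (x - y) * g y).

Let mg : measurable_fun setT g. Proof. exact: intg_meas ig. Qed.

Let gloc x M : `|x| <= M -> forall c, (forall z, `|z| <= M + 1 -> `|g z| <= c) ->
  forall z, `|x - z| <= 1 -> `|g z| <= c.
Proof.
move=> xM c hc z xz; apply: hc; have -> : z = x - (x - z) by ring.
by apply: le_trans (ler_normB _ _) _; exact: lerD.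
Qed.

Let isng x : intg (fun y => sng (x - y)). Proof. exact: intg_refl intg_sng. Qed.

Lemma Qk_intg x : intg (fun y => kd (x - y) * g y).
Proof.
have [c c0 hc] := bounded_loc (`|x| + 1) cg.
have m : measurable_fun setT (fun y => kd (x - y) * g y).
  have mk : measurable_fun setT (fun y => kd (x - y)) by apply: (mfcomp kd_meas); mfun.
  by mfun.
have b y : `|kd (x - y) * g y| <= c * sng (x - y) + `|g y|.
  by rewrite normrM; apply: kd_bound => //; exact: (gloc (lexx _) hc).
exact: intg_le m b (intgD (intgZ c (isng x)) (intg_norm ig)).
Qed.

Lemma Qk_loc M : exists2 c, 0 <= c & forall x, `|x| <= M -> `|Qk x| <= c.
Proof.
have [c c0 hc] := bounded_loc (M + 1) cg.
exists (c * \int[mu]_y sng y + \int[mu]_y `|g y|).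
  by rewrite addr_ge0 ?mulr_ge0//; apply: I_ge0 => // y; exact: sng_ge0.
move=> x xM.
rewrite -(I_refl x intg_sng) -(IZ _ (isng x)) -(ID (intgZ _ (isng x)) (intg_norm ig)).
apply: (I_norm_le (Qk_intg x) (intgD (intgZ _ (isng x)) (intg_norm ig))) => y.
by rewrite normrM; apply: kd_bound => //; exact: (gloc xM hc).
Qed.

Lemma pot_derive x : is_derive x 1 (Pot s g) (p * Qk x).
Proof.
apply: seq_derive => h h0 ch.
have [c c0 hc] := bounded_loc (`|x| + 1) cg.
(* At y = x the difference quotient of N is unbounded as h tends to 0; changing g at this one point
   makes the domination hold everywhere without altering the integrals. *)
pose gx y := if y == x then 0 else g y.
have mgx : measurable_fun setT gx.
  have me : measurable_fun setT (fun y : R => y == x) by exact: measurable_fun_eqr.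
  by apply: mfif; mfun.
have nx : {ae mu, forall y : R, y != x}.
  exists [set x]; split; [exact: measurable_set1|exact: lebesgue_measure_set1|].
  by move=> y /= /negP; rewrite negbK => /eqP.
have gxE F : measurable_fun setT F -> \int[mu]_y (F y * gx y) = \int[mu]_y (F y * g y).
  move=> mF; apply: I_ae; [by mfun|by mfun|].
  by apply: ae_sub nx => y yx; rewrite /gx (negbTE yx).
have mD n : measurable_fun setT (fun y => (h n)^-1 * (N (x + h n - y) - N (x - y))).
  by rewrite /Nker; mfun.
have mk : measurable_fun setT (fun y => p * kd (x - y)).
  have := kd_meas => ?; have mm : measurable_fun setT (fun y => kd (x - y)) by apply: (mfcomp kd_meas); mfun.
  by mfun.
have bnd n y : `|(h n)^-1 * (N (x + h n - y) - N (x - y)) * gx y| <= c * sng (x - y) + `|g y|.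
  rewrite /gx; have [yx|yx] := eqVneq y x.
    by rewrite mulr0 normr0 addr_ge0// mulr_ge0// sng_ge0.
  have xy0 : x - y != 0 by rewrite subr_eq0 eq_sym.
  rewrite normrM; apply: (@le_trans _ _ (`|kd (x - y)| * `|g y|)).
    apply: ler_wpM2r => //; rewrite kd_norm normrM normfV.
    rewrite ler_pdivrMl ?normr_gt0//.
    by have := Nker_quot (h n) xy0; rewrite addrAC.
  by apply: kd_bound => //; exact: (gloc (lexx _) hc).
have cv y : (h n)^-1 * (N (x + h n - y) - N (x - y)) * gx y @[n --> \oo] --> p * kd (x - y) * gx y.
  rewrite /gx; have [yx|yx] := eqVneq y x.
    rewrite mulr0; apply: cvg_near_cst; apply: nearW => n; by rewrite mulr0.
  have xy0 : x - y != 0 by rewrite subr_eq0 eq_sym.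
  apply: cvgM; last exact: cvg_cst.
  have := derive_seq (powR_abs_derive p xy0) h0 ch.
  apply: cvg_trans; apply: near_eq_cvg; apply: nearW => n; by rewrite /Nker addrAC.
have mF n : measurable_fun setT (fun y => (h n)^-1 * (N (x + h n - y) - N (x - y)) * gx y).
  by have := mD n => ?; mfun.
have [_] := dct mF (intgD (intgZ c (isng x)) (intg_norm ig)) bnd cv.
rewrite (gxE _ mk).
have -> : \int[mu]_y (p * kd (x - y) * g y) = p * Qk x.
  by rewrite /Qk -(IZ _ (Qk_intg x)); apply: eq_I => y; rewrite mulrA.
apply: cvg_trans; apply: near_eq_cvg; apply: nearW => n.
rewrite (gxE _ (mD n)).
have i1 := pot_intg hs (x + h n) ig; have i2 := pot_intg hs x ig.
rewrite /Pot -(IB i1 i2) -(IZ _ (intgB i1 i2)); apply: eq_I => y; ring.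
Qed.

(** The kernel splits into a globally Lipschitz part [kb] and an integrable part [ka] supported in
    [-1, 1]. In [Qk_lip] the increment falls on the kernel for the first and on the locally
    Lipschitz density for the second. *)
Definition kb t : R := if `|t| <= 1 then t else kd t.
Definition ka t : R := if `|t| <= 1 then kd t - t else 0.

Lemma kdab t : kd t = kb t + ka t.
Proof. by rewrite /kb /ka; case: ifP => _; [rewrite addrC subrK|rewrite addr0]. Qed.

Let kdE t : 0 < t -> kd t = t `^ (p - 1).
Proof.
move=> t0; have := kd_norm t; rewrite !gtr0_norm//.
by rewrite /kd mulr_gt0// powR_gt0// normr_gt0 gt_eqF.
Qed.

Let kb_pos t : 1 < t -> t^-1 <= kd t <= 1.
Proof.
move=> t1; have t0 : 0 < t by lra.
rewrite kdE//; apply/andP; split.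
  by rewrite -(powR_inv1 (ltW t0)); apply: ler_powR; [exact: ltW|move: p0; lra].
have -> : p - 1 = - (1 - p) by ring.
by apply: powRV_le1; [move: p1; lra|exact: ltW].
Qed.

(** Beyond 1 the product t kd t = t^p increases, so kd t - kd t' <= 1 - t / t' <= t' - t. Across the
    point 1 the bound kd t' >= 1 / t' >= 2 - t' is enough. *)
Let kb_lip_pos t t' : 0 <= t -> t <= t' -> `|kb t - kb t'| <= t' - t.
Proof.
move=> t0 tt; have t0' : 0 <= t' by lra.
rewrite /kb (ger0_norm t0) (ger0_norm t0').
have inv (x : R) : 1 < x -> 2 - x <= x^-1.
  move=> x1; have x0 : 0 < x by lra.
  have n0 : x != 0 by rewrite gt_eqF.
  rewrite -(ler_pM2l x0) mulfV//; have := sqr_ge0 (x - 1); lra.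
have [t'1|t'1] := leP t' 1.
  by rewrite (le_trans tt t'1) distrC ger0_norm ?subr_ge0.
have /andP[k1 k2] := kb_pos t'1; have i' := inv _ t'1.
have [t1|t1] := leP t 1.
  by rewrite ler_norml; apply/andP; split; lra.
have /andP[k3 k4] := kb_pos t1; have i := inv _ t1.
have p' : 0 < t by lra. have p'' : 0 < t' by lra.
have mono : kd t' <= kd t.
  rewrite !kdE//; have -> : p - 1 = - (1 - p) by ring.
  by apply: le_powRN; [move: p1; lra|rewrite p' tt].
rewrite ger0_norm ?subr_ge0//.
have E : kd t * (t / t') <= kd t'.
  rewrite !kdE//; have r0 : 0 < t / t' <= 1.
    by rewrite divr_gt0//= ler_pdivrMr// mul1r.
  have [r1 r2] := andP r0.
  have h : t / t' <= (t / t') `^ (1 - p) by apply: ger1_powR => //; move: p0; lra.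
  apply: le_trans (ler_wpM2l (powR_ge0 _ _) h) _.
  have -> : t `^ (p - 1) * (t / t') `^ (1 - p) = t' `^ (p - 1); last exact: lexx.
  rewrite powRM ?invr_ge0 ?(ltW p'')// mulrA -powRD; last by rewrite (gt_eqF p') implybT.
  have -> : p - 1 + (1 - p) = 0 by ring.
  rewrite powRr0 mul1r -(powR_inv1 (ltW p'')) -powRrM; congr powR; ring.
have h2 : kd t * (1 - t / t') <= 1 * (1 - t / t').
  by apply: ler_wpM2r => //; rewrite subr_ge0 ler_pdivrMr// mul1r.
have h3 : 1 - t / t' <= t' - t.
  have -> : 1 - t / t' = (t' - t) / t' by field; rewrite gt_eqF.
  by rewrite ler_pdivrMr// ler_peMr ?subr_ge0// ltW.
lra.
Qed.

Let kb_odd t : kb (- t) = - kb t.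
Proof. by rewrite /kb normrN kdN; case: ifP. Qed.

Let kb_abs t : 0 <= t -> 0 <= kb t <= t.
Proof.
move=> t0; rewrite /kb ger0_norm//; case: ifPn => [_|]; first by rewrite t0 lexx.
rewrite -ltNge => t1; have /andP[h1 h2] := kb_pos t1.
apply/andP; split; last by lra.
by apply: le_trans h1; rewrite invr_ge0.
Qed.

Lemma kb_lip t t' : `|kb t - kb t'| <= `|t - t'|.
Proof.
wlog tt : t t' / t <= t'.
  move=> H; have [/H//|/ltW/H] := leP t t'.
  by rewrite distrC [`|t' - t|]distrC.
rewrite [`|t - t'|]distrC [`|t' - t|]ger0_norm ?subr_ge0//.
have [t0|t0] := leP 0 t; first exact: kb_lip_pos.
have [t'0|t'0] := leP t' 0.
  have h := @kb_lip_pos (- t') (- t); rewrite !kb_odd in h.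
  have -> : kb t - kb t' = - kb t' - - kb t by ring.
  have -> : t' - t = - t - - t' by ring.
  by apply: h; lra.
have nt : 0 <= - t by rewrite oppr_ge0 ltW.
have /andP[a1 a2] := kb_abs (ltW t'0); have /andP[b1 b2] := kb_abs nt.
rewrite kb_odd in b1 b2; rewrite ler_norml; apply/andP; split; lra.
Qed.

Lemma ka_intg : intg ka.
Proof.
have m : measurable_fun setT ka by have := kd_meas => ?; rewrite /ka; apply: mfif; mfun.
have b t : `|ka t| <= 2 * sng t.
  rewrite /ka /sng; case: ifPn => [t1|_]; last by rewrite normr0 mulr0.
  apply: le_trans (ler_normB _ _) _; rewrite kd_norm.
  have -> : - (1 - p) = p - 1 by ring.
  suff : `|t| <= `|t| `^ (p - 1) by lra.
  have [->|t0] := eqVneq t 0; first by rewrite normr0 powR_ge0.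
  by apply: ger1_powR; [rewrite normr_gt0 t0|move: p1; lra].
exact: intg_le m b (intgZ 2 intg_sng).
Qed.

Lemma Qk_lip : lip_loc g -> lip_loc Qk.
Proof.
move=> lg M; have [c c0 hc] := lg (M + 1).
pose I := \int[mu]_y `|g y|; pose A := \int[mu]_t `|ka t|.
have I_0 : 0 <= I by exact: I_ge0.
have A_0 : 0 <= A by exact: I_ge0.
have [d d0 hd] := bounded_loc (M + 1) cg.
have ika x : `|x| <= M -> intg (fun t => ka t * g (x - t)).
  move=> xM; have mk := intg_meas ka_intg.
  have mgx : measurable_fun setT (fun t => g (x - t)) by apply: (mfcomp mg); mfun.
  have m : measurable_fun setT (fun t => ka t * g (x - t)) by mfun.
  have b t : `|ka t * g (x - t)| <= d * `|ka t|.
    rewrite normrM mulrC; have [t1|t1] := leP `|t| 1.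
      apply: ler_wpM2r => //; apply: hd; apply: le_trans (ler_normB _ _) _; exact: lerD.
    by rewrite /ka (lt_geF t1) normr0 !mulr0.
  exact: intg_le m b (intgZ d (intg_norm ka_intg)).
have ikb x : `|x| <= M -> intg (fun y => kb (x - y) * g y).
  move=> xM; apply: eq_intg (intgB (Qk_intg x) (intg_refl x (ika x xM))) => y.
  by rewrite kdab subKr; ring.
have QE x : `|x| <= M -> Qk x = \int[mu]_y (kb (x - y) * g y) + \int[mu]_t (ka t * g (x - t)).
  move=> xM; have i1 := ikb x xM; have i2 := ika x xM.
  rewrite -(I_refl x i2) -(ID i1 (intg_refl x i2)); apply: eq_I => y.
  by rewrite subKr kdab mulrDl.
exists (I + c * A) => [|x y xM yM]; first by rewrite addr_ge0// mulr_ge0.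
rewrite (QE x xM) (QE y yM).
have j1 := ikb x xM; have j2 := ikb y yM; have j3 := ika x xM; have j4 := ika y yM.
have b1 : `|\int[mu]_z (kb (x - z) * g z) - \int[mu]_z (kb (y - z) * g z)| <= I * `|x - y|.
  rewrite -(IB j1 j2) -(IZr _ (intg_norm ig)).
  apply: (I_norm_le (intgB j1 j2) (intgZr _ (intg_norm ig))) => z.
  rewrite -mulrBl normrM mulrC; apply: ler_wpM2l => //.
  apply: le_trans (kb_lip _ _) _.
  by have -> : x - z - (y - z) = x - y by ring.
have b2 : `|\int[mu]_t (ka t * g (x - t)) - \int[mu]_t (ka t * g (y - t))| <= c * `|x - y| * A.
  rewrite -(IB j3 j4) -(IZ _ (intg_norm ka_intg)).
  apply: (I_norm_le (intgB j3 j4) (intgZ _ (intg_norm ka_intg))) => t.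
  rewrite -mulrBr normrM mulrC; have [t1|t1] := leP `|t| 1.
    apply: ler_wpM2r => //.
    have xt : `|x - t| <= M + 1 by apply: le_trans (ler_normB _ _) _; exact: lerD.
    have yt : `|y - t| <= M + 1 by apply: le_trans (ler_normB _ _) _; exact: lerD.
    apply: le_trans (hc _ _ xt yt) _.
    by have -> : x - t - (y - t) = x - y by ring.
  by rewrite /ka (lt_geF t1) normr0 !mulr0.
set a1 := Rintegral _ _ _ in b1 *; set a2 := Rintegral _ _ _ in b1 *.
set a3 := Rintegral _ _ _ in b2 *; set a4 := Rintegral _ _ _ in b2 *.
have -> : a1 + a3 - (a2 + a4) = (a1 - a2) + (a3 - a4) by ring.
apply: le_trans (ler_normD _ _) _; apply: le_trans (lerD b1 b2) _.
by rewrite le_eqVlt; apply/orP; left; apply/eqP; ring.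
Qed.

End OneDensity.

Lemma C1_lip (K : R -> R) : is_Ck 1 K ->
  [/\ forall x, is_derive x 1 K (derive1 K x), continuous (derive1 K) & lip_loc K].
Proof.
move=> [dK cK1].
have h x : is_derive x 1 K (derive1 K x).
  by rewrite derive1E; apply: DeriveDef => //; exact: (dK 0%N).
have c : continuous (derive1 K) by exact: cK1.
by split => //; apply: lip_of_derive h _ => M; exact: bounded_loc.
Qed.

(** A bootstrap: a locally bounded derivative makes v locally Lipschitz, hence f = K e^v locally
    Lipschitz, hence the derivative itself locally Lipschitz. *)
Lemma potential_regularity (K : R -> R) a b (v : R -> R) : is_Ck 1 K ->
  intg (fun x => K x * expR (v x)) ->
  (forall x, v x = a + b * x - sig s * Pot s (fun x => K x * expR (v x)) x) ->
  lip_loc v /\ let f := fun x => K x * expR (v x) in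
  [/\ continuous f, lip_loc (Qk f) & forall x, is_derive x 1 v (b - sig s * (p * Qk f x))].
Proof.
move=> C1K; have [dK cK1 lK] := C1_lip C1K.
set f := fun x => K x * expR (v x) => fi vE.
have cv : continuous v.
  have -> : v = (fun x => a + b * x - sig s * Pot s f x) by apply/funext.
  move=> x; apply: cvgB; last by apply: cvgM; [exact: cvg_cst|exact: pot_cont].
  by apply: cvgD; [exact: cvg_cst|apply: cvgM; [exact: cvg_cst|exact: cvg_id]].
have cf : continuous f.
  move=> x; apply: cvgM; first exact: (lip_loc_cont lK).
  by apply: (@continuous_comp _ _ _ v expR); [exact: cv|exact: continuous_expR].
have dv x : is_derive x 1 v (b - sig s * (p * Qk f x)).
  have h1 : is_derive x 1 (fun x => b * x + a) b.
    by have := is_derive_affine (a := b) (b := a) (x := x) (@is_derive_id R R _ 1); rewrite mulr1.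
  have := is_deriveDr h1 (is_deriveZr (- sig s) (pot_derive cf fi x)).
  rewrite mulNr; apply: is_derive_ext => y; rewrite vE; ring.
have lv : lip_loc v.
  apply: lip_of_derive dv _ => M; have [c c0 hc] := Qk_loc cf fi M.
  have s0 := sig_gt0 hs.
  exists (`|b| + sig s * (p * c)); first by rewrite addr_ge0// !mulr_ge0// ltW.
  move=> x xM; apply: le_trans (ler_normB _ _) _; rewrite lerD2l !normrM (gtr0_norm s0) (gtr0_norm p0).
  by apply: ler_wpM2l; [exact: ltW|apply: ler_wpM2l; [exact: ltW|exact: hc]].
split => //; split => //; apply: Qk_lip => //.
exact: lip_locM lK (lip_loc_exp lv).
Qed.

Lemma regularity (K u : R -> R) : (forall x, 0 < K x) -> is_Ck 1 K -> liouville_solution s K u ->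
  exists v, {ae mu, forall x, u x = v x} /\ exists2 g, 0 < g & holder_loc (2 * s + g) v.
Proof.
move=> K0 C1K su; have [dK cK1 lK] := C1_lip C1K.
have cK := lip_loc_cont lK.
have [mu' fi [a [b hab]]] := representation hs K0 cK su.
set f := fun x => K x * expR (u x) in fi hab.
pose v x := a + b * x - sig s * Pot s f x.
have mf := intg_meas fi.
have cv : continuous v.
  move=> x; apply: cvgB; last by apply: cvgM; [exact: cvg_cst|exact: pot_cont].
  by apply: cvgD; [exact: cvg_cst|apply: cvgM; [exact: cvg_cst|exact: cvg_id]].
have mv : measurable_fun setT v by exact: continuous_measurable_fun.
have mK : measurable_fun setT K by exact: continuous_measurable_fun.
have mh : measurable_fun setT (fun x => K x * expR (v x)) by mfun.
have fE : {ae mu, forall x, f x = K x * expR (v x)}.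
  by apply: ae_sub hab => x h; rewrite /f h.
have iv : intg (fun x => K x * expR (v x)) := intg_ae mh fE fi.
(* The integral equation defines v from the values of u; since u = v almost everywhere, v solves its
   own equation at every point. *)
have vE x : v x = a + b * x - sig s * Pot s (fun x => K x * expR (v x)) x.
  rewrite /v; congr (_ - _ * _); apply: I_ae.
  - by have := Ndiff_meas s x => ?; mfun.
  - by have := Ndiff_meas s x => ?; mfun.
  by apply: ae_sub fE => y h; rewrite -h.
have [lv [cf lQ dv]] := potential_regularity C1K iv vE.
(* With gamma = 1 - s the order 2 s + gamma is 1 + s: one derivative, Hoelder of exponent s < 1,
   which a locally Lipschitz derivative satisfies. *)
exists v; split => //; exists (1 - s); first by case/andP: hs; lra.
set h := fun x => K x * expR (v x) in cf lQ dv.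
have E : 2 * s + (1 - s) = 1 + s by ring.
have tr : Num.truncn (1 + s) = 1%N.
  have [s1 s2] := andP hs.
  have s0 : 0 <= 1 + s by lra.
  by apply/eqP; rewrite truncn_eq //; apply/andP; split; lra.
rewrite /holder_loc E tr.
have d1 : derive1n 1 v = (fun x => b - sig s * (p * Qk h x)).
  apply/funext => x; rewrite /derive1n/= derive1E.
  exact: (@derive_val _ _ _ _ _ _ _ (dv x)).
have lQ' : lip_loc (fun x => b - sig s * (p * Qk h x)).
  move=> M; have [c c0 hc] := lQ M; have s0 := sig_gt0 hs.
  exists (sig s * p * c) => [|x y xM yM]; first by rewrite !mulr_ge0// ltW.
  have -> : b - sig s * (p * Qk h x) - (b - sig s * (p * Qk h y)) = sig s * p * (Qk h y - Qk h x).
    by move: (Qk h x) (Qk h y) => ? ?; ring.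
  rewrite normrM (gtr0_norm (mulr_gt0 s0 p0)) -[leRHS]mulrA distrC.
  by apply: ler_wpM2l; [rewrite ltW// mulr_gt0|exact: hc].
split; first split.
- by case=> [_ x|//]; have [] := dv x.
- by rewrite d1; exact: lip_loc_cont.
move=> M; have [c c0 hc] := lQ' M; rewrite d1.
have s1 : 1 + s - 1 = s by ring.
(* From |x - y| = |x - y|^(1 - s) |x - y|^s with |x - y| at most 2 |M|. *)
exists (c * (2 * `|M|) `^ (1 - s)) => x y xM yM; rewrite s1.
apply: le_trans (hc x y xM yM) _; rewrite -mulrA; apply: ler_wpM2l => //.
have [->|xy] := eqVneq x y.
  by rewrite subrr normr0 mulr_ge0 ?powR_ge0.
have n0 : 0 < `|x - y| by rewrite normr_gt0 subr_eq0.
rewrite -{1}(powRr1 (ltW n0)) (_ : 1 = (1 - s) + s); last by ring.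
rewrite powRD; last by rewrite (gt_eqF n0) implybT.
rewrite subrK; apply: ler_wpM2r; first exact: powR_ge0.
apply: le_powRr; first by case/andP: hs; lra.
rewrite normr_ge0/=; apply: le_trans (ler_normB _ _) _.
by have := ler_norm M; lra.
Qed.

End PotentialDerivative.

(** * Uniqueness *)

Section LaplacePositivity.
Context {R : realType}.
Local Notation mu := (@lebesgue_measure R).
Implicit Types (f g F phi rho h : R -> R) (a b c r x y z t M : R).

Variable s : R.
Hypothesis hs : 2^-1 < s < 1.
Local Notation p := (pp s).
Let hp := pp01 hs.
Let p0 : 0 < p. Proof. by case/andP: hp. Qed.
Let p1 : p < 1. Proof. by case/andP: hp. Qed.

(** The integrand of the Gamma integral that represents a^(p - 1), extended evenly so that integrals
    run over the line; thus [Gl] is 2 Gamma (1 - p). *)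
Definition lap a t : R := `|t| `^ (- p) * expR (- (a * `|t|)).

Lemma lap_ge0 a t : 0 <= lap a t.
Proof. by rewrite mulr_ge0 ?powR_ge0 ?expR_ge0. Qed.

Lemma lapD a b t : lap (a + b) t = lap a t * expR (- (b * `|t|)).
Proof.
rewrite /lap; have -> : - ((a + b) * `|t|) = - (a * `|t|) + - (b * `|t|) by ring.
by rewrite expRD mulrA.
Qed.

Lemma lap_meas a : measurable_fun setT (lap a).
Proof. by rewrite /lap; mfun. Qed.

Lemma intg_lap1 : intg (lap 1).
Proof.
have [c c0 hc] := @exp_wt R 2.
have isg := intg_sing (r := p) hp.
have w2 : intg (wt (2 : R)) by apply: intg_wt; lra.
have b t : `|lap 1 t| <= (if `|t| <= 1 then `|t| `^ (- p) else 0) + c * wt 2 t.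
  rewrite ger0_norm ?lap_ge0// /lap mul1r; have h := hc `|t| (normr_ge0 t).
  have w0 : 0 <= c * wt 2 t by rewrite mulr_ge0 ?wt_ge0// ltW.
  case: ifPn => [t1|].
    apply: (@le_trans _ _ (`|t| `^ (- p))); last by rewrite lerDl.
    by rewrite ler_piMr ?powR_ge0// -expR0 ler_expR oppr_le0.
  rewrite -ltNge => t1; rewrite add0r; apply: le_trans h.
  by rewrite ler_piMl ?expR_ge0// powRV_le1// ltW.
exact: intg_le (lap_meas 1) b (intgD isg (intgZ c w2)).
Qed.

Definition Gl := \int[mu]_t lap 1 t.

Lemma lap_scale a : 0 < a -> intg (lap a) /\ \int[mu]_t lap a t = Gl * a `^ (p - 1).
Proof.
move=> a0; have an := lt0r_neq0 a0.
have E t : lap a t = a `^ p * lap 1 (a * t + 0).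
  rewrite addr0 /lap normrM (gtr0_norm a0) mul1r powRM ?(ltW a0)// !mulrA -powRD.
    by rewrite subrr powRr0 mul1r.
  by rewrite (gt_eqF a0) implybT.
have i1 := intg_affine 0 an intg_lap1.
rewrite (funext E); split; first exact: intgZ.
rewrite (IZ _ i1) /Gl (I_affine 0 an intg_lap1) (gtr0_norm a0).
have -> : a `^ (p - 1) = a `^ p / a.
  by rewrite powRD; [rewrite powR_inv1// ltW|rewrite (gt_eqF a0) implybT].
by move: (\int[mu]_t _) => I; field.
Qed.

Lemma Gl_gt0 : 0 < Gl.
Proof.
have i1 := intg_lap1.
pose m : R := 2 `^ (- p) * expR (- 2).
have m0 : 0 < m by rewrite mulr_gt0 ?expR_gt0// powR_gt0.
apply: (@lt_le_trans _ _ (\int[mu]_t (if 1 <= t <= 2 then m else 0))).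
  by rewrite I_itv_cst; [rewrite mulr_gt0//; lra|lra].
have i2 : intg (fun t => if 1 <= t <= 2 then m else 0).
  by apply: (@intg_itv R 1 2 `|m| (fun=> m)) => // ; exact: mfC.
apply: (I_le i2 i1) => t; case: ifPn => [/andP[t1 t2]|_]; last exact: lap_ge0.
rewrite /lap mul1r ger0_norm; last lra.
apply: ler_pM; [exact: powR_ge0|exact: expR_ge0| |by rewrite ler_expR; lra].
by apply: le_powRN; [exact: ltW|apply/andP; split; lra].
Qed.

Section Positivity.
Variables (d : R -> R) (C : R).
Hypotheses (id : intg d) (C0 : 0 <= C) (bd : forall x, `|d x| <= C) (d0 : d 0 = 0).
Let md : measurable_fun setT d. Proof. exact: intg_meas id. Qed.

Let D t := \int[mu]_y (d y * expR (- (`|y| * `|t|))).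
Let I := \int[mu]_y `|d y|.
Let J x := \int[mu]_y (d y * (`|x| + `|y|) `^ (p - 1)).

Let iD t : intg (fun y => d y * expR (- (`|y| * `|t|))).
Proof.
have m : measurable_fun setT (fun y => expR (- (`|y| * `|t|))) by mfun.
have b y : `|expR (- (`|y| * `|t|))| <= 1.
  by rewrite ger0_norm ?expR_ge0// -expR0 ler_expR oppr_le0 mulr_ge0.
by apply: eq_intg (intgMb id m b) => y; rewrite mulrC.
Qed.

Let bD t : `|D t| <= I.
Proof.
apply: (I_norm_le (iD t) (intg_norm id)) => y; rewrite normrM ler_piMr//.
by rewrite ger0_norm ?expR_ge0// -expR0 ler_expR oppr_le0 mulr_ge0.
Qed.

Let step x : x != 0 -> [/\ intg (fun t => lap `|x| t * D t),
  \int[mu]_t (lap `|x| t * D t) = Gl * J x &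
  \int[mu]_t `|lap `|x| t * D t| <= I * Gl * `|x| `^ (p - 1)].
Proof.
move=> x0; have ax : 0 < `|x| by rewrite normr_gt0.
have q0 : 0 <= 1 - p by move: p1; lra.
have qE : p - 1 = - (1 - p) by ring.
pose F y t := d y * lap (`|x| + `|y|) t.
have mF : measurable_fun setT (fun z : R * R => F z.1 z.2).
  have m1 : measurable_fun setT (fun z : R * R => d z.1) by apply: (mfcomp md); mfun.
  by rewrite /F /lap; mfun.
have xy y : 0 < `|x| + `|y| by rewrite ltr_wpDr.
have iF y : intg (F y) by apply: intgZ; have [] := lap_scale (xy y).
have bF y : \int[mu]_t `|F y t| <= Gl * `|x| `^ (p - 1) * `|d y|.
  have [i1 E1] := lap_scale (xy y).
  have -> : \int[mu]_t `|F y t| = `|d y| * (Gl * (`|x| + `|y|) `^ (p - 1)).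
    rewrite -E1 -(IZ _ i1); apply: eq_I => t.
    by rewrite normrM (ger0_norm (lap_ge0 _ _)).
  rewrite mulrC; apply: ler_wpM2r => //; apply: ler_wpM2l; first exact: ltW Gl_gt0.
  by rewrite qE; apply: le_powRN => //; rewrite ax lerDl normr_ge0.
have [_ j1 j2 E] := fub mF iF (intgZ _ (intg_norm id)) bF.
have FE t : \int[mu]_y F y t = lap `|x| t * D t.
  rewrite -(IZ _ (iD t)); apply: eq_I => y; rewrite /F lapD; ring.
have ilD : intg (fun t => lap `|x| t * D t) by apply: eq_intg j2 => t; exact: FE.
split; [exact: ilD| |].
  rewrite -(eq_I FE) -E.
  have E2 y : \int[mu]_t F y t = Gl * (d y * (`|x| + `|y|) `^ (p - 1)).
    by have [i1 E1] := lap_scale (xy y); rewrite (IZ _ i1) E1; ring.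
  have Gn : Gl != 0 := lt0r_neq0 Gl_gt0.
  have iJ : intg (fun y => d y * (`|x| + `|y|) `^ (p - 1)).
    by apply: eq_intg (intgZ Gl^-1 j1) => y; rewrite E2 (mulKf Gn).
  by rewrite (eq_I E2) (IZ _ iJ).
have [i1 E1] := lap_scale ax.
have -> : I * Gl * `|x| `^ (p - 1) = I * \int[mu]_t lap `|x| t by rewrite E1 mulrA.
rewrite -(IZ _ i1); apply: (I_le (intg_norm ilD) (intgZ _ i1)) => t.
by rewrite normrM (ger0_norm (lap_ge0 _ _)) mulrC; apply: ler_wpM2r; [exact: lap_ge0|exact: bD].
Qed.

(** With D the Laplace transform of [d] in |y|, Fubini turns Gl times the double integral of d (x) d
    (y) (|x| + |y|)^(p - 1) into the integral of |t|^(-p) D (t)^2. *)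
Lemma laplace_pos : intg (fun x => d x * J x) /\ 0 <= \int[mu]_x (d x * J x).
Proof.
have [iH _ _] := step (oner_neq0 R).
(* Measurability in t is known for this product, from [step] at x = 1; the general weight differs
   from it by the factor e^((1 - |x|) |t|). *)
pose H t := lap `|1 : R| t * D t.
have mH : measurable_fun setT H by exact: intg_meas iH.
pose F x t := d x * (H t * expR ((1 - `|x|) * `|t|)).
have FE x t : F x t = d x * (lap `|x| t * D t).
  rewrite /F /H normr1 {2}(_ : `|x| = 1 + (`|x| - 1)); last by ring.
  have -> : (1 - `|x|) * `|t| = - ((`|x| - 1) * `|t|) by ring.
  by rewrite lapD -!mulrA [D t * _]mulrC.
have mF : measurable_fun setT (fun z : R * R => F z.1 z.2).
  have m1 : measurable_fun setT (fun z : R * R => d z.1) by apply: (mfcomp md); mfun.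
  have m2 : measurable_fun setT (fun z : R * R => H z.2) by apply: (mfcomp mH); mfun.
  by rewrite /F; mfun.
have iF x : intg (F x).
  have [->|x0] := eqVneq x 0.
    by apply: eq_intg (intg0 (R := R)) => t; rewrite /F d0 mul0r.
  have [i1 _ _] := step x0; apply: eq_intg (intgZ (d x) i1) => t; by rewrite FE.
have I_0 : 0 <= I by exact: I_ge0.
have G0 := Gl_gt0.
have ig : intg (fun x => I * Gl * (C * sng s x + `|d x|)).
  exact: (intgZ _ (intgD (intgZ C (intg_sng hs)) (intg_norm id))).
have bF x : \int[mu]_t `|F x t| <= I * Gl * (C * sng s x + `|d x|).
  have [->|x0] := eqVneq x 0.
    have -> : \int[mu]_t `|F 0 t| = 0.
      by rewrite -[RHS](I0 (R := R)); apply: eq_I => t; rewrite /F d0 mul0r normr0.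
    by rewrite !mulr_ge0 ?(ltW G0)// addr_ge0// mulr_ge0// sng_ge0.
  have [i1 _ b1] := step x0.
  have -> : \int[mu]_t `|F x t| = `|d x| * \int[mu]_t `|lap `|x| t * D t|.
    by rewrite -(IZ _ (intg_norm i1)); apply: eq_I => t; rewrite FE normrM.
  apply: le_trans (ler_wpM2l (normr_ge0 _) b1) _.
  rewrite mulrCA; apply: ler_wpM2l; first by rewrite mulr_ge0// ltW.
  rewrite -(kd_norm hs) mulrC; apply: le_trans (ler_wpM2r (normr_ge0 _) (kd_sng hs x)) _.
  rewrite mulrDl mul1r lerD2r mulrC; apply: ler_wpM2r; [exact: sng_ge0|exact: bd].
have [_ j1 j2 E] := fub mF iF ig bF.
have E1 x : \int[mu]_t F x t = Gl * (d x * J x).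
  have [->|x0] := eqVneq x 0.
    rewrite d0 mul0r mulr0 -[RHS](I0 (R := R)); apply: eq_I => t.
    by rewrite /F d0 mul0r.
  have [i1 e1 _] := step x0.
  by rewrite (eq_I (FE x)) (IZ _ i1) e1; ring.
have E2 t : \int[mu]_x F x t = `|t| `^ (- p) * D t ^+ 2.
  have -> : `|t| `^ (- p) * D t ^+ 2 = `|t| `^ (- p) * D t * D t by ring.
  by rewrite -(IZ _ (iD t)); apply: eq_I => x; rewrite FE /lap; ring.
have iJ : intg (fun x => d x * J x).
  by apply: eq_intg (intgZ Gl^-1 j1) => x; rewrite E1 (mulKf (lt0r_neq0 G0)).
split; first exact: iJ.
rewrite -(pmulr_rge0 _ G0) -(IZ _ iJ) -(eq_I E1) E (eq_I E2).
by apply: I_ge0 => t; apply: mulr_ge0; [exact: powR_ge0|exact: sqr_ge0].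
Qed.

End Positivity.

Lemma Qk_bound g c x : 0 <= c -> intg g -> (forall y, `|g y| <= c) ->
  intg (fun y => `|kd s (x - y)| * `|g y|) /\
  \int[mu]_y (`|kd s (x - y)| * `|g y|) <= c * \int[mu]_t sng s t + \int[mu]_y `|g y|.
Proof.
move=> c0 ig hc; have mg := intg_meas ig.
have isg : intg (fun y => sng s (x - y)) := intg_refl x (intg_sng hs).
have m : measurable_fun setT (fun y => `|kd s (x - y)| * `|g y|).
  have mk : measurable_fun setT (fun y => kd s (x - y)) by apply: (mfcomp (kd_meas s)); mfun.
  by mfun.
have b y : `|kd s (x - y)| * `|g y| <= c * sng s (x - y) + `|g y|.
  by apply: (kd_bound hs) => // z _; exact: hc.
have ib := intgD (intgZ c isg) (intg_norm ig).
have ii : intg (fun y => `|kd s (x - y)| * `|g y|).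
  by apply: (intg_le m _ ib) => y; rewrite ger0_norm// mulr_ge0.
split => //; rewrite -(I_refl x (intg_sng hs)) -(IZ _ isg) -(ID (intgZ _ isg) (intg_norm ig)).
exact: I_le.
Qed.

(* the antisymmetric part of the kernel integrates to zero on the half line; evenness leaves (x + y)^(p - 1) *)
Lemma half_line_pos d C : continuous d -> intg d -> even_fun d -> d 0 = 0 -> 0 <= C ->
  (forall x, `|d x| <= C) -> 0 <= \int[mu]_x ((if 0 <= x then d x else 0) * Qk s d x).
Proof.
move=> cd id ed d0 C0 bd.
have md := intg_meas id.
pose e x := if 0 <= x then d x else 0.
have me : measurable_fun setT e by apply: mfif; mfun.
have eb x : `|e x| <= `|d x| by rewrite /e; case: ifP => // _; rewrite normr0.
have ie : intg e := intg_le me eb (intg_norm id).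
have bC x : `|e x| <= C by apply: le_trans (eb x) _.
have e0 : e 0 = 0 by rewrite /e lexx.
(* At y = 0 both halves contribute the value d 0, so the splitting relies on d 0 = 0. *)
have dE y : d y = e y + e (- y).
  rewrite /e oppr_ge0; have [y0|y0|<-] := ltgtP 0 y; rewrite ?lexx ?oppr0 ?d0 ?addr0 ?add0r//.
have ier : intg (fun y => e (- y)) by apply: eq_intg (intg_refl 0 ie) => y; rewrite sub0r.
have ber x : `|e (- x)| <= C by [].
pose B := C * \int[mu]_t sng s t + \int[mu]_y `|e y|.
have mk x : measurable_fun setT (fun y => kd s (x - y)).
  by apply: (mfcomp (kd_meas s)); mfun.
have i1 x : intg (fun y => kd s (x - y) * e y).
  have [ii _] := Qk_bound x C0 ie bC; have := mk x => ?.
  by apply: (intg_le _ _ ii); [mfun|move=> y; rewrite normrM].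
have i2 x : intg (fun y => kd s (x - y) * e (- y)).
  have [ii _] := Qk_bound x C0 ier ber; have := mk x => ?.
  have mer := intg_meas ier.
  by apply: (intg_le _ _ ii); [mfun|move=> y; rewrite normrM].
have QE x : Qk s d x = \int[mu]_y (kd s (x - y) * e y) + \int[mu]_y (kd s (x + y) * e y).
  have -> : \int[mu]_y (kd s (x + y) * e y) = \int[mu]_y (kd s (x - y) * e (- y)).
    rewrite -(I_refl 0 (i2 x)); apply: eq_I => y.
    by rewrite sub0r !opprK.
  rewrite -(ID (i1 x) (i2 x)); apply: eq_I => y; by rewrite dE mulrDr.
pose F x y := e x * (kd s (x - y) * e y).
have mF : measurable_fun setT (fun z : R * R => F z.1 z.2).
  have m1 : measurable_fun setT (fun z : R * R => e z.1) by apply: (mfcomp me); mfun.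
  have m2 : measurable_fun setT (fun z : R * R => e z.2) by apply: (mfcomp me); mfun.
  have m3 : measurable_fun setT (fun z : R * R => kd s (z.1 - z.2)) by apply: (mfcomp (kd_meas s)); mfun.
  by rewrite /F; mfun.
have iF x : intg (F x) by exact: (intgZ (e x) (i1 x)).
have bF x : \int[mu]_y `|F x y| <= B * `|e x|.
  have [ii bb] := Qk_bound x C0 ie bC.
  have -> : \int[mu]_y `|F x y| = `|e x| * \int[mu]_y (`|kd s (x - y)| * `|e y|).
    by rewrite -(IZ _ ii); apply: eq_I => y; rewrite !normrM.
  by rewrite mulrC; apply: ler_wpM2r.
have [_ j1 j2 E] := fub mF iF (intgZ B (intg_norm ie)) bF.
have T1 : \int[mu]_x \int[mu]_y F x y = 0.
  have : \int[mu]_x \int[mu]_y F x y = - \int[mu]_x \int[mu]_y F x y.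
    rewrite {1}E -(IN j1); apply: eq_I => y; rewrite -(IN (iF y)); apply: eq_I => x.
    by rewrite /F -[y - x]opprB kdN; ring.
  by move: (\int[mu]_x _) => T hT; lra.
pose J x := \int[mu]_y (e y * (`|x| + `|y|) `^ (p - 1)).
have T2 x : e x * \int[mu]_y (kd s (x + y) * e y) = e x * J x.
  have [x0|x0] := ltP 0 x; last first.
    by rewrite (_ : e x = 0) ?mul0r// /e; case: ifP => // x0'; rewrite (_ : x = 0)//; apply/eqP; rewrite eq_le x0 x0'.
  congr (_ * _); apply: eq_I => y; rewrite mulrC.
  have [y0|y0] := leP 0 y; last by rewrite /e (lt_geF y0) !mul0r.
  have xy : 0 < x + y by rewrite ltr_wpDr.
  congr (_ * _); have := kd_norm hs (x + y).
  rewrite (ger0_norm (ltW xy)) (ger0_norm (ltW x0)) (ger0_norm y0) => <-.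
  by rewrite ger0_norm// /kd mulr_ge0 ?powR_ge0// ltW.
have E1 x : e x * Qk s d x = (\int[mu]_y F x y) + e x * J x.
  by rewrite QE mulrDr T2 (IZ _ (i1 x)).
have [iJ pJ] := laplace_pos ie C0 bC e0.
by rewrite (eq_I E1) (ID j1 iJ) T1 add0r.
Qed.

End LaplacePositivity.

(** * Comparison of two even solutions on the half line *)

Section Uniqueness.
Context {R : realType}.
Local Notation mu := (@lebesgue_measure R).
Implicit Types (f g F phi rho h : R -> R) (a b c r x y z t M X : R).

Lemma derive_le0 f x d : is_derive x 1 f d -> (forall y, x < y -> f y <= f x) -> d <= 0.
Proof.
move=> df hf; have en0 n : en n != 0 :> R by rewrite gt_eqF// en_gt0.
apply: (lim_le (derive_seq df en0 (@en_cvg R))) => n.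
have e0 := @en_gt0 R n; rewrite pmulr_rle0 ?invr_gt0// subr_le0.
by apply: hf; rewrite ltrDl.
Qed.

Lemma cont_comp_exp f : continuous f -> continuous (fun x => expR (f x)).
Proof.
by move=> cf x; apply: (@continuous_comp _ _ _ f expR); [exact: cf|exact: continuous_expR].
Qed.

Lemma contM f g : continuous f -> continuous g -> continuous (fun x => f x * g x).
Proof. by move=> cf cg x; apply: cvgM; [exact: cf|exact: cg]. Qed.

Lemma contB f g : continuous f -> continuous g -> continuous (fun x => f x - g x).
Proof. by move=> cf cg x; apply: cvgB; [exact: cf|exact: cg]. Qed.

(** [I_eq0] asks for a nonnegative continuous function on the whole line, so [h] is localised around
    the given point. *)
Lemma nonneg_half_line h : continuous h -> (forall x, 0 <= x -> 0 <= h x) ->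
  (forall n : nat, \int[mu]_x (if 0 <= x <= n%:R then h x else 0) <= 0) ->
  forall x, 0 < x -> h x = 0.
Proof.
move=> ch h0 hI x x0; have xn := lt0r_neq0 x0.
pose n := (Num.truncn (2 * x)).+1.
have x2n : 2 * x <= n%:R by apply: ltW; exact: truncnS_gt.
have [c c0 hc] := test_bounded (@bump_test R).
(* A bump centred at x and supported in [0, 2 x], inside the interval where [h] is nonnegative. *)
pose th y := bump (x^-1 * y + -1).
have cb : continuous (@bump R) := test_cont (@bump_test R).
have cth : continuous th.
  move=> y; apply: (@continuous_comp _ _ _ (fun y => x^-1 * y + -1) bump); last exact: cb.
  by apply: cvgD; [apply: cvgM; [exact: cvg_cst|exact: cvg_id]|exact: cvg_cst].
have mh : measurable_fun setT h by exact: continuous_measurable_fun.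
have th0 y : 0 <= th y by exact: bump_ge0.
have tout y : ~~ (0 <= y <= n%:R) -> th y = 0.
  move=> hy; apply: bump_vanish; move: hy; rewrite negb_and -!ltNge => /orP[hy|hy].
    have : x^-1 * y < 0 by rewrite pmulr_rlt0// invr_gt0.
    by move=> ?; rewrite ltr0_norm; lra.
  have : 2 < x^-1 * y by rewrite mulrC ltr_pdivlMr//; lra.
  by move=> ?; rewrite gtr0_norm; lra.
pose hn y := if 0 <= y <= n%:R then h y else 0.
have hn0 y : 0 <= hn y by rewrite /hn; case: ifP => // /andP[y0 _]; exact: h0.
have [d d0 hd] := bounded_loc n%:R ch.
have ihn : intg hn.
  apply: (intg_itv (c := d) mh) => y /andP[y0 yn]; apply: hd.
  by rewrite ger0_norm.
have E y : th y * h y = th y * hn y.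
  by rewrite /hn; case: ifPn => // /tout ->; rewrite !mul0r.
have cth' : continuous (fun y => th y * h y) by exact: contM.
have mth : measurable_fun setT th by exact: continuous_measurable_fun.
have ith : intg (fun y => th y * h y).
  by apply: eq_intg (intgMb ihn mth (fun y => hc _)) => y; rewrite E.
have pos y : 0 <= th y * h y by rewrite E mulr_ge0.
have I0' : \int[mu]_y (th y * h y) = 0.
  apply/eqP; rewrite eq_le I_ge0// andbT.
  apply: (@le_trans _ _ (\int[mu]_y (c * hn y))).
    apply: (I_le ith (intgZ c ihn)) => y; rewrite E; apply: ler_wpM2r => //.
    by apply: le_trans (ler_norm _) _; exact: hc.
  by rewrite (IZ _ ihn); apply: mulr_ge0_le0 => //; exact: hI.
have := I_eq0 cth' ith pos I0' x.
rewrite /th mulVf// subrr => /eqP; rewrite mulf_eq0 gt_eqF ?bump0_gt0//= => /eqP.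
by [].
Qed.

Variable s : R.
Hypothesis hs : 2^-1 < s < 1.
Local Notation p := (pp s).
Let hp := pp01 hs.
Let p0 : 0 < p. Proof. by case/andP: hp. Qed.
Let p1 : p < 1. Proof. by case/andP: hp. Qed.

Variable K : R -> R.
Hypothesis K0 : forall x, 0 < K x.
Hypothesis C1K : is_Ck 1 K.
Hypothesis dK : decreasing_in_abs K.
Hypothesis eK : even_fun K.
Hypothesis ncK : ~ exists c, forall x, K x = c.

Lemma uniqueness (u w : R -> R) a : continuous u -> continuous w ->
  intg (fun x => K x * expR (u x)) -> intg (fun x => K x * expR (w x)) ->
  (forall x, u x = a - sig s * Pot s (fun x => K x * expR (u x)) x) ->
  (forall x, w x = a - sig s * Pot s (fun x => K x * expR (w x)) x) ->
  forall x, u x = w x.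
Proof.
move=> cu cw fi gi uE wE.
have [dK1 cK1 lK] := C1_lip C1K; have cK := lip_loc_cont lK.
have uE0 x : u x = a + 0 * x - sig s * Pot s (fun x => K x * expR (u x)) x by rewrite mul0r addr0 -uE.
have wE0 x : w x = a + 0 * x - sig s * Pot s (fun x => K x * expR (w x)) x by rewrite mul0r addr0 -wE.
have [_ [cf lQf du]] := potential_regularity hs C1K fi uE0.
have [_ [cg lQg dw]] := potential_regularity hs C1K gi wE0.
have [eu su] := symmetry hs K0 cK dK eK ncK cu fi uE.
have [ew sw] := symmetry hs K0 cK dK eK ncK cw gi wE.
have [cuf cuf0 huf] := solution_decay hs K0 cK dK 0 cu fi uE.
have [cwg cwg0 hwg] := solution_decay hs K0 cK dK 0 cw gi wE.
set f := fun x => K x * expR (u x) in fi uE cf lQf du huf *.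
set g := fun x => K x * expR (w x) in gi wE cg lQg dw hwg *.
pose u' x := 0 - sig s * (p * Qk s f x); pose w' x := 0 - sig s * (p * Qk s g x).
have cw' : continuous w'.
  move=> x; apply: cvgB; first exact: cvg_cst.
  apply: cvgM; first exact: cvg_cst.
  by apply: cvgM; [exact: cvg_cst|exact: lip_loc_cont lQg x].
have cu' : continuous u'.
  move=> x; apply: cvgB; first exact: cvg_cst.
  apply: cvgM; first exact: cvg_cst.
  by apply: cvgM; [exact: cvg_cst|exact: lip_loc_cont lQf x].
have uw0 : u 0 = w 0 by rewrite uE wE !pot0.
pose d x := f x - g x; pose z' x := u' x - w' x.
(* The convexity remainder of exp between w and u: nonnegative, and zero exactly where u = w. *)
pose B x := expR (u x) - expR (w x) - expR (w x) * (u x - w x).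
pose h x := - (derive1 K x + K x * w' x) * B x.
have f0 x : 0 < f x by rewrite mulr_gt0 ?expR_gt0.
have g0 x : 0 < g x by rewrite mulr_gt0 ?expR_gt0.
have id : intg d := intgB fi gi.
have cd : continuous d by exact: contB.
have ed : even_fun d by move=> x; rewrite /d /f /g eK eu ew.
have d0 : d 0 = 0 by rewrite /d /f /g uw0 subrr.
have bd x : `|d x| <= cuf + cwg.
  apply: le_trans (ler_normB _ _) _; rewrite !gtr0_norm//; apply: lerD.
    by apply: le_trans (huf x) _; rewrite ler_piMr// wt_le1.
  by apply: le_trans (hwg x) _; rewrite ler_piMr// wt_le1.
have C0 : 0 <= cuf + cwg by exact: addr_ge0.
have BE x : B x = expR (w x) * (expR (u x - w x) - (1 + (u x - w x))).
  have -> : expR (w x) * (expR (u x - w x) - (1 + (u x - w x))) =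
     expR (w x) * expR (u x - w x) - expR (w x) - expR (w x) * (u x - w x) by ring.
  have -> : expR (w x) * expR (u x - w x) = expR (u x) by rewrite -expRD; congr expR; ring.
  by [].
have B0 x : 0 <= B x by rewrite BE mulr_ge0 ?expR_ge0// subr_ge0 expR_ge1Dx.
have cB : continuous B.
  apply: contB; first by apply: contB; exact: cont_comp_exp.
  by apply: contM; [exact: cont_comp_exp|exact: contB].
have ch : continuous h.
  apply: contM => // x; apply: cvgN; apply: cvgD; first exact: cK1.
  by apply: cvgM; [exact: cK|exact: cw'].
have sK x : 0 <= x -> derive1 K x <= 0.
  move=> x0; apply: (derive_le0 (dK1 x)) => y xy; apply: dK.
  by rewrite !ger0_norm//; lra.
have sw' x : 0 <= x -> w' x <= 0.
  move=> x0; apply: (derive_le0 (dw x)) => y xy; apply/ltW/sw.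
  by rewrite !ger0_norm//; lra.
have h0 x : 0 <= x -> 0 <= h x.
  move=> x0; rewrite mulr_ge0//; have := sK x x0.
  by have := mulr_ge0_le0 (ltW (K0 x)) (sw' x x0); lra.
(* Differentiating B leaves (e^u - e^w) z' + w' B, so K B has derivative d z' plus (K' + K w') B.
   The last term is -h, and h is nonnegative because K and w decrease on the half line. *)
have dKB x : is_derive x 1 (fun x => K x * B x) (d x * z' x - h x).
  have du1 := du x; have dw1 := dw x.
  have deu : is_derive x 1 (fun x => expR (u x)) (u' x * expR (u x)).
    by have := @is_derive1_comp R expR u x (expR (u x)) (u' x) _ du1; rewrite mulrC; apply.
  have dew : is_derive x 1 (fun x => expR (w x)) (w' x * expR (w x)).
    by have := @is_derive1_comp R expR w x (expR (w x)) (w' x) _ dw1; rewrite mulrC; apply.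
  have dz := is_deriveDr du1 (is_deriveZr (-1) dw1).
  have dB := is_deriveDr (is_deriveDr deu (is_deriveZr (-1) dew)) (is_deriveZr (-1) (is_deriveMr dew dz)).
  have := is_deriveMr (dK1 x) dB.
  have -> : (fun y => K y * (expR (u y) + -1 * expR (w y) + -1 * (expR (w y) * (u y + -1 * w y)))) = (fun x => K x * B x).
    by apply/funext => y; rewrite /B !mulN1r mulrBr.
  rewrite -/(u' x) -/(w' x); congr is_derive; rewrite /d /z' /h /B /f /g; ring.
have cz' : continuous z' := contB cu' cw'.
have czd : continuous (fun x => d x * z' x - h x).
  exact: contB (contM cd cz') ch.
(* The boundary term at 0 vanishes since u 0 = w 0; the one at n is nonnegative, which is all that
   is used afterwards. *)
have ftcn (n : nat) : \int[mu]_x (if 0 <= x <= n%:R then d x * z' x - h x else 0) = K n%:R * B n%:R.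
  have B00 : B 0 = 0 by rewrite /B uw0 !subrr mulr0 subrr.
  have -> := ftc (ler0n R n) (fun x _ => dKB x) (fun x _ => czd x).
  by rewrite B00 mulr0 subr0.
have z'E x : z' x = - (sig s * p) * Qk s d x.
  rewrite /z' /u' /w'; have -> : Qk s d x = Qk s f x - Qk s g x.
    rewrite /Qk -(IB (Qk_intg hs cf fi x) (Qk_intg hs cg gi x)); apply: eq_I => y.
    by rewrite /d mulrBr.
  by ring.
pose Bz := (sig s * p) * ((cuf + cwg) * \int[mu]_t sng s t + \int[mu]_y `|d y|).
have s0 := sig_gt0 hs; have sp0 : 0 < sig s * p by rewrite mulr_gt0.
have bz x : `|z' x| <= Bz.
  rewrite z'E mulNr normrN normrM (gtr0_norm sp0); apply: ler_wpM2l; first exact: ltW.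
  have [ii bb] := Qk_bound hs x C0 id bd; apply: le_trans bb.
  apply: (I_norm_le (Qk_intg hs cd id x) ii) => y; by rewrite normrM.
have mz : measurable_fun setT z' by exact: continuous_measurable_fun cz'.
have md := intg_meas id.
have idz : intg (fun x => d x * z' x).
  by apply: eq_intg (intgMb id mz bz) => x; rewrite mulrC.
have mdz := intg_meas idz.
pose P (n : nat) := \int[mu]_x (if 0 <= x <= n%:R then d x * z' x else 0).
have cP : P n @[n --> \oo] --> \int[mu]_x (if 0 <= x then d x * z' x else 0).
  have mm n : measurable_fun setT (fun x => if 0 <= x <= (n%:R : R) then d x * z' x else 0).
    by apply: mfif; mfun.
  have bb n x : `|if 0 <= x <= (n%:R : R) then d x * z' x else 0| <= `|d x * z' x|.
    by case: ifP => // _; rewrite normr0.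
  have cc x : (if 0 <= x <= n%:R then d x * z' x else 0) @[n --> \oo] --> (if 0 <= x then d x * z' x else 0).
    apply: cvg_near_cst; exists (Num.truncn `|x|).+1 => // n /= kn.
    rewrite (_ : x <= n%:R) ?andbT//; apply: le_trans (ler_norm x) _.
    by apply: ltW; apply: lt_le_trans (truncnS_gt _) _; rewrite ler_nat.
  by have [_] := dct mm (intg_norm idz) bb cc.
have Pinf : \int[mu]_x (if 0 <= x then d x * z' x else 0) <= 0.
  have hl := half_line_pos hs cd id ed d0 C0 bd.
  have -> : \int[mu]_x (if 0 <= x then d x * z' x else 0) =
     - (sig s * p) * \int[mu]_x ((if 0 <= x then d x else 0) * Qk s d x).
    have ii : intg (fun x => (if 0 <= x then d x else 0) * Qk s d x).
      have idz' : intg (fun x => if 0 <= x then d x * z' x else 0).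
        have mm : measurable_fun setT (fun x => if 0 <= x then d x * z' x else 0) by apply: mfif; mfun.
        by apply: (intg_le mm _ (intg_norm idz)) => x; case: ifP => // _; rewrite normr0.
      apply: eq_intg (intgZ (- (sig s * p)^-1) idz') => x.
      case: ifP => _; last by rewrite mulr0 mul0r.
      have kn : sig s * p != 0 := lt0r_neq0 sp0.
      rewrite z'E; move: (sig s * p) (Qk s d x) (d x) kn => k q e kn; by field.
    rewrite -(IZ _ ii); apply: eq_I => x; case: ifP => _; last by rewrite mul0r mulr0.
    by rewrite z'E; ring.
  by rewrite mulNr oppr_le0 mulr_ge0// ltW.
have ihn (n : nat) : intg (fun x => if 0 <= x <= n%:R then h x else 0).
  have [c c0 hc] := bounded_loc n%:R ch.
  have mh : measurable_fun setT h by exact: continuous_measurable_fun.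
  by apply: (intg_itv (c := c) mh) => y /andP[y0 yn]; apply: hc; rewrite ger0_norm.
have idn (n : nat) : intg (fun x => if 0 <= x <= n%:R then d x * z' x else 0).
  have mm : measurable_fun setT (fun x => if 0 <= x <= n%:R then d x * z' x else 0) by apply: mfif; mfun.
  by apply: (intg_le mm _ (intg_norm idz)) => x; case: ifP => // _; rewrite normr0.
pose H (n : nat) := \int[mu]_x (if 0 <= x <= n%:R then h x else 0).
have HP n : H n <= P n.
  rewrite -subr_ge0 /H /P -(IB (idn n) (ihn n)).
  have -> : \int[mu]_x ((if 0 <= x <= n%:R then d x * z' x else 0) - (if 0 <= x <= n%:R then h x else 0)) =
     \int[mu]_x (if 0 <= x <= n%:R then d x * z' x - h x else 0).
    by apply: eq_I => x; case: ifP => // _; rewrite subrr.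
  by rewrite ftcn mulr_ge0// ltW.
have Hmono n m : (n <= m)%N -> H n <= H m.
  move=> nm; apply: (I_le (ihn n) (ihn m)) => x.
  have [/andP[x0 xn]|_] := boolP (0 <= x <= n%:R).
    by rewrite x0 (le_trans xn)// ler_nat.
  by case: ifP => // /andP[x0 _]; exact: h0.
(* The integral of h up to n is at most that of d z' up to any larger m, whose limit is nonpositive;
   as h is nonnegative it must vanish. *)
have hz x : 0 < x -> h x = 0.
  apply: (nonneg_half_line ch h0) => n; apply: le_trans Pinf.
  apply: (lim_ge (cvg_shift_nat n cP)) => k.
  by apply: le_trans (HP _); apply: Hmono; exact: leq_addl.
(* Where u and w differ, B is positive on an interval; h = 0 then forces w' = 0 there, against the
   strict monotonicity of w. *)
have zz x : 0 < x -> u x = w x.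
  move=> x0; apply/eqP; rewrite -subr_eq0; apply/negPn/negP => nz.
  have np : 0 < `|u x - w x| by rewrite normr_gt0.
  have czw : continuous (fun y => u y - w y) by exact: contB.
  have /cvgrPdist_lt/(_ _ np)[e /= e0 he] := czw x.
  have x1 : x <= x + e / 2 by rewrite lerDl divr_ge0// ltW.
  have w'0 y : x <= y <= x + e / 2 -> w' y = 0.
    move=> /andP[y1 y2]; have y0 : 0 < y by lra.
    have nzy : u y - w y != 0.
      have : `|x - y| < e by rewrite ler0_norm; lra.
      move=> /(he y)/=; apply: contraTN => /eqP ->; by rewrite subr0 ltxx.
    have By : 0 < B y by rewrite BE mulr_gt0 ?expR_gt0// subr_gt0 expR_gt1Dx.
    have /eqP := hz y y0; rewrite mulf_eq0 (gt_eqF By) orbF oppr_eq0 => /eqP E.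
    have k1 := sK y (ltW y0); have k2 := mulr_ge0_le0 (ltW (K0 y)) (sw' y (ltW y0)).
    have /eqP : K y * w' y = 0 by lra.
    by rewrite mulf_eq0 (gt_eqF (K0 y)) => /eqP.
  have [c hc E] := mvt_eq x1 (fun y _ => dw y).
  rewrite -/(w' c) (w'0 c hc) mul0r in E.
  have : `|x| < `|x + e / 2| by rewrite !gtr0_norm ?ltrDl ?divr_gt0//; lra.
  by move=> /sw; move: E; lra.
move=> x; have [x0|x0|<-] := ltgtP 0 x => //; first exact: zz.
by rewrite -(eu x) -(ew x); apply: zz; rewrite oppr_gt0.
Qed.

End Uniqueness.

Theorem theorem1p6 (R : realType) (s : R) (K : R -> R)
    (hs : 2^-1 < s < 1)
    (hK : assumption_A K)
    (hKnc : ~ exists c : R, forall x, K x = c) :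
  [/\ exists u : R -> R, cont_liouville_solution s K u /\ even_fun u,
      forall u : R -> R, liouville_solution s K u ->
        exists v : R -> R,
          {ae @lebesgue_measure R, forall x, u x = v x} /\
          exists2 g : R, 0 < g & holder_loc (2 * s + g) v,
      forall u : R -> R, cont_liouville_solution s K u ->
        bigO_at_infty u (fun x => `|x| `^ (2 * s - 1)) ->
        even_fun u /\ decreasing_in_abs u,
      forall u w : R -> R,
        cont_liouville_solution s K u -> cont_liouville_solution s K w ->
        even_fun u -> even_fun w -> u 0 = w 0 ->
        forall x, u x = w x &
      forall u : R -> R, cont_liouville_solution s K u -> even_fun u ->
        (morse_index s K u < +oo)%E].

Proof.
have [K0 eK dK C1K _] := hK.
have [_ _ lK] := C1_lip C1K; have cK := lip_loc_cont lK.
(* Evenness removes the linear term, and since the potential vanishes at 0 the constant is u 0. Two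
   even solutions with the same value at 0 therefore satisfy the same equation, the form required by
   [uniqueness]. *)
have even_rep (u : R -> R) : cont_liouville_solution s K u -> even_fun u ->
    intg (fun x => K x * expR (u x)) /\
    forall x, u x = u 0 - sig s * Pot s (fun x => K x * expR (u x)) x.
  move=> su eu; have [fi [a [b uE]]] := cont_representation hs K0 cK su; split => // x.
  have ef : even_fun (fun x => K x * expR (u x)) by move=> y; rewrite eK eu.
  have b0 : b = 0.
    have := eu 1; rewrite (uE (- 1)) (uE 1) (pot_even hs fi ef) => h.
    by move: h; move: (sig s * _) => q h; lra.
  by rewrite (uE 0) pot0 {1}uE b0 !mul0r mulr0 subr0 !addr0.
split.
- exact: (existence hs K0 cK dK eK).
- by move=> u su; exact: (regularity hs K0 C1K su).
- move=> u su [c [M hu]]; have [cu _] := su.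
  have [fi [a [b uE]]] := cont_representation hs K0 cK su.
  have b0 : b = 0.
    apply: (slope0 hs (c := c) (M := `|M|) fi uE) => x Mx.
    have := hu x; rewrite (ger0_norm (powR_ge0 _ _)); apply.
    apply: le_trans (ler_norm M) _; apply: le_trans Mx _; exact: ler_norm.
  have uE' x : u x = a - sig s * Pot s (fun x => K x * expR (u x)) x.
    by rewrite {1}uE b0 mul0r addr0.
  have [eu du] := symmetry hs K0 cK dK eK hKnc cu fi uE'; split => // x y.
  rewrite le_eqVlt => /predU1P[xy|/du/ltW//].
  have ua z : u z = u `|z|.
    by have [z0|z0] := leP 0 z; [rewrite ger0_norm|rewrite ltr0_norm// eu].
  by rewrite (ua x) (ua y) xy.
- move=> u w su sw eu ew uw0.
  have [[cu _] [cw _]] := (su, sw).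
  have [fi uE] := even_rep u su eu; have [gi wE] := even_rep w sw ew.
  rewrite uw0 in uE.
  exact: (uniqueness hs K0 C1K dK eK hKnc cu cw fi gi uE wE).
- move=> u su eu; have [cu _] := su; have [fi uE] := even_rep u su eu.
  exact: (finite_morse hs K0 cK dK cu fi uE).
Qed.
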